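(* Let $N>0$, let $0<\tau_0\le\tau<k$ with $\tau_0<1/2$ and $k$ an integer, and let $\varphi\in G^{\tau_0}_{\tau,k}$ be such that $0\notin\varphi(\mathbb{S})$. If $f\in B^1_{-N}$ satisfies $\mathcal{T}^N_\varphi(f)=h\in B^\infty_\tau$, then $f\in B^\infty_\tau$ and $$\|f\|_{B^\infty_\tau}\le C\left(\|f\|_{B^1_{-N}}+\|h\|_{B^\infty_\tau}\right),$$ where $C>0$ is a finite constant depending only on $\varphi$, $N$ and $n$ (in particular, not on $f$ or $h$). In particular, $\|f\|_{B^\infty_\tau}\le C\|f\|_{B^1_{-N}}$ for any $f\in\ker\mathcal{T}^N_\varphi$.
   Context: $\mathbb{B}$ is the open unit ball of $\mathbb{C}^n$ ($n\ge1$), $\mathbb{S}$ its boundary, $\nu$ Lebesgue measure on $\mathbb{B}$, $H$ the space of holomorphic functions on $\mathbb{B}$. The parameters $\tau_0,\tau,k$ and the norms below are considered fixed. Derivatives: $|\partial^j\varphi|=\sum_{|\alpha|=j}|\partial_\alpha\varphi|$ (holomorphic derivatives), $|d^j\varphi|=\sum_{|\alpha|+|\beta|=j}|\partial_\alpha\bar\partial_\beta\varphi|$, $|\bar\partial\varphi|=\sum_j|\bar\partial_j\varphi|$, and $|\bar\partial_T\varphi|=\sum_{1\le i<j\le n}|(z_i\bar\partial_j-z_j\bar\partial_i)\varphi|$ (which is $0$ if $n=1$). For $\varphi\in\mathcal{C}^1(\mathbb{B})$ let $\widetilde\varphi(z)=(1-|z|^2)|\bar\partial\varphi(z)|+(1-|z|^2)^{1/2}|\bar\partial_T\varphi(z)|$.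 For $t\in\mathbb{R}$ let $\omega_t(z)=(1-|z|^2)^{\min(t,0)}$ if $t\ne0$ and $\omega_0(z)=\log\frac{e}{1-|z|^2}$. $G^{\tau_0}_{\tau,k}$ is the space of all $\varphi\in\mathcal{C}^k(\mathbb{B})\cap\mathcal{C}(\overline{\mathbb{B}})$ (complex-valued) with $$\|\varphi\|_{G^{\tau_0}_{\tau,k}}=\sum_{j=0}^k\sup_{z\in\mathbb{B}}\frac{|\partial^j\varphi(z)|}{\omega_{\tau-j}(z)}+\sup_{z\in\mathbb{B}}\frac{\widetilde\varphi(z)}{(1-|z|^2)^{\tau_0}}<\infty.$$ $B^\infty_\tau$ is the space of $f\in H$ with $\|f\|_{B^\infty_\tau}=\sum_{j=0}^m\sup_{z\in\mathbb{B}}|d^jf(z)|(1-|z|^2)^{m-\tau}<\infty$ for an integer $m>\tau$ (different $m$ give the same space and equivalent norms). $B^1_{-N}$ is the space of $f\in H$ with $\|f\|_{B^1_{-N}}=\int_{\mathbb{B}}|f(z)|(1-|z|^2)^{N-1}d\nu(z)<\infty$. Let $d\nu_N(w)=c_N(1-|w|^2)^{N-1}d\nu(w)$ with $c_N=\frac{\Gamma(n+N)}{n!\,\Gamma(N)}$ (so $\nu_N(\mathbb{B})=1$, with $\nu$ normalized accordingly), $\mathcal{P}^N(\psi)(z)=\int_{\mathbb{B}}\frac{\psi(w)}{(1-\bar wz)^{n+N}}d\nu_N(w)$ for $\psi\in L^1(\mathbb{B},d\nu_N)$, where $\bar wz=\sum_j\bar w_jz_j$, and $\mathcal{T}^N_\varphi(f)=\mathcal{P}^N(\varphi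 f)$ for $f\in B^1_{-N}$. *)

(* Defs.v *)
From HB Require Import structures.
From mathcomp Require Import all_boot all_order all_algebra.
From mathcomp Require Import complex.
From mathcomp Require Import all_classical all_reals all_analysis.

Set Implicit Arguments.
Unset Strict Implicit.
Unset Printing Implicit Defensive.

Import Order.TTheory GRing.Theory Num.Theory.
Import numFieldNormedType.Exports.
Import ComplexField ComplexField.Normc.

Local Open Scope classical_set_scope.
Local Open Scope ring_scope.
Local Open Scope complex_scope.

(** The library gives topologies to abstract numeric fields only, so [R[i]]
    gets the usual one here, as the regular module over itself. *)
HB.instance Definition _ (R : realType) := PseudoPointedMetric.copy R[i] R[i]^o.
HB.instance Definition _ (R : realType) := NormedModule.copy R[i] R[i]^o.

(** C^n is ['rV[R[i]]_n]; [normc] is the [R]-valued modulus on [R[i]]. *)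

Section Geometry.
Context {R : realType} {n : nat}.
Implicit Types z w : 'rV[R[i]]_n.

Definition sqnorm z : R := \sum_(j < n) normc (z 0 j) ^+ 2.

Definition cball : set 'rV[R[i]]_n := [set z | sqnorm z < 1].
Definition cclosed_ball : set 'rV[R[i]]_n := [set z | sqnorm z <= 1].
Definition csphere : set 'rV[R[i]]_n := [set z | sqnorm z = 1].

Definition defect z : R := 1 - sqnorm z.

Definition hdot w z : R[i] := \sum_(j < n) conjc (w 0 j) * z 0 j.

End Geometry.

Section Differentiation.
Context {R : realType} {n : nat}.
Implicit Types (f : 'rV[R[i]]_n -> R[i]) (v z : 'rV[R[i]]_n).

(** Differentiability and derivative of [f] at [z] in the direction [v] with
    respect to a real parameter. They are taken on the real and imaginary
    parts because the normed module structure of [R[i]] is over [R[i]]. *)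
Definition rderivable f v z : Prop :=
  derivable (fun t : R => complex.Re (f (z + t%:C *: v))) 0 1 /\
  derivable (fun t : R => complex.Im (f (z + t%:C *: v))) 0 1.

Definition rderive v f z : R[i] :=
  derive1 (fun t : R => complex.Re (f (z + t%:C *: v))) 0 +i*
  derive1 (fun t : R => complex.Im (f (z + t%:C *: v))) 0.

(** Directions of the real coordinates x_j and y_j, where z_j = x_j + i y_j *)
Definition dirx (j : 'I_n) : 'rV[R[i]]_n := delta_mx 0 j.
Definition diry (j : 'I_n) : 'rV[R[i]]_n := (0 +i* 1) *: delta_mx 0 j.

(** C^k on the open ball, in the 2n real variables *)
Fixpoint Ck_ball (k : nat) f : Prop :=
  (forall z, cball z -> {for z, continuous f}) /\
  (if k is k'.+1 then
     forall j : 'I_n, forall v, v = dirx j \/ v = diry j ->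
       (forall z, cball z -> rderivable f v z) /\ Ck_ball k' (rderive v f)
   else True).

Definition pd (j : 'I_n) f z : R[i] :=
  (2^-1)%:C * (rderive (dirx j) f z - (0 +i* 1) * rderive (diry j) f z).
Definition pdbar (j : 'I_n) f z : R[i] :=
  (2^-1)%:C * (rderive (dirx j) f z + (0 +i* 1) * rderive (diry j) f z).

(** [iterpd D a] is D_0^(a 0) o ... o D_(n-1)^(a (n-1)). *)
Definition iterpd (D : 'I_n -> ('rV[R[i]]_n -> R[i]) -> 'rV[R[i]]_n -> R[i])
    (a : 'I_n -> nat) f : 'rV[R[i]]_n -> R[i] :=
  foldr (fun i g => iter (a i) (D i) g) f (enum 'I_n).

(** Multi-indices of length j have entries at most j, whence ['I_j.+1]. *)
Definition norm_pd (j : nat) f z : R :=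
  \sum_(a : {ffun 'I_n -> 'I_j.+1} | (\sum_i (a i : nat))%N == j)
    normc (iterpd pd (fun i => a i) f z).

Definition norm_d (j : nat) f z : R :=
  \sum_(ab : {ffun 'I_n -> 'I_j.+1} * {ffun 'I_n -> 'I_j.+1}
        | (\sum_i (ab.1 i : nat) + \sum_i (ab.2 i : nat))%N == j)
    normc (iterpd pd (fun i => ab.1 i) (iterpd pdbar (fun i => ab.2 i) f) z).

Definition norm_pdbar f z : R := \sum_(j < n) normc (pdbar j f z).

Definition norm_pdbarT f z : R :=
  \sum_(i < n) \sum_(j < n | (i < j)%N)
    normc (z 0 i * pdbar j f z - z 0 j * pdbar i f z).

Definition tilde f z : R :=
  defect z * norm_pdbar f z + Num.sqrt (defect z) * norm_pdbarT f z.

(** The base field is [R[i]], so [differentiable] means complex differentiable. *)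
Definition holo f : Prop :=
  forall z, cball z -> differentiable (f : 'rV[R[i]]_n -> R[i]^o) z.

End Differentiation.

Section Measure.
Context {R : realType}.

Definition tcons (m : nat) (p : measurableTypeR R * m.-tuple (measurableTypeR R))
    : m.+1.-tuple (measurableTypeR R) :=
  [the m.+1.-tuple _ of p.1 :: p.2].

Lemma measurable_tcons m : measurable_fun setT (@tcons m).
Proof. exact: measurable_cons. Qed.

Definition cons_measure m (mu : {measure set (m.-tuple (measurableTypeR R)) -> \bar R}) :=
  pushforward (@lebesgue_measure R \x^ mu)%E (@tcons m).

Section cons_measure.
Context m (mu : {measure set (m.-tuple (measurableTypeR R)) -> \bar R}).

Let mt : measurable_fun setT (@tcons m) := @measurable_tcons m.

Let cons_measure0 : cons_measure mu set0 = 0%E.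
Proof. exact: measure0. Qed.

Let cons_measure_ge0 A : (0 <= cons_measure mu A)%E.
Proof. exact: measure_ge0. Qed.

Let cons_measure_sigma_additive : semi_sigma_additive (cons_measure mu).
Proof. exact: measure_semi_sigma_additive. Qed.

HB.instance Definition _ := isMeasure.Build _ _ _ (cons_measure mu)
  cons_measure0 cons_measure_ge0 cons_measure_sigma_additive.

End cons_measure.

Fixpoint lebesgue_tuple (m : nat) :
    {measure set (m.-tuple (measurableTypeR R)) -> \bar R} :=
  match m with
  | 0 => \d_ [the 0.-tuple (measurableTypeR R) of [::]]
  | m'.+1 => cons_measure (lebesgue_tuple m')
  end.

End Measure.

Section Integration.
Context {R : realType} {n : nat}.
Implicit Types z w : 'rV[R[i]]_n.

(** R^2n -> C^n; the first n coordinates are the real parts *)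
Definition Cn_of_R2n (v : (n + n).-tuple (measurableTypeR R)) : 'rV[R[i]]_n :=
  \row_j (tnth v (lshift n j) +i* tnth v (rshift n j)).

Definition rball : set ((n + n).-tuple (measurableTypeR R)) := Cn_of_R2n @^-1` cball.

Definition ball_volume : R := fine (lebesgue_tuple (n + n) rball).

Lemma ball_volume_inv_ge0 : 0 <= ball_volume^-1.
Proof. by rewrite invr_ge0 fine_ge0. Qed.

(** Lebesgue measure normalized by nu(B) = 1, as c_N requires *)
Definition nu : {measure set ((n + n).-tuple (measurableTypeR R)) -> \bar R} :=
  mscale (NngNum ball_volume_inv_ge0) (lebesgue_tuple (n + n)).

Definition cintegral (g : 'rV[R[i]]_n -> R[i]) : R[i] :=
  (\int[nu]_(v in rball) complex.Re (g (Cn_of_R2n v))) +i*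
  (\int[nu]_(v in rball) complex.Im (g (Cn_of_R2n v))).

Definition Gamma (s : R) : R :=
  \int[lebesgue_measure]_(t in `]0, +oo[) (t `^ (s - 1) * expR (- t)).

Definition c_ (N : R) : R := Gamma (n%:R + N) / (n`!%:R * Gamma N).

(** Principal power [x ^ s] for [0 < Re x], where [atan (Im x / Re x)] is the
    principal argument. It is only used at [1 - hdot w z] with [w], [z] in the
    ball, whose real part is positive. *)
Definition cpow (x : R[i]) (s : R) : R[i] :=
  let a := s * atan (complex.Im x / complex.Re x) in
  (normc x `^ s)%:C * (cos a +i* sin a).

(** Density of nu_N with respect to nu *)
Definition dens (N : R) w : R := c_ N * defect w `^ (N - 1).

Definition bergman (N : R) (psi : 'rV[R[i]]_n -> R[i]) z : R[i] :=
  cintegral (fun w => psi w / cpow (1 - hdot w z) (n%:R + N) * (dens N w)%:C).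

Definition toeplitz (N : R) (phi f : 'rV[R[i]]_n -> R[i]) : 'rV[R[i]]_n -> R[i] :=
  bergman N (fun w => phi w * f w).

End Integration.

Section Spaces.
Context {R : realType} {n : nat}.
Implicit Types (f phi : 'rV[R[i]]_n -> R[i]) (z : 'rV[R[i]]_n).

Definition sup_ball (F : 'rV[R[i]]_n -> R) : \bar R :=
  ereal_sup [set (F z)%:E | z in cball].

Definition omega (t : R) z : R :=
  if t == 0%R then ln (expR 1 / defect z) else defect z `^ Num.min t 0.

Definition normG (tau0 tau : R) (k : nat) phi : \bar R :=
  (\sum_(j < k.+1) sup_ball (fun z => norm_pd j phi z / omega (tau - j%:R) z)%R
   + sup_ball (fun z => tilde phi z / defect z `^ tau0)%R)%E.

Definition inG (tau0 tau : R) (k : nat) phi : Prop :=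
  [/\ Ck_ball k phi, {within cclosed_ball, continuous phi} &
      (normG tau0 tau k phi < +oo)%E].

(** Norms take values in [\bar R]; [m] is any order with [tau < m]. *)
Definition normBinf (m : nat) (tau : R) f : \bar R :=
  (\sum_(j < m.+1) sup_ball (fun z => norm_d j f z * defect z `^ (m%:R - tau))%R)%E.

Definition inBinf (m : nat) (tau : R) f : Prop :=
  holo f /\ (normBinf m tau f < +oo)%E.

Definition normB1 (N : R) f : \bar R :=
  (\int[nu]_(v in rball)
    (normc (f (Cn_of_R2n v)) * defect (Cn_of_R2n v) `^ (N - 1))%R%:E)%E.

Definition inB1 (N : R) f : Prop := holo f /\ (normB1 N f < +oo)%E.

End Spaces.

(* Main.v *)
From HB Require Import structures.
Require Import Defs.
From mathcomp Require Import all_boot all_order all_algebra.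
From mathcomp Require Import complex ring lra.
From mathcomp Require Import all_classical all_reals all_analysis measurable_realfun.

(** Write D = 1 - |z|^2, rho = |1 - <z, w>| and K_s for the kernel of exponent
    s. The reproducing formula turns T_phi f = h into
      phi(z) f(z) - h(z) = int (phi(z) - phi(w)) f(w) K_{n+N}(z, w) dnu_N(w),
    up to a constant factor. The bounds on D |dbar phi| and D^{1/2} |dbar_T phi|
    make phi Hoelder: |phi(z) - phi(w)| <= c rho^{tau0/2}. Since phi does not
    vanish near the sphere, f is bounded there by a bounded function plus a
    small multiple of an integral operator that contracts L^1(nu_N), hence f is
    bounded.
    A derivative of order K = min(k, m) of the formula is estimated after
    integrating by parts in the ball, which moves derivatives from the kernel
    to phi f. In the term where all of them fall on f the factor
    phi(z) - phi(w) gains rho^{tau0/2}, and in the others the growth of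
    the derivatives of phi is controlled by the norm of G. By the Forelli-Rudin
    estimates a bound D^{s-K} on the derivatives of order K of f improves to
    D^{min(s+tau0/2,tau)-K}, and finitely many steps from s = 0 reach tau. *)

Set Implicit Arguments.
Unset Strict Implicit.
Unset Printing Implicit Defensive.

Import Order.TTheory GRing.Theory Num.Theory.
Import numFieldNormedType.Exports.
Import ComplexField ComplexField.Normc.

Local Open Scope classical_set_scope.
Local Open Scope ring_scope.
Local Open Scope complex_scope.

(** The integral formulas rest on one tool: the integral over the ball of a derivative of g vanishes
    as soon as g / D is integrable, because the cutoffs [chi e] of D satisfy D chi' <= 4 uniformly
    in e. It gives the integrability of D^{M-1} for M > 0, the identities behind the reproducing
    formula, and the transfer of derivatives from the kernel. In the reproducing formula the
    obstacle is that u may grow at the sphere: the weight (1 - q |w|^2)_+^p with q > 1 lives on a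
    smaller ball, and then q tends to 1 and p is lowered. Holomorphy is given as complex
    differentiability, whereas integration by parts needs continuous derivatives; Goursat's
    bisection provides them. The contraction in L^1(nu_N) uses the symmetry of rho^{-s}: integrals
    of the kernel in one variable bound the operator. Applied to the positive part of |f| minus a
    constant, it yields a pointwise bound. A small eta > 0 replaces the logarithms that come from
    integrating a growth of exponent 1 and from omega_0. Derivatives of phi are taken along sorted
    index sequences, the order in which the norm of G controls them. *)

(** * Lebesgue measure on tuples and integrals of partial derivatives *)

Section TupleMeasure.
Context {R : realType}.
Local Notation RT := (measurableTypeR R).
Local Notation leb := (@lebesgue_measure R).
Local Notation L m := (@lebesgue_tuple R m).
Local Notation tup m := (m.-tuple RT).

Lemma measurable_tnthT m (i : 'I_m) : measurable_fun setT (fun v : m.-tuple RT => tnth v i).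
Proof. exact: measurable_tnth. Qed.

Definition tset m (v : m.-tuple RT) (i : 'I_m) (x : RT) : m.-tuple RT :=
  [tuple if j == i then x else tnth v j | j < m].

Lemma tnth_tset m (v : m.-tuple RT) i x j :
  tnth (tset v i x) j = if j == i then x else tnth v j.
Proof. by rewrite tnth_mktuple. Qed.

Lemma tset_tset m (v : m.-tuple RT) i x y : tset (tset v i x) i y = tset v i y.
Proof. by apply: eq_from_tnth => j; rewrite !tnth_tset; case: eqP. Qed.

Lemma tset_tcons0 m (p : RT * m.-tuple RT) x :
  tset (tcons p) ord0 x = tcons (x, p.2).
Proof.
apply: eq_from_tnth => j; rewrite tnth_tset.
case: (unliftP ord0 j) => [j' ->|->]; last by rewrite eqxx.
by rewrite eq_sym (negbTE (neq_lift _ _)) /tcons !tnthS.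
Qed.

Lemma tset_tconsS m (p : RT * m.-tuple RT) i x :
  tset (tcons p) (lift ord0 i) x = tcons (p.1, tset p.2 i x).
Proof.
apply: eq_from_tnth => j; rewrite tnth_tset.
case: (unliftP ord0 j) => [j' ->|->].
  by rewrite (inj_eq (@lift_inj _ _)) /tcons !tnthS tnth_tset.
by rewrite (negbTE (neq_lift _ _)).
Qed.

Definition tcube m (r : R) : set (m.-tuple RT) := [set v | forall i, `|tnth v i| <= r].
Arguments tcube : clear implicits.

Lemma measurable_absle (r : R) : measurable [set x : RT | `|x| <= r].
Proof.
have -> : [set x : RT | `|x| <= r] = `[- r, r]%classic.
  by apply/seteqP; split => x /=; rewrite in_itv/= ler_norml.
exact: measurable_itv.
Qed.

Lemma measurable_tcube m r : measurable (tcube m r).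
Proof.
have -> : tcube m r = \big[setI/setT]_(i <- enum 'I_m) [set v | `|tnth v i| <= r].
  apply/seteqP; split => v /=.
    by move=> h; rewrite -bigcap_seq => i /= _; exact: h.
  by rewrite -bigcap_seq => h i; apply: h => /=; rewrite mem_enum.
apply: bigsetI_measurable => i _.
have := @measurable_tnthT m i measurableT _ (measurable_absle r).
by rewrite setTI.
Qed.

Lemma lebesgue_tuple_tcube m r : 0 <= r -> (L m (tcube m r) = ((r *+ 2) ^+ m)%:E)%E.
Proof.
move=> r0; elim: m => [|m ih].
  by rewrite /= /dirac indicE mem_set ?expr0// => -[].
rewrite /= /cons_measure /pushforward.
have -> : @tcons R m @^-1` (tcube m.+1 r) = [set x | `|x| <= r] `*` tcube m r.
  apply/seteqP; split => -[x v] /=.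
    move=> h; split; first exact: (h ord0).
    by move=> i; have := h (lift ord0 i); rewrite /tcons tnthS.
  move=> [/= h1 h2] i; case: (unliftP ord0 i) => [j ->|->//].
  by rewrite /tcons tnthS.
rewrite product_measure2E//; [|exact: measurable_absle|exact: measurable_tcube].
rewrite [X in (_ * X)%E]ih.
have -> : [set x : RT | `|x| <= r] = `[- r, r]%classic.
  by apply/seteqP; split => x /=; rewrite in_itv/= ler_norml.
rewrite [X in (X * _)%E](lebesgue_measure_itv `[- r, r])/= lte_fin; case: ifPn => [r1|r1].
  by rewrite -EFinD -EFinM opprK -mulr2n exprS.
have -> : r = 0 by lra.
by rewrite mul0e mul0rn exprS mul0r.
Qed.

Lemma lebesgue_tuple_sigma_finite m : sigma_finite setT (L m).
Proof.
exists (fun k => tcube m k%:R).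
  apply/esym/seteqP; split => // v _.
  exists (Num.truncn (\sum_i `|tnth v i|)).+1 => // => i.
  apply: le_trans (ltW (truncnS_gt _)).
  by rewrite (bigD1 i)//= lerDl sumr_ge0.
move=> k; split; first exact: measurable_tcube.
by rewrite lebesgue_tuple_tcube// ltry.
Qed.

(** An alias of [lebesgue_tuple] that carries the sigma-finite structure required by Fubini-Tonelli;
    the recursive definition provides a measure only. *)
Definition ltup m : set (m.-tuple RT) -> \bar R := L m.
Arguments ltup : clear implicits.

HB.instance Definition _ m := Measure.copy (ltup m) (L m).

HB.instance Definition _ m := @Measure_isSigmaFinite.Build _ _ _
  (ltup m) (@lebesgue_tuple_sigma_finite m).

Lemma ge0_integral_cons m (F : tup m.+1 -> \bar R) :
  measurable_fun [set: tup m.+1] F -> (forall v, 0 <= F v)%E ->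
  (\int[L m.+1]_v F v = \int[L m]_v \int[leb]_x F (tcons (x, v)))%E.
Proof.
move=> mF F0.
rewrite /= ge0_integral_pushforward//; last exact: measurable_tcons.
rewrite preimage_setT.
have mFt : measurable_fun setT (F \o @tcons R m).
  by apply: measurableT_comp => //; exact: measurable_tcons.
apply: etrans (@fubini_tonelli2 _ _ _ _ _ leb (ltup m) _ mFt _); last first.
  by move=> x /=; exact: F0.
(* The two product measures integrate the factors in opposite orders; they agree on rectangles,
   hence everywhere by uniqueness. *)
apply: eq_measure_integral => A mA _; apply/esym.
by apply: product_measure_unique => // B C mB mC /=; rewrite product_measure2E.
Qed.

Lemma ge0_integral_cons' m (F : tup m.+1 -> \bar R) :
  measurable_fun [set: tup m.+1] F -> (forall v, 0 <= F v)%E ->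
  (\int[L m.+1]_v F v = \int[leb]_x \int[L m]_v F (tcons (x, v)))%E.
Proof.
move=> mF F0; rewrite ge0_integral_cons//.
have mFt : measurable_fun setT (F \o @tcons R m).
  by apply: measurableT_comp => //; exact: measurable_tcons.
by rewrite -(@fubini_tonelli _ _ _ _ _ leb (ltup m) _ mFt)// => x /=; exact: F0.
Qed.

Lemma integral_derive_compact (F G : R -> R) :
  (forall t : R, is_derive t 1 F (G t)) -> continuous G ->
  (forall t, 1 <= `|t| -> F t = 0) ->
  (\int[leb]_x (G x)%:E = 0)%E.
Proof.
move=> dF cG F0.
(* Vanishing is assumed of [F] alone; for |t| > 2 it holds on a neighbourhood of [t], so the
   derivative vanishes there too. *)
have G0 t : 2 < `|t| -> G t = 0.
  move=> t2.
  have -> : G t = 'D_1 F t by rewrite derive_val.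
  rewrite -[RHS](derive_cst (0 : R) t (1 : R)).
  apply: near_eq_derive.
  near=> s.
  apply: F0.
  have : `|t - s| <= 1 by near: s; apply: cvgr_dist_le; [exact: cvg_id|].
  have := ler_normB t (t - s); rewrite subKr => h1 h2.
  have := ler_normD (t - s) s; rewrite subrK => h3.
  lra.
transitivity (\int[leb]_(x in `[(-2)%R, 2%R]) (G x)%:E)%E.
  rewrite [RHS]integral_mkcond; apply: eq_integral => x _.
  rewrite patchE; case: ifPn => //; rewrite notin_setE /= in_itv/= => /negP h.
  by rewrite G0// ltNge ler_norml.
rewrite (@continuous_FTC2 _ G F).
- have -> : F 2 = 0 by apply: F0; rewrite normr_nat ler1n.
  have -> : F (- 2) = 0 by apply: F0; rewrite normrN normr_nat ler1n.
  by rewrite sube0.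
- by lra.
- exact: continuous_subspaceT.
- split.
  + by move=> x _.
  + by apply: cvg_at_right_filter; apply: differentiable_continuous; apply/derivable1_diffP.
  + by apply: cvg_at_left_filter; apply: differentiable_continuous; apply/derivable1_diffP.
- by move=> x _; rewrite derive1E derive_val.
Unshelve. all: end_near. Qed.

(** Fubini isolates the coordinate [i] by induction on the dimension: on each line in that direction
    [F] has compact support, so its derivative integrates to 0. Support is restricted in the
    direction [i] only; the other directions are covered by the integrability of [G]. *)
Lemma integral_partial_eq0 m (i : 'I_m) (F G : tup m -> R) :
  (forall v t, is_derive (t : R) 1 (fun s => F (tset v i s)) (G (tset v i t))) ->
  (forall v, continuous (fun s : R => G (tset v i s))) ->
  (forall v, 1 <= `|tnth v i| -> F v = 0) ->
  (L m).-integrable setT (EFin \o G) ->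
  (\int[L m]_v (G v)%:E = 0)%E.
Proof.
elim: m i F G => [[]//|m ih] i F G dF cG F0 iG.
have mG : measurable_fun setT (EFin \o G) by case/integrableP: iG.
have mabs : measurable_fun setT (abse \o (EFin \o G)) by exact: measurableT_comp.
have mt := @measurable_tcons R m.
have mGt : measurable_fun setT (EFin \o G \o @tcons R m) by exact: measurableT_comp.
have ifin : (\int[L m.+1]_v (abse \o (EFin \o G)) v < +oo)%E by case/integrableP: iG.
have iGt : (leb \x ltup m)%E.-integrable setT (EFin \o G \o @tcons R m).
  apply/integrableP; split => //; move: ifin; apply: le_lt_trans.
  rewrite le_eqVlt; apply/orP; left; apply/eqP.
  rewrite (fubini_tonelli1 (abse \o (EFin \o G) \o @tcons R m)).
  - by rewrite (ge0_integral_cons' mabs) => // v; exact: abse_ge0.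
  - by apply: measurableT_comp.
  - by move=> x; exact: abse_ge0.
have iGt2 : (leb \x^ ltup m)%E.-integrable setT (EFin \o G \o @tcons R m).
  apply/integrableP; split => //; move: ifin; apply: le_lt_trans.
  rewrite le_eqVlt; apply/orP; left; apply/eqP; apply/esym.
  rewrite /= ge0_integral_pushforward//.
have EG : (\int[L m.+1]_v (G v)%:E = \int[leb \x^ ltup m]_p (G (tcons p))%:E)%E.
  by rewrite /= (integral_pushforward (@measurable_tcons R m) mG).
(* For a tail coordinate the induction hypothesis applies to almost every slice, since slices of an
   integrable function are integrable almost everywhere. For the head coordinate the inner integral
   is one-dimensional and vanishes on every slice. *)
have [j ij|i0] := unliftP ord0 i; subst i.
  rewrite EG -(integral12_prod_meas2 iGt).
  rewrite (ae_eq_integral (cst 0%E)) => //; last 2 first.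
  - exact: (measurable_fubini_F iGt).
  - have := ae_integrable1 iGt; apply: filterS => x ix _ /=.
    apply: (ih j (fun v => F (tcons (x, v))) (fun v => G (tcons (x, v)))) => //.
    + move=> v t; have := dF (tcons (x, v)) t; rewrite tset_tconsS /=.
      by under eq_fun do rewrite tset_tconsS.
    + by move=> v; have := cG (tcons (x, v)); under eq_fun do rewrite tset_tconsS.
    + by move=> v h; apply: F0; rewrite /tcons tnthS.
  by rewrite integral0.
rewrite EG -(integral21_prod_meas2 iGt).
apply: integral0_eq => v _ /=.
apply: (@integral_derive_compact (fun x => F (tcons (x, v))) (fun x => G (tcons (x, v)))).
- by move=> t; have := dF (tcons (0, v)) t; rewrite tset_tcons0 /=;
    under eq_fun do rewrite tset_tcons0.
- by have := cG (tcons (0, v)); under eq_fun do rewrite tset_tcons0.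
- by move=> t ht; apply: F0.
Qed.

End TupleMeasure.

(** * Real and imaginary parts and the modulus *)

Section ComplexModulus.
Context {R : realType}.
Implicit Types x y : R[i].
Local Notation Re := (@complex.Re R).
Local Notation Im := (@complex.Im R).

Lemma cReD x y : Re (x + y) = Re x + Re y. Proof. by case: x; case: y. Qed.
Lemma cImD x y : Im (x + y) = Im x + Im y. Proof. by case: x; case: y. Qed.
Lemma cReN x : Re (- x) = - Re x. Proof. by case: x. Qed.
Lemma cImN x : Im (- x) = - Im x. Proof. by case: x. Qed.
Lemma cReM x y : Re (x * y) = Re x * Re y - Im x * Im y. Proof. by case: x; case: y. Qed.
Lemma cImM x y : Im (x * y) = Re x * Im y + Im x * Re y. Proof. by case: x; case: y. Qed.
Lemma Re_conjc x : Re (conjc x) = Re x. Proof. by case: x. Qed.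
Lemma Im_conjc x : Im (conjc x) = - Im x. Proof. by case: x. Qed.

Lemma cRe_sum I (r : seq I) (P : pred I) (F : I -> R[i]) :
  Re (\sum_(i <- r | P i) F i) = \sum_(i <- r | P i) Re (F i).
Proof. by apply: (big_morph Re cReD). Qed.
Lemma cIm_sum I (r : seq I) (P : pred I) (F : I -> R[i]) :
  Im (\sum_(i <- r | P i) F i) = \sum_(i <- r | P i) Im (F i).
Proof. by apply: (big_morph Im cImD). Qed.

Lemma complex_eqP x y : Re x = Re y -> Im x = Im y -> x = y.
Proof. by case: x => a b; case: y => c d /= -> ->. Qed.

Lemma sqr_normcE x : normc x ^+ 2 = Re x ^+ 2 + Im x ^+ 2.
Proof. by case: x => a b /=; rewrite sqr_sqrtr// addr_ge0 ?sqr_ge0. Qed.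

Lemma normc_ge0 x : 0 <= normc x.
Proof. by case: x => a b /=; exact: sqrtr_ge0. Qed.

Lemma abs_Re_le x : `|Re x| <= normc x.
Proof.
by rewrite -(@ler_pXn2r _ 2)// ?nnegrE ?normc_ge0// sqr_normcE real_normK ?num_real// lerDl sqr_ge0.
Qed.

Lemma abs_Im_le x : `|Im x| <= normc x.
Proof.
by rewrite -(@ler_pXn2r _ 2)// ?nnegrE ?normc_ge0// sqr_normcE real_normK ?num_real// lerDr sqr_ge0.
Qed.

Lemma normc_le_ReIm x : normc x <= `|Re x| + `|Im x|.
Proof.
rewrite -(@ler_pXn2r _ 2)// ?nnegrE ?normc_ge0 ?addr_ge0// sqr_normcE sqrrD.
rewrite !real_normK ?num_real//.
have := mulr_ge0 (normr_ge0 (Re x)) (normr_ge0 (Im x)).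
rewrite mulr2n; lra.
Qed.

Lemma normc_real (r : R) : normc r%:C = `|r|.
Proof. by rewrite /= expr0n/= addr0 sqrtr_sqr. Qed.

Lemma normc_conj x : normc (conjc x) = normc x.
Proof. by case: x => a b /=; rewrite sqrrN. Qed.

Lemma normc_opp x : normc (- x) = normc x.
Proof. by case: x => a b /=; rewrite !sqrrN. Qed.

Lemma normc_sub x y : normc (x - y) = normc (y - x).
Proof. by rewrite -normc_opp opprB. Qed.

Lemma normc_sum I (r : seq I) (P : pred I) (F : I -> R[i]) :
  normc (\sum_(i <- r | P i) F i) <= \sum_(i <- r | P i) normc (F i).
Proof.
elim/big_ind2 : _ => //; first by rewrite normc0.
by move=> x1 x2 y1 y2 h1 h2; apply: le_trans (le_normcD _ _) _; exact: lerD.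
Qed.

Lemma normc_prod I (r : seq I) (P : pred I) (F : I -> R[i]) :
  normc (\prod_(i <- r | P i) F i) = \prod_(i <- r | P i) normc (F i).
Proof. by apply: (big_morph _ (@normcM R) (@normc1 R)). Qed.

Lemma normc_eq0 x : (normc x == 0) = (x == 0).
Proof. by apply/eqP/eqP => [/eq0_normc//|->]; exact: normc0. Qed.

Lemma normc_gt0 x : (0 < normc x) = (x != 0).
Proof. by rewrite lt_neqAle normc_ge0 andbT eq_sym normc_eq0. Qed.

Lemma mulc_conj x : x * conjc x = (normc x ^+ 2)%:C.
Proof. by apply: complex_eqP; rewrite ?cReM ?cImM Re_conjc Im_conjc ?sqr_normcE /=; ring. Qed.

Lemma normc_normE x : `|x| = (normc x)%:C.
Proof. by []. Qed.

Lemma ler_normcB x y : `|normc x - normc y| <= normc (x - y).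
Proof.
rewrite ler_norml; apply/andP; split.
  have := le_normcD (y - x) x; rewrite subrK normc_sub; lra.
by have := le_normcD (x - y) y; rewrite subrK; lra.
Qed.

Lemma normc_i : normc (0 +i* 1 : R[i]) = 1.
Proof. by rewrite /= expr0n/= add0r expr1n sqrtr1. Qed.

End ComplexModulus.

(** * Geometry and topology of the ball *)

Section BallGeometry.
Context {R : realType} {n : nat}.
Local Notation C := R[i].
Local Notation V := 'rV[C]_n.
Implicit Types z w : V.
Local Notation Re := (@complex.Re R).
Local Notation Im := (@complex.Im R).

Lemma sqnorm_ge0 z : 0 <= sqnorm z.
Proof. by apply: sumr_ge0 => j _; exact: sqr_ge0. Qed.

Lemma sqnorm0 : sqnorm (0 : V) = 0.
Proof. by rewrite /sqnorm big1// => j _; rewrite mxE normc0 expr0n. Qed.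

Lemma normc_coord_le z j : normc (z 0 j) ^+ 2 <= sqnorm z.
Proof. by rewrite /sqnorm (bigD1 j)//= lerDl; apply: sumr_ge0 => i _; exact: sqr_ge0. Qed.

Lemma normc_coord_lt1 z j : cball z -> normc (z 0 j) < 1.
Proof.
move=> zB; rewrite -(@ltr_pXn2r _ 2)// ?nnegrE ?normc_ge0//.
by rewrite expr1n; apply: le_lt_trans zB; exact: normc_coord_le.
Qed.

Lemma sqnormZ (q : R) z : sqnorm (q%:C *: z) = q ^+ 2 * sqnorm z.
Proof.
rewrite /sqnorm mulr_sumr; apply: eq_bigr => j _.
by rewrite mxE normcM exprMn normc_real real_normK ?num_real.
Qed.

Lemma sqnormN z : sqnorm (- z) = sqnorm z.
Proof. by rewrite /sqnorm; apply: eq_bigr => j _; rewrite mxE normc_opp. Qed.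

Lemma sqnormB z w : sqnorm (z - w) = sqnorm z + sqnorm w - 2 * Re (hdot w z).
Proof.
rewrite /sqnorm /hdot cRe_sum mulr_sumr -sumrN -!big_split/=; apply: eq_bigr => j _.
rewrite !mxE !sqr_normcE cReM Re_conjc Im_conjc !cReD !cImD !cReN !cImN; ring.
Qed.

Lemma hdot_conj z w : hdot z w = conjc (hdot w z).
Proof.
by rewrite /hdot rmorph_sum; apply: eq_bigr => j _; rewrite rmorphM /= conjcK mulrC.
Qed.

Lemma hdotZ (q : R) w z : hdot w (q%:C *: z) = q%:C * hdot w z.
Proof. by rewrite /hdot mulr_sumr; apply: eq_bigr => j _; rewrite mxE mulrCA. Qed.

Lemma hdot_self w : hdot w w = (sqnorm w)%:C.
Proof.
rewrite /hdot /sqnorm rmorph_sum; apply: eq_bigr => j _.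
by rewrite mulrC mulc_conj.
Qed.

Lemma hdotDl w w' z : hdot (w + w') z = hdot w z + hdot w' z.
Proof. by rewrite /hdot -big_split; apply: eq_bigr => j _; rewrite mxE rmorphD /= mulrDl. Qed.

Lemma Re_hdot w z : 2 * Re (hdot w z) = sqnorm w + sqnorm z - sqnorm (z - w).
Proof. by rewrite sqnormB; ring. Qed.

Definition rho w z : R := normc (1 - hdot w z).

Lemma rho_sym w z : rho w z = rho z w.
Proof.
rewrite /rho (hdot_conj z w) -[RHS]normc_conj; congr normc.
by rewrite rmorphB /= conjcK oppr0.
Qed.

(** Polarization. Every lower bound on [rho] comes from this identity: up to a factor 2, [rho]
    dominates both defects and the squared distance. *)
Lemma Re_1hdot w z : 2 * Re (1 - hdot w z) = defect w + defect z + sqnorm (z - w).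
Proof. by rewrite cReD cReN mulrDr mulrN Re_hdot /defect /=; ring. Qed.

Lemma Re_le_rho w z : Re (1 - hdot w z) <= rho w z.
Proof. exact: le_trans (ler_norm _) (abs_Re_le _). Qed.

Lemma defect_gt0 z : cball z -> 0 < defect z.
Proof. by rewrite /defect subr_gt0. Qed.

Lemma defect_le1 z : defect z <= 1.
Proof. by rewrite /defect gerBl sqnorm_ge0. Qed.

Lemma defect_rho w z : 0 <= defect w -> 0 <= defect z -> 0 < defect w + defect z ->
  [/\ 0 < Re (1 - hdot w z), 0 < rho w z, defect w <= 2 * rho w z,
      defect z <= 2 * rho w z & sqnorm (z - w) <= 2 * rho w z].
Proof.
move=> w0 z0 wz; have := Re_1hdot w z; have := Re_le_rho w z.
have := sqnorm_ge0 (z - w) => h1 h2 h3; split; lra.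
Qed.

Lemma rho_le2 w z : 0 <= defect w -> 0 <= defect z -> rho w z <= 2.
Proof.
rewrite /defect !subr_ge0 => w1 z1; rewrite /rho.
apply: le_trans (le_normcD _ _) _; rewrite normc1 normc_opp.
suff : normc (hdot w z) <= 1 by lra.
apply: le_trans (normc_sum _ _ _) _.
suff : \sum_(j < n) normc (conjc (w 0 j) * z 0 j) <= (sqnorm w + sqnorm z) / 2 by lra.
rewrite /sqnorm -big_split/= mulr_suml; apply: ler_sum => j _.
rewrite normcM normc_conj.
have := sqr_ge0 (normc (w 0 j) - normc (z 0 j)); rewrite sqrrB mulr2n; lra.
Qed.

(** The norm of [R[i]] takes values in [R[i]], so radii of balls are complex numbers; this restates
    neighbourhoods with real radii, coordinate by coordinate. *)
Lemma near_rVP z (P : V -> Prop) : (\forall w \near z, P w) <->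
  exists2 d : R, 0 < d & forall w, (forall j, normc (w 0 j - z 0 j) < d) -> P w.
Proof.
split.
  move=> /nbhs_ballP[e /= e0 h].
  exists (Re e).
    by move: e0; rewrite ltcE/= => /andP[_].
  move=> w hw; apply: h; split => // i j.
  rewrite (ord1 i) -ball_normE /ball_/= normc_normE -normcN opprB.
  by move: e0 (hw j); rewrite !ltcE/= => /andP[/eqP-> _] ->; rewrite eqxx.
move=> [d d0 h]; apply/nbhs_ballP; exists d%:C => /=.
  by rewrite ltcE /= eqxx.
move=> w [_ hw]; apply: h => j.
have := hw 0 j; rewrite -ball_normE /ball_/= normc_normE ltcE/= => /andP[_].
by rewrite normc_sub.
Qed.

Lemma near_CP (x : C) (P : C -> Prop) : (\forall y \near x, P y) <->
  exists2 d : R, 0 < d & forall y, normc (y - x) < d -> P y.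
Proof.
split.
  move=> /nbhs_ballP[e /= e0 h]; exists (Re e).
    by move: e0; rewrite ltcE/= => /andP[_].
  move=> w hw; apply: h.
  rewrite -ball_normE /ball_/= normc_normE -normcN opprB.
  by move: e0 hw; rewrite !ltcE/= => /andP[/eqP-> _] ->; rewrite eqxx.
move=> [d d0 h]; apply/nbhs_ballP; exists d%:C => /=.
  by rewrite ltcE /= eqxx.
move=> w hw; apply: h.
move: hw; rewrite -ball_normE /ball_/= normc_normE ltcE/= => /andP[_].
by rewrite normc_sub.
Qed.

Lemma continuousCP (f : V -> C) z : {for z, continuous f} <->
  forall e : R, 0 < e -> exists2 d : R, 0 < d &
    forall w, (forall j, normc (w 0 j - z 0 j) < d) -> normc (f w - f z) < e.
Proof.
split=> [cf e e0|h].
  apply/near_rVP; apply: (cf [set y | normc (y - f z) < e]).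
  by apply/near_CP; exists e.
move=> A /near_CP [e e0 hA]; apply/near_rVP.
by have [d d0 hd] := h e e0; exists d => // w /hd /hA.
Qed.

Lemma continuousRP (f : V -> R) z : {for z, continuous f} <->
  forall e : R, 0 < e -> exists2 d : R, 0 < d &
    forall w, (forall j, normc (w 0 j - z 0 j) < d) -> `|f w - f z| < e.
Proof.
split=> [cf e e0|h].
  apply/near_rVP; apply: (cf [set y | `|y - f z| < e]).
  by apply/nbhs_ballP; exists e => // y; rewrite -ball_normE /ball_/= distrC.
move=> A /nbhs_ballP [e e0 hA]; apply/near_rVP.
have [d d0 hd] := h e e0; exists d => // w /hd; rewrite distrC => ?.
by apply: hA; rewrite -ball_normE.
Qed.

Lemma continuous_Re (f : V -> C) z : {for z, continuous f} -> {for z, continuous (fun w => Re (f w))}.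
Proof.
move/continuousCP => h; apply/continuousRP => e /h [d d0 hd]; exists d => // w /hd.
by apply: le_lt_trans; rewrite -cReN -cReD abs_Re_le.
Qed.

Lemma continuous_Im (f : V -> C) z : {for z, continuous f} -> {for z, continuous (fun w => Im (f w))}.
Proof.
move/continuousCP => h; apply/continuousRP => e /h [d d0 hd]; exists d => // w /hd.
by apply: le_lt_trans; rewrite -cImN -cImD abs_Im_le.
Qed.

Lemma continuous_normc (f : V -> C) z :
  {for z, continuous f} -> {for z, continuous (fun w => normc (f w))}.
Proof.
move/continuousCP => h; apply/continuousRP => e /h [d d0 hd]; exists d => // w /hd.
by apply: le_lt_trans; exact: ler_normcB.
Qed.

Lemma continuous_complex (f g : V -> R) z :
  {for z, continuous f} -> {for z, continuous g} -> {for z, continuous (fun w => f w +i* g w)}.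
Proof.
move/continuousRP => hf /continuousRP hg; apply/continuousCP => e e0.
have e2 : 0 < e / 2 by lra.
have [d d0 hd] := hf _ e2; have [d' d0' hd'] := hg _ e2.
exists (Num.min d d'); first by rewrite lt_min d0.
move=> w hw; apply: le_lt_trans (normc_le_ReIm _) _ => /=.
have := hd w; have := hd' w.
have h1 j : normc (w 0 j - z 0 j) < d by have := hw j; rewrite lt_min => /andP[].
have h2 j : normc (w 0 j - z 0 j) < d' by have := hw j; rewrite lt_min => /andP[].
by move=> /(_ h2) ? /(_ h1) ?; lra.
Qed.

Lemma continuous_coord j z : {for z, continuous (fun w : V => w 0 j)}.
Proof. by apply/continuousCP => e e0; exists e => // w /(_ j). Qed.

Lemma continuous_conj (f : V -> C) z :
  {for z, continuous f} -> {for z, continuous (fun w => conjc (f w))}.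
Proof.
move/continuousCP => h; apply/continuousCP => e /h [d d0 hd]; exists d => // w /hd.
by rewrite -rmorphB /= normc_conj.
Qed.

Lemma continuousMc (f g : V -> C) z :
  {for z, continuous f} -> {for z, continuous g} -> {for z, continuous (fun w => f w * g w)}.
Proof. by move=> hf hg; exact: (@cvgM _ _ _ _ (f : V -> C^o) g _ _ hf hg). Qed.

Lemma continuousDc (f g : V -> C) z :
  {for z, continuous f} -> {for z, continuous g} -> {for z, continuous (fun w => f w + g w)}.
Proof. by move=> hf hg; exact: (@cvgD _ _ _ _ _ (f : V -> C^o) g _ _ hf hg). Qed.

Lemma continuousNc (f : V -> C) z :
  {for z, continuous f} -> {for z, continuous (fun w => - f w)}.
Proof. by move=> hf; exact: (@cvgN _ _ _ _ _ (f : V -> C^o) _ hf). Qed.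

Lemma continuous_cstc (c : C) z : {for z, continuous (fun _ : V => c)}.
Proof. by apply/continuousCP => e e0; exists 1 => // w _; rewrite subrr normc0. Qed.

Lemma continuous_sumc I (r : seq I) (P : pred I) (F : I -> V -> C) z :
  (forall i, P i -> {for z, continuous (F i)}) ->
  {for z, continuous (fun w => \sum_(i <- r | P i) F i w)}.
Proof.
move=> h; elim: r => [|i r ih].
  have -> : (fun w => \sum_(i <- [::] | P i) F i w) = (fun=> 0).
    by apply/funext => w; rewrite big_nil.
  exact: continuous_cstc.
have -> : (fun w => \sum_(j <- i :: r | P j) F j w) =
    (fun w => (if P i then F i w else 0) + \sum_(j <- r | P j) F j w).
  by apply/funext => w; rewrite big_cons; case: ifP => _; rewrite ?add0r.
apply: (@continuousDc (fun w => if P i then F i w else 0) _ z _ ih).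
case: (boolP (P i)) => Pi; first exact: (h i Pi).
exact: continuous_cstc.
Qed.

Lemma continuous_hdotl z w : {for w, continuous (fun w => hdot w z)}.
Proof.
apply: continuous_sumc => j _; apply: continuousMc; last exact: continuous_cstc.
by apply: continuous_conj; exact: continuous_coord.
Qed.

Lemma continuous_sqnorm z : {for z, continuous (@sqnorm R n)}.
Proof.
have -> : @sqnorm R n = (fun w => Re (hdot w w)).
  by apply/funext => w; rewrite hdot_self.
apply: continuous_Re; apply: continuous_sumc => j _; apply: continuousMc.
  by apply: continuous_conj; exact: continuous_coord.
exact: continuous_coord.
Qed.

Lemma continuous_defect z : {for z, continuous (@defect R n)}.
Proof.
have /continuousRP h := @continuous_sqnorm z.
apply/continuousRP => e /h[d d0 hd]; exists d => // w /hd.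
by rewrite /defect (_ : 1 - _ - _ = - (sqnorm w - sqnorm z)) ?normrN//; ring.
Qed.

Lemma cball_near z : cball z -> exists2 d : R, 0 < d &
  forall w, (forall j, normc (w 0 j - z 0 j) < d) -> cball w.
Proof.
move=> zB; have /continuousRP := @continuous_sqnorm z.
move=> /(_ (1 - sqnorm z)); rewrite subr_gt0 => /(_ zB)[d d0 hd]; exists d => // w /hd.
by rewrite /cball/= ltr_norml; lra.
Qed.

Lemma near_eq_continuous (f g : V -> C) z : cball z -> (forall w, cball w -> f w = g w) ->
  {for z, continuous f} -> {for z, continuous g}.
Proof.
move=> zB fg /continuousCP h; apply/continuousCP => e /h[d d0 hd].
have [d' d0' hd'] := cball_near zB.
exists (Num.min d d'); first by rewrite lt_min d0.
move=> w hw; rewrite -!fg//; last first.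
  by apply: hd' => j; have := hw j; rewrite lt_min => /andP[].
by apply: hd => j; have := hw j; rewrite lt_min => /andP[].
Qed.

End BallGeometry.

(** * Measurability and volume on the ball *)

Section BallMeasure.
Context {R : realType} {n : nat}.
Local Notation C := R[i].
Local Notation V := 'rV[C]_n.
Local Notation RT := (measurableTypeR R).
Local Notation tup m := (m.-tuple RT).
Local Notation L m := (@lebesgue_tuple R m).
Local Notation Cn := (@Cn_of_R2n R n).
Local Notation Re := (@complex.Re R).
Local Notation Im := (@complex.Im R).
Local Notation nn := (n + n)%N.
Local Notation vol := (@ball_volume R n).

Definition dir (i : 'I_nn) : V :=
  match fintype.split i with inl j => dirx j | inr j => diry j end.

Lemma dir_lshift j : dir (lshift n j) = dirx j.
Proof. by rewrite /dir; case: splitP => k /= e; [congr dirx; exact/val_inj|have := ltn_ord j; rewrite e ltnNge leq_addr]. Qed.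

Lemma dir_rshift j : dir (rshift n j) = diry j.
Proof. by rewrite /dir; case: splitP => k /= e; [have := ltn_ord k; rewrite -e ltnNge leq_addr|congr diry; apply/val_inj/(@addnI n)]. Qed.

Lemma CnE v j : Cn v 0 j = tnth v (lshift n j) +i* tnth v (rshift n j).
Proof. by rewrite mxE. Qed.

Lemma Cn_tset v i (x : R) : Cn (tset v i x) = Cn v + (x - tnth v i)%:C *: dir i.
Proof.
apply/rowP => j; rewrite CnE [RHS]mxE CnE [X in _ + X]mxE !tnth_tset.
rewrite -(splitK i); case: (fintype.split i) => k /=.
  rewrite (inj_eq (@lshift_inj _ _)) eq_rlshift dir_lshift mxE eqxx /=.
  by apply: complex_eqP; rewrite ?cReD ?cImD ?cReM ?cImM /=; case: eqP => [->|_] /=; ring.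
rewrite (inj_eq (@rshift_inj _ _)) eq_lrshift dir_rshift !mxE eqxx /=.
by apply: complex_eqP; rewrite ?cReD ?cImD ?cReM ?cImM /=; case: eqP => [->|_] /=; ring.
Qed.

Lemma sqnorm_Cn v : sqnorm (Cn v) = \sum_i tnth v i ^+ 2.
Proof.
rewrite big_split_ord /= -big_split /sqnorm; apply: eq_bigr => j _.
by rewrite sqr_normcE CnE.
Qed.

Lemma tnth_le_sqnorm v i : tnth v i ^+ 2 <= sqnorm (Cn v).
Proof. by rewrite sqnorm_Cn (bigD1 i)//= lerDl; apply: sumr_ge0 => j _; exact: sqr_ge0. Qed.

Lemma rball_tcube : @rball R n `<=` @tcube R nn 1.
Proof.
move=> v vB i; have := le_lt_trans (tnth_le_sqnorm v i) vB => h.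
by rewrite -(@ler_pXn2r _ 2)// ?nnegrE// real_normK ?num_real// expr1n ltW.
Qed.

Lemma absB_itv (a b e : R) : (a \in `]b - e, b + e[) = (`|a - b| < e).
Proof.
by rewrite in_itv/= ltr_norml; apply/andP/andP => -[h1 h2]; split; lra.
Qed.

Definition rbox (q : {ffun 'I_nn -> rat}) (k : nat) : set (tup nn) :=
  [set v | forall i, `|tnth v i - ratr (q i)| < k.+1%:R^-1].

Lemma measurable_rbox q k : measurable (rbox q k).
Proof.
have -> : rbox q k = \big[setI/setT]_(i <- enum 'I_nn)
    [set v | `|tnth v i - ratr (q i)| < k.+1%:R^-1].
  apply/seteqP; split => v /=.
    by move=> h; rewrite -bigcap_seq => i /= _; exact: h.
  by rewrite -bigcap_seq => h i; apply: h => /=; rewrite mem_enum.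
apply: bigsetI_measurable => i _.
rewrite (_ : [set v | _] = (fun v : tup nn => tnth v i) @^-1`
   `]ratr (q i) - k.+1%:R^-1, ratr (q i) + k.+1%:R^-1[%classic); last first.
  by apply/seteqP; split => v /=; rewrite absB_itv.
rewrite -[X in measurable X]setTI.
by apply: (measurable_tnthT i) => //; exact: measurable_itv.
Qed.

(** The sigma-algebra on tuples is generated by the coordinates, so an open set is written as a
    countable union of boxes with rational centres. *)
Lemma measurable_open_Cn (U : set V) :
  (forall z, U z -> exists2 d : R, 0 < d &
    forall w : V, (forall j, normc (w 0 j - z 0 j) < d) -> U w) ->
  measurable (Cn @^-1` U).
Proof.
move=> hU.
have -> : Cn @^-1` U = \bigcup_(p : {ffun 'I_nn -> rat} * nat)
    (if `[< Cn @` rbox p.1 p.2 `<=` U >] then rbox p.1 p.2 else set0).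
  apply/seteqP; split => v /=; last first.
    by move=> [[q k] _ /=]; case: asboolP => // h vb; apply: h; exists v.
  move=> Uv; have [d d0 hd] := hU _ Uv.
  (* Two points of a box of half-width below d/4 differ by less than d/2 in each real coordinate,
     hence by less than d in modulus. *)
  have [k hk] : exists k : nat, (k.+1%:R^-1 : R) < d / 4.
    exists (Num.truncn (d / 4)^-1).
    rewrite -[ltRHS]invrK ltf_pV2 ?posrE ?invr_gt0 ?divr_gt0//.
    by apply: truncnS_gt.
  have kp : 0 < (k.+1%:R^-1 : R) by rewrite invr_gt0.
  have /choice[q hq] : forall i, exists q : rat, `|tnth v i - ratr q| < k.+1%:R^-1.
    move=> i.
    have hh (a e : R) : 0 < e -> a - e < a + e by lra.
    have [q] := rat_in_itvoo (hh (tnth v i) _ kp).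
    by rewrite absB_itv distrC => hq; exists q.
  exists ([ffun i => q i], k) => //=; case: asboolP => [_ i|]; first by rewrite ffunE.
  case; move=> _ [w hw <-]; apply: hd => j.
  apply: le_lt_trans (normc_le_ReIm _) _.
  rewrite !CnE /=.
  have tri (a b c e : R) : `|a - c| < e -> `|b - c| < e -> e < d / 4 -> `|a - b| < d / 2.
    by rewrite !ltr_norml => /andP[? ?] /andP[? ?] ?; apply/andP; split; lra.
  have := tri _ _ _ _ (hw (lshift n j)) _ hk; rewrite ffunE => /(_ _ (hq _)) h1.
  have := tri _ _ _ _ (hw (rshift n j)) _ hk; rewrite ffunE => /(_ _ (hq _)) h2.
  by rewrite [ltRHS](splitr d); exact: ltrD.
apply: countable_bigcupT_measurable; first exact: countableP.
by move=> [q k] /=; case: ifP => _; [exact: measurable_rbox|exact: measurable0].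
Qed.

Lemma measurable_rball : measurable (@rball R n).
Proof. by apply: measurable_open_Cn => z /cball_near. Qed.

Lemma measurable_cont_rball (g : V -> R) :
  (forall z, cball z -> {for z, continuous g}) -> measurable_fun (@rball R n) (g \o Cn).
Proof.
move=> cg; apply: (measurability _ (RGenOInfty.measurableE R)).
move=> /= _ [_ [a ->]] <-.
have -> : @rball R n `&` (g \o Cn) @^-1` `]a, +oo[ =
    Cn @^-1` [set z | cball z /\ a < g z].
  by apply/seteqP; split => v /=; rewrite in_itv/= andbT.
apply: measurable_open_Cn => z [zB ga].
have [d d0 hd] := cball_near zB.
have /continuousRP /(_ (g z - a)) := cg _ zB.
rewrite subr_gt0 => /(_ ga) [d' d0' hd'].
exists (Num.min d d'); first by rewrite lt_min d0.
move=> w hw; split.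
  by apply: hd => j; have := hw j; rewrite lt_min => /andP[].
have : `|g w - g z| < g z - a.
  by apply: hd' => j; have := hw j; rewrite lt_min => /andP[].
by rewrite ltr_norml; lra.
Qed.

Lemma lebesgue_rball_fin : (L nn (@rball R n) < +oo)%E.
Proof.
apply: (@le_lt_trans _ _ (L nn (@tcube R nn 1))).
  apply: le_measure; rewrite ?inE; [exact: measurable_rball|exact: measurable_tcube|exact: rball_tcube].
by rewrite lebesgue_tuple_tcube// ltry.
Qed.

Lemma lebesgue_rball_gt0 : (0 < L nn (@rball R n))%E.
Proof.
(* The cube of half-side r = 1/(2n+1) lies in the ball because 2n r^2 <= 2n r < 1. *)
pose r : R := nn.+1%:R^-1.
have r0 : 0 < r by rewrite invr_gt0.
apply: (@lt_le_trans _ _ (L nn (@tcube R nn r))).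
  by rewrite lebesgue_tuple_tcube ?ltW// lte_fin exprn_gt0// mulr2n addr_gt0.
apply: le_measure; rewrite ?inE; [exact: measurable_tcube|exact: measurable_rball|].
move=> v hv; rewrite /rball/= /cball/= sqnorm_Cn.
apply: (@le_lt_trans _ _ (\sum_(i < nn) r)).
  apply: ler_sum => i _; have h := hv i.
  rewrite -real_normK ?num_real// expr2.
  have r1 : r <= 1 by rewrite invf_le1// ler1n.
  have := normr_ge0 (tnth v i); nra.
rewrite sumr_const card_ord -[X in X < _](mulr_natl r) /r.
by rewrite ltr_pdivrMr// mul1r ltr_nat.
Qed.

Lemma ball_volume_gt0 : 0 < @ball_volume R n.
Proof. by rewrite /ball_volume fine_gt0// lebesgue_rball_gt0 lebesgue_rball_fin. Qed.

Lemma ge0_integral_nu (D : set (tup nn)) (f : tup nn -> \bar R) :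
  measurable D -> measurable_fun D f -> (forall x, D x -> 0 <= f x)%E ->
  (\int[@nu R n]_(x in D) f x = vol^-1%:E * \int[L nn]_(x in D) f x)%E.
Proof. by move=> mD mf f0; rewrite /nu ge0_integral_mscale. Qed.

Lemma integrable_nuE (D : set (tup nn)) (f : tup nn -> \bar R) :
  measurable D -> (@nu R n).-integrable D f -> (L nn).-integrable D f.
Proof.
move=> mD /integrableP[mf fi]; apply/integrableP; split => //.
move: fi; rewrite ge0_integral_nu//; last exact: measurableT_comp.
have h0 : (0 <= \int[L nn]_(x in D) `|f x|)%E by apply: integral_ge0.
have c0 : 0 < vol^-1 by rewrite invr_gt0 ball_volume_gt0.
move: h0; case: (\int[L nn]_(x in D) `|f x|)%E => [r _ _||]//=; first by rewrite ltry.
by rewrite gt0_muley ?lte_fin.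
Qed.

Lemma integral_nu_eq0 (D : set (tup nn)) (f : tup nn -> \bar R) :
  measurable D -> (L nn).-integrable D f ->
  (\int[L nn]_(x in D) f x = 0)%E -> (\int[@nu R n]_(x in D) f x = 0)%E.
Proof.
move=> mD fi; have mf : measurable_fun D f by case/integrableP: fi.
rewrite integralE [X in _ -> X = _]integralE !ge0_integral_nu//; last 2 first.
- exact: measurable_funeneg.
- exact: measurable_funepos.
have p1 : (\int[L nn]_(x in D) f^\+ x)%E \is a fin_num.
  by apply: integrable_fin_num => //; exact: integrable_funepos.
have p2 : (\int[L nn]_(x in D) f^\- x)%E \is a fin_num.
  by apply: integrable_fin_num => //; exact: integrable_funeneg.
move: p1 p2; case: (\int[L nn]_(x in D) f^\+ x)%E => [r||]//.
case: (\int[L nn]_(x in D) f^\- x)%E => [r'||]// _ _ [] /eqP.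
by rewrite subr_eq0 => /eqP ->; rewrite -!EFinM -EFinB subrr.
Qed.

Lemma nu_rball_fin : (@nu R n rball < +oo)%E.
Proof. by rewrite /nu/= /mscale/= lte_mul_pinfty// ?lebesgue_rball_fin// lee_fin ball_volume_inv_ge0. Qed.

End BallMeasure.

(** * One-variable derivatives and the cutoff *)

Section RealDerivative.
Context {R : realType}.

(** A quadratic remainder is easy to check for functions defined by cases, such as the squared
    positive part at its corner. *)
Lemma is_derive_quad (F : R -> R) (x d K e : R) : 0 < e ->
  (forall h, `|h| < e -> `|F (x + h) - F x - d * h| <= K * h ^+ 2) ->
  is_derive x 1 F d.
Proof.
move=> e0 H.
have cF : h^-1 *: (F (h *: 1 + x) - F x) @[h --> 0^'] --> d.
  apply/cvgrPdist_le => /= r r0.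
  near=> h.
  have h0 : h != 0 by near: h; exact: nbhs_dnbhs_neq.
  have he : `|h| < e by near: h; apply: dnbhs0_lt.
  have hK : `|h| <= r / (`|K| + 1).
    by near: h; apply: dnbhs0_le; rewrite divr_gt0// ltr_wpDl.
  rewrite -(@ler_pM2r _ `|h|) ?normr_gt0// -normrM.
  rewrite mulrBl /GRing.scale/= mulr1 mulrAC mulVf// mul1r.
  rewrite distrC (addrC h x).
  apply: le_trans (H _ he) _.
  rewrite -real_normK ?num_real// expr2 mulrA ler_wpM2r//.
  apply: (@le_trans _ _ ((`|K| + 1) * `|h|)).
    by apply: ler_wpM2r => //; have := ler_norm K; lra.
  by rewrite mulrC -ler_pdivlMr// ltr_wpDl.
apply: DeriveDef; first by apply/cvg_ex; exists d.
exact: cvg_lim.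
Unshelve. all: end_near. Qed.

Lemma is_derive_maxsq (e s : R) :
  is_derive s 1 (fun s => Num.max (s - e) 0 ^+ 2) (2 * Num.max (s - e) 0).
Proof.
apply: (@is_derive_quad _ _ _ 1 1) => // h _.
have [h1|h1] := leP (s + h - e) 0; have [h2|h2] := leP (s - e) 0; rewrite ler_norml; apply/andP; split; nra.
Qed.

(** A cutoff in the variable s = D that vanishes for s <= e and tends to 1 as e tends to 0. Squaring
    the positive part makes it C^1, and the rational form keeps [s * dchi e s] bounded independently
    of [e]. *)
Definition chi (e s : R) : R := Num.max (s - e) 0 ^+ 2 / (Num.max (s - e) 0 ^+ 2 + e ^+ 2).
Definition dchi (e s : R) : R :=
  2 * Num.max (s - e) 0 * e ^+ 2 / (Num.max (s - e) 0 ^+ 2 + e ^+ 2) ^+ 2.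

Lemma chi_den (e s : R) : 0 < e -> 0 < Num.max (s - e) 0 ^+ 2 + e ^+ 2.
Proof. by move=> e0; rewrite ltr_wpDl ?sqr_ge0// exprn_gt0. Qed.

Lemma is_derive_chi (e s : R) : 0 < e -> is_derive s 1 (chi e) (dchi e s).
Proof.
move=> e0.
have h := is_derive_maxsq e s.
have hd : is_derive s 1 (fun s => Num.max (s - e) 0 ^+ 2 + e ^+ 2) (2 * Num.max (s - e) 0).
  by apply: is_derive_eq; rewrite addr0.
have hi : is_derive s 1 (fun s => (Num.max (s - e) 0 ^+ 2 + e ^+ 2)^-1)
   (- (Num.max (s - e) 0 ^+ 2 + e ^+ 2) ^- 2 *: (2 * Num.max (s - e) 0)).
  by apply: is_deriveV; rewrite gt_eqF// chi_den.
have hm := is_deriveM h hi.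
apply: is_derive_eq hm _.
rewrite /dchi /GRing.scale/=; field.
by rewrite gt_eqF// chi_den.
Qed.

Lemma chi_ge0 (e s : R) : 0 < e -> 0 <= chi e s.
Proof. by move=> e0; rewrite divr_ge0 ?sqr_ge0// ltW// chi_den. Qed.

Lemma chi_le1 (e s : R) : 0 < e -> chi e s <= 1.
Proof. by move=> e0; rewrite ler_pdivrMr ?chi_den// mul1r lerDl sqr_ge0. Qed.

Lemma chi_eq0 (e s : R) : s <= e -> chi e s = 0.
Proof.
move=> se; rewrite /chi; have -> : Num.max (s - e) 0 = 0 by apply/max_idPr; lra.
by rewrite expr0n/= mul0r. Qed.

Lemma dchi_eq0 (e s : R) : s <= e -> dchi e s = 0.
Proof.
move=> se; rewrite /dchi; have -> : Num.max (s - e) 0 = 0 by apply/max_idPr; lra.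
by rewrite mulr0 !mul0r. Qed.

Lemma dchi_ge0 (e s : R) : 0 < e -> 0 <= dchi e s.
Proof.
move=> e0; rewrite /dchi divr_ge0 ?sqr_ge0// !mulr_ge0 ?(ltW e0)//.
by rewrite le_max lexx orbT.
Qed.

(** Homogeneity: with p = s - e the product depends on p / e only. Uniformity in [e] is what lets
    dominated convergence remove the cutoff. *)
Lemma dchi_bound (e s : R) : 0 < e -> s * dchi e s <= 4.
Proof.
move=> e0; case: (leP s e) => se; first by rewrite dchi_eq0// mulr0.
rewrite /dchi; have -> : Num.max (s - e) 0 = s - e by apply/max_idPl; lra.
rewrite mulrA ler_pdivrMr; last by rewrite exprn_gt0// ltr_wpDl ?sqr_ge0// exprn_gt0.
set p := s - e.
have p0 : 0 < p by rewrite /p; lra.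
have -> : s = p + e by rewrite /p; lra.
have pe := mulr_gt0 p0 e0.
have h1 : 2 * p * e <= p ^+ 2 + e ^+ 2 by have := sqr_ge0 (p - e); nra.
have h2 : (p + e) * e <= 2 * (p ^+ 2 + e ^+ 2) by nra.
have -> : (p + e) * (2 * p * e ^+ 2) = (2 * p * e) * ((p + e) * e) by ring.
apply: (@le_trans _ _ ((p ^+ 2 + e ^+ 2) * (2 * (p ^+ 2 + e ^+ 2)))).
  by apply: ler_pM => //; nra.
have := sqr_ge0 (p ^+ 2 + e ^+ 2); nra.
Qed.

Lemma cvg_max0 T (F : set_system T) {FF : Filter F} (f : T -> R) (l : R) :
  f x @[x --> F] --> l -> Num.max (f x) 0 @[x --> F] --> Num.max l 0.
Proof.
have E (x : R) : Num.max x 0 = (x + `|x|) / 2.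
  by have [h|h] := leP x 0; [rewrite ler0_norm//; lra|rewrite gtr0_norm//; lra].
move=> fl; rewrite E; under eq_fun do rewrite E.
by apply: cvgM; [apply: cvgD => //; exact: cvg_norm|exact: cvg_cst].
Qed.

Lemma continuous_maxsub (e : R) : continuous (fun s : R => Num.max (s - e) 0).
Proof.
by move=> s; apply: cvg_max0; apply: cvgB => //; exact: cvg_cst.

Qed.

Lemma continuous_chi (e : R) : 0 < e -> continuous (chi e).
Proof.
move=> e0 s; apply: differentiable_continuous; apply/derivable1_diffP.
by have := is_derive_chi s e0 => -[].
Qed.

Lemma continuous_dchi (e : R) : 0 < e -> continuous (dchi e).
Proof.
move=> e0 s; rewrite /dchi.
have cm := @continuous_maxsub e s.
have csq : {for s, continuous (fun s : R => Num.max (s - e) 0 ^+ 2 + e ^+ 2)}.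
  apply: cvgD; last exact: cvg_cst.
  by apply: (@cvgM _ _ _ _ (fun s : R => Num.max (s - e) 0) (fun s : R => Num.max (s - e) 0)).
apply: cvgM.
  apply: cvgM; last exact: cvg_cst.
  by apply: cvgM => //; exact: cvg_cst.
apply: cvgV.
  by rewrite gt_eqF// exprn_gt0// chi_den.
by apply: (@cvgM _ _ _ _ (fun s : R => Num.max (s - e) 0 ^+ 2 + e ^+ 2) (fun s : R => Num.max (s - e) 0 ^+ 2 + e ^+ 2)).
Qed.

Lemma cvg_harmonic0 : (k.+1%:R^-1 : R) @[k --> \oo] --> (0 : R).
Proof. exact: cvg_harmonic. Qed.

Lemma cvg_chi (s : R) : 0 < s -> chi (k.+1%:R^-1) s @[k --> \oo] --> (1 : R).
Proof.
move=> s0.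
have cm : Num.max (s - k.+1%:R^-1) 0 @[k --> \oo] --> (s : R).
  rewrite [X in _ --> X](_ : s = Num.max (s - 0) 0); last by rewrite subr0; apply/esym/max_idPl/ltW.
  apply: (@cvg_comp _ _ _ (fun k : nat => (k.+1%:R^-1 : R)) (fun x : R => Num.max (s - x) 0)).
    exact: cvg_harmonic0.
  by apply: cvg_max0; apply: cvgB => //; exact: cvg_cst.
have c2 : (Num.max (s - k.+1%:R^-1) 0 * Num.max (s - k.+1%:R^-1) 0) @[k --> \oo] --> s * s.
  exact: cvgM.
have e2 : ((k.+1%:R^-1 : R) * k.+1%:R^-1) @[k --> \oo] --> (0 * 0 : R).
  by apply: cvgM; exact: cvg_harmonic0.
have cd : (Num.max (s - k.+1%:R^-1) 0 * Num.max (s - k.+1%:R^-1) 0 + k.+1%:R^-1 * k.+1%:R^-1)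
    @[k --> \oo] --> s * s.
  by rewrite -[X in _ --> X]addr0 -[X in _ --> _ + X](mulr0 0); exact: cvgD.
have s2 : s * s != 0 by rewrite mulf_neq0// gt_eqF.
rewrite [X in _ --> X](_ : 1 = (s * s) * (s * s)^-1); last by rewrite mulfV.
by apply: cvgM => //; exact: cvgV.
Qed.

Lemma cvg_dchi (s : R) : 0 < s -> dchi (k.+1%:R^-1) s @[k --> \oo] --> (0 : R).
Proof.
move=> s0.
have cm : Num.max (s - k.+1%:R^-1) 0 @[k --> \oo] --> (s : R).
  rewrite [X in _ --> X](_ : s = Num.max (s - 0) 0); last by rewrite subr0; apply/esym/max_idPl/ltW.
  apply: (@cvg_comp _ _ _ (fun k : nat => (k.+1%:R^-1 : R)) (fun x : R => Num.max (s - x) 0)).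
    exact: cvg_harmonic0.
  by apply: cvg_max0; apply: cvgB => //; exact: cvg_cst.
have c2 : (Num.max (s - k.+1%:R^-1) 0 * Num.max (s - k.+1%:R^-1) 0) @[k --> \oo] --> s * s.
  exact: cvgM.
have e2 : ((k.+1%:R^-1 : R) * k.+1%:R^-1) @[k --> \oo] --> (0 * 0 : R).
  by apply: cvgM; exact: cvg_harmonic0.
have cd : (Num.max (s - k.+1%:R^-1) 0 * Num.max (s - k.+1%:R^-1) 0 + k.+1%:R^-1 * k.+1%:R^-1)
    @[k --> \oo] --> s * s.
  by rewrite -[X in _ --> X]addr0 -[X in _ --> _ + X](mulr0 0); exact: cvgD.
have s2 : (s * s) * (s * s) != 0 by rewrite !mulf_neq0// gt_eqF.
rewrite [X in _ --> X](_ : 0 = (2 * s * (0 * 0)) * ((s * s) * (s * s))^-1); last by rewrite !mulr0 mul0r.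
apply: cvgM; last by apply: cvgV => //; exact: cvgM.
by apply: cvgM => //; apply: cvgM => //; exact: cvg_cst.
Qed.

End RealDerivative.

(** * Directional and Wirtinger derivatives *)

Section Wirtinger.
Context {R : realType} {n : nat}.
Local Notation C := R[i].
Local Notation V := 'rV[C]_n.
Local Notation Re := (@complex.Re R).
Local Notation Im := (@complex.Im R).
Local Notation ic := (0 +i* 1 : C).
Implicit Types (f g : V -> C) (z v : V).

Definition rder f v z (d : C) : Prop :=
  is_derive (0 : R) 1 (fun t : R => Re (f (z + t%:C *: v))) (Re d) /\
  is_derive (0 : R) 1 (fun t : R => Im (f (z + t%:C *: v))) (Im d).

Lemma line0 z v : z + (0 : R)%:C *: v = z.
Proof. by rewrite scale0r addr0. Qed.

Lemma rder_rderivable f v z d : rder f v z d -> rderivable f v z.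
Proof. by move=> [[h1 _] [h2 _]]; exact (conj h1 h2). Qed.

Lemma rder_rderive f v z d : rder f v z d -> rderive v f z = d.
Proof.
move=> [h1 h2]; apply: complex_eqP => /=; rewrite derive1E.
  by case: h1.
by case: h2.
Qed.

Lemma rderivable_rder f v z : rderivable f v z -> rder f v z (rderive v f z).
Proof. by move=> [h1 h2]; rewrite /rder /rderive !derive1E; split; apply: DeriveDef. Qed.

Lemma rder_cst (c : C) v z : rder (fun=> c) v z 0.
Proof. by split => /=; exact: is_derive_cst. Qed.

Lemma rderD f g v z a b : rder f v z a -> rder g v z b -> rder (fun w => f w + g w) v z (a + b).
Proof.
move=> [f1 f2] [g1 g2]; split.
  under eq_fun do rewrite cReD.
  by apply: (is_derive_eq (is_deriveD f1 g1)); rewrite cReD.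
under eq_fun do rewrite cImD.
by apply: (is_derive_eq (is_deriveD f2 g2)); rewrite cImD.
Qed.

Lemma rderN f v z a : rder f v z a -> rder (fun w => - f w) v z (- a).
Proof.
move=> [f1 f2]; split.
  under eq_fun do rewrite cReN.
  by apply: (is_derive_eq (is_deriveN f1)); rewrite cReN.
under eq_fun do rewrite cImN.
by apply: (is_derive_eq (is_deriveN f2)); rewrite cImN.
Qed.

Lemma rderM f g v z a b : rder f v z a -> rder g v z b ->
  rder (fun w => f w * g w) v z (f z * b + a * g z).
Proof.
move=> [f1 f2] [g1 g2]; split.
  under eq_fun do rewrite cReM.
  apply: (is_derive_eq (is_deriveB (is_deriveM f1 g1) (is_deriveM f2 g2))).
  by rewrite !line0 cReD !cReM /GRing.scale/=; ring.
under eq_fun do rewrite cImM.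
apply: (is_derive_eq (is_deriveD (is_deriveM f1 g2) (is_deriveM f2 g1))).
by rewrite !line0 cImD !cImM /GRing.scale/=; ring.
Qed.

Lemma rder_conj f v z a : rder f v z a -> rder (fun w => conjc (f w)) v z (conjc a).
Proof.
move=> [f1 f2]; split.
  under eq_fun do rewrite Re_conjc.
  by rewrite Re_conjc.
under eq_fun do rewrite Im_conjc.
by apply: (is_derive_eq (is_deriveN f2)); rewrite Im_conjc.
Qed.

Lemma rder_sum I (r : seq I) (P : pred I) (F : I -> V -> C) v z (d : I -> C) :
  (forall i, P i -> rder (F i) v z (d i)) ->
  rder (fun w => \sum_(i <- r | P i) F i w) v z (\sum_(i <- r | P i) d i).
Proof.
move=> h; elim: r => [|i r ih].
  rewrite big_nil (_ : (fun w => _) = fun=> 0); first exact: rder_cst.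
  by apply/funext => w; rewrite big_nil.
rewrite big_cons (_ : (fun w => _) = fun w => (if P i then F i w else 0) + \sum_(j <- r | P j) F j w).
  rewrite -[X in rder _ _ _ X](_ : (if P i then d i else 0) + \sum_(j <- r | P j) d j = _); last first.
    by case: ifP => _; rewrite ?add0r.
  apply: rderD => //; case: ifPn => Pi; [exact: h|exact: rder_cst].
by apply/funext => w; rewrite big_cons; case: ifP => _; rewrite ?add0r.
Qed.

Lemma rder_coord j v z : rder (fun w => w 0 j) v z (v 0 j).
Proof.
split.
  under eq_fun do rewrite !mxE cReD cReM /= mul0r subr0.
  apply: (@is_derive_quad _ _ _ _ 0 1) => // h _.
  by rewrite add0r mul0r addr0 mul0r [X in `|X|](_ : _ = 0) ?normr0//; ring.
under eq_fun do rewrite !mxE cImD cImM /= mul0r addr0.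
apply: (@is_derive_quad _ _ _ _ 0 1) => // h _.
by rewrite add0r mul0r addr0 mul0r [X in `|X|](_ : _ = 0) ?normr0//; ring.
Qed.

Lemma rder_near f g v z d : (exists2 e : R, 0 < e &
   forall w : V, (forall j, normc (w 0 j - z 0 j) < e) -> f w = g w) ->
  rder f v z d -> rder g v z d.
Proof.
move=> [e e0 H] [h1 h2].
have N : \forall t \near (0 : R), f (z + t%:C *: v) = g (z + t%:C *: v).
  pose M := 1 + \sum_j normc (v 0 j).
  have M0 : 0 < M by rewrite ltr_wpDr// sumr_ge0// => j _; exact: normc_ge0.
  near=> t.
  apply: H => j; rewrite [X in normc X](_ : _ = t%:C * v 0 j); last by rewrite !mxE; ring.
  rewrite normcM normc_real.
  have tM : `|t| < e / M.
    near: t; apply: (@cvgr0_norm_lt _ _ _ _ _ id); first exact: cvg_id.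
    by rewrite divr_gt0.
  apply: (@le_lt_trans _ _ (`|t| * M)).
    apply: ler_wpM2l => //; rewrite /M (bigD1 j)//=.
    have : 0 <= \sum_(i < n | i != j) normc (v 0 i) by apply: sumr_ge0 => i _; exact: normc_ge0.
    lra.
  by rewrite -ltr_pdivlMr.
split.
  apply: near_eq_is_derive h1.
  by apply: filterS N => t ->.
apply: near_eq_is_derive h2.
by apply: filterS N => t ->.
Unshelve. all: end_near. Qed.

Lemma rder_ball f g v z d : cball z -> (forall w, cball w -> f w = g w) ->
  rder f v z d -> rder g v z d.
Proof.
move=> zB fg; apply: rder_near.
by have [e e0 he] := cball_near zB; exists e => // w /he /fg.
Qed.

Lemma rder_real_comp (u : V -> R) (F : R -> R) v z (du dF : R) :
  is_derive (0 : R) 1 (fun t : R => u (z + t%:C *: v)) du ->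
  is_derive (u z) 1 F dF ->
  rder (fun w => (F (u w))%:C) v z (dF * du)%:C.
Proof.
move=> hu hF; split => /=; last exact: is_derive_cst.
by apply: (@is_derive1_comp _ F (fun t => u (z + t%:C *: v))); rewrite line0.
Qed.

(** Here [a] and [b] are the holomorphic and antiholomorphic j-th derivatives: d/dx = a + b and d/dy
    = i (a - b) invert [pd] and [pdbar]. Carrying both values as a relation lets products,
    conjugates and compositions be computed by algebra, existence included. *)
Definition wd j f z (a b : C) : Prop :=
  rder f (dirx j) z (a + b) /\ rder f (diry j) z (ic * (a - b)).

Lemma mulii : ic * ic = -1.
Proof. by apply: complex_eqP => /=; ring. Qed.

Lemma two_neq0c : (2 : C) != 0. Proof. by rewrite pnatr_eq0. Qed.

Lemma half_c : (2^-1)%:C = 2^-1 :> C.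
Proof. by rewrite rmorphV ?unitfE ?pnatr_eq0//= rmorph_nat. Qed.

Lemma wd_pd j f z a b : wd j f z a b -> pd j f z = a.
Proof.
move=> [/rder_rderive h1 /rder_rderive h2]; rewrite /pd h1 h2 mulrA mulii half_c.
by field.
Qed.

Lemma wd_pdbar j f z a b : wd j f z a b -> pdbar j f z = b.
Proof.
move=> [/rder_rderive h1 /rder_rderive h2]; rewrite /pdbar h1 h2 mulrA mulii half_c.
by field.
Qed.

Lemma wdP j f z : rderivable f (dirx j) z -> rderivable f (diry j) z ->
  wd j f z (pd j f z) (pdbar j f z).
Proof.
move=> /rderivable_rder h1 /rderivable_rder h2; split.
  rewrite [X in rder _ _ _ X](_ : _ = rderive (dirx j) f z)//.
  by rewrite /pd /pdbar half_c; move: (rderive _ _ _) (rderive _ _ _) => X Y; field.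
rewrite [X in rder _ _ _ X](_ : _ = rderive (diry j) f z)//.
rewrite /pd /pdbar half_c; move: (rderive _ _ _) (rderive _ _ _) => X Y.
rewrite (_ : ic * _ = - (ic * ic) * X); last by field.
by rewrite mulii opprK mul1r.
Qed.

Lemma wd_eq j f z a b a' b' : wd j f z a b -> a = a' -> b = b' -> wd j f z a' b'.
Proof. by move=> h <- <-. Qed.

Lemma wd_cst j (c : C) z : wd j (fun=> c) z 0 0.
Proof. by split; rewrite ?subr0 ?addr0 ?mulr0; exact: rder_cst. Qed.

Lemma wdD j f g z a b a' b' : wd j f z a b -> wd j g z a' b' ->
  wd j (fun w => f w + g w) z (a + a') (b + b').
Proof.
move=> [f1 f2] [g1 g2]; split.
  by rewrite addrACA; exact: rderD.
by rewrite opprD addrACA mulrDr; exact: rderD.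
Qed.

Lemma wdN j f z a b : wd j f z a b -> wd j (fun w => - f w) z (- a) (- b).
Proof.
move=> [f1 f2]; split; first by rewrite -opprD; exact: rderN.
by rewrite -opprD mulrN; exact: rderN.
Qed.

Lemma wdM j f g z a b a' b' : wd j f z a b -> wd j g z a' b' ->
  wd j (fun w => f w * g w) z (f z * a' + a * g z) (f z * b' + b * g z).
Proof.
move=> [f1 f2] [g1 g2]; split.
  rewrite [X in rder _ _ _ X](_ : _ = f z * (a' + b') + (a + b) * g z); last by ring.
  exact: rderM.
rewrite [X in rder _ _ _ X](_ : _ = f z * (ic * (a' - b')) + (ic * (a - b)) * g z); last by ring.
exact: rderM.
Qed.

Lemma conjc_ic : conjc ic = - ic. Proof. by apply: complex_eqP => /=; rewrite ?oppr0. Qed.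

Lemma wd_conj j f z a b : wd j f z a b -> wd j (fun w => conjc (f w)) z (conjc b) (conjc a).
Proof.
move=> [f1 f2]; split.
  by rewrite addrC -rmorphD; exact: rder_conj.
rewrite [X in rder _ _ _ X](_ : _ = conjc (ic * (a - b))); first exact: rder_conj.
by rewrite rmorphM rmorphB /= -/(conjc ic) conjc_ic; ring.
Qed.

Lemma wd_ball j f g z a b : cball z -> (forall w, cball w -> f w = g w) ->
  wd j f z a b -> wd j g z a b.
Proof. by move=> zB fg [h1 h2]; split; apply: rder_ball h1 || apply: rder_ball h2. Qed.

Lemma wd_coord i j z : wd j (fun w => w 0 i) z (i == j)%:R 0.
Proof.
have := rder_coord i (dirx j) z; have := rder_coord i (diry j) z.
by rewrite /dirx /diry !mxE eqxx /= => h1 h2; split; rewrite ?addr0 ?subr0.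
Qed.

Lemma wd_coordbar i j z : wd j (fun w => conjc (w 0 i)) z 0 (i == j)%:R.
Proof. by apply: wd_eq (wd_conj (wd_coord i j z)) _ _; rewrite ?rmorph0 ?rmorph_nat. Qed.

Lemma wd_sum j I (r : seq I) (P : pred I) (F : I -> V -> C) z (a b : I -> C) :
  (forall i, P i -> wd j (F i) z (a i) (b i)) ->
  wd j (fun w => \sum_(i <- r | P i) F i w) z (\sum_(i <- r | P i) a i) (\sum_(i <- r | P i) b i).
Proof.
move=> h; split.
  by rewrite -big_split; apply: rder_sum => i /h [].
by rewrite -sumrB mulr_sumr; apply: rder_sum => i /h [].
Qed.

Lemma wd_hdot j w z : wd j (fun w => hdot w z) w 0 (z 0 j).
Proof.
have := @wd_sum j _ (index_enum 'I_n) xpredT (fun i w => conjc (w 0 i) * z 0 i) w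
  (fun i => 0) (fun i => (i == j)%:R * z 0 i).
rewrite big1// (bigD1 j)//= eqxx mul1r big1 ?addr0//; last first.
  by move=> i /negbTE ->; rewrite mul0r.
apply=> i _.
by apply: wd_eq (wdM (wd_coordbar i j w) (wd_cst j (z 0 i) w)) _ _; rewrite !mulr0 ?mul0r add0r.
Qed.

Lemma wd_sqnorm j z : wd j (fun w => (sqnorm w)%:C) z (conjc (z 0 j)) (z 0 j).
Proof.
have -> : (fun w : V => (sqnorm w)%:C) = (fun w => \sum_(i < n) conjc (w 0 i) * w 0 i).
  by apply/funext => w; rewrite -hdot_self.
have := @wd_sum j _ (index_enum 'I_n) xpredT (fun i w => conjc (w 0 i) * w 0 i) z
  (fun i => conjc (z 0 i) * (i == j)%:R) (fun i => (i == j)%:R * z 0 i).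
rewrite (bigD1 j)//= eqxx mulr1 big1 ?addr0//; last by move=> i /negbTE ->; rewrite mulr0.
rewrite (bigD1 j)//= eqxx mul1r big1 ?addr0//; last by move=> i /negbTE ->; rewrite mul0r.
apply=> i _.
apply: wd_eq (wdM (wd_coordbar i j z) (wd_coord i j z)) _ _; by rewrite ?mul0r ?mulr0 ?addr0 ?add0r.
Qed.

Lemma wd_defect j z : wd j (fun w => (defect w)%:C) z (- conjc (z 0 j)) (- (z 0 j)).
Proof.
have -> : (fun w : V => (defect w)%:C) = (fun w => 1 + - (sqnorm w)%:C).
  by apply/funext => w; rewrite /defect rmorphB.
by apply: wd_eq (wdD (wd_cst j 1 z) (wdN (wd_sqnorm j z))) _ _; rewrite add0r.
Qed.

(* A real function of a real-valued function: the Wirtinger derivatives pick up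
   the same real factor. *)
Lemma wd_real_comp j (u : V -> R) (F : R -> R) z a b (dF : R) :
  wd j (fun w => (u w)%:C) z a b -> is_derive (u z) 1 F dF ->
  wd j (fun w => (F (u w))%:C) z (dF%:C * a) (dF%:C * b).
Proof.
move=> [[h1 h1'] [h2 h2']] hF; split.
  have := rder_real_comp h1 hF.
  have -> // : (dF * Re (a + b))%:C = dF%:C * a + dF%:C * b.
  rewrite -mulrDr rmorphM; congr (_ * _).
  have [_ e] := h1'; move: e; rewrite /= -derive1E.
  rewrite (_ : (fun=> 0) = cst 0)// derive1_cst => e.
  by apply: complex_eqP.
have := rder_real_comp h2 hF.
have -> // : (dF * Re (ic * (a - b)))%:C = ic * (dF%:C * a - dF%:C * b).
rewrite -mulrBr mulrCA rmorphM; congr (_ * _).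
have [_ e] := h2'; move: e; rewrite /= -derive1E.
rewrite (_ : (fun=> 0) = cst 0)// derive1_cst => e.
by apply: complex_eqP.
Qed.

Lemma wd_defect_comp j (F : R -> R) z (dF : R) : is_derive (defect z) 1 F dF ->
  wd j (fun w => (F (defect w))%:C) z (- (dF%:C * conjc (z 0 j))) (- (dF%:C * z 0 j)).
Proof.
move=> h; apply: wd_eq (wd_real_comp (wd_defect j z) h) _ _; by rewrite mulrN.
Qed.

End Wirtinger.

(** * Compactness of closed balls *)

Section BallCompact.
Context {R : realType} {n : nat}.
Local Notation C := R[i].
Local Notation V := 'rV[C]_n.
Local Notation nn := (n + n)%N.

Definition row_complex (x : 'rV[R]_nn) : V := \row_j (x 0 (lshift n j) +i* x 0 (rshift n j)).

Lemma row_complex_nbhs (x : 'rV[R]_nn) (A : set V) :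
  nbhs (row_complex x) A -> nbhs x (row_complex @^-1` A).
Proof.
move=> /near_rVP [d d0 hd]; apply/nbhs_ballP; exists (d / 2) => /=; first by lra.
move=> y [_ hy]; apply: hd => j.
apply: le_lt_trans (normc_le_ReIm _) _; rewrite !mxE /=.
have := hy 0 (lshift n j); have := hy 0 (rshift n j).
by rewrite -!ball_normE /ball_/= -(distrC (y 0 _)) -(distrC (y 0 (lshift n j))); lra.
Qed.

Lemma compact_closed_ball (r : R) : compact [set z : V | sqnorm z <= r].
Proof.
pose M := `|r| + 1.
have M0 : 0 < M by rewrite /M; have := normr_ge0 r; lra.
have cK : compact [set x : 'rV[R]_nn | forall i, `[- M, M]%classic (x 0 i)].
  by apply: (@rV_compact _ _ (fun=> `[- M, M]%classic)) => i; exact: segment_compact.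
have cI : compact (row_complex @` [set x : 'rV[R]_nn | forall i, `[- M, M]%classic (x 0 i)]).
  apply: continuous_compact => //; apply: continuous_subspaceT => x A; exact: row_complex_nbhs.
apply: subclosed_compact cI _.
  rewrite (_ : [set z : V | _] = (@sqnorm R n) @^-1` [set x | x <= r])//.
  apply: closed_comp; last exact: closed_le.
  by move=> z _; exact: continuous_sqnorm.
move=> z /= zr; exists (\row_i (match fintype.split i with inl j => complex.Re (z 0 j) | inr j => complex.Im (z 0 j) end)).
  move=> i; rewrite mxE /= in_itv/= -ler_norml.
  have K (a : R) j : a ^+ 2 <= normc (z 0 j) ^+ 2 -> `|a| <= M.
    move=> h; have h2 := normc_coord_le z j.
    rewrite -(@ler_pXn2r _ 2)// ?nnegrE ?ltW// real_normK ?num_real//.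
    have := ler_norm r; rewrite /M; have := normr_ge0 r; nra.
  case: (fintype.split i) => j; apply: (K _ j); rewrite sqr_normcE; have := sqr_ge0 (complex.Re (z 0 j)); have := sqr_ge0 (complex.Im (z 0 j)); lra.
apply/rowP => j; rewrite !mxE.
have -> : fintype.split (lshift n j) = inl j by rewrite -[lshift n j]/(unsplit (inl j)) unsplitK.
have -> : fintype.split (rshift n j) = inr j by rewrite -[rshift n j]/(unsplit (inr j)) unsplitK.
by case: (z 0 j).
Qed.

(** Compactness in near-covering form, the passage from local to uniform parameters. It serves for
    bounds, for uniform continuity and for nonvanishing near the sphere. *)
Lemma closed_ball_uniform (r : R) (P : R -> V -> Prop) :
  (forall z : V, sqnorm z <= r -> exists2 d : R, 0 < d & forall (w : V) e, (forall j, normc (w 0 j - z 0 j) < d) ->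
     sqnorm w <= r -> 0 < e -> e <= d -> P e w) ->
  exists2 e : R, 0 < e & forall z : V, sqnorm z <= r -> P e z.
Proof.
move=> H.
have := @compact_closed_ball r; rewrite compact_near_coveringP => nc.
have := nc R (0 : R)^'+ (fun e w => sqnorm w <= r -> P e w) _.
case.
  move=> z /= zr; have [d d0 hd] := H z zr.
  exists ([set w : V | forall j, normc (w 0 j - z 0 j) < d], [set e : R | 0 < e /\ e <= d]) => /=.
    split; first by apply/near_rVP; exists d.
    near=> e; split; first by near: e; exact: nbhs_right_gt.
    by near: e; exact: nbhs_right_le.
  by move=> [w e] /= [hw [e0 ed]] wr; apply: hd.
move=> e /= e0 he; exists (e / 2); first by lra.
move=> z zr; apply: he => //=; last by lra.
by rewrite sub0r normrN gtr0_norm; lra.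
Unshelve. all: end_near. Qed.

Lemma closed_ball_bounded (r : R) (g : V -> R) :
  (forall z, sqnorm z <= r -> {for z, continuous g}) ->
  exists M : R, forall z, sqnorm z <= r -> `|g z| <= M.
Proof.
move=> cg.
(* The parameter is the inverse of the bound, so that a smaller parameter is a weaker property. *)
have [z /cg /continuousRP /(_ 1 ltr01)[d d0 hd]|e e0 he] :=
    @closed_ball_uniform r (fun e w => `|g w| <= e^-1).
  have p0 : 0 < `|g z| + 1 by have := normr_ge0 (g z); lra.
  exists (Num.min d (`|g z| + 1)^-1); first by rewrite lt_min d0 invr_gt0.
  move=> w e hw _ e0; rewrite le_min => /andP[_ h].
  apply: (@le_trans _ _ (`|g z| + 1)).
    have := hd w; have hw' j : normc (w 0 j - z 0 j) < d by have := hw j; rewrite lt_min => /andP[].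
    move=> /(_ hw'); have := ler_normD (g w - g z) (g z); rewrite subrK; lra.
  by rewrite -[leLHS]invrK lef_pV2 ?posrE ?invr_gt0.
by exists e^-1.
Qed.

End BallCompact.

(** * Integration over the ball *)

Section ComplexIntegral.
Context {R : realType} {n : nat}.
Local Notation C := R[i].
Local Notation V := 'rV[C]_n.
Local Notation nn := (n + n)%N.
Local Notation RT := (measurableTypeR R).
Local Notation tup m := (m.-tuple RT).
Local Notation Cn := (@Cn_of_R2n R n).
Local Notation Re := (@complex.Re R).
Local Notation Im := (@complex.Im R).
Local Notation nuT := (@nu R n).
Local Notation rB := (@rball R n).
Implicit Types (f g : V -> C) (F G : V -> R).

Definition contB f := forall z : V, cball z -> {for z, continuous f}.
Definition contBr F := forall z : V, cball z -> {for z, continuous F}.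
Definition measB F := measurable_fun rB (fun v => F (Cn v)).
Definition measC f := measB (fun z => Re (f z)) /\ measB (fun z => Im (f z)).
Definition intB F := nuT.-integrable rB (fun v => (F (Cn v))%:E).
Definition cintble f := intB (fun z => Re (f z)) /\ intB (fun z => Im (f z)).
Definition Rint F := (\int[nuT]_(v in rB) F (Cn v))%R.

Let mB := @measurable_rball R n.

Lemma measB_cont F : contBr F -> measB F.
Proof. exact: measurable_cont_rball. Qed.

Lemma measC_cont f : contB f -> measC f.
Proof.
move=> h; split; apply: measB_cont => z /h; [exact: continuous_Re|exact: continuous_Im].
Qed.

Lemma intB_meas F : intB F -> measB F.
Proof. by case/integrableP => /measurable_EFinP. Qed.

Lemma eq_measB F G : (forall z, cball z -> F z = G z) -> measB F -> measB G.
Proof.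
move=> h; apply: eq_measurable_fun => v; rewrite inE => vB; exact: h.
Qed.

Lemma measBM F G : measB F -> measB G -> measB (fun z => F z * G z).
Proof. exact: measurable_funM. Qed.

Lemma measBD F G : measB F -> measB G -> measB (fun z => F z + G z).
Proof. exact: measurable_funD. Qed.

Lemma measB_cst (c : R) : measB (fun=> c).
Proof. exact: measurable_cst. Qed.

Lemma measB_norm F : measB F -> measB (fun z => `|F z|).
Proof. by move=> h; apply: measurableT_comp. Qed.

Lemma measB_powR F p : measB F -> measB (fun z => F z `^ p).
Proof. by move=> h; apply: (measurableT_comp (f := fun x => x `^ p)) => //; exact: measurable_powR. Qed.

Lemma measB_defect : measB (@defect R n).
Proof. by apply: measB_cont => z _; exact: continuous_defect. Qed.

Lemma measB_normc f : measC f -> measB (fun z => normc (f z)).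
Proof.
move=> [h1 h2].
apply: (@eq_measB (fun z => (Re (f z) * Re (f z) + Im (f z) * Im (f z)) `^ 2^-1)).
  by move=> z _; rewrite powR12_sqrt ?addr_ge0 -?expr2 ?sqr_ge0//; case: (f z).
by apply: measB_powR; apply: measBD; exact: measBM.
Qed.

Lemma intB_le F G : measB F -> (forall z, cball z -> `|F z| <= G z) -> intB G -> intB F.
Proof.
move=> mF h; apply: le_integrable => //; first exact/measurable_EFinP.
move=> v vB /=; rewrite lee_fin; apply: le_trans (h _ vB) (ler_norm _).
Qed.

Lemma eq_intB F G : (forall z, cball z -> F z = G z) -> intB F -> intB G.
Proof.
move=> h; apply: eq_integrable => // v; rewrite inE => vB.
by rewrite h.
Qed.

Lemma intB_bounded F (M : R) : measB F -> (forall z, cball z -> `|F z| <= M) -> intB F.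
Proof.
move=> mF h; apply: (@intB_le _ (fun=> M)) => //.
apply: (@measurable_bounded_integrable _ _ _ nuT (fun=> M) _ mB).
- exact: nu_rball_fin.
- exact: measurable_cst.
- exact: bounded_cst.
Qed.

Lemma intBD F G : intB F -> intB G -> intB (fun z => F z + G z).
Proof.
move=> hF hG; have := integrableD mB hF hG.
by apply: eq_integrable => // v _ /=.
Qed.

Lemma intBZ F (c : R) : intB F -> intB (fun z => c * F z).
Proof.
move=> hF; have := integrableZl mB c hF.
by apply: eq_integrable => // v _ /=.
Qed.

Lemma intBN F : intB F -> intB (fun z => - F z).
Proof. by move=> /(intBZ (-1)); apply: eq_intB => z _; rewrite mulN1r. Qed.

Lemma intB_norm F : intB F -> intB (fun z => `|F z|).
Proof.
move=> hF; apply: (@intB_le _ (fun z => `|F z|)).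
- by apply: measB_norm; exact: intB_meas.
- by move=> z _; rewrite normr_id.
have := integrable_abse hF; exact: eq_integrable.
Qed.

Lemma intB_sum I (r : seq I) (P : pred I) (F : I -> V -> R) :
  (forall i, P i -> intB (F i)) -> intB (fun z => \sum_(i <- r | P i) F i z).
Proof.
move=> h; elim: r => [|i r ih].
  apply: (@intB_bounded _ 0) => [|z _]; last by rewrite big_nil normr0.
  by apply: eq_measB (measB_cst 0) => z _; rewrite big_nil.
apply: (@eq_intB (fun z => (if P i then F i z else 0) + \sum_(j <- r | P j) F j z)).
  by move=> z _; rewrite big_cons; case: ifP => _; rewrite ?add0r.
apply: intBD => //; case: (boolP (P i)) => Pi; first exact: h.
by apply: (@intB_bounded _ 0) => [|z _]; [exact: measB_cst|rewrite normr0].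
Qed.

Lemma RintD F G : intB F -> intB G -> Rint (fun z => F z + G z) = Rint F + Rint G.
Proof. by move=> hF hG; rewrite /Rint RintegralD. Qed.

Lemma RintZ F (c : R) : intB F -> Rint (fun z => c * F z) = c * Rint F.
Proof. by move=> hF; rewrite /Rint RintegralZl. Qed.

Lemma eq_Rint F G : (forall z, cball z -> F z = G z) -> Rint F = Rint G.
Proof. by move=> h; apply: eq_Rintegral => v; rewrite inE => vB; exact: h. Qed.

Lemma le_Rint F G : intB F -> intB G -> (forall z, cball z -> F z <= G z) -> Rint F <= Rint G.
Proof. by move=> hF hG h; apply: le_Rintegral => // v vB; exact: h. Qed.

Lemma Rint_ge0 F : (forall z, cball z -> 0 <= F z) -> 0 <= Rint F.
Proof. by move=> h; apply: Rintegral_ge0 => v vB; exact: h. Qed.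

Lemma RintE F : intB F -> (Rint F)%:E = (\int[nuT]_(v in rB) (F (Cn v))%:E)%E.
Proof. by move=> h; rewrite /Rint /Rintegral fineK//; exact: integrable_fin_num. Qed.

Lemma norm_Rint_le F G : intB F -> intB G -> (forall z, cball z -> `|F z| <= G z) -> `|Rint F| <= Rint G.
Proof.
move=> hF hG h; apply: le_trans (le_normr_Rintegral mB hF) _.
by apply: (@le_Rint (fun z => `|F z|)) => //; exact: intB_norm.
Qed.

Lemma cintble_le f G : measC f -> (forall z, cball z -> normc (f z) <= G z) -> intB G -> cintble f.
Proof.
move=> [m1 m2] h iG; split; apply: (intB_le _ _ iG) => // z zB; apply: le_trans (h z zB).
  exact: abs_Re_le.
exact: abs_Im_le.
Qed.

Lemma cintble_meas f : cintble f -> measC f.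
Proof. by move=> [/intB_meas ? /intB_meas ?]. Qed.

Lemma cintble_normc f : cintble f -> intB (fun z => normc (f z)).
Proof.
move=> h; have [h1 h2] := h.
apply: (@intB_le _ (fun z => `|Re (f z)| + `|Im (f z)|)).
- by apply: measB_normc; exact: cintble_meas.
- by move=> z _; rewrite ger0_norm ?normc_ge0// normc_le_ReIm.
by apply: intBD; exact: intB_norm.
Qed.

Lemma eq_cintble f g : (forall z, cball z -> f z = g z) -> cintble f -> cintble g.
Proof. by move=> h [h1 h2]; split; [apply: eq_intB h1|apply: eq_intB h2] => z zB; rewrite h. Qed.

Lemma Re_cintegral f : Re (cintegral f) = Rint (fun z => Re (f z)).
Proof. by []. Qed.

Lemma Im_cintegral f : Im (cintegral f) = Rint (fun z => Im (f z)).
Proof. by []. Qed.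

Lemma eq_cintegral f g : (forall z, cball z -> f z = g z) -> cintegral f = cintegral g.
Proof. by move=> h; apply: complex_eqP; rewrite ?Re_cintegral ?Im_cintegral; apply: eq_Rint => z zB; rewrite h. Qed.

Lemma cintbleD f g : cintble f -> cintble g -> cintble (fun z => f z + g z).
Proof.
move=> [f1 f2] [g1 g2]; split; [apply: eq_intB (intBD f1 g1)|apply: eq_intB (intBD f2 g2)] => z _.
  by rewrite cReD.
by rewrite cImD.
Qed.

Lemma cintegralD f g : cintble f -> cintble g ->
  cintegral (fun z => f z + g z) = cintegral f + cintegral g.
Proof.
move=> [f1 f2] [g1 g2]; apply: complex_eqP; rewrite ?cReD ?cImD ?Re_cintegral ?Im_cintegral.
  by rewrite -RintD//; apply: eq_Rint => z _; rewrite cReD.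
by rewrite -RintD//; apply: eq_Rint => z _; rewrite cImD.
Qed.

Lemma cintbleZ f (c : C) : cintble f -> cintble (fun z => c * f z).
Proof.
move=> [f1 f2]; split.
  apply: eq_intB (intBD (intBZ (Re c) f1) (intBZ (- Im c) f2)) => z _.
  by rewrite cReM; ring.
apply: eq_intB (intBD (intBZ (Re c) f2) (intBZ (Im c) f1)) => z _.
by rewrite cImM.
Qed.

Lemma cintegralZ f (c : C) : cintble f -> cintegral (fun z => c * f z) = c * cintegral f.
Proof.
move=> [f1 f2]; apply: complex_eqP; rewrite ?cReM ?cImM ?Re_cintegral ?Im_cintegral.
  rewrite (@eq_Rint _ (fun z => Re c * Re (f z) + (- Im c) * Im (f z))).
    by rewrite RintD ?RintZ//; [rewrite mulNr|exact: intBZ|exact: intBZ].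
  by move=> z _; rewrite cReM; ring.
rewrite (@eq_Rint _ (fun z => Re c * Im (f z) + Im c * Re (f z))).
  by rewrite RintD ?RintZ//; exact: intBZ.
by move=> z _; rewrite cImM.
Qed.

Lemma cintbleN f : cintble f -> cintble (fun z => - f z).
Proof. by move=> /(cintbleZ (-1)); apply: eq_cintble => z _; rewrite mulN1r. Qed.

Lemma cintegralN f : cintble f -> cintegral (fun z => - f z) = - cintegral f.
Proof. by move=> h; rewrite -mulN1r -cintegralZ//; apply: eq_cintegral => z _; rewrite mulN1r. Qed.

Lemma cintegral0 : cintegral (fun _ : V => 0) = 0.
Proof.
have h : cintble (fun _ : V => 0).
  by split; apply: (@intB_bounded _ 0); rewrite ?normr0//; exact: measB_cst.
have e : 0 * cintegral (fun _ : V => 0 : C) = 0 by rewrite mul0r.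
by rewrite -[RHS]e -cintegralZ//; apply: eq_cintegral => z _; rewrite mul0r.
Qed.

Lemma cintble_sum I (r : seq I) (P : pred I) (F : I -> V -> C) :
  (forall i, P i -> cintble (F i)) -> cintble (fun z => \sum_(i <- r | P i) F i z).
Proof.
move=> h; split.
  have h1 i : P i -> intB (fun z => Re (F i z)) by move=> /h[].
  by apply: eq_intB (intB_sum r h1) => z _; rewrite cRe_sum.
have h1 i : P i -> intB (fun z => Im (F i z)) by move=> /h[].
by apply: eq_intB (intB_sum r h1) => z _; rewrite cIm_sum.
Qed.

Lemma cintegral_sum I (r : seq I) (P : pred I) (F : I -> V -> C) :
  (forall i, P i -> cintble (F i)) ->
  cintegral (fun z => \sum_(i <- r | P i) F i z) = \sum_(i <- r | P i) cintegral (F i).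
Proof.
move=> h; elim: r => [|i r ih].
  by rewrite big_nil -[RHS]cintegral0; apply: eq_cintegral => z _; rewrite big_nil.
rewrite big_cons -ih; case: ifPn => Pi; last first.
  by apply: eq_cintegral => z _; rewrite big_cons (negbTE Pi).
rewrite -cintegralD; [|exact: h|exact: cintble_sum].
by apply: eq_cintegral => z _; rewrite big_cons Pi.
Qed.

(** The factor 2 is the price of bounding real and imaginary parts separately. *)
Lemma normc_cintegral_le f G : measC f -> (forall z, cball z -> normc (f z) <= G z) -> intB G ->
  normc (cintegral f) <= 2 * Rint G.
Proof.
move=> mf h iG; have [h1 h2] := cintble_le mf h iG.
apply: le_trans (normc_le_ReIm _) _; rewrite mulr_natl mulr2n; rewrite Re_cintegral Im_cintegral; apply: lerD.
  by apply: norm_Rint_le => // z zB; apply: le_trans (h z zB); exact: abs_Re_le.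
by apply: norm_Rint_le => // z zB; apply: le_trans (h z zB); exact: abs_Im_le.
Qed.

Lemma Rint_dominated (Fk : nat -> V -> R) F G :
  (forall k, measB (Fk k)) -> (forall z, cball z -> Fk k z @[k --> \oo] --> F z) ->
  intB G -> (forall k z, cball z -> `|Fk k z| <= G z) ->
  intB F /\ Rint (Fk k) @[k --> \oo] --> Rint F.
Proof.
move=> mF cF iG h.
have mF' : measB F.
  by apply: (@measurable_fun_cvg _ _ _ _ (fun k v => Fk k (Cn v))) => // v vB; exact: cF.
have mk k : measurable_fun rB (fun v => (Fk k (Cn v))%:E) by apply/measurable_EFinP; exact: mF.
have mf : measurable_fun rB (fun v => (F (Cn v))%:E) by exact/measurable_EFinP.
have c1 : {ae nuT, forall v, rB v -> (Fk k (Cn v))%:E @[k --> \oo] --> (F (Cn v))%:E}.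
  by apply: (@aeW _ _ _ nuT) => v vB; apply: cvg_EFin; [exact: nearW|exact: cF].
have c2 : {ae nuT, forall v k, rB v -> (`|(Fk k (Cn v))%:E| <= (G (Cn v))%:E)%E}.
  by apply: (@aeW _ _ _ nuT) => v k vB; rewrite lee_fin h.
have [i1 _ i2] := dominated_convergence mB mk mf c1 iG c2.
split => //; rewrite /Rint /Rintegral.
by apply: fine_cvg; rewrite fineK//; exact: integrable_fin_num.
Qed.

End ComplexIntegral.

(** * Integration by parts on the ball *)

Section BallByParts.
Context {R : realType} {n : nat}.
Local Notation C := R[i].
Local Notation V := 'rV[C]_n.
Local Notation nn := (n + n)%N.
Local Notation RT := (measurableTypeR R).
Local Notation tup m := (m.-tuple RT).
Local Notation Cn := (@Cn_of_R2n R n).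
Local Notation Re := (@complex.Re R).
Local Notation Im := (@complex.Im R).
Local Notation L m := (@lebesgue_tuple R m).
Local Notation rB := (@rball R n).
Local Notation ic := (0 +i* 1 : C).
Implicit Types (f g : V -> C).

Lemma rder_tset (H : V -> C) d i v (t : R) : rder H (dir i) (Cn (tset v i t)) d ->
  is_derive t 1 (fun s : R => Re (H (Cn (tset v i s)))) (Re d) /\
  is_derive t 1 (fun s : R => Im (H (Cn (tset v i s)))) (Im d).
Proof.
move=> [h1 h2].
have E s : Cn (tset v i s) = Cn (tset v i t) + (s - t)%:C *: dir i.
  by rewrite -[in LHS](tset_tset v i t s) Cn_tset tnth_tset eqxx.
have sh : is_derive t 1 (fun s : R => s - t) 1.
  by apply: is_derive_eq; rewrite subr0.
split.
  have h : is_derive (t - t) 1 (fun s : R => Re (H (Cn (tset v i t) + s%:C *: dir i))) (Re d) by rewrite subrr.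
  have hh := @is_derive1_comp _ _ (fun s : R => s - t) _ _ _ h sh; rewrite mulr1 in hh.
  rewrite (_ : (fun s : R => _) = (fun s : R => Re (H (Cn (tset v i t) + s%:C *: dir i))) \o (fun s : R => s - t)); first exact: hh.
  by apply/funext => s /=; rewrite E.
have h : is_derive (t - t) 1 (fun s : R => Im (H (Cn (tset v i t) + s%:C *: dir i))) (Im d) by rewrite subrr.
have hh := @is_derive1_comp _ _ (fun s : R => s - t) _ _ _ h sh; rewrite mulr1 in hh.
rewrite (_ : (fun s : R => _) = (fun s : R => Im (H (Cn (tset v i t) + s%:C *: dir i))) \o (fun s : R => s - t)); first exact: hh.
by apply/funext => s /=; rewrite E.
Qed.

Lemma continuous_tset (F : V -> R) i v : (forall z, {for z, continuous F}) ->
  continuous (fun s : R => F (Cn (tset v i s))).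
Proof.
move=> cF t; apply/cvgrPdist_lt => e e0.
have /continuousRP /(_ e e0)[d d0 hd] := cF (Cn (tset v i t)).
have E s : Cn (tset v i s) = Cn (tset v i t) + (s - t)%:C *: dir i.
  by rewrite -[in LHS](tset_tset v i t s) Cn_tset tnth_tset eqxx.
near=> s; rewrite distrC; apply: hd => j.
rewrite E [X in normc X](_ : _ = (s - t)%:C * dir i 0 j); last by rewrite !mxE; ring.
rewrite normcM normc_real.
have st : `|s - t| < d by rewrite distrC; near: s; exact: cvgr_dist_lt.
apply: le_lt_trans st; rewrite ler_piMr//.
rewrite /dir; case: (fintype.split i) => k; rewrite /dirx /diry !mxE.
  by case: (_ && _); rewrite ?normc1// normc0.
by rewrite normcM normc_i mul1r; case: (_ && _); rewrite ?normc1// normc0.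
Unshelve. all: end_near. Qed.

Lemma ibp_compact_dir i (H dH : V -> C) (M : R) :
  (forall z, rder H (dir i) z (dH z)) -> (forall z, {for z, continuous dH}) ->
  (forall z, 1 <= sqnorm z -> H z = 0) -> (forall z, 1 <= sqnorm z -> dH z = 0) ->
  (forall z, normc (dH z) <= M) ->
  cintble dH /\ cintegral dH = 0.
Proof.
move=> rH cH H0 dH0 HM.
have ci : cintble dH.
  apply: (@cintble_le _ _ _ (fun=> M)) => //; first by apply: measC_cont => z _; exact: cH.
  by apply: (@intB_bounded _ _ _ `|M|) => //; exact: measB_cst.
split => //.
have key (P : C -> R) : (forall x, `|P x| <= normc x) -> P 0 = 0 ->
   (forall f z, {for z, continuous f} -> {for z, continuous (fun w : V => P (f w))}) ->
   (forall v t, is_derive (t : R) 1 (fun s : R => P (H (Cn (tset v i s)))) (P (dH (Cn (tset v i t))))) ->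
   intB (fun z : V => P (dH z)) -> Rint (fun z : V => P (dH z)) = 0.
  move=> Pn P0 Pc Pd Pi; rewrite /Rint /Rintegral.
  have iL := integrable_nuE measurable_rball Pi.
  rewrite (integral_nu_eq0 measurable_rball iL)//.
  have E : ((fun v => (P (dH (Cn v)))%:E) \_ rB) = (fun v => (P (dH (Cn v)))%:E).
    apply/funext => v; rewrite patchE; case: ifPn => //; rewrite notin_setE => /negP h.
    by rewrite dH0 ?P0// leNgt.
  rewrite integral_mkcond E.
  refine (@integral_partial_eq0 _ _ i (fun v => P (H (Cn v))) (fun v => P (dH (Cn v))) Pd _ _ _).
  - by move=> v; apply: (@continuous_tset (fun z => P (dH z))) => z; exact: Pc.
  - move=> v hv; rewrite H0 ?P0//; apply: le_trans (tnth_le_sqnorm v i).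
    by rewrite -real_normK ?num_real// expr_ge1.
  - move: iL; rewrite (integrable_mkcond _ measurable_rball) => iL.
    by rewrite E in iL.
have [i1 i2] := ci.
apply: complex_eqP; rewrite ?Re_cintegral ?Im_cintegral.
  have k1 := key Re (@abs_Re_le R) erefl (fun f z => @continuous_Re R n f z).
  by apply: k1 => // v t; have [] := rder_tset (rH (Cn (tset v i t))).
have k1 := key Im (@abs_Im_le R) erefl (fun f z => @continuous_Im R n f z).
by apply: k1 => // v t; have [] := rder_tset (rH (Cn (tset v i t))).
Qed.

(** The directions x_j and y_j show that A + B and i (A - B) have integral 0; the two equations
    separate A from B. *)
Lemma ibp_compact_wd j (H A B : V -> C) (M : R) :
  (forall z, wd j H z (A z) (B z)) ->
  (forall z, {for z, continuous A}) -> (forall z, {for z, continuous B}) ->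
  (forall z, 1 <= sqnorm z -> H z = 0) ->
  (forall z, 1 <= sqnorm z -> A z = 0) -> (forall z, 1 <= sqnorm z -> B z = 0) ->
  (forall z, normc (A z) <= M) -> (forall z, normc (B z) <= M) ->
  cintegral A = 0 /\ cintegral B = 0.
Proof.
move=> wH cA cB H0 A0 B0 AM BM.
have [] := @ibp_compact_dir (lshift n j) H (fun z => A z + B z) (M + M).
- by move=> z; rewrite dir_lshift; have [] := wH z.
- by move=> z; exact: (continuousDc (cA z) (cB z)).
- exact: H0.
- by move=> z z1; rewrite A0// B0// addr0.
- by move=> z; apply: le_trans (le_normcD _ _) _; apply: lerD.
move=> _ h1.
have [] := @ibp_compact_dir (rshift n j) H (fun z => ic * (A z + - B z)) (M + M).
- by move=> z; rewrite dir_rshift; have [] := wH z.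
- move=> z; exact: (continuousMc (@continuous_cstc _ _ ic z) (continuousDc (cA z) (continuousNc (cB z)))).
- exact: H0.
- by move=> z z1; rewrite A0// B0// oppr0 addr0 mulr0.
- by move=> z; rewrite normcM normc_i mul1r; apply: le_trans (le_normcD _ _) _; rewrite normc_opp lerD.
move=> _ h2.
have iA : cintble A.
  apply: (@cintble_le _ _ _ (fun=> M)) => //; first by apply: measC_cont => z _; exact: cA.
  by apply: (@intB_bounded _ _ _ `|M|) => //; exact: measB_cst.
have iB : cintble B.
  apply: (@cintble_le _ _ _ (fun=> M)) => //; first by apply: measC_cont => z _; exact: cB.
  by apply: (@intB_bounded _ _ _ `|M|) => //; exact: measB_cst.
move: h1; rewrite cintegralD// => h1.
move: h2; rewrite cintegralZ; last by apply: cintbleD => //; exact: cintbleN.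
rewrite cintegralD//; last exact: cintbleN.
rewrite cintegralN// => /eqP; rewrite mulf_eq0 => /orP[/eqP e|/eqP h2].
  by have := @normc_i R; rewrite e normc0 => /esym/eqP; rewrite oner_eq0.
have hB : cintegral A = cintegral B by apply/eqP; rewrite -subr_eq0; apply/eqP.
move: h1; rewrite hB -mulr2n -mulr_natr => /eqP.
by rewrite mulf_eq0 (negbTE (two_neq0c)) orbF => /eqP.
Qed.

Lemma continuous_cstr (c : R) (z : V) : {for z, continuous (fun=> c)}.
Proof. by apply/continuousRP => e e0; exists 1 => // w _; rewrite subrr normr0. Qed.

Lemma continuous_fun_defect (F : R -> R) z : continuous F ->
  {for z, continuous (fun w : V => (F (defect w))%:C)}.
Proof.
move=> cF; apply: (@continuous_complex _ _ (fun w => F (defect w)) (fun=> 0)); last exact: continuous_cstr.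
by apply: continuous_comp; [exact: continuous_defect|exact: cF].
Qed.

(** [integral_partial_eq0] lives on the whole space, while functions are controlled in the ball;
    those that vanish near the sphere extend by 0 and stay C^1. *)
Definition ext0 (F : V -> C) : V -> C := fun z => if sqnorm z < 1 then F z else 0.

Lemma ext0_near (F : V -> C) (e : R) z : 0 < e -> ~~ (sqnorm z < 1) ->
  (forall w, cball w -> defect w <= e -> F w = 0) ->
  exists2 d : R, 0 < d & forall w : V, (forall j, normc (w 0 j - z 0 j) < d) -> 0 = ext0 F w.
Proof.
move=> e0 z1 F0; have /continuousRP /(_ e e0)[d d0 hd] := @continuous_defect R n z.
exists d => // w /hd; rewrite /ext0; case: ifPn => // w1 h.
rewrite F0//; move: h; rewrite ltr_norml => /andP[_].
have : defect z <= 0 by rewrite /defect subr_le0 leNgt.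
lra.
Qed.

Lemma wd_ext0 j (F A B : V -> C) (e : R) : 0 < e ->
  (forall z, cball z -> wd j F z (A z) (B z)) ->
  (forall z, cball z -> defect z <= e -> F z = 0) ->
  forall z, wd j (ext0 F) z (ext0 A z) (ext0 B z).
Proof.
move=> e0 wF F0 z; rewrite {2 3}/ext0; case: ifPn => z1.
  by apply: wd_ball (wF z z1) => // w w1; rewrite /ext0 (w1 : sqnorm w < 1).
have [h1 h2] := wd_cst j 0 z.
have N := ext0_near e0 z1 F0.
by split; [apply: rder_near h1|apply: rder_near h2].
Qed.

Lemma continuous_ext0 (F : V -> C) (e : R) : 0 < e -> contB F ->
  (forall z, cball z -> defect z <= e -> F z = 0) ->
  forall z, {for z, continuous (ext0 F)}.
Proof.
move=> e0 cF F0 z; case: (boolP (sqnorm z < 1)) => z1.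
  by apply: near_eq_continuous (cF z z1) => // w w1; rewrite /ext0 (w1 : sqnorm w < 1).
have [d d0 hd] := ext0_near e0 z1 F0.
apply/continuousCP => r r0; exists d => // w hw.
by rewrite -hd// {1}/ext0 (negbTE z1) subrr normc0.
Qed.

Lemma bounded_ext0 (F : V -> C) (e : R) : 0 < e -> contB F ->
  (forall z, cball z -> defect z <= e -> F z = 0) ->
  exists2 M : R, 0 <= M & forall z, normc (ext0 F z) <= M.
Proof.
move=> e0 cF F0.
have [z z1|M hM] := @closed_ball_bounded R n 1 (fun z => normc (ext0 F z)).
  by apply: continuous_normc; exact: (continuous_ext0 e0).
exists `|M| => // z; case: (boolP (sqnorm z < 1)) => z1.
  apply: le_trans (ler_norm _) _; apply: le_trans (hM _ (ltW z1)) (ler_norm _).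
by rewrite /ext0 (negbTE z1) normc0.
Qed.

Lemma cintegral_ext0 (F : V -> C) : cintegral (ext0 F) = cintegral F.
Proof. by apply: eq_cintegral => z z1; rewrite /ext0 (z1 : sqnorm z < 1). Qed.

Lemma ibp_chi j (g a b : V -> C) (e : R) : 0 < e ->
  (forall z, cball z -> wd j g z (a z) (b z)) -> contB g -> contB a -> contB b ->
  cintegral (fun z => (chi e (defect z))%:C * a z + - ((dchi e (defect z))%:C * conjc (z 0 j)) * g z) = 0
  /\ cintegral (fun z => (chi e (defect z))%:C * b z + - ((dchi e (defect z))%:C * z 0 j) * g z) = 0.
Proof.
move=> e0 wg cg ca cb.
pose H := fun z : V => (chi e (defect z))%:C * g z.
pose A := fun z : V => (chi e (defect z))%:C * a z + - ((dchi e (defect z))%:C * conjc (z 0 j)) * g z.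
pose B := fun z : V => (chi e (defect z))%:C * b z + - ((dchi e (defect z))%:C * z 0 j) * g z.
have cA : contB A.
  move=> z z1.
  have c1 := @continuous_fun_defect _ z (continuous_chi e0).
  have c2 := @continuous_fun_defect _ z (continuous_dchi e0).
  have c3 := continuous_conj (@continuous_coord _ _ j z).
  exact: (continuousDc (continuousMc c1 (ca z z1)) (continuousMc (continuousNc (continuousMc c2 c3)) (cg z z1))).
have cB : contB B.
  move=> z z1.
  have c1 := @continuous_fun_defect _ z (continuous_chi e0).
  have c2 := @continuous_fun_defect _ z (continuous_dchi e0).
  have c3 := @continuous_coord _ _ j z.
  exact: (continuousDc (continuousMc c1 (cb z z1)) (continuousMc (continuousNc (continuousMc c2 c3)) (cg z z1))).
have H0 z : cball z -> defect z <= e -> H z = 0 by move=> _ h; rewrite /H chi_eq0// mul0r.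
have A0 z : cball z -> defect z <= e -> A z = 0.
  by move=> _ h; rewrite /A chi_eq0// dchi_eq0// !mul0r oppr0 mul0r addr0.
have B0 z : cball z -> defect z <= e -> B z = 0.
  by move=> _ h; rewrite /B chi_eq0// dchi_eq0// !mul0r oppr0 mul0r addr0.
have [M1 M10 hM1] := bounded_ext0 e0 cA A0.
have [M2 M20 hM2] := bounded_ext0 e0 cB B0.
have out (F : V -> C) z : 1 <= sqnorm z -> ext0 F z = 0 by rewrite /ext0 ltNge => ->.
have [] := @ibp_compact_wd j (ext0 H) (ext0 A) (ext0 B) (M1 + M2).
- apply: (wd_ext0 e0) => // z z1.
  exact: wdM (wd_defect_comp j (is_derive_chi (defect z) e0)) (wg z z1).
- exact: (continuous_ext0 e0).
- exact: (continuous_ext0 e0).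
- exact: out.
- exact: out.
- exact: out.
- by move=> z; have := hM1 z; lra.
- by move=> z; have := hM2 z; lra.
by rewrite !cintegral_ext0.
Qed.

(** As e = 1/(k+1) tends to 0, the term with [chi] converges to the integral of [a], while the term
    with [dchi] tends to 0 pointwise and is dominated by 4 |g| / D through [dchi_bound].
    Integrability of g / D thus plays the part of vanishing boundary values. *)
Lemma ibp_limit (a g : V -> C) (s : V -> C) :
  contB g -> contB a -> contB s -> (forall z, cball z -> normc (s z) <= 1) ->
  intB (fun z => normc (a z)) -> intB (fun z => normc (g z) / defect z) ->
  (forall e : R, 0 < e ->
    cintegral (fun z => (chi e (defect z))%:C * a z + - ((dchi e (defect z))%:C * s z) * g z) = 0) ->
  cintegral a = 0.
Proof.
move=> cg ca cs s1 ia ig h.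
pose A (k : nat) (z : V) := (chi k.+1%:R^-1 (defect z))%:C * a z + - ((dchi k.+1%:R^-1 (defect z))%:C * s z) * g z.
have k0 (k : nat) : 0 < (k.+1%:R^-1 : R) by rewrite invr_gt0.
have cA k : contB (A k).
  move=> z z1.
  have c1 := @continuous_fun_defect _ z (continuous_chi (k0 k)).
  have c2 := @continuous_fun_defect _ z (continuous_dchi (k0 k)).
  exact: (continuousDc (continuousMc c1 (ca z z1)) (continuousMc (continuousNc (continuousMc c2 (cs z z1))) (cg z z1))).
have key (P : C -> R) : (forall x, `|P x| <= normc x) ->
    (forall x y, P (x + y) = P x + P y) -> (forall (r : R) x, P (r%:C * x) = r * P x) ->
    (forall f z, {for z, continuous f} -> {for z, continuous (fun w : V => P (f w))}) ->
    (forall k, Rint (fun z => P (A k z)) = 0) -> Rint (fun z => P (a z)) = 0.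
  move=> Pn PD PM Pc P0.
  have [||||_] := @Rint_dominated _ _ (fun k z => P (A k z)) (fun z => P (a z))
    (fun z => normc (a z) + 4 * (normc (g z) / defect z)).
  - by move=> k; apply: measB_cont => z zB; apply: Pc; exact: cA.
  - move=> z zB.
    have -> : (fun k => P (A k z)) = (fun k : nat => chi k.+1%:R^-1 (defect z) * P (a z) +
        dchi k.+1%:R^-1 (defect z) * P (- (s z * g z))).
      apply/funext => k; rewrite PD PM; congr (_ + _); rewrite -PM; congr P; ring.
    rewrite -[X in _ --> X]addr0 -[X in _ --> X + _]mul1r -[X in _ --> _ + X](mul0r (P (- (s z * g z)))).
    have dz := defect_gt0 zB.
    by apply: cvgD; apply: cvgM; [exact: cvg_chi|exact: cvg_cst|exact: cvg_dchi|exact: cvg_cst].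
  - by apply: intBD => //; exact: intBZ.
  - move=> k z zB; apply: le_trans (Pn _) _; apply: le_trans (le_normcD _ _) _.
    have dz := defect_gt0 zB.
    apply: lerD.
      rewrite normcM normc_real ger0_norm ?chi_ge0// ler_piMl ?normc_ge0// chi_le1//.
    rewrite normcM normc_opp normcM normc_real ger0_norm ?dchi_ge0//.
    rewrite mulrAC mulrA ler_pdivlMr// mulrAC.
    apply: (@le_trans _ _ (dchi k.+1%:R^-1 (defect z) * normc (g z) * defect z)).
      by rewrite ler_pM2r// ler_wpM2r ?normc_ge0// ler_piMr ?dchi_ge0 ?s1.
    rewrite mulrAC ler_wpM2r ?normc_ge0// mulrC.
    exact: dchi_bound.
  under eq_fun do rewrite P0.
  by move=> /cvg_lim <-//; rewrite lim_cst.
apply: complex_eqP; rewrite ?Re_cintegral ?Im_cintegral.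
  apply: (key Re); [exact: abs_Re_le|exact: cReD|by move=> r x; rewrite cReM /= mul0r subr0|by move=> *; exact: continuous_Re|].
  by move=> k; rewrite -Re_cintegral h.
apply: (key Im); [exact: abs_Im_le|exact: cImD|by move=> r x; rewrite cImM /= mul0r addr0|by move=> *; exact: continuous_Im|].
by move=> k; rewrite -Im_cintegral h.
Qed.

Lemma ibp_pd j (g a b : V -> C) :
  (forall z, cball z -> wd j g z (a z) (b z)) -> contB g -> contB a -> contB b ->
  intB (fun z => normc (a z)) -> intB (fun z => normc (g z) / defect z) ->
  cintegral a = 0.
Proof.
move=> wg cg ca cb ia ig.
refine (@ibp_limit a g (fun z => conjc (z 0 j)) cg ca _ _ ia ig _).
- by move=> z _; apply: continuous_conj; exact: continuous_coord.
- by move=> z zB; rewrite normc_conj ltW// normc_coord_lt1.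
by move=> e e0; have [] := ibp_chi e0 wg cg ca cb.
Qed.

Lemma ibp_pdbar j (g a b : V -> C) :
  (forall z, cball z -> wd j g z (a z) (b z)) -> contB g -> contB a -> contB b ->
  intB (fun z => normc (b z)) -> intB (fun z => normc (g z) / defect z) ->
  cintegral b = 0.
Proof.
move=> wg cg ca cb ib ig.
refine (@ibp_limit b g (fun z => z 0 j) cg cb _ _ ib ig _).
- by move=> z _; exact: continuous_coord.
- by move=> z zB; rewrite ltW// normc_coord_lt1.
by move=> e e0; have [] := ibp_chi e0 wg cg ca cb.
Qed.

End BallByParts.

(** * Principal complex powers *)

Section Cpow.
Context {R : realType}.
Local Notation C := R[i].
Local Notation Re := (@complex.Re R).
Local Notation Im := (@complex.Im R).
Implicit Types (x : C) (s : R).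

Definition carg x : R := atan (Im x / Re x).

Lemma cpowE x s : cpow x s = (normc x `^ s)%:C * (cos (s * carg x) +i* sin (s * carg x)).
Proof. by []. Qed.

Lemma normc_cis (a : R) : normc (cos a +i* sin a) = 1.
Proof.
apply/eqP; rewrite -(@eqrXn2 _ 2)// ?normc_ge0// sqr_normcE /= cos2Dsin2 expr1n.
by [].
Qed.

Lemma normc_cpow x s : normc (cpow x s) = normc x `^ s.
Proof. by rewrite cpowE normcM normc_cis mulr1 normc_real ger0_norm// powR_ge0. Qed.

Lemma cisD (a b : R) : (cos a +i* sin a) * (cos b +i* sin b) = cos (a + b) +i* sin (a + b).
Proof. by apply: complex_eqP; rewrite ?cReM ?cImM /= ?cosD ?sinD//; ring. Qed.

Lemma normc_gt0Re x : 0 < Re x -> 0 < normc x.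
Proof. by move=> x0; apply: lt_le_trans (abs_Re_le x); rewrite gtr0_norm. Qed.

Lemma cpowD x s t : 0 < Re x -> cpow x (s + t) = cpow x s * cpow x t.
Proof.
move=> x0; have n0 := normc_gt0Re x0.
have E : (s + t) * carg x = s * carg x + t * carg x by rewrite mulrDl.
rewrite !cpowE powRD; last by rewrite (gt_eqF n0) implybT.
by rewrite E -cisD rmorphM /=; ring.
Qed.

Lemma cpow0 x : cpow x 0 = 1.
Proof. by rewrite cpowE powRr0 mul0r cos0 sin0 mul1r. Qed.

Lemma cpow1 x : 0 < Re x -> cpow x 1 = x.
Proof.
move=> x0; have n0 := normc_gt0Re x0; rewrite cpowE mul1r powRr1 ?normc_ge0//.
(* The cosine of the principal argument, positive because the argument lies in (-pi/2, pi/2); |x| c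
   = Re x is then checked on squares. *)
set c := cos _; have c0 : 0 < c by apply: cos_gt0_pihalf; rewrite atan_gtNpi2 atan_ltpi2.
have sE : sin (carg x) = c * (Im x / Re x).
  by rewrite -[Im x / Re x]atanK /tan -/(carg x) -/c mulrCA divff ?mulr1// gt_eqF.
have cc : c ^+ 2 + sin (carg x) ^+ 2 = 1 by exact: cos2Dsin2.
have nc : normc x * c = Re x.
  apply/eqP; rewrite -(@eqrXn2 _ 2)// ?mulr_ge0 ?ltW//; apply/eqP.
  rewrite exprMn sqr_normcE; move: cc; rewrite sE => cc.
  have -> : Im x = Re x * (Im x / Re x) by field; rewrite gt_eqF.
  have -> : (Re x ^+ 2 + (Re x * (Im x / Re x)) ^+ 2) * c ^+ 2 = Re x ^+ 2 * (c ^+ 2 + (c * (Im x / Re x)) ^+ 2) by ring.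
  by rewrite cc mulr1.
apply: complex_eqP; rewrite ?cReM ?cImM /= ?mul0r ?subr0 ?addr0//.
by rewrite sE mulrA nc; field; rewrite gt_eqF.
Qed.

Lemma cpow_neq0 x s : 0 < Re x -> cpow x s != 0.
Proof. by move=> x0; rewrite -normc_gt0 normc_cpow powR_gt0// normc_gt0Re. Qed.

Lemma cpowN x s : 0 < Re x -> cpow x (- s) = (cpow x s)^-1.
Proof.
move=> x0; apply: (mulfI (cpow_neq0 s x0)).
by rewrite -cpowD// subrr cpow0 divff// cpow_neq0.
Qed.

Lemma cpowB1 x s : 0 < Re x -> cpow x (s - 1) = cpow x s / x.
Proof. by move=> x0; rewrite cpowD// cpowN// cpow1. Qed.

Lemma cpow_conj x s : cpow (conjc x) s = conjc (cpow x s).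
Proof.
have E : carg (conjc x) = - carg x by rewrite /carg Re_conjc Im_conjc mulNr atanN.
rewrite !cpowE normc_conj E mulrN cosN sinN.
by apply: complex_eqP; rewrite ?Re_conjc ?Im_conjc ?cReM ?cImM /= ?mul0r; ring.
Qed.

Lemma cpow_real (r : R) s : 0 < r -> cpow r%:C s = (r `^ s)%:C.
Proof.
by move=> r0; rewrite cpowE /carg /= mul0r atan0 mulr0 cos0 sin0 mulr1 expr0n addr0 sqrtr_sqr gtr0_norm.
Qed.

(** In polar form the modulus is exp((s/2) ln(p^2 + q^2)) and the argument is s atan(q/p). The
    logarithmic derivative of the first and the derivative of the second are s [al] and s [be],
    where al + i be = (dp + i dq)/(p + i q). *)
Lemma is_derive_cpow (p q : R -> R) (t s dp dq : R) :
  is_derive t 1 p dp -> is_derive t 1 q dq -> 0 < p t ->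
  let d := s%:C * cpow (p t +i* q t) s / (p t +i* q t) * (dp +i* dq) in
  is_derive t 1 (fun u => Re (cpow (p u +i* q u) s)) (Re d) /\
  is_derive t 1 (fun u => Im (cpow (p u +i* q u) s)) (Im d).
Proof.
move=> hp hq p0 d.
pose L u := p u ^+ 2 + q u ^+ 2.
have L0 u : 0 < p u -> 0 < L u by move=> pu; rewrite ltr_wpDr ?sqr_ge0// exprn_gt0.
have {}L0 u (pu : 0 < p u) := L0 u pu.
have pn : \forall u \near t, 0 < p u.
  have cp : {for t, continuous p} by apply: differentiable_continuous; apply/derivable1_diffP; exact: ex_derive.
  exact: (cvgr_gt _ cp).
pose A := fun u => expR (s * (2^-1 * ln (L u))).
pose B := fun u => s * atan (q u / p u).
have nE u : 0 < p u -> normc (p u +i* q u) `^ s = A u.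
  move=> pu; rewrite /powR gt_eqF; last exact: normc_gt0Re.
  have -> : normc (p u +i* q u) = L u `^ 2^-1 by rewrite powR12_sqrt// ltW// L0.
  by rewrite ln_powR.
pose al := (p t * dp + q t * dq) / L t.
pose be := (p t * dq - q t * dp) / L t.
have hL : is_derive t 1 L (2 * (p t * dp + q t * dq)).
  have -> : L = p * p + q * q by apply/funext => u; rewrite /L !expr2.
  apply: is_derive_eq (is_deriveD (is_deriveM hp hp) (is_deriveM hq hq)) _.
  by rewrite /GRing.scale/=; ring.
have hA : is_derive t 1 A (A t * (s * al)).
  have h1 := is_derive1_comp (is_derive1_ln (L0 t p0)) hL.
  have h2 := is_derive_eq (is_deriveZ (2^-1) h1) erefl.
  have h3 := is_derive_eq (is_deriveZ s h2) erefl.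
  have h4 := is_derive1_comp (is_derive_expR _) h3.
  apply: is_derive_eq h4 _.
  rewrite /A /al /GRing.scale /=; have := L0 t p0; rewrite -/(L t) => l0; field.
  by rewrite gt_eqF.
have hB : is_derive t 1 B (s * be).
  have pt0 : p t != 0 by rewrite gt_eqF.
  have h0 := is_deriveV pt0 hp.
  have h1 := is_deriveM hq h0.
  have h2 := @is_derive1_comp _ (@atan R) (fun u => q u / p u) t _ _ (is_derive1_atan (q t / p t)) h1.
  have h4 := is_deriveZ s h2.
  apply: is_derive_eq h4 _.
  rewrite /be /GRing.scale /=; have := L0 t p0; rewrite /L => l0; field.
  by rewrite pt0 gt_eqF//= gt_eqF.
have dE : d = (A t * s)%:C * (al +i* be) * (cos (B t) +i* sin (B t)).
  have g0 : (p t +i* q t : C) != 0 by rewrite -normc_gt0 normc_gt0Re.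
  have E : dp +i* dq = (p t +i* q t) * (al +i* be).
    have := L0 t p0; rewrite /al /be /L => l0.
    by apply: complex_eqP; rewrite ?cReM ?cImM /=; field; rewrite gt_eqF.
  by rewrite /d E cpowE nE// -!mulrA mulKf// rmorphM /=; ring.
have hc := is_derive1_comp (is_derive_cos (B t)) hB.
have hs := is_derive1_comp (is_derive_sin (B t)) hB.
have key (F G : R -> R) (x y : R) : (forall u, 0 < p u -> F u = G u) -> is_derive t 1 F x -> x = y -> is_derive t 1 G y.
  move=> E h <-; have : \forall u \near t, F u = G u by near=> u; apply: E; near: u.
  by move=> nE'; apply: near_eq_is_derive h => //; exact: oner_neq0.
split.
  apply: (key (A * (cos \o B))) (is_deriveM hA hc) _.
    by move=> u pu; rewrite cpowE nE// cReM /= mul0r subr0.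
  by rewrite dE !cReM !cImM /= /GRing.scale/=; ring.
apply: (key (A * (sin \o B))) (is_deriveM hA hs) _.
  by move=> u pu; rewrite cpowE nE// cImM /= mul0r addr0.
by rewrite dE !cImM !cReM /= /GRing.scale/=; ring.
Unshelve. all: end_near. Qed.

End Cpow.

(** * Calculus of powers of functions on C^n *)

Section CpowCalculus.
Context {R : realType} {n : nat}.
Local Notation C := R[i].
Local Notation V := 'rV[C]_n.
Local Notation Re := (@complex.Re R).
Local Notation Im := (@complex.Im R).
Implicit Types (f g : V -> C) (z w v : V).

Lemma rder_cpow g v z d s : rder g v z d -> 0 < Re (g z) ->
  rder (fun w => cpow (g w) s) v z (s%:C * cpow (g z) s / g z * d).
Proof.
move=> [h1 h2] g0.
have E x : Re x +i* Im x = x by case: x.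
have g1 : 0 < Re (g (z + (0 : R)%:C *: v)) by rewrite line0.
have [k1 k2] := @is_derive_cpow R (fun t => Re (g (z + t%:C *: v))) (fun t => Im (g (z + t%:C *: v))) 0 s _ _ h1 h2 g1.
rewrite !line0 !E in k1 k2.
split.
  by rewrite (_ : (fun t => _) = (fun u => Re (cpow (Re (g (z + u%:C *: v)) +i* Im (g (z + u%:C *: v))) s))) //; apply/funext => u; rewrite E.
by rewrite (_ : (fun t => _) = (fun u => Im (cpow (Re (g (z + u%:C *: v)) +i* Im (g (z + u%:C *: v))) s))) //; apply/funext => u; rewrite E.
Qed.

Lemma rder_eq f v z a b : rder f v z a -> a = b -> rder f v z b.
Proof. by move=> h <-. Qed.

Lemma wd_cpow j g z a b s : wd j g z a b -> 0 < Re (g z) ->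
  wd j (fun w => cpow (g w) s) z (s%:C * cpow (g z) s / g z * a) (s%:C * cpow (g z) s / g z * b).
Proof.
move=> [h1 h2] g0; split.
  by apply: rder_eq (rder_cpow s h1 g0) _; rewrite mulrDr.
by apply: rder_eq (rder_cpow s h2 g0) _; ring.
Qed.

Lemma continuous_cpow g z s : {for z, continuous g} -> 0 < Re (g z) ->
  {for z, continuous (fun w => cpow (g w) s)}.
Proof.
move=> cg g0.
have c1 : {for z, continuous (fun w => Re (g w))} by exact: continuous_Re.
have c2 : {for z, continuous (fun w => Im (g w))} by exact: continuous_Im.
have c3 : {for z, continuous (fun w => normc (g w))} by exact: continuous_normc.
have n0 : 0 < normc (g z) by exact: normc_gt0Re.
have ca : {for z, continuous (fun w => s * carg (g w))}.
  apply: (@continuous_comp _ _ _ (fun w => Im (g w) / Re (g w)) (fun r : R => s * atan r)).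
    apply: (@continuousM R V (fun w => Im (g w)) (fun w => (Re (g w))^-1)) => //.
    by apply: (@continuousV R V (fun w => Re (g w))) => //; rewrite gt_eqF.
  apply: differentiable_continuous; apply/derivable1_diffP.
  by have h := is_deriveZ s (is_derive1_atan (Im (g z) / Re (g z))); exact: ex_derive.
apply: (@continuousMc _ _ (fun w => (normc (g w) `^ s)%:C) (fun w => cos (s * carg (g w)) +i* sin (s * carg (g w)))).
  apply: (@continuous_complex _ _ (fun w => normc (g w) `^ s) (fun=> 0)); last exact: continuous_cstr.
  apply: (@continuous_comp _ _ _ (fun w => normc (g w)) (fun r : R => r `^ s)) => //.
  by apply: differentiable_continuous; apply/derivable1_diffP; apply: derivable_powR; rewrite in_itv/= n0.
apply: (@continuous_complex _ _ (fun w => cos (s * carg (g w))) (fun w => sin (s * carg (g w)))).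
  by apply: (@continuous_comp _ _ _ (fun w => s * carg (g w)) (@cos R)) => //; exact: continuous_cos.
by apply: (@continuous_comp _ _ _ (fun w => s * carg (g w)) (@sin R)) => //; exact: continuous_sin.
Qed.

End CpowCalculus.

(** * Inequalities for real powers *)

Section PowerKit.
Context {R : realType}.
Implicit Types x y a b e : R.

Lemma powRDp x a b : 0 < x -> x `^ (a + b) = x `^ a * x `^ b.
Proof. by move=> x0; rewrite powRD// (gt_eqF x0) implybT. Qed.

Lemma powR_pred x a : 0 < x -> x `^ a = x * x `^ (a - 1).
Proof.
move=> x0; rewrite -[X in X * _](powRr1 (ltW x0)) -powRDp//; congr (_ `^ _); ring.
Qed.

Lemma le_powRN x y e : 0 < x -> x <= y -> 0 <= e -> y `^ (- e) <= x `^ (- e).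
Proof.
move=> x0 xy e0; have y0 := lt_le_trans x0 xy.
rewrite !powRN lef_pV2 ?posrE ?powR_gt0//.
by apply: ge0_ler_powR => //; rewrite nnegrE ltW.
Qed.

Lemma le_powR_exp x a b : 0 < x -> x <= 1 -> a <= b -> x `^ b <= x `^ a.
Proof. by move=> x0 x1 ab; apply: ger_powR => //; rewrite x0. Qed.

Lemma powR_half x e : 0 < x -> (x / 2) `^ (- e) = 2 `^ e * x `^ (- e).
Proof.
move=> x0; have i2 : (0 : R) <= 2^-1 by rewrite invr_ge0.
rewrite powRM ?ltW// mulrC; congr (_ * _).
by rewrite -powR_inv1// -powRrM mulN1r opprK.
Qed.

End PowerKit.

(** * Differentiation under the integral and growth along rays *)

Section LineDerivative.
Context {R : realType} {n : nat}.
Local Notation C := R[i].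
Local Notation V := 'rV[C]_n.
Local Notation Re := (@complex.Re R).
Local Notation Im := (@complex.Im R).
Implicit Types (f g : V -> C) (z w v : V).

Definition rdc (F : R -> C) (t : R) (d : C) : Prop :=
  is_derive t 1 (fun s => Re (F s)) (Re d) /\ is_derive t 1 (fun s => Im (F s)) (Im d).

Lemma rder_line g v z d (t : R) : rder g v (z + t%:C *: v) d ->
  rdc (fun s => g (z + s%:C *: v)) t d.
Proof.
move=> [h1 h2].
have E s : z + s%:C *: v = (z + t%:C *: v) + (s - t)%:C *: v.
  by rewrite -addrA -scalerDl -rmorphD /= addrCA subrr addr0.
have sh : is_derive t 1 (fun s : R => s - t) 1 by apply: is_derive_eq; rewrite subr0.
split.
  have h : is_derive (t - t) 1 (fun s : R => Re (g ((z + t%:C *: v) + s%:C *: v))) (Re d) by rewrite subrr.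
  have hh := @is_derive1_comp _ _ (fun s : R => s - t) _ _ _ h sh; rewrite mulr1 in hh.
  rewrite (_ : (fun s : R => _) = (fun s : R => Re (g ((z + t%:C *: v) + s%:C *: v))) \o (fun s : R => s - t)); first exact: hh.
  by apply/funext => s /=; rewrite E.
have h : is_derive (t - t) 1 (fun s : R => Im (g ((z + t%:C *: v) + s%:C *: v))) (Im d) by rewrite subrr.
have hh := @is_derive1_comp _ _ (fun s : R => s - t) _ _ _ h sh; rewrite mulr1 in hh.
rewrite (_ : (fun s : R => _) = (fun s : R => Im (g ((z + t%:C *: v) + s%:C *: v))) \o (fun s : R => s - t)); first exact: hh.
by apply/funext => s /=; rewrite E.
Qed.

(** On a short segment the defect keeps half its value, so kernel bounds are uniform there, as
    domination under the integral requires. *)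
Lemma cball_line z v : cball z -> exists2 e : R, 0 < e & forall t : R, `|t| < e ->
  cball (z + t%:C *: v) /\ defect z / 2 <= defect (z + t%:C *: v).
Proof.
move=> zB; have dz := defect_gt0 zB.
have /continuousRP /(_ (defect z / 2))[|d d0 hd] := @continuous_defect R n z.
  by rewrite divr_gt0.
pose M := 1 + \sum_j normc (v 0 j).
have M0 : 0 < M by rewrite ltr_wpDr// sumr_ge0// => j _; exact: normc_ge0.
exists (d / M); first by rewrite divr_gt0.
move=> t tM.
have : `|defect (z + t%:C *: v) - defect z| < defect z / 2.
  apply: hd => j; rewrite [X in normc X](_ : _ = t%:C * v 0 j); last by rewrite !mxE; ring.
  rewrite normcM normc_real.
  have vM : normc (v 0 j) <= M.
    rewrite /M (bigD1 j)//= addrCA lerDl addr_ge0// sumr_ge0// => i _; exact: normc_ge0.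
  apply: (@le_lt_trans _ _ (`|t| * M)); first by rewrite ler_wpM2l.
  by rewrite -ltr_pdivlMr.
rewrite ltr_norml => /andP[h _]; split; last lra.
by rewrite /cball /=; have : 0 < defect (z + t%:C *: v) by [lra|]; rewrite /defect subr_gt0.
Qed.

Lemma rdc_cintegral (F dF : V -> R -> C) (t0 e : R) (G : V -> R) :
  0 < e -> intB G ->
  (forall t : R, `|t - t0| < e -> forall w, cball w ->
    rdc (F w) t (dF w t) /\ normc (dF w t) <= G w) ->
  (forall t : R, `|t - t0| < e -> cintble (fun w => F w t)) ->
  rdc (fun t => cintegral (fun w => F w t)) t0 (cintegral (fun w => dF w t0)).
Proof.
move=> e0 iG hF iF.
have key (P : C -> R) : (forall x, `|P x| <= normc x) ->
   (forall t : R, `|t - t0| < e -> intB (fun w => P (F w t))) ->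
   (forall t : R, `|t - t0| < e -> forall w, cball w -> is_derive t 1 (fun s : R => P (F w s)) (P (dF w t))) ->
   is_derive t0 1 (fun t : R => Rint (fun w => P (F w t))) (Rint (fun w => P (dF w t0))).
  move=> Pn Pi Pd.
  have I0 : `]t0 - e, t0 + e[%classic t0 by rewrite /= in_itv/= ltrBlDr !ltrDl e0.
  have Ie t : `]t0 - e, t0 + e[%classic t -> `|t - t0| < e by rewrite /= in_itv/= ltr_distl.
  pose f (t : R) y := P (F (Cn_of_R2n y) t).
  have h1 x : `]t0 - e, t0 + e[%classic x -> (@nu R n).-integrable rball (EFin \o f x) by move=> /Ie; exact: Pi.
  have h2 x y : `]t0 - e, t0 + e[%classic x -> rball y -> derivable (f ^~ y) x 1.
    by move=> /Ie xe yB; have h := Pd x xe _ yB; exact: ex_derive.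
  have d1 x y : `]t0 - e, t0 + e[%classic x -> rball y -> partial1of2 f x y = P (dF (Cn_of_R2n y) x).
    by move=> /Ie xe yB; have h := Pd x xe _ yB; rewrite /partial1of2 derive1E; exact: derive_val.
  have h3 x y : `]t0 - e, t0 + e[%classic x -> rball y -> `|partial1of2 f x y| <= `|G (Cn_of_R2n y)|.
    move=> xe yB; rewrite d1//; apply: le_trans (Pn _) _; apply: le_trans (ler_norm _).
    by have [] := hF x (Ie _ xe) _ yB.
  have := derivable_under_integral measurable_rball I0 h1 h2 (fun y => normr_ge0 _) (intB_norm iG) h3.
  have := differentiation_under_integral measurable_rball I0 h1 h2 (fun y => normr_ge0 _) (intB_norm iG) h3.
  rewrite derive1E => E1 D1; split; first exact: D1.
  rewrite [LHS]E1 /Rint; apply: eq_Rintegral => y /[!inE] yB.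
  by rewrite d1.
split.
  rewrite Re_cintegral.
  rewrite (_ : (fun t : R => _) = (fun t : R => Rint (fun w => Re (F w t)))).
    apply: (key Re (@abs_Re_le R)).
      by move=> t te; have [] := iF t te.
    by move=> t te w wB; have [[]] := hF t te w wB.
  by apply/funext => t; rewrite Re_cintegral.
rewrite Im_cintegral.
rewrite (_ : (fun t : R => _) = (fun t : R => Rint (fun w => Im (F w t)))).
  apply: (key Im (@abs_Im_le R)).
    by move=> t te; have [] := iF t te.
  by move=> t te w wB; have [[]] := hF t te w wB.
by apply/funext => t; rewrite Im_cintegral.
Qed.

Lemma rder_cintegral (F dF : V -> V -> C) z v (e : R) (G : V -> R) :
  0 < e -> intB G ->
  (forall t : R, `|t| < e -> forall w, cball w ->
    rder (F w) v (z + t%:C *: v) (dF w (z + t%:C *: v)) /\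
    normc (dF w (z + t%:C *: v)) <= G w) ->
  (forall t : R, `|t| < e -> cintble (fun w => F w (z + t%:C *: v))) ->
  rder (fun x => cintegral (fun w => F w x)) v z (cintegral (fun w => dF w z)).
Proof.
move=> e0 iG hF iF.
have := @rdc_cintegral (fun w t => F w (z + t%:C *: v)) (fun w t => dF w (z + t%:C *: v)) 0 e G e0 iG.
rewrite line0; apply => [t|t]; rewrite subr0 => te; last exact: iF.
by move=> w wB; have [/rder_line h1 h2] := hF t te w wB.
Qed.

(** Comparison with a majorant: [U - u] and [U + u] have nonnegative derivatives. Expressing the
    bound through a primitive [U] makes growth estimates explicit without integrating. *)
Lemma MVT_bound (u du U dU : R -> R) (a b : R) : a <= b ->
  (forall t, t \in `[a, b] -> is_derive t 1 u (du t)) ->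
  (forall t, t \in `[a, b] -> is_derive t 1 U (dU t)) ->
  (forall t, t \in `[a, b] -> `|du t| <= dU t) ->
  `|u b - u a| <= U b - U a.
Proof.
move=> ab hu hU le.
have sub t : t \in `]a, b[ -> t \in `[a, b] by apply: subset_itv_oo_cc.
have cont (g dg : R -> R) : (forall t, t \in `[a, b] -> is_derive t 1 g (dg t)) -> {within `[a, b], continuous g}.
  move=> hg; apply: derivable_within_continuous => t tab; have h := hg t tab; exact: ex_derive.
have h1 t (ht : t \in `[a, b]) : is_derive t 1 (U - u) (dU t - du t).
  by have h := hu t ht; have h' := hU t ht; apply: is_deriveB.
have h2 t (ht : t \in `[a, b]) : is_derive t 1 (U + u) (dU t + du t).
  by have h := hu t ht; have h' := hU t ht; apply: is_deriveD.
have [c1 c1ab E1] := MVT_segment ab (fun t ht => h1 t (sub t ht)) (cont _ _ h1).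
have [c2 c2ab E2] := MVT_segment ab (fun t ht => h2 t (sub t ht)) (cont _ _ h2).
have := le _ c1ab; have := le _ c2ab; rewrite !ler_norml => /andP[b1 b2] /andP[b3 b4].
have p1 : 0 <= (dU c1 - du c1) * (b - a) by rewrite mulr_ge0 ?subr_ge0.
have p2 : 0 <= (dU c2 + du c2) * (b - a) by rewrite mulr_ge0 ?subr_ge0//; lra.
move: E1 E2; rewrite -[(U - u) b]/(U b - u b) -[(U - u) a]/(U a - u a) -[(U + u) b]/(U b + u b) -[(U + u) a]/(U a + u a).
move=> E1 E2; rewrite -E1 in p1; rewrite -E2 in p2; apply/andP; split; lra.
Qed.

(* The factor 2 comes from estimating real and imaginary parts separately. *)
Lemma curve_bound (g dg : R -> C) (U dU : R -> R) (a b : R) : a <= b ->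
  (forall t, t \in `[a, b] -> rdc g t (dg t)) ->
  (forall t, t \in `[a, b] -> is_derive t 1 U (dU t)) ->
  (forall t, t \in `[a, b] -> normc (dg t) <= dU t) ->
  normc (g b - g a) <= 2 * (U b - U a).
Proof.
move=> ab hg hU le.
have h1 := @MVT_bound (fun s => Re (g s)) (fun t => Re (dg t)) U dU a b ab
  (fun t ht => (hg t ht).1) hU (fun t ht => le_trans (abs_Re_le _) (le t ht)).
have h2 := @MVT_bound (fun s => Im (g s)) (fun t => Im (dg t)) U dU a b ab
  (fun t ht => (hg t ht).2) hU (fun t ht => le_trans (abs_Im_le _) (le t ht)).
apply: le_trans (normc_le_ReIm _) _; rewrite cReD cImD cReN cImN; lra.
Qed.

Lemma line_bound g v z (dg : R -> C) (U dU : R -> R) (a b : R) : a <= b ->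
  (forall t, t \in `[a, b] -> rder g v (z + t%:C *: v) (dg t)) ->
  (forall t, t \in `[a, b] -> is_derive t 1 U (dU t)) ->
  (forall t, t \in `[a, b] -> normc (dg t) <= dU t) ->
  normc (g (z + b%:C *: v) - g (z + a%:C *: v)) <= 2 * (U b - U a).
Proof.
move=> ab hg; apply: (@curve_bound (fun t => g (z + t%:C *: v)) dg) => // t ht.
exact: rder_line (hg t ht).
Qed.

Lemma is_derive_pow1B (r t p A : R) : 0 < 1 - t * r ->
  is_derive t 1 (fun s : R => A * (1 - s * r) `^ p) (- (A * r * p * (1 - t * r) `^ (p - 1))).
Proof.
move=> h.
have h0 : is_derive t 1 (fun s : R => 1 - s * r) (- r).
  have -> : (fun s : R => 1 - s * r) = cst 1 - r *: id.
    by apply/funext => s /=; rewrite [RHS]/(1 - r * s) mulrC.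
  apply: (is_derive_eq (is_deriveB (is_derive_cst (1 : R) t 1) (is_deriveZ r (is_derive_id t 1)))).
  by rewrite /GRing.scale/= mulr1 sub0r.
have h1 := @is_derive1_comp _ (fun x : R => x `^ p) (fun s : R => 1 - s * r) t _ _ (is_derive1_powR p h) h0.
by apply: is_derive_eq (is_deriveZ A h1) _; rewrite /GRing.scale/=; ring.
Qed.

Definition cnorm z : R := Num.sqrt (sqnorm z).

Lemma cnorm_ge0 z : 0 <= cnorm z. Proof. exact: sqrtr_ge0. Qed.

Lemma sqr_cnorm z : cnorm z ^+ 2 = sqnorm z.
Proof. by rewrite sqr_sqrtr// sqnorm_ge0. Qed.

Lemma cnorm_lt1 z : cball z -> cnorm z < 1.
Proof. by move=> zB; rewrite -(@ltr_pXn2r _ 2)// ?nnegrE ?cnorm_ge0// expr1n sqr_cnorm. Qed.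

Lemma normc_le_cnorm z j : normc (z 0 j) <= cnorm z.
Proof. by rewrite -(@ler_pXn2r _ 2)// ?nnegrE ?cnorm_ge0 ?normc_ge0// sqr_cnorm normc_coord_le. Qed.

Lemma defect_ray z (t : R) : cball z -> 0 <= t <= 1 -> 1 - t * cnorm z <= defect (t%:C *: z).
Proof.
move=> zB /andP[t0 t1]; rewrite /defect sqnormZ -sqr_cnorm -exprMn lerD2l lerN2.
have := cnorm_lt1 zB; have := cnorm_ge0 z => c0 c1.
by rewrite expr2 ler_piMr ?mulr_ge0// mulr_ile1// ltW.
Qed.

Lemma ray_gt0 z (t : R) : cball z -> 0 <= t <= 1 -> 0 < 1 - t * cnorm z.
Proof.
move=> zB /andP[t0 t1]; rewrite subr_gt0; apply: le_lt_trans (cnorm_lt1 zB).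
by rewrite ler_piMl ?cnorm_ge0.
Qed.

Lemma cball_ray z (t : R) : cball z -> 0 <= t <= 1 -> cball (t%:C *: z).
Proof.
move=> zB t01; have := lt_le_trans (ray_gt0 zB t01) (defect_ray zB t01).
by rewrite /defect subr_gt0.
Qed.

(** The bound has the primitive -(A/p) (1 - t |z|)^p along the ray; p = 0 would give a logarithm. *)
Lemma radial_bound g (dg : R -> C) z (A p : R) : cball z -> 0 <= A -> p != 0 ->
  (forall t : R, 0 <= t <= 1 -> rder g z (t%:C *: z) (dg t)) ->
  (forall t : R, 0 <= t <= 1 -> normc (dg t) <= A * cnorm z * (1 - t * cnorm z) `^ (p - 1)) ->
  normc (g z) <= normc (g 0) + 2 * (A * (1 - (1 - cnorm z) `^ p) / p).
Proof.
move=> zB A0 p0 hg le.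
have it (t : R) : t \in `[0, 1] -> 0 <= t <= 1 by rewrite in_itv.
have E (t : R) : (0 : V) + t%:C *: z = t%:C *: z by rewrite add0r.
have := @line_bound g z 0 dg (fun t => - (A / p) * (1 - t * cnorm z) `^ p)
  (fun t => - (- (A / p) * cnorm z * p * (1 - t * cnorm z) `^ (p - 1))) 0 1 ler01.
rewrite !E scale1r scale0r mul1r mul0r subr0 powR1 => /(_ _ _ _)h.
have {h}: normc (g z - g 0) <= 2 * (- (A / p) * (1 - cnorm z) `^ p - - (A / p) * 1).
  apply: h => t /it t01.
  - by rewrite E; exact: hg.
  - exact: is_derive_pow1B (ray_gt0 zB t01).
  - apply: le_trans (le t t01) _; rewrite le_eqVlt; apply/orP; left; apply/eqP.
    by field.
move=> h; have := le_normcD (g z - g 0) (g 0); rewrite subrK => h2.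
apply: le_trans h2 _; rewrite addrC lerD2l; apply: le_trans h _.
by rewrite le_eqVlt; apply/orP; left; apply/eqP; field.
Qed.

Lemma le_1Bcnorm z : cball z -> defect z / 2 <= 1 - cnorm z <= 1.
Proof.
move=> zB; have := cnorm_lt1 zB; have := cnorm_ge0 z; rewrite /defect -sqr_cnorm.
set c := cnorm z => c0 c1; apply/andP; split; last lra.
rewrite ler_pdivrMr//; nra.
Qed.

Lemma radial_bound_neg g (dg : R -> C) z (A e : R) : cball z -> 0 <= A -> 1 < e ->
  (forall t : R, 0 <= t <= 1 -> rder g z (t%:C *: z) (dg t)) ->
  (forall t : R, 0 <= t <= 1 -> normc (dg t) <= A * cnorm z * defect (t%:C *: z) `^ (- e)) ->
  normc (g z) <= normc (g 0) + 2 `^ e / (e - 1) * A * defect z `^ (1 - e).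
Proof.
move=> zB A0 e1 hg le.
have p0 : 1 - e != 0 by rewrite subr_eq0 eq_sym gt_eqF.
have dz := defect_gt0 zB; have /andP[h1 h2] := le_1Bcnorm zB.
apply: le_trans (radial_bound zB A0 p0 hg _) _ => [t t01|].
  apply: le_trans (le t t01) _; rewrite ler_wpM2l ?mulr_ge0 ?cnorm_ge0//.
  rewrite (_ : 1 - e - 1 = - e); last by ring.
  by rewrite le_powRN ?ray_gt0 ?defect_ray//; lra.
rewrite lerD2l.
have e0 : 0 < e - 1 by rewrite subr_gt0.
have key : (1 - cnorm z) `^ (1 - e) <= 2 `^ (e - 1) * defect z `^ (1 - e).
  have -> : 1 - e = - (e - 1) by ring.
  by rewrite -powR_half// le_powRN ?divr_gt0// ltW.
have -> : 2 * (A * (1 - (1 - cnorm z) `^ (1 - e)) / (1 - e)) =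
  2 / (e - 1) * A * ((1 - cnorm z) `^ (1 - e) - 1) by field; rewrite p0 gt_eqF.
have -> : 2 `^ e / (e - 1) * A * defect z `^ (1 - e) = 2 / (e - 1) * A * (2 `^ (e - 1) * defect z `^ (1 - e)).
  have -> : 2 `^ e = 2 * 2 `^ (e - 1) :> R by rewrite -{2}(@powRr1 _ 2)// -powRDp// addrC subrK.
  by field; rewrite gt_eqF.
apply: ler_wpM2l; last lra.
by rewrite !mulr_ge0// ?invr_ge0 ltW.
Qed.

Lemma radial_bound_pos g (dg : R -> C) z (A e : R) : cball z -> 0 <= A -> 0 <= e -> e < 1 ->
  (forall t : R, 0 <= t <= 1 -> rder g z (t%:C *: z) (dg t)) ->
  (forall t : R, 0 <= t <= 1 -> normc (dg t) <= A * cnorm z * defect (t%:C *: z) `^ (- e)) ->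
  normc (g z) <= normc (g 0) + 2 / (1 - e) * A.
Proof.
move=> zB A0 e0 e1 hg le.
have p0 : 1 - e != 0 by rewrite subr_eq0 eq_sym lt_eqF.
apply: le_trans (radial_bound zB A0 p0 hg _) _ => [t t01|].
  apply: le_trans (le t t01) _; rewrite ler_wpM2l ?mulr_ge0 ?cnorm_ge0//.
  rewrite (_ : 1 - e - 1 = - e); last by ring.
  by rewrite le_powRN ?ray_gt0 ?defect_ray.
rewrite lerD2l.
have -> : 2 * (A * (1 - (1 - cnorm z) `^ (1 - e)) / (1 - e)) =
  2 / (1 - e) * A * (1 - (1 - cnorm z) `^ (1 - e)) by field.
rewrite ler_piMr ?mulr_ge0 ?invr_ge0 ?subr_ge0 ?(ltW e1)//.
by rewrite lerBlDr lerDl powR_ge0.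
Qed.

End LineDerivative.

(** * Integrability of powers of the defect *)

Section BaseWeight.
Context {R : realType} {n : nat}.
Local Notation C := R[i].
Local Notation V := 'rV[C]_n.
Local Notation nuT := (@nu R n).
Local Notation rB := (@rball R n).
Local Notation Cn := (@Cn_of_R2n R n).
Local Notation Re := (@complex.Re R).
Implicit Types (F G : V -> R).

Lemma intB_fatou (Fk : nat -> V -> R) F (B : R) :
  (forall k, intB (Fk k)) -> (forall k z, cball z -> 0 <= Fk k z) -> measB F ->
  (forall z, cball z -> Fk k z @[k --> \oo] --> F z) ->
  (forall k, Rint (Fk k) <= B) -> intB F.
Proof.
move=> iF F0 mF cF FB; have mB := @measurable_rball R n.
have mk k : measurable_fun rB (fun v => (Fk k (Cn v))%:E) by apply/measurable_EFinP; exact: intB_meas.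
have fk0 k v : rB v -> (0 <= (Fk k (Cn v))%:E)%E by move=> vB; rewrite lee_fin F0.
have Fz0 z : cball z -> 0 <= F z.
  move=> zB; have c := cF z zB; rewrite -(cvg_lim _ c)//.
  apply: limr_ge; first by apply/cvg_ex; exists (F z).
  by apply: nearW => k; exact: F0.
apply/integrableP; split; first exact/measurable_EFinP.
apply: (@le_lt_trans _ _ B%:E); last exact: ltry.
have -> : (\int[nuT]_(v in rB) `|(F (Cn v))%:E|)%E = (\int[nuT]_(v in rB) limn_einf (fun k => (Fk k (Cn v))%:E))%E.
  apply: eq_integral => v; rewrite inE => vB.
  rewrite is_cvg_limn_einfE; last by apply/cvg_ex; exists (F (Cn v))%:E; apply: cvg_EFin; [exact: nearW|exact: cF].
  rewrite gee0_abs ?lee_fin ?Fz0//; apply/esym/cvg_lim => //.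
  by apply: cvg_EFin; [exact: nearW|exact: cF].
apply: le_trans (fatou nuT mB mk fk0) _; rewrite limn_einf_lim.
apply: lime_le; first exact: is_cvg_einfs.
apply: nearW => k; apply: le_trans (_ : (\int[nuT]_(v in rB) (Fk k (Cn v))%:E <= _)%E).
  by apply: ereal_inf_lbound; exists k => /=.
by rewrite -RintE// lee_fin.
Qed.

Lemma contBr_powR (F : V -> R) (p : R) : contBr F -> (forall z, cball z -> 0 < F z) ->
  contBr (fun z => F z `^ p).
Proof.
move=> cF F0 z zB; apply: (@continuous_comp _ _ _ F (fun r : R => r `^ p)); first exact: cF.
by apply: differentiable_continuous; apply/derivable1_diffP; apply: derivable_powR; rewrite in_itv/= F0.
Qed.

Lemma contBr_defectp (p : R) : contBr (fun z : V => defect z `^ p).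
Proof. by apply: contBr_powR => z zB; [exact: continuous_defect|exact: defect_gt0]. Qed.

Lemma contB_real (F : V -> R) : contBr F -> contB (fun z => (F z)%:C).
Proof.
move=> cF z zB; apply: (@continuous_complex _ _ F (fun=> 0)); [exact: cF|exact: continuous_cstr].
Qed.

Lemma is_derive_defectp (p : R) (z : V) : cball z ->
  is_derive (defect z) 1 (fun s : R => s `^ p) (p * defect z `^ (p - 1)).
Proof. by move=> zB; exact: (is_derive1_powR p (defect_gt0 zB)). Qed.

Lemma wd_defectp j (p : R) (z : V) : cball z ->
  wd j (fun w => (defect w `^ p)%:C) z (- ((p * defect z `^ (p - 1))%:C * conjc (z 0 j)))
    (- ((p * defect z `^ (p - 1))%:C * z 0 j)).
Proof. by move=> zB; exact: (wd_defect_comp j (is_derive_defectp p zB)). Qed.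

(** Integrate the j-th holomorphic derivative of chi(D) z_j D^M: M times the integral of chi |z_j|^2
    D^{M-1} equals that of chi D^M minus that of chi' |z_j|^2 D^M. The subtracted term is
    nonnegative and D^M <= 1, so the bound is uniform in the cutoff, which Fatou's lemma removes. *)
Lemma intB_coord_defectp j (M : R) : 0 < M -> M <= 1 ->
  intB (fun z : V => normc (z 0 j) ^+ 2 * defect z `^ (M - 1)).
Proof.
move=> M0 M1.
have dz (z : V) : cball z -> 0 < defect z by exact: defect_gt0.
have c2 (z : V) : cball z -> 0 <= normc (z 0 j) ^+ 2 <= 1.
  by move=> zB; rewrite sqr_ge0 -[X in _ <= X](expr1n _ 2) ler_pXn2r// ?nnegrE ?normc_ge0// ltW// normc_coord_lt1.
have dM (z : V) : cball z -> 0 <= defect z `^ M <= 1.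
  by move=> zB; rewrite powR_ge0 -[X in _ <= X](powRr0 (defect z)) le_powR_exp ?dz ?defect_le1// ltW.
have mc : measB (fun z : V => normc (z 0 j) ^+ 2).
  apply: eq_measB (_ : measB (fun z : V => normc (z 0 j) * normc (z 0 j))) => [z zB|]; first by rewrite expr2.
  by apply: measBM; apply: measB_cont => z _; apply: continuous_normc; exact: continuous_coord.
have mw : measB (fun z : V => normc (z 0 j) ^+ 2 * defect z `^ (M - 1)).
  by apply: measBM => //; apply: measB_powR; exact: measB_defect.
pose e (k : nat) : R := k.+1%:R^-1.
have e0 k : 0 < e k by rewrite invr_gt0.
have mchi k : measB (fun z : V => chi (e k) (defect z)).
  by apply: measB_cont => z _; apply: continuous_comp; [exact: continuous_defect|exact: continuous_chi].
have mdchi k : measB (fun z : V => dchi (e k) (defect z)).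
  by apply: measB_cont => z _; apply: continuous_comp; [exact: continuous_defect|exact: continuous_dchi].
pose F k (z : V) := chi (e k) (defect z) * (normc (z 0 j) ^+ 2 * defect z `^ (M - 1)).
pose T k (z : V) := chi (e k) (defect z) * defect z `^ M.
pose U k (z : V) := dchi (e k) (defect z) * normc (z 0 j) ^+ 2 * defect z `^ M.
have low k (z : V) : cball z -> ~~ (defect z <= e k) -> defect z `^ (M - 1) <= e k `^ (M - 1).
  move=> zB; rewrite -ltNge => h; rewrite -opprB le_powRN//; first exact: ltW.
  by rewrite subr_ge0.
have iF k : intB (F k).
  apply: (@intB_bounded _ _ _ (e k `^ (M - 1))); first by apply: measBM.
  move=> z zB; rewrite /F ger0_norm; last exact: (mulr_ge0 (chi_ge0 _ (e0 k)) (mulr_ge0 (sqr_ge0 _) (powR_ge0 _ _))).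
  case: (boolP (defect z <= e k)) => [h|/low h]; first by rewrite chi_eq0// mul0r powR_ge0.
  have /andP[a1 a2] := c2 z zB.
  apply: le_trans (h zB); rewrite mulrA ler_piMl ?powR_ge0// mulr_ile1 ?chi_ge0 ?chi_le1//.
have iT k : intB (T k).
  apply: (@intB_bounded _ _ _ 1); first by apply: measBM => //; apply: measB_powR; exact: measB_defect.
  move=> z zB; have /andP[a1 a2] := dM z zB.
  by rewrite /T ger0_norm; [rewrite mulr_ile1 ?chi_ge0 ?chi_le1|exact: (mulr_ge0 (chi_ge0 _ (e0 k)))].
have iU k : intB (U k).
  apply: (@intB_bounded _ _ _ (4 * e k `^ (M - 1))).
    by apply: measBM; [apply: measBM|apply: measB_powR; exact: measB_defect].
  move=> z zB; have /andP[a1 a2] := c2 z zB; have d0 := dz z zB.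
  rewrite /U ger0_norm; last exact: (mulr_ge0 (mulr_ge0 (dchi_ge0 _ (e0 k)) (sqr_ge0 _)) (powR_ge0 _ _)).
  case: (boolP (defect z <= e k)) => [h|/low h].
    by rewrite dchi_eq0// !mul0r mulr_ge0 ?powR_ge0.
  have -> : defect z `^ M = defect z * defect z `^ (M - 1).
    by rewrite -{2}(@powRr1 _ (defect z)) ?ltW// -powRDp// addrC subrK.
  have dd := dchi_bound (defect z) (e0 k); have q0 := dchi_ge0 (defect z) (e0 k).
  move: (dchi _ _) dd q0 => q dd q0.
  rewrite (_ : _ * _ = (defect z * q) * normc (z 0 j) ^+ 2 * defect z `^ (M - 1)); last by ring.
  have p0 : 0 <= defect z * q by rewrite mulr_ge0// ltW.
  have p1 := mulr_ge0 p0 a1.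
  apply: (ler_pM p1 (powR_ge0 _ _)); last exact: h.
  by apply: le_trans dd; rewrite ler_piMr.
apply: (@intB_fatou F _ (M^-1 * Rint (fun=> 1))) => //.
- by move=> k z zB; exact: (mulr_ge0 (chi_ge0 _ (e0 k)) (mulr_ge0 (sqr_ge0 _) (powR_ge0 _ _))).
- move=> z zB; rewrite -[X in _ --> X]mul1r; apply: cvgM; last exact: cvg_cst.
  by apply: cvg_chi; exact: dz.
move=> k; rewrite ler_pdivlMl// -RintZ//.
pose a (z : V) := z 0 j * (- ((M * defect z `^ (M - 1))%:C * conjc (z 0 j))) + (j == j)%:R * (defect z `^ M)%:C : C.
pose b (z : V) := z 0 j * (- ((M * defect z `^ (M - 1))%:C * z 0 j)) + 0 * (defect z `^ M)%:C : C.
pose g (z : V) := z 0 j * (defect z `^ M)%:C.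
have cc : contB (fun z : V => z 0 j) by move=> z _; exact: continuous_coord.
have ccb : contB (fun z : V => conjc (z 0 j)) by move=> z _; apply: continuous_conj; exact: continuous_coord.
have cp p : contB (fun z : V => (defect z `^ p)%:C) by apply: contB_real; exact: contBr_defectp.
have cMp : contB (fun z : V => (M * defect z `^ (M - 1))%:C).
  move=> z zB; have h := continuousMc (@continuous_cstc _ _ M%:C z) (cp (M - 1) z zB).
  rewrite (_ : (fun z => _) = (fun z : V => M%:C * (defect z `^ (M - 1))%:C)); first exact: h.
  by apply/funext => w; rewrite rmorphM.
have wg z : cball z -> wd j g z (a z) (b z).
  by move=> zB; exact: (wdM (wd_coord j j z) (wd_defectp j M zB)).
have cg : contB g by move=> z zB; exact: (continuousMc (cc z zB) (cp M z zB)).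
have ca : contB a.
  move=> z zB; exact: (continuousDc (continuousMc (cc z zB) (continuousNc (continuousMc (cMp z zB) (ccb z zB))))
    (continuousMc (@continuous_cstc _ _ _ z) (cp M z zB))).
have cb : contB b.
  move=> z zB; exact: (continuousDc (continuousMc (cc z zB) (continuousNc (continuousMc (cMp z zB) (cc z zB))))
    (continuousMc (@continuous_cstc _ _ _ z) (cp M z zB))).
have [h _] := ibp_chi (e0 k) wg cg ca cb.
have {}h : Rint (fun z => T k z + - (M * F k z) + - U k z) = 0.
  transitivity (Re (0 : C)) => //; rewrite -h Re_cintegral; apply: eq_Rint => z zB.
  rewrite /T /F /U /a /g eqxx sqr_normcE.
  by case: (z 0 j) => x y /=; ring.
have iE : intB (fun z => T k z + - (M * F k z) + - U k z).
  by apply: intBD; [apply: intBD => //; apply: intBN; exact: intBZ|exact: intBN].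
have iMF : intB (fun z => M * F k z) by exact: intBZ.
rewrite -[leLHS]addr0 -h -RintD//.
apply: le_Rint => //; [exact: intBD|exact: (intB_bounded (measB_cst 1))|].
move=> z zB; have /andP[a1 a2] := dM z zB.
have t1 : T k z <= 1 by rewrite /T mulr_ile1 ?chi_ge0 ?chi_le1.
have u0 : 0 <= U k z by exact: (mulr_ge0 (mulr_ge0 (dchi_ge0 _ (e0 k)) (sqr_ge0 _)) (powR_ge0 _ _)).
lra.
Qed.

Lemma intB_defectp (M : R) : 0 < M -> intB (fun z : V => defect z `^ (M - 1)).
Proof.
move=> M0; have mD : measB (fun z : V => defect z `^ (M - 1)) by apply: measB_powR; exact: measB_defect.
have dz (z : V) : cball z -> 0 < defect z by exact: defect_gt0.
case: (lerP M 1) => M1; last first.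
  apply: (@intB_bounded _ _ _ 1) => // z zB; rewrite ger0_norm ?powR_ge0//.
  by rewrite -[X in _ <= X](powRr0 (defect z)) le_powR_exp ?dz ?defect_le1//; lra.
(* Where |z|^2 >= 1/2 the sum over j dominates D^{M-1} by 2 |z|^2 D^{M-1}; elsewhere D >= 1/2 and
   the constant suffices. *)
apply: (@intB_le _ _ _ (fun z => 2 * (\sum_j normc (z 0 j) ^+ 2 * defect z `^ (M - 1)) + 2 `^ (1 - M))) => //.
- move=> z zB; rewrite ger0_norm ?powR_ge0// -mulr_suml -/(sqnorm z).
  case: (lerP (1 / 2) (sqnorm z)) => h.
    have := @powR_ge0 R (defect z) (M - 1); have := @powR_ge0 R 2 (1 - M); nra.
  have h2 : 2^-1 <= defect z by rewrite /defect; lra.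
  apply: le_trans (_ : 2 `^ (1 - M) <= _); last by rewrite lerDr !mulr_ge0 ?sqnorm_ge0 ?powR_ge0.
  have -> : M - 1 = - (1 - M) by ring.
  apply: le_trans (le_powRN _ h2 _) _; [by rewrite invr_gt0|lra|].
  by rewrite -{1}(mul1r 2^-1) powR_half// powR1 mulr1.
apply: intBD; last exact: (@intB_bounded _ _ _ `|2 `^ (1 - M)| (measB_cst _)).
by apply: intBZ; apply: intB_sum => j _; exact: intB_coord_defectp.
Qed.

End BaseWeight.

(** * The kernel and holomorphic functions *)

Section Kernel.
Context {R : realType} {n : nat}.
Local Notation C := R[i].
Local Notation V := 'rV[C]_n.
Local Notation Re := (@complex.Re R).
Local Notation Im := (@complex.Im R).
Local Notation ic := (0 +i* 1 : C).
Implicit Types (f g u : V -> C) (z w v : V).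

(* C^1 with vanishing antiholomorphic derivatives, in the form of a derivative
   along every line; [a j] is the j-th holomorphic derivative. *)
Definition hol f (a : 'I_n -> V -> C) : Prop :=
  [/\ contB f, forall j, contB (a j) &
      forall z, cball z -> forall v, rder f v z (\sum_j v 0 j * a j z)].

Lemma hol_wd f a j z : hol f a -> cball z -> wd j f z (a j z) 0.
Proof.
move=> [_ _ h] zB; split.
  apply: rder_eq (h z zB (dirx j)) _; rewrite (bigD1 j)//= /dirx !mxE !eqxx mul1r addr0.
  by rewrite big1 ?addr0// => i ij; rewrite !mxE eqxx (negbTE ij) mul0r.
apply: rder_eq (h z zB (diry j)) _; rewrite (bigD1 j)//= /diry !mxE !eqxx mulr1 subr0.
by rewrite big1 ?addr0// => i ij; rewrite !mxE eqxx (negbTE ij) mulr0 mul0r.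
Qed.

(** The first argument is the variable of integration: the kernel is antiholomorphic in [w] and
    holomorphic in [z]. *)
Definition kern (s : R) w z : C := cpow (1 - hdot w z) (- s).

Lemma Re_1hdot_gt0 w z : cball w -> cball z -> 0 < Re (1 - hdot w z).
Proof.
move=> wB zB; have dw := defect_gt0 wB; have dz := defect_gt0 zB.
by have [] := defect_rho (ltW dw) (ltW dz) (addr_gt0 dw dz).
Qed.

Lemma rho_gt0 w z : cball w -> cball z -> 0 < rho w z.
Proof. by move=> wB zB; exact: normc_gt0Re (Re_1hdot_gt0 wB zB). Qed.

Lemma defect_le_2rho w z : cball w -> cball z -> defect z <= 2 * rho w z.
Proof.
move=> wB zB; have dw := defect_gt0 wB; have dz := defect_gt0 zB.
by have [] := defect_rho (ltW dw) (ltW dz) (addr_gt0 dw dz).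
Qed.

Lemma normc_kern s w z : normc (kern s w z) = rho w z `^ (- s).
Proof. by rewrite /kern normc_cpow. Qed.

Lemma kern_le s w z : 0 <= s -> cball w -> cball z -> normc (kern s w z) <= 2 `^ s * defect z `^ (- s).
Proof.
move=> s0 wB zB; have dz := defect_gt0 zB.
rewrite normc_kern -powR_half// le_powRN ?divr_gt0//.
by have := defect_le_2rho wB zB; lra.
Qed.

Lemma kernS s w z : cball w -> cball z -> kern s w z = (1 - hdot w z) * kern (s + 1) w z.
Proof.
move=> wB zB; have h := Re_1hdot_gt0 wB zB.
rewrite /kern -{2}(cpow1 h) -cpowD//; congr cpow; ring.
Qed.

Lemma kern_conj s w z : conjc (kern s w z) = kern s z w.
Proof. by rewrite /kern -cpow_conj rmorphB rmorph1 /= hdot_conj conjcK. Qed.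

Lemma continuous_hdotr w z : {for z, continuous (fun z => hdot w z)}.
Proof.
apply: continuous_sumc => j _.
exact: (continuousMc (@continuous_cstc _ _ _ z) (@continuous_coord _ _ j z)).
Qed.

Lemma contB_kernl s z : cball z -> contB (fun w => kern s w z).
Proof.
move=> zB w wB; apply: continuous_cpow; last exact: Re_1hdot_gt0.
exact: (continuousDc (@continuous_cstc _ _ 1 w) (continuousNc (@continuous_hdotl _ _ z w))).
Qed.

Lemma contB_kernr s w : cball w -> contB (fun z => kern s w z).
Proof.
move=> wB z zB; apply: continuous_cpow; last exact: Re_1hdot_gt0.
exact: (continuousDc (@continuous_cstc _ _ 1 z) (continuousNc (@continuous_hdotr w z))).
Qed.

Lemma kern_diffE s w z (x : C) : cball w -> cball z ->
  (- s)%:C * cpow (1 - hdot w z) (- s) / (1 - hdot w z) * (- x) = s%:C * x * kern (s + 1) w z.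
Proof.
move=> wB zB; have h := Re_1hdot_gt0 wB zB.
by rewrite /kern opprD cpowB1// rmorphN /=; ring.
Qed.

Lemma wd_kern j s w z : cball w -> cball z ->
  wd j (fun w => kern s w z) w 0 (s%:C * z 0 j * kern (s + 1) w z).
Proof.
move=> wB zB; have h := Re_1hdot_gt0 wB zB.
apply: wd_eq (wd_cpow (- s) (wdD (wd_cst j 1 w) (wdN (wd_hdot j w z))) h) _ _.
  by rewrite oppr0 addr0 mulr0.
by rewrite add0r kern_diffE.
Qed.

Lemma rder_hdot w v z : rder (fun z => hdot w z) v z (hdot w v).
Proof.
have h (j : 'I_n) : true -> rder (fun z : V => conjc (w 0 j) * z 0 j) v z (conjc (w 0 j) * v 0 j + 0 * z 0 j).
  by move=> _; exact: (rderM (rder_cst (conjc (w 0 j)) v z) (rder_coord j v z)).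
apply: rder_eq (rder_sum (index_enum 'I_n) h) _.
by apply: eq_bigr => j _; rewrite mul0r addr0.
Qed.

Lemma rder_kern s w v z : cball w -> cball z ->
  rder (fun z => kern s w z) v z (s%:C * hdot w v * kern (s + 1) w z).
Proof.
move=> wB zB; have h := Re_1hdot_gt0 wB zB.
apply: rder_eq (rder_cpow (- s) (rderD (rder_cst 1 v z) (rderN (rder_hdot w v z))) h) _.
by rewrite add0r kern_diffE.
Qed.

Lemma hol_kern s w : cball w -> hol (fun z => kern s w z)
  (fun j z => s%:C * conjc (w 0 j) * kern (s + 1) w z).
Proof.
move=> wB; split.
- exact: contB_kernr.
- move=> j z zB; exact: (continuousMc (@continuous_cstc _ _ (s%:C * conjc (w 0 j)) z) (@contB_kernr (s + 1) w wB z zB)).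
- move=> z zB v; apply: rder_eq (rder_kern s v wB zB) _.
  rewrite /hdot mulr_sumr mulr_suml; apply: eq_bigr => j _; ring.
Qed.

Lemma contBM f g : contB f -> contB g -> contB (fun z => f z * g z).
Proof. by move=> cf cg z zB; exact: (continuousMc (cf z zB) (cg z zB)). Qed.
Lemma contBD f g : contB f -> contB g -> contB (fun z => f z + g z).
Proof. by move=> cf cg z zB; exact: (continuousDc (cf z zB) (cg z zB)). Qed.
Lemma contBN f : contB f -> contB (fun z => - f z).
Proof. by move=> cf z zB; exact: (continuousNc (cf z zB)). Qed.
Lemma contB_cst (c : C) : contB (fun _ : V => c).
Proof. by move=> z zB; exact: continuous_cstc. Qed.
Lemma contB_coord j : contB (fun z : V => z 0 j).
Proof. by move=> z zB; exact: continuous_coord. Qed.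
Lemma contB_conj f : contB f -> contB (fun z => conjc (f z)).
Proof. by move=> cf z zB; apply: continuous_conj; exact: cf. Qed.
Lemma contB_sum I (r : seq I) (P : pred I) (F : I -> V -> C) :
  (forall i, P i -> contB (F i)) -> contB (fun z => \sum_(i <- r | P i) F i z).
Proof. by move=> h z zB; apply: continuous_sumc => i Pi; exact: h. Qed.
Lemma contBr_normc f : contB f -> contBr (fun z => normc (f z)).
Proof. by move=> cf z zB; apply: continuous_normc; exact: cf. Qed.
Lemma contBrM (F G : V -> R) : contBr F -> contBr G -> contBr (fun z => F z * G z).
Proof. by move=> cF cG z zB; apply: (@continuousM R V F G); [exact: cF|exact: cG]. Qed.
Lemma contBr_cst (c : R) : contBr (fun _ : V => c).
Proof. by move=> z zB; exact: continuous_cstr. Qed.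
Lemma contBrV (F : V -> R) : contBr F -> (forall z, cball z -> F z != 0) -> contBr (fun z => (F z)^-1).
Proof. by move=> cF F0 z zB; apply: (@continuousV R V F); [exact: F0|exact: cF]. Qed.
Lemma contBr_defect : contBr (@defect R n).
Proof. by move=> z zB; exact: continuous_defect. Qed.
Lemma contB_at f z : contB f -> cball z -> {for z, continuous f}.
Proof. by move=> cf; exact: cf. Qed.
Lemma eq_contB f g : (forall z, cball z -> f z = g z) -> contB f -> contB g.
Proof. by move=> E cf z zB; exact: near_eq_continuous zB E (cf z zB). Qed.
Lemma contB_cbar j : contB (fun z : V => conjc (z 0 j)).
Proof. by apply: contB_conj; exact: contB_coord. Qed.

End Kernel.

(* Otherwise failing unification problems compare unfolded topologies. *)
Opaque contB contBr intB.

(** Directed by the syntax of the goal: each case extracts the component functions by pattern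
    matching and passes them explicitly, so that unification has nothing to guess. *)
Ltac contB_step := lazymatch goal with
  | H : contB ?g |- contB ?g => exact H
  | H : contBr ?g |- contBr ?g => exact H
  | H : forall j, contB (?g j) |- contB (?g ?j) => exact (H j)
  | |- contB (fun w => fun_of_matrix w _ _) => apply contB_coord
  | |- contB (fun w => conjc (fun_of_matrix w _ _)) => apply contB_cbar
  | |- contB (fun w => conjc (@?f w)) => apply (contB_conj (f := f))
  | |- contB (fun w => @GRing.mul _ (@?f w) (@?g w)) => apply (contBM (f := f) (g := g))
  | |- contB (fun w => @GRing.add _ (@?f w) (@?g w)) => apply (contBD (f := f) (g := g))
  | |- contB (fun w => @GRing.opp _ (@?f w)) => apply (contBN (f := f))
  | |- contB (fun w => (@?F w)%:C) => apply (contB_real (F := F))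
  | |- contB (fun w => kern ?s w ?z) => apply (contB_kernl (s := s) (z := z))
  | |- contB (kern ?s ?w) => apply (contB_kernr (s := s) (w := w))
  | |- contBr (fun w => normc (@?f w)) => apply (contBr_normc (f := f))
  | |- contBr (fun w => powR _ ?p) => apply contBr_defectp
  | |- contBr (fun w => (@?f w)^-1) => apply (contBrV (F := f))
  | |- contBr (@defect _ _) => apply contBr_defect
  | |- contBr (fun w => @GRing.mul _ (@?f w) (@?g w)) => apply (contBrM (F := f) (G := g))
  | |- contB (fun w => ?g w) => change (contB g)
  | |- contBr (fun w => ?g w) => change (contBr g)
  | |- contB (fun w => ?c) => apply contB_cst
  | |- contBr (fun w => ?c) => apply contBr_cst
  end.

Ltac contB_tac := repeat contB_step.

(** * Weighted integration by parts *)

Section WeightedByParts.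
Context {R : realType} {n : nat}.
Local Notation C := R[i].
Local Notation V := 'rV[C]_n.
Local Notation Re := (@complex.Re R).
Implicit Types (f g u : V -> C) (z w v : V).

(* [W] stands for [(1 - q |w|^2)_+ ^ p] and [W'] for the same with exponent [p - 1]. *)
Definition weight (q p : R) (W W' : V -> R) : Prop :=
  [/\ forall j w, cball w -> wd j (fun w => (W w)%:C) w
        (- ((q * p * W' w)%:C * conjc (w 0 j))) (- ((q * p * W' w)%:C * w 0 j)),
      contBr W /\ contBr W',
      forall w, cball w -> 0 <= W' w /\ 0 <= W w <= defect w * W' w &
      forall w, cball w -> q * sqnorm w * W' w = W' w - W w].

Lemma cintbleM_le f u (W : V -> R) (M : R) : contB f -> contB u -> contBr W ->
  (forall w, cball w -> 0 <= W w) -> (forall w, cball w -> normc (f w) <= M) ->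
  intB (fun w => normc (u w) * W w) -> cintble (fun w => f w * (u w * (W w)%:C)).
Proof.
move=> cf cu cW W0 fM iu.
apply: (@cintble_le _ _ _ (fun w => M * (normc (u w) * W w))); last exact: intBZ.
  by apply: measC_cont; contB_tac.
move=> w wB; rewrite !normcM normc_real ger0_norm ?W0// ler_wpM2r ?fM// mulr_ge0 ?normc_ge0 ?W0//.
Qed.

Section Identities.
Variables (q p s : R) (W W' : V -> R) (z' : V) (u : V -> C) (a : 'I_n -> V -> C).
Hypotheses (hW : weight q p W W') (zB : cball z') (hu : hol u a).
Hypothesis iu : intB (fun w => normc (u w) * W' w).
Hypothesis s0 : 0 <= s.

Let M (s : R) := 2 `^ s * defect z' `^ (- s).
Let K (s : R) w := kern s w z'.

Let intW : intB (fun w => normc (u w) * W w).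
Proof.
have [cu ca _] := hu; have [_ [cW cW'] W0 _] := hW.
apply: (intB_le _ _ iu).
  by apply: measB_cont; contB_tac.
move=> w wB; have [h1 /andP[h2 h3]] := W0 w wB; rewrite ger0_norm ?mulr_ge0 ?normc_ge0//.
rewrite ler_wpM2l ?normc_ge0//; apply: le_trans h3 _; rewrite ler_piMl ?defect_le1//.
Qed.

Let ible (t : R) f (M0 : R) : 0 <= t -> contB f -> (forall w, cball w -> normc (f w) <= M0) ->
  cintble (fun w => f w * K t w * (u w * (W' w)%:C)) /\ cintble (fun w => f w * K t w * (u w * (W w)%:C)).
Proof.
move=> t0 cf fM; have [cu ca _] := hu; have [_ [cW cW'] W0 _] := hW.
have cfK : contB (fun w => f w * K t w) by rewrite /K; contB_tac.
have fKM w : cball w -> normc (f w * K t w) <= M0 * M t.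
  by move=> wB; rewrite normcM ler_pM ?normc_ge0 ?fM ?kern_le.
split; apply: (cintbleM_le cfK cu _ _ fKM) => //.
- by move=> w wB; have [] := W0 w wB.
- by move=> w wB; have [_ /andP[]] := W0 w wB.
Qed.

(** Integrate the sum over j of the antiholomorphic derivatives of conj(w_j) u W K_s. The
    coordinates contribute n, the weight contributes -p (W' - W), and the kernel contributes s
    ([hdot w z']) K_{s+1} = s (K_{s+1} - K_s); [u] is holomorphic and contributes nothing. *)
Lemma weight_raise :
  cintegral (fun w => (n%:R + p - s)%:C * (K s w * (u w * (W w)%:C))
    + - (p%:C * (K s w * (u w * (W' w)%:C))) + s%:C * (K (s + 1) w * (u w * (W w)%:C))) = 0.
Proof.
have [cu ca _] := hu; have [wW [cW cW'] W0 WE] := hW.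
pose b j w := (conjc (w 0 j) * u w) * ((W w)%:C * (s%:C * z' 0 j * K (s + 1) w)
   + - ((q * p * W' w)%:C * w 0 j) * K s w) + (conjc (w 0 j) * 0 + 1 * u w) * ((W w)%:C * K s w).
have cK t : contB (K t) by rewrite /K; contB_tac.
have cWc : contB (fun w => (W w)%:C) by contB_tac.
have cWc' : contB (fun w => (q * p * W' w)%:C).
  by contB_tac.
have s10 : 0 <= s + 1 by rewrite addr_ge0.
have ib j : cintble (b j).
  have cj w : cball w -> 0 <= normc (w 0 j) <= 1 by move=> wB; rewrite normc_ge0 ltW// normc_coord_lt1.
  have b1 w : cball w -> normc (conjc (w 0 j) * (s%:C * z' 0 j)) <= normc (s%:C * z' 0 j).
    by move=> /cj /andP[c0 c1]; rewrite normcM normc_conj ler_piMl ?normc_ge0.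
  have b2 w : cball w -> normc (conjc (w 0 j) * (- (q * p)%:C * w 0 j)) <= normc (- (q * p)%:C : C).
    by move=> /cj /andP[c0 c1]; rewrite !normcM normc_conj mulrCA ler_piMr ?normc_ge0// mulr_ile1.
  have b3 w : cball w -> normc (1 : C) <= 1 by rewrite normc1.
  have c1 : contB (fun w : V => conjc (w 0 j) * (s%:C * z' 0 j)) by contB_tac.
  have [_ h1] := ible s10 c1 b1.
  have c2 : contB (fun w : V => conjc (w 0 j) * (- (q * p)%:C * w 0 j)) by contB_tac.
  have [h2 _] := ible s0 c2 b2.
  have c3 : contB (fun w : V => 1 : C) by apply contB_cst.
  have [_ h3] := @ible s (fun=> 1) 1 s0 c3 b3.
  apply: eq_cintble (cintbleD (cintbleD h1 h2) h3) => w wB.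
  by rewrite /b [in RHS]rmorphM; ring.
have b0 j : cintegral (b j) = 0.
  pose A w := (conjc (w 0 j) * u w) * ((W w)%:C * 0
   + - ((q * p * W' w)%:C * conjc (w 0 j)) * K s w) + (conjc (w 0 j) * a j w + 0 * u w) * ((W w)%:C * K s w).
  apply: (@ibp_pdbar _ _ j (fun w => (conjc (w 0 j) * u w) * ((W w)%:C * K s w)) A (b j)).
  - move=> w wB; have := wdM (wdM (wd_coordbar j j w) (hol_wd j hu wB)) (wdM (wW j w wB) (wd_kern j s wB zB)).
    by rewrite eqxx.
  - by contB_tac.
  - by rewrite /A; contB_tac.
  - by rewrite /b; contB_tac.
  - exact: cintble_normc.
  (* The boundary condition of [ibp_pdbar]: since W <= D W', division by D leaves an integrable
     function. *)
  - apply: (@intB_le _ _ _ (fun w => M s * (normc (u w) * W' w))); last exact: intBZ.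
      apply: measB_cont; contB_tac.
      by move=> w wB; rewrite gt_eqF// defect_gt0.
    move=> w wB; have dw := defect_gt0 wB; have [w1 /andP[w2 w3]] := W0 w wB.
    have k1 : normc (K s w) <= M s by exact: kern_le.
    move: (K s w) k1 => k k1.
    rewrite ger0_norm ?divr_ge0 ?normc_ge0 ?(ltW dw)// ler_pdivrMr// !normcM normc_conj normc_real ger0_norm//.
    have c1 := ltW (normc_coord_lt1 j wB); have c0 := normc_ge0 (w 0 j).
    apply: (@le_trans _ _ (normc (u w) * (defect w * W' w * M s))); last by rewrite le_eqVlt; apply/orP; left; apply/eqP; ring.
    apply: ler_pM; rewrite ?mulr_ge0 ?normc_ge0// ?ler_piMl ?normc_ge0//.
    by apply: ler_pM; rewrite ?normc_ge0.
have := cintegral_sum (index_enum 'I_n) (P := xpredT) (F := b) (fun j _ => ib j).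
rewrite [X in _ = X -> _]big1 => [h|j _]; last exact: b0.
rewrite -[RHS]h; apply: eq_cintegral => w wB.
have E1 : \sum_j conjc (w 0 j) * z' 0 j = hdot w z' by [].
have E2 : \sum_j conjc (w 0 j) * w 0 j = (sqnorm w)%:C by rewrite -hdot_self.
have -> : \sum_j b j w = s%:C * (\sum_j conjc (w 0 j) * z' 0 j) * (u w * (W w)%:C * K (s + 1) w)
   + - ((q * p * W' w)%:C * (\sum_j conjc (w 0 j) * w 0 j) * (u w * K s w)) + n%:R * (u w * ((W w)%:C * K s w)).
  transitivity (\sum_(j < n) (s%:C * (conjc (w 0 j) * z' 0 j) * (u w * (W w)%:C * K (s + 1) w)
    + - ((q * p * W' w)%:C * (conjc (w 0 j) * w 0 j) * (u w * K s w)) + u w * ((W w)%:C * K s w))).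
    by apply: eq_bigr => j _; rewrite /b; ring.
  rewrite !big_split /= sumr_const card_ord mulr_natl sumrN; congr (_ + - _ + _).
    by rewrite mulr_sumr mulr_suml.
  by rewrite mulr_sumr mulr_suml.
rewrite E1 E2.
have -> : (q * p * W' w)%:C * (sqnorm w)%:C = p%:C * ((W' w)%:C - (W w)%:C).
  rewrite -rmorphB /= -WE// -!rmorphM /=; congr (_%:C); ring.
have -> : K s w = (1 - hdot w z') * K (s + 1) w by exact: kernS.
rewrite rmorphB rmorphD /= rmorph_nat; ring.
Qed.

Variable z : V.
Hypothesis zE : z' = q%:C *: z.
Hypothesis ia : forall j, intB (fun w => normc (a j w) * W w).
Hypothesis s1 : 1 <= s.

(** Integrate the sum over j of the holomorphic derivatives of (w_j - z_j) u W K_s; the kernel,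
    antiholomorphic in [w], is not differentiated. Because z' = q z, the weight contributes -p W' (q
    |w|^2 - [hdot w z']) u K_s = p u W K_s - p u W' K_{s-1}; this is why the kernel sits at q z. *)
Lemma weight_euler :
  cintegral (fun w => (\sum_j (w 0 j - z 0 j) * a j w) * (K s w * (W w)%:C)
    + (n%:R + p)%:C * (K s w * (u w * (W w)%:C)) + - (p%:C * (K (s - 1) w * (u w * (W' w)%:C)))) = 0.
Proof.
have [cu ca _] := hu; have [wW [cW cW'] W0 WE] := hW.
have W00 w : cball w -> 0 <= W w by move=> /W0 [_ /andP[]].
pose A j w := ((w 0 j + - z 0 j) * u w) * ((W w)%:C * 0
   + - ((q * p * W' w)%:C * conjc (w 0 j)) * K s w) + ((w 0 j + - z 0 j) * a j w + (1 + - 0) * u w) * ((W w)%:C * K s w).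
pose B j w := ((w 0 j + - z 0 j) * u w) * ((W w)%:C * (s%:C * z' 0 j * K (s + 1) w)
   + - ((q * p * W' w)%:C * w 0 j) * K s w) + ((w 0 j + - z 0 j) * 0 + (0 + - 0) * u w) * ((W w)%:C * K s w).
have cK t : contB (K t) by rewrite /K; contB_tac.
have cWc : contB (fun w => (W w)%:C) by contB_tac.
have cWc' : contB (fun w => (q * p * W' w)%:C) by contB_tac.
have cz j : contB (fun w : V => w 0 j + - z 0 j) by contB_tac.
pose c j := 1 + normc (z 0 j).
have cj j w : cball w -> normc (w 0 j + - z 0 j) <= c j.
  move=> wB; apply: le_trans (le_normcD _ _) _; rewrite normc_opp lerD2r.
  exact: ltW (normc_coord_lt1 j wB).
have iA j : cintble (A j).
  have b2 w : cball w -> normc ((w 0 j + - z 0 j) * (- (q * p)%:C * conjc (w 0 j))) <= c j * normc (- (q * p)%:C : C).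
    move=> wB; rewrite !normcM; apply: ler_pM; rewrite ?normc_ge0 ?mulr_ge0 ?normc_ge0 ?cj// normc_conj.
    by rewrite ler_piMr ?normc_ge0// ltW// normc_coord_lt1.
  have c2 : contB (fun w : V => (w 0 j + - z 0 j) * (- (q * p)%:C * conjc (w 0 j))) by contB_tac.
  have [h2 _] := ible s0 c2 b2.
  have b3 w : cball w -> normc (1 : C) <= 1 by rewrite normc1.
  have c3 : contB (fun w : V => 1 : C) by apply contB_cst.
  have [_ h3] := @ible s (fun=> 1) 1 s0 c3 b3.
  have c1 : contB (fun w => (w 0 j + - z 0 j) * K s w) by contB_tac.
  have b1 w : cball w -> normc ((w 0 j + - z 0 j) * K s w) <= c j * M s.
    by move=> wB; rewrite normcM ler_pM ?normc_ge0 ?cj ?kern_le.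
  have h1 := cintbleM_le c1 (ca j) cW W00 b1 (ia j).
  apply: eq_cintble (cintbleD (cintbleD h1 h2) h3) => w wB.
  by rewrite /A [in RHS]rmorphM; ring.
have A0 j : cintegral (A j) = 0.
  apply: (@ibp_pd _ _ j (fun w => ((w 0 j + - z 0 j) * u w) * ((W w)%:C * K s w)) (A j) (B j)).
  - move=> w wB; have := wdM (wdM (wdD (wd_coord j j w) (wdN (wd_cst j (z 0 j) w))) (hol_wd j hu wB)) (wdM (wW j w wB) (wd_kern j s wB zB)).
    by rewrite eqxx.
  - by contB_tac.
  - by rewrite /A; contB_tac.
  - by rewrite /B; contB_tac.
  - exact: cintble_normc.
  - apply: (@intB_le _ _ _ (fun w => c j * M s * (normc (u w) * W' w))); last exact: intBZ.
      apply: measB_cont; contB_tac.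
      by move=> w wB; rewrite gt_eqF// defect_gt0.
    move=> w wB; have dw := defect_gt0 wB; have [w1 /andP[w2 w3]] := W0 w wB.
    have k1 : normc (K s w) <= M s by exact: kern_le.
    move: (K s w) k1 => k k1.
    rewrite ger0_norm ?divr_ge0 ?normc_ge0 ?(ltW dw)// ler_pdivrMr// !normcM normc_real ger0_norm//.
    have c1 := cj j w wB; have c0 := normc_ge0 (w 0 j + - z 0 j).
    apply: (@le_trans _ _ (c j * normc (u w) * (defect w * W' w * M s))); last by rewrite le_eqVlt; apply/orP; left; apply/eqP; ring.
    apply: ler_pM; rewrite ?mulr_ge0 ?normc_ge0// ?ler_wpM2r ?normc_ge0//.
    by apply: ler_pM; rewrite ?normc_ge0.
have := cintegral_sum (index_enum 'I_n) (P := xpredT) (F := A) (fun j _ => iA j).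
rewrite [X in _ = X -> _]big1 => [h|j _]; last exact: A0.
rewrite -[RHS]h; apply: eq_cintegral => w wB.
have E1 : q%:C * \sum_j conjc (w 0 j) * z 0 j = hdot w z' by rewrite zE hdotZ.
have E2 : \sum_j conjc (w 0 j) * w 0 j = (sqnorm w)%:C by rewrite -hdot_self.
have -> : \sum_j A j w = (\sum_j (w 0 j - z 0 j) * a j w) * (K s w * (W w)%:C)
   + - ((p * W' w)%:C * (q%:C * (\sum_j conjc (w 0 j) * w 0 j) - q%:C * (\sum_j conjc (w 0 j) * z 0 j)) * (u w * K s w))
   + n%:R * (u w * ((W w)%:C * K s w)).
  transitivity (\sum_(j < n) ((w 0 j - z 0 j) * a j w * (K s w * (W w)%:C)
    + - ((p * W' w)%:C * (q%:C * (conjc (w 0 j) * w 0 j) - q%:C * (conjc (w 0 j) * z 0 j)) * (u w * K s w)) + u w * ((W w)%:C * K s w))).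
    by apply: eq_bigr => j _; rewrite /A !rmorphM /=; ring.
  rewrite !big_split /= sumr_const card_ord mulr_natl sumrN; congr (_ + - _ + _).
    by rewrite mulr_suml.
  by rewrite !mulr_sumr -sumrB mulr_sumr mulr_suml.
rewrite E1 E2.
have -> : K (s - 1) w = (1 - hdot w z') * K s w by have := kernS (s - 1) wB zB; rewrite subrK.
have E3 : q%:C * (sqnorm w)%:C * (W' w)%:C = (W' w)%:C - (W w)%:C by rewrite -!rmorphM /= WE// rmorphB.
have -> : (p * W' w)%:C * (q%:C * (sqnorm w)%:C - hdot w z') = p%:C * (((W' w)%:C - (W w)%:C) - hdot w z' * (W' w)%:C).
  by rewrite -E3 rmorphM /=; ring.
rewrite rmorphD /= rmorph_nat; ring.
Qed.

End Identities.
End WeightedByParts.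

(** * Powers of the defect and truncated weights *)

Section Weights.
Context {R : realType} {n : nat}.
Local Notation C := R[i].
Local Notation V := 'rV[C]_n.
Local Notation Re := (@complex.Re R).
Implicit Types (f g u : V -> C) (z w v : V).

(** The condition p >= 2 makes the remainder at the corner quadratic: h^p <= h^2 for 0 < h <= 1. *)
Lemma is_derive_maxpow (p x : R) : 2 <= p ->
  is_derive x 1 (fun s : R => Num.max s 0 `^ p) (p * Num.max x 0 `^ (p - 1)).
Proof.
move=> p2; have p0 : p != 0 by rewrite gt_eqF//; lra.
have p10 : p - 1 != 0 by rewrite gt_eqF//; lra.
have [x0|x0|->] := ltgtP x 0.
- rewrite powR0// mulr0.
  have hc := is_derive_cst (0 : R) x 1; apply: near_eq_is_derive hc.
  have : \forall s \near x, s < 0 by exact: lt_nbhsl.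
  by apply: filterS => s s0 /=; rewrite max_r ?powR0// ltW.
- apply: (@near_eq_is_derive _ _ _ (fun s => s `^ p)); last exact: is_derive1_powR.
  have : \forall s \near x, 0 < s by exact: lt_nbhsr.
  by apply: filterS => s s0 /=; rewrite max_l// ltW.
- rewrite powR0// mulr0.
  apply: (@is_derive_quad _ _ _ _ 1 1) => // h h1.
  rewrite add0r maxxx powR0// subr0 mul0r subr0 mul1r ger0_norm ?powR_ge0//.
  have [h0|h0] := lerP h 0; first by rewrite powR0// sqr_ge0.
  have -> : h ^+ 2 = h `^ 2 by rewrite powR_mulrn// ltW.
  apply: le_powR_exp => //.
  by move: h1; rewrite gtr0_norm// => /ltW.
Qed.

Lemma weight_defect (p : R) : weight 1 p (fun w : V => defect w `^ p) (fun w => defect w `^ (p - 1)).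
Proof.
have D w : cball w -> defect w `^ p = defect w * defect w `^ (p - 1).
  by move=> wB; rewrite -powR_pred// defect_gt0.
split.
- by move=> j w wB; have := wd_defectp j p wB; rewrite mul1r.
- by split; exact: contBr_defectp.
- by move=> w wB; split; [exact: powR_ge0|rewrite powR_ge0 D/=].
- move=> w wB; rewrite D// /defect; ring.
Qed.

(** For q > 1 the weight is supported in |w|^2 <= 1/q, a compact subset of the open ball. *)
Definition trunc (q p : R) w : R := Num.max (1 - q * sqnorm w) 0 `^ p.

Lemma trunc_ge0 q p w : 0 <= trunc q p w. Proof. exact: powR_ge0. Qed.

Lemma truncE q p w : p - 1 != 0 -> p != 0 ->
  trunc q p w = Num.max (1 - q * sqnorm w) 0 * trunc q (p - 1) w.
Proof.
move=> p1 p0; rewrite /trunc; have [h|h] := lerP (1 - q * sqnorm w) 0.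
  by rewrite !powR0// mul0r.
by rewrite -powR_pred.
Qed.

Lemma trunc_eq0 q p w : p != 0 -> 1 <= q * sqnorm w -> trunc q p w = 0.
Proof. by move=> p0 h; rewrite /trunc max_r ?powR0// subr_le0. Qed.

Lemma trunc_le_defect q p w : 1 <= q -> 0 <= p -> cball w -> trunc q p w <= defect w `^ p.
Proof.
move=> q1 p0 wB; have dw := defect_gt0 wB.
apply: ge0_ler_powR => //; first by rewrite nnegrE le_max lexx orbT.
  by rewrite nnegrE ltW.
rewrite ge_max (ltW dw) andbT /defect lerD2l lerN2.
by rewrite ler_peMl ?sqnorm_ge0.
Qed.

Lemma is_derive_truncsq (q p x : R) : 2 <= p ->
  is_derive x 1 (fun s : R => Num.max (1 - q * s) 0 `^ p) (- (q * p * Num.max (1 - q * x) 0 `^ (p - 1))).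
Proof.
move=> p2; have h0 : is_derive x 1 (fun s : R => 1 - q * s) (- q).
  apply: (is_derive_eq (is_deriveB (is_derive_cst (1 : R) x 1) (is_deriveZ q (is_derive_id x 1)))).
  by rewrite /GRing.scale/= mulr1 sub0r.
have h1 := @is_derive1_comp _ (fun x : R => Num.max x 0 `^ p) (fun s : R => 1 - q * s) _ _ _
  (is_derive_maxpow (1 - q * x) p2) h0.
by apply: is_derive_eq h1 _; ring.
Qed.

Lemma wd_trunc j (q p : R) w : 2 <= p ->
  wd j (fun w => (trunc q p w)%:C) w (- ((q * p * trunc q (p - 1) w)%:C * conjc (w 0 j)))
    (- ((q * p * trunc q (p - 1) w)%:C * w 0 j)).
Proof.
move=> p2; have h := is_derive_truncsq q (sqnorm w) p2.
by apply: wd_eq (wd_real_comp (wd_sqnorm j w) h) _ _; rewrite rmorphN mulNr.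
Qed.

Lemma contBr_trunc (q p : R) : 2 <= p -> contBr (trunc q p).
Proof.
move=> p2; move=> z zB.
apply: (@continuous_comp _ _ _ (@sqnorm R n) (fun s : R => Num.max (1 - q * s) 0 `^ p)); first exact: continuous_sqnorm.
apply: differentiable_continuous; apply/derivable1_diffP.
by have h := is_derive_truncsq q (sqnorm z) p2; exact: ex_derive.
Qed.

(** With p >= 3 the companion exponent p - 1 is still at least 2, within reach of [contBr_trunc]. *)
Lemma weight_trunc (q p : R) : 1 <= q -> 3 <= p -> weight q p (trunc q p) (trunc q (p - 1)).
Proof.
move=> q1 p3; have p0 : p != 0 by rewrite gt_eqF//; lra.
have p10 : p - 1 != 0 by rewrite gt_eqF//; lra.
split.
- by move=> j w _; apply: wd_trunc; lra.
- by split; apply: contBr_trunc; lra.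
- move=> w wB; have dw := defect_gt0 wB; rewrite !trunc_ge0; split => //=.
  rewrite truncE// ler_wpM2r ?trunc_ge0// ge_max (ltW dw) andbT /defect lerD2l lerN2.
  by rewrite ler_peMl ?sqnorm_ge0.
- move=> w wB; rewrite (@truncE q p w p10 p0); case: (leP (1 - q * sqnorm w) 0) => h; last by ring.
  by rewrite trunc_eq0 ?mulr0 ?subr0//; lra.
Qed.

End Weights.

(** * Segments in the ball *)

Section Segment.
Context {R : realType} {n : nat}.
Local Notation C := R[i].
Local Notation V := 'rV[C]_n.
Local Notation Re := (@complex.Re R).
Implicit Types (f g u : V -> C) (z w v : V).

Definition seg z w (t : R) : V := z + t%:C *: (w - z).

Lemma sqnorm_seg z w t : sqnorm (seg z w t) =
  (1 - t) * sqnorm z + t * sqnorm w - t * (1 - t) * sqnorm (w - z).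
Proof.
have -> : seg z w t = z - (- t)%:C *: (w - z) by rewrite /seg rmorphN /= scaleNr opprK.
rewrite [LHS]sqnormB (sqnormZ (- t) (w - z)).
have -> : Re (hdot ((- t)%:C *: (w - z)) z) = - t * (Re (hdot w z) - sqnorm z).
  rewrite hdot_conj Re_conjc hdotZ hdot_conj hdotDl cReM /= mul0r subr0 Re_conjc cReD.
  have -> : hdot (- z) z = - hdot z z.
    by rewrite /hdot -sumrN; apply: eq_bigr => j _; rewrite !mxE rmorphN mulNr.
  by rewrite cReN hdot_self.
have := Re_hdot w z; rewrite -(sqnormN (z - w)) opprB => h.
have -> : Re (hdot w z) = (sqnorm w + sqnorm z - sqnorm (w - z)) / 2 by lra.
by field.
Qed.

Lemma seg0 z w : seg z w 0 = z. Proof. by rewrite /seg scale0r addr0. Qed.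
Lemma seg1 z w : seg z w 1 = w. Proof. by rewrite /seg scale1r addrC subrK. Qed.

Lemma cball_seg z w (t : R) : cball z -> cball w -> 0 <= t <= 1 -> cball (seg z w t).
Proof.
move=> zB wB /andP[t0 t1]; rewrite /cball /= sqnorm_seg.
have h : 0 <= t * (1 - t) * sqnorm (w - z) by rewrite !mulr_ge0 ?sqnorm_ge0 ?subr_ge0.
move: zB wB; rewrite /cball /= -(subr_gt0 (sqnorm z)) -(subr_gt0 (sqnorm w)) => zB wB.
have h2 := mulr_ge0 t0 (ltW wB).
have [t1'|t1'] := ltrP t 1; first by have := mulr_gt0 (_ : 0 < 1 - t) zB; rewrite subr_gt0 => /(_ t1'); lra.
have -> : t = 1 by lra.
lra.
Qed.

Lemma rdc_seg u a z w t : hol u a -> cball (seg z w t) ->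
  rdc (fun s => u (seg z w s)) t (\sum_j (w 0 j - z 0 j) * a j (seg z w t)).
Proof.
move=> [_ _ h] sB; have := rder_line (h _ sB (w - z)).
by rewrite (eq_bigr (fun j => (w 0 j - z 0 j) * a j (seg z w t)))// => j _; rewrite !mxE.
Qed.

Lemma continuous_seg u z w t : `|t| <= 1 -> {for seg z w t, continuous u} ->
  {for w, continuous (fun w => u (seg z w t))}.
Proof.
move=> t1 /continuousCP cu; apply/continuousCP => e e0; have [d d0 hd] := cu e e0.
exists d => // w' hw; apply: hd => j.
rewrite /seg !mxE [X in normc X](_ : _ = t%:C * (w' 0 j - w 0 j)); last by ring.
by rewrite normcM normc_real; apply: le_lt_trans (hw j); rewrite ler_piMl ?normc_ge0.
Qed.

Lemma hol_seg u a z t : hol u a -> cball z -> 0 <= t <= 1 ->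
  hol (fun w => u (seg z w t)) (fun j w => t%:C * a j (seg z w t)).
Proof.
move=> [cu ca h] zB t01; have t1 : `|t| <= 1 by case/andP: t01 => t0 t1; rewrite ger0_norm.
split.
- move=> w wB; apply: continuous_seg => //; apply: (contB_at cu); exact: cball_seg.
- move=> j w wB; apply: (@continuousMc _ _ (fun=> t%:C) (fun w => a j (seg z w t))).
    exact: continuous_cstc.
  apply: continuous_seg => //; apply: (contB_at (ca j)); exact: cball_seg.
- move=> w wB v; have := h _ (cball_seg zB wB t01) (t%:C *: v).
  have E (s : R) : seg z w t + s%:C *: (t%:C *: v) = seg z (w + s%:C *: v) t.
    by rewrite /seg !scalerBr scalerDr !scalerA [s%:C * _]mulrC -!addrA [_ *: v + _]addrC.
  have -> : \sum_j (t%:C *: v) 0 j * a j (seg z w t) = \sum_j v 0 j * (t%:C * a j (seg z w t)).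
    by apply: eq_bigr => j _; rewrite !mxE; ring.
  have F : (fun s : R => u (seg z w t + s%:C *: (t%:C *: v))) = (fun s : R => u (seg z (w + s%:C *: v) t)).
    by apply/funext => s; rewrite E.
  move: (\sum_j v 0 j * _) => d h'.
  have : rdc (fun s : R => u (seg z w t + s%:C *: (t%:C *: v))) 0 d by exact: h'.
  by rewrite F => h''; exact: h''.
Qed.

End Segment.

(** * Limits of complex sequences and integrals *)

Section ComplexLimits.
Context {R : realType} {n : nat}.
Local Notation C := R[i].
Local Notation V := 'rV[C]_n.
Local Notation Re := (@complex.Re R).
Local Notation Im := (@complex.Im R).

Definition ccvg (u : nat -> C) (l : C) : Prop :=
  (Re (u k) @[k --> \oo] --> Re l) /\ (Im (u k) @[k --> \oo] --> Im l).

Lemma ccvg_unique u l l' : ccvg u l -> ccvg u l' -> l = l'.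
Proof.
move=> [h1 h2] [h3 h4]; apply: complex_eqP.
  by rewrite -[LHS](cvg_lim _ h1)// -[RHS](cvg_lim _ h3).
by rewrite -[LHS](cvg_lim _ h2)// -[RHS](cvg_lim _ h4).
Qed.

Lemma ccvg_cst (l : C) : ccvg (fun=> l) l.
Proof. by split; exact: cvg_cst. Qed.

Lemma ccvgM u v l m : ccvg u l -> ccvg v m -> ccvg (fun k => u k * v k) (l * m).
Proof.
move=> [a1 a2] [b1 b2]; split; rewrite ?cReM ?cImM.
  under eq_fun do rewrite cReM.
  by apply: cvgB; apply: cvgM.
under eq_fun do rewrite cImM.
by apply: cvgD; apply: cvgM.
Qed.

Lemma ccvg_real (u : nat -> R) (l : R) : u k @[k --> \oo] --> l -> ccvg (fun k => (u k)%:C) l%:C.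
Proof. by move=> h; split => //=; exact: cvg_cst. Qed.

Lemma ccvg_continuous (g : V -> C) (x : nat -> V) (z : V) (e : nat -> R) :
  {for z, continuous g} -> e k @[k --> \oo] --> (0 : R) ->
  (forall k j, normc (x k 0 j - z 0 j) <= e k) -> ccvg (g \o x) (g z).
Proof.
move=> /continuousCP cg e0 xe.
have key (P : C -> R) : (forall x, `|P x| <= normc x) -> (forall x y, P (x - y) = P x - P y) ->
    P (g (x k)) @[k --> \oo] --> P (g z).
  move=> Pn PB; apply/cvgrPdist_lt => d d0; have [d' d'0 hd] := cg d d0.
  move/cvgrPdist_lt : (e0) => /(_ _ d'0).
  apply: filterS => k; rewrite sub0r normrN => ek; rewrite distrC -PB; apply: le_lt_trans (Pn _) _.
  by apply: hd => j; apply: le_lt_trans (xe k j) _; apply: le_lt_trans (ler_norm _) ek.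
by split; apply: key; [exact: abs_Re_le|move=> a b; rewrite cReD cReN|exact: abs_Im_le|move=> a b; rewrite cImD cImN].
Qed.

Lemma cint_dominated (Fk : nat -> V -> C) F (G : V -> R) :
  (forall k, measC (Fk k)) -> (forall z, cball z -> ccvg (fun k => Fk k z) (F z)) ->
  intB G -> (forall k z, cball z -> normc (Fk k z) <= G z) ->
  ccvg (fun k => cintegral (Fk k)) (cintegral F).
Proof.
move=> mF cF iG FG.
have [_ h1] := @Rint_dominated _ _ (fun k z => Re (Fk k z)) (fun z => Re (F z)) G
  (fun k => (mF k).1) (fun z zB => (cF z zB).1) iG (fun k z zB => le_trans (abs_Re_le _) (FG k z zB)).
have [_ h2] := @Rint_dominated _ _ (fun k z => Im (Fk k z)) (fun z => Im (F z)) G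
  (fun k => (mF k).2) (fun z zB => (cF z zB).2) iG (fun k z zB => le_trans (abs_Im_le _) (FG k z zB)).
split; first by rewrite Re_cintegral; under eq_fun do rewrite Re_cintegral.
by rewrite Im_cintegral; under eq_fun do rewrite Im_cintegral.
Qed.

Lemma rdcMr (F : R -> C) (t : R) d (c : C) : rdc F t d -> rdc (fun s => F s * c) t (d * c).
Proof.
move=> [h1 h2]; split.
  have h := is_deriveB (is_deriveZ (Re c) h1) (is_deriveZ (Im c) h2).
  have E : (fun s => Re (F s * c)) = Re c *: (fun s => Re (F s)) - Im c *: (fun s => Im (F s)).
    apply/funext => s; transitivity (Re c * Re (F s) - Im c * Im (F s)); last by [].
    by rewrite cReM; ring.
  by rewrite E; apply: is_derive_eq h _; rewrite /GRing.scale/= cReM; ring.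
have h := is_deriveD (is_deriveZ (Im c) h1) (is_deriveZ (Re c) h2).
have E : (fun s => Im (F s * c)) = Im c *: (fun s => Re (F s)) + Re c *: (fun s => Im (F s)).
  apply/funext => s; transitivity (Im c * Re (F s) + Re c * Im (F s)); last by [].
  by rewrite cImM; ring.
by rewrite E; apply: is_derive_eq h _; rewrite /GRing.scale/= cImM; ring.
Qed.

Lemma rdc_ccvg (F : R -> C) (t : R) d (x : nat -> R) : rdc F t d ->
  x k @[k --> \oo] --> t -> ccvg (F \o x) (F t).
Proof.
move=> [h1 h2] xt.
have key (P : R -> R) dP : is_derive t 1 P dP -> P (x k) @[k --> \oo] --> P t.
  move=> h; have c : {for t, continuous P}.
    by apply: differentiable_continuous; apply/derivable1_diffP; exact: ex_derive.
  exact: (cvg_comp x P xt c).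
by split; [exact: key h1|exact: key h2].
Qed.

Lemma rdc0_eq (g dg : R -> C) (a b : R) : a <= b ->
  (forall t, t \in `[a, b] -> rdc g t (dg t)) -> (forall t, t \in `[a, b] -> dg t = 0) -> g a = g b.
Proof.
move=> ab h h0.
have := @curve_bound _ g dg (fun=> 0) (fun=> 0) a b ab h (fun t _ => is_derive_cst (0 : R) t 1).
rewrite subrr mulr0 => k; apply/esym/eqP; rewrite -subr_eq0 -normc_eq0 eq_le normc_ge0 andbT.
by apply: k => t tab; rewrite h0// normc0.
Qed.

End ComplexLimits.

(** * Reproducing property of truncated weights, by homotopy *)

Section Homotopy.
Context {R : realType} {n : nat}.
Local Notation C := R[i].
Local Notation V := 'rV[C]_n.
Local Notation Re := (@complex.Re R).
Local Notation Im := (@complex.Im R).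
Variables (u : V -> C) (a : 'I_n -> V -> C) (z : V) (q p : R).
Hypotheses (hu : hol u a) (zB : cball z) (q1 : 1 < q) (qzB : cball (q%:C *: z)) (p3 : 3 <= p).

Let s : R := n%:R + p + 1.
Let K w := kern s w (q%:C *: z).
Let M : R := 2 `^ s * defect (q%:C *: z) `^ (- s).
Let q0 : 0 < q. Proof. exact: lt_trans q1. Qed.
Let p1 : 1 <= p. Proof. by move: p3; lra. Qed.
Let p2 : 2 <= p. Proof. by move: p3; lra. Qed.
Let p12 : 2 <= p - 1. Proof. by move: p3; lra. Qed.
Let p11 : 1 <= p - 1. Proof. by move: p3; lra. Qed.
Let s1 : 1 <= s.
Proof. by rewrite /s lerDr addr_ge0//; apply: le_trans p1. Qed.
Let s0 : 0 <= s. Proof. exact: le_trans s1. Qed.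

Let KM w : cball w -> normc (K w) <= M.
Proof. by move=> wB; exact: (kern_le s0 wB qzB). Qed.

Lemma sqnorm_seg_le w (t r : R) : 0 <= t <= 1 -> sqnorm z <= r -> sqnorm w <= r -> sqnorm (seg z w t) <= r.
Proof.
move=> /andP[t0 t1] zr wr; rewrite sqnorm_seg.
have h : 0 <= t * (1 - t) * sqnorm (w - z) by rewrite !mulr_ge0 ?sqnorm_ge0 ?subr_ge0.
have h1 : 0 <= t * (r - sqnorm w) by rewrite mulr_ge0// subr_ge0.
have h2 : 0 <= (1 - t) * (r - sqnorm z) by rewrite mulr_ge0// subr_ge0.
lra.
Qed.

(** Where the weight is nonzero, [z] and [w] lie in the closed ball of squared radius max(|z|^2,
    1/q) < 1, and so does the segment between them; there [f] is bounded by compactness, whatever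
    its growth at the sphere. *)
Lemma seg_trunc_bounded (f : V -> C) : contB f -> exists2 B : R, 0 <= B &
  forall (p' : R) w (t : R), 1 <= p' -> cball w -> 0 <= t <= 1 -> normc (f (seg z w t)) * trunc q p' w <= B.
Proof.
move=> cf; pose r := Num.max (sqnorm z) q^-1.
have r1 : r < 1 by rewrite gt_max zB/= invf_lt1.
have [y yr|B hB] := @closed_ball_bounded R n r (fun y => normc (f y)).
  by apply: continuous_normc; apply: (contB_at cf); exact: le_lt_trans yr r1.
exists `|B| => // p' w t p1' wB t01.
have T1 : trunc q p' w <= 1.
  apply: le_trans (trunc_le_defect _ _ wB) _; [exact: ltW|lra|].
  by rewrite -[X in _ <= X](powRr0 (defect w)); apply: le_powR_exp; [exact: defect_gt0|exact: defect_le1|lra].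
case: (lerP 1 (q * sqnorm w)) => h.
  by rewrite trunc_eq0 ?mulr0// gt_eqF//; lra.
have sr : sqnorm (seg z w t) <= r.
  apply: sqnorm_seg_le => //; rewrite le_max ?lexx//; apply/orP; right.
  by rewrite -div1r ler_pdivlMr// mulrC ltW.
apply: le_trans (_ : normc (f (seg z w t)) * 1 <= _); first by rewrite ler_wpM2l ?normc_ge0.
rewrite mulr1; apply: le_trans (ler_norm _) _; apply: le_trans (hB _ sr) (ler_norm _).
Qed.

Let mult (w : V) : C := K w * (trunc q p w)%:C.

Let cmult : contB mult.
Proof.
have c : contBr (@trunc R n q p) by exact: contBr_trunc.
by rewrite /mult /K; contB_tac.
Qed.

Let mult_le w : cball w -> normc (mult w) <= M.
Proof.
move=> wB; rewrite /mult; have kw := KM wB; move: (K w) kw => x xM.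
rewrite normcM normc_real ger0_norm ?trunc_ge0//.
apply: le_trans xM; rewrite ler_piMr ?normc_ge0//.
apply: le_trans (trunc_le_defect (ltW q1) (le_trans ler01 p1) wB) _.
rewrite -[X in _ <= X](powRr0 (defect w)); apply: le_powR_exp; [exact: defect_gt0|exact: defect_le1|].
exact: le_trans p1.
Qed.

Let F (w : V) (t : R) : C := u (seg z w t) * mult w.
Let dF (w : V) (t : R) : C := (\sum_j (w 0 j - z 0 j) * a j (seg z w t)) * mult w.

Let F_le : exists2 B : R, 0 <= B & forall w (t : R), cball w -> 0 <= t <= 1 -> normc (F w t) <= B.
Proof.
have [cu _ _] := hu; have [B B0 hB] := seg_trunc_bounded cu.
have M0 : 0 <= M by rewrite mulr_ge0 ?powR_ge0.
exists (B * M); first exact: mulr_ge0.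
move=> w t wB t01; rewrite /F /mult mulrCA mulrC normcM.
apply: ler_pM; rewrite ?normc_ge0// ?KM// normcM normc_real ger0_norm ?trunc_ge0//.
exact: hB.
Qed.

Let dF_le : exists2 B : R, 0 <= B & forall w (t : R), cball w -> 0 <= t <= 1 -> normc (dF w t) <= B.
Proof.
have [_ ca _] := hu.
have /choice[B hB] : forall j, exists B : R, 0 <= B /\ forall (p' : R) w (t : R), 1 <= p' -> cball w -> 0 <= t <= 1 ->
    normc (a j (seg z w t)) * trunc q p' w <= B.
  by move=> j; have [B B0 hB] := seg_trunc_bounded (ca j); exists B.
have M0 : 0 <= M by rewrite mulr_ge0 ?powR_ge0.
exists (\sum_j (2 * B j * M)).
  by apply: sumr_ge0 => j _; exact: (mulr_ge0 (mulr_ge0 (ler0n _ 2) (hB j).1) M0).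
move=> w t wB t01; rewrite /dF mulr_suml; apply: le_trans (normc_sum _ _ _) _.
apply: ler_sum => j _; rewrite /mult.
have -> : (w 0 j - z 0 j) * a j (seg z w t) * (K w * (trunc q p w)%:C) =
  ((w 0 j - z 0 j) * (a j (seg z w t) * (trunc q p w)%:C)) * K w by ring.
rewrite normcM; apply: ler_pM; rewrite ?normc_ge0// ?KM// normcM.
apply: ler_pM; rewrite ?normc_ge0//.
  apply: le_trans (le_normcD _ _) _; rewrite normc_opp.
  have := normc_coord_lt1 j wB; have := normc_coord_lt1 j zB; lra.
rewrite normcM normc_real ger0_norm ?trunc_ge0//; exact: (hB j).2.
Qed.

Let contF (t : R) : 0 <= t <= 1 -> contB (F^~ t).
Proof.
move=> t01; have [cu _ _] := hol_seg hu zB t01.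
by have cm := cmult; rewrite /F; contB_tac.
Qed.

(** The homotopy: at t = 1 it is the weighted integral of [u], at t = 0 it is [u z] times the
    integral of the multiplier. *)
Let Phi (t : R) := cintegral (fun w => F w t).

Let Phi_rdc (t : R) : 0 < t < 1 -> rdc Phi t (cintegral (fun w => dF w t)).
Proof.
move=> /andP[t0 t1]; have [B B0 hB] := dF_le; have [B' B'0 hB'] := F_le.
have near1 t' : `|t' - t| < Num.min t (1 - t) -> 0 <= t' <= 1.
  by rewrite lt_min !ltr_norml => /andP[/andP[h1 h2] /andP[h3 h4]]; apply/andP; split; lra.
apply: (@rdc_cintegral _ _ F dF t (Num.min t (1 - t)) (fun=> B)).
- by rewrite lt_min t0 subr_gt0.
- exact: (@intB_bounded _ _ _ `|B| (measB_cst _)).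
- move=> t' /near1 t01 w wB; split; last exact: hB.
  exact: rdcMr (rdc_seg hu (cball_seg zB wB t01)).
- move=> t' /near1 t01; apply: (@cintble_le _ _ _ (fun=> B')).
  + by apply: measC_cont; exact: contF.
  + by move=> w wB; exact: hB'.
  + exact: (@intB_bounded _ _ _ `|B'| (measB_cst _)).
Qed.

(** Both weight identities are applied to w -> u(seg z w t), whose derivatives are t times those of
    [u]. Their difference is t times the integral in question, and t > 0. *)
Let dF0 (t : R) : 0 < t < 1 -> cintegral (fun w => dF w t) = 0.
Proof.
move=> /andP[t0 t1]; have t01 : 0 <= t <= 1 by rewrite !ltW.
have hut := hol_seg hu zB t01.
have [cu ca _] := hut; have [cu0 ca0 _] := hu.
have q1' := ltW q1.
have hW := @weight_trunc R n q p q1' p3.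
have [B B0 hB] := seg_trunc_bounded cu0.
have cT : contBr (@trunc R n q p) by exact: contBr_trunc.
have cT' : contBr (@trunc R n q (p - 1)) by exact: contBr_trunc.
have iu : intB (fun w => normc (u (seg z w t)) * trunc q (p - 1) w).
  apply: (@intB_bounded _ _ _ B); first by apply: measB_cont; contB_tac.
  move=> w wB; rewrite ger0_norm ?mulr_ge0 ?normc_ge0 ?trunc_ge0//; exact: hB.
have ia j : intB (fun w => normc (t%:C * a j (seg z w t)) * trunc q p w).
  have [B' B'0 hB'] := seg_trunc_bounded (ca0 j).
  apply: (@intB_bounded _ _ _ B'); first by apply: measB_cont; have caj := ca j; contB_tac.
  move=> w wB; rewrite ger0_norm ?mulr_ge0 ?normc_ge0 ?trunc_ge0//.
  apply: le_trans (hB' p w t p1 wB t01).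
  rewrite ler_wpM2r ?trunc_ge0// normcM normc_real ger0_norm; last by case/andP: t01.
  by rewrite ler_piMl ?normc_ge0//; case/andP: t01.
have sm0 : 0 <= s - 1 by rewrite subr_ge0.
have E := @weight_euler _ _ q p s _ _ (q%:C *: z) _ _ hW qzB hut iu s0 z erefl ia.
have E' := @weight_raise _ _ q p (s - 1) _ _ (q%:C *: z) _ _ hW qzB hut iu sm0.
have mle (f : V -> C) (W : V -> R) : contBr W -> (forall w, cball w -> 0 <= W w) ->
    intB (fun w => normc (u (seg z w t)) * W w) ->
    forall s', 0 <= s' -> cintble (fun w => kern s' w (q%:C *: z) * (u (seg z w t) * (W w)%:C)).
  move=> cW W0 iW s' s'0.
  have ck : contB (fun w => kern s' w (q%:C *: z)) by contB_tac.
  exact: (cintbleM_le ck cu cW W0 (fun w wB => kern_le s'0 wB qzB)).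
have iT : intB (fun w => normc (u (seg z w t)) * trunc q p w).
  apply: (@intB_bounded _ _ _ B); first by apply: measB_cont; contB_tac.
  move=> w wB; rewrite ger0_norm ?mulr_ge0 ?normc_ge0 ?trunc_ge0//; exact: hB.
have h1 := mle (fun=> 0) _ cT (fun w _ => trunc_ge0 q p w) iT.
have h2 := mle (fun=> 0) _ cT' (fun w _ => trunc_ge0 q (p - 1) w) iu.
have iYZ := cintbleD (cintbleD (cintbleZ (n%:R + p - (s - 1))%:C (h1 _ sm0)) (cintbleN (cintbleZ p%:C (h2 _ sm0))))
  (cintbleZ (s - 1)%:C (h1 (s - 1 + 1) (addr_ge0 sm0 ler01))).
have [B' B'0 hB'] := dF_le.
have iX : cintble (fun w => dF w t).
  apply: (@cintble_le _ _ _ (fun=> B')).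
  - apply: measC_cont; rewrite /dF; apply contBM; last exact: cmult.
    apply contB_sum => j _; apply contBM; first by contB_tac.
    move=> w wB; apply: (@continuous_seg _ _ (a j) z w t); last exact: (contB_at (ca0 j) (cball_seg zB wB t01)).
    by rewrite ger0_norm ?ltW.
  - by move=> w wB; exact: hB'.
  - exact: (@intB_bounded _ _ _ `|B'| (measB_cst _)).
have := cintegralD (cintbleZ t%:C iX) iYZ; rewrite E' addr0 cintegralZ//.
rewrite (_ : cintegral _ = 0).
  move=> /esym/eqP; rewrite mulf_eq0 => /orP[|/eqP//].
  by rewrite -normc_eq0 normc_real normr_eq0 gt_eqF.
rewrite -[RHS]E; apply: eq_cintegral => w wB.
have Es : s - 1 = n%:R + p by rewrite /s addrK.
rewrite /dF /mult /K subrK Es subrr.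
rewrite [in RHS](eq_bigr (fun j => t%:C * ((w 0 j - z 0 j) * a j (seg z w t)))); last by move=> j _; ring.
rewrite -mulr_sumr; ring.
Qed.

(** [Phi] is differentiated inside (0, 1), where there is room on both sides; the endpoints are
    reached by dominated convergence along e_k and 1 - e_k, with e_k = 1/(k+2) <= 1/2. *)
Lemma homotopy : cintegral (fun w => u w * mult w) = u z * cintegral mult.
Proof.
have [B B0 hB] := F_le.
have conv (x : nat -> R) (t : R) : 0 <= t <= 1 -> (forall k, 0 <= x k <= 1) -> x k @[k --> \oo] --> t ->
    ccvg (Phi \o x) (Phi t).
  move=> t01 x01 xt; apply: (@cint_dominated _ _ (fun k w => F w (x k)) (fun w => F w t) (fun=> B)).
  - by move=> k; apply: measC_cont; exact: contF.
  - move=> w wB; apply: ccvgM; last exact: ccvg_cst.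
    exact: rdc_ccvg (rdc_seg hu (cball_seg zB wB t01)) xt.
  - exact: (@intB_bounded _ _ _ `|B| (measB_cst _)).
  - by move=> k w wB; exact: hB.
have half (t t' : R) : 0 < t -> t <= t' -> t' < 1 -> Phi t = Phi t'.
  move=> t0 tt t1; apply: (rdc0_eq tt) => x; rewrite in_itv /= => /andP[x0 x1].
    by apply: Phi_rdc; rewrite (lt_le_trans t0)//= (le_lt_trans x1).
  by apply: dF0; rewrite (lt_le_trans t0)//= (le_lt_trans x1).
pose e (k : nat) : R := k.+2%:R^-1.
have e0 k : 0 < e k by rewrite invr_gt0.
have e1 k : e k <= 2^-1 by rewrite lef_pV2 ?posrE// ler_nat.
have ee : e k @[k --> \oo] --> (0 : R).
  by have := @cvg_harmonic0 R; rewrite -(cvg_shiftS (fun k : nat => (k.+1%:R^-1 : R))).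
have c0 : ccvg (Phi \o e) (Phi 0).
  apply: conv => //; first by rewrite lexx ler01.
  by move=> k; have := e0 k; have := e1 k; move=> h1 h2; apply/andP; split; lra.
have c1 : ccvg (Phi \o (fun k => 1 - e k)) (Phi 1).
  apply: conv => //; first by rewrite lexx ler01.
    by move=> k; have := e0 k; have := e1 k; move=> h1 h2; apply/andP; split; lra.
  by rewrite -[X in _ --> X]subr0; apply: cvgB => //; exact: cvg_cst.
have E : Phi \o e = Phi \o (fun k => 1 - e k).
  by apply/funext => k /=; have := e0 k; have := e1 k => h1 h2; apply: half; lra.
rewrite E in c0; have := ccvg_unique c0 c1.
rewrite /Phi /F => h.
transitivity (cintegral (fun w => u (seg z w 1) * mult w)).
  by apply: eq_cintegral => w wB; rewrite seg1.
rewrite -h -cintegralZ; last first.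
  apply: (@cintble_le _ _ _ (fun=> M)).
  - by apply: measC_cont; exact: cmult.
  - exact: mult_le.
  - exact: (@intB_bounded _ _ _ `|M| (measB_cst _)).
by apply: eq_cintegral => w wB; rewrite seg0.
Qed.

End Homotopy.

(** * The reproducing formula for all exponents *)

Section Reproducing.
Context {R : realType} {n : nat}.
Local Notation C := R[i].
Local Notation V := 'rV[C]_n.
Local Notation Re := (@complex.Re R).
Implicit Types (u : V -> C) (a : 'I_n -> V -> C) (z w : V).

Lemma defectp_le1 (p : R) w : 0 <= p -> cball w -> defect w `^ p <= 1.
Proof.
move=> p0 wB; rewrite -[X in _ <= X](powRr0 (defect w)).
by apply: le_powR_exp => //; [exact: defect_gt0|exact: defect_le1].
Qed.

Lemma normc_scale_sub (r : R) z j : normc ((r%:C *: z) 0 j - z 0 j) = `|r - 1| * normc (z 0 j).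
Proof.
rewrite [X in normc X](_ : _ = (r - 1)%:C * z 0 j) ?normcM ?normc_real//.
by rewrite !mxE rmorphB rmorph1 mulrBl mul1r.
Qed.

(** Limit of [homotopy] as q decreases to 1: the truncated weights are dominated by D^p, and the
    kernels at q z are uniformly bounded. *)
Lemma reproduce_big u a z (p : R) : hol u a -> cball z -> 3 <= p ->
  intB (fun w => normc (u w) * defect w `^ p) ->
  cintegral (fun w => u w * (kern (n%:R + p + 1) w z * (defect w `^ p)%:C)) =
  u z * cintegral (fun w => kern (n%:R + p + 1) w z * (defect w `^ p)%:C).
Proof.
move=> hu zB p3 iu; have [cu _ _] := hu.
have p2 : 2 <= p by lra.
have p0 : 0 <= p by lra.
set s := n%:R + p + 1; have s0 : 0 <= s by rewrite /s !addr_ge0.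
have dz := defect_gt0 zB; have dz1 := defect_le1 z.
(* For q = 1 + e with e <= D(z)/6, the inequality q^2 <= 1 + 3 e gives D(q z) >= D(z)/2. *)
pose c := defect z / 6.
pose e (k : nat) : R := c * k.+1%:R^-1.
pose q k := 1 + e k.
have c0 : 0 < c by rewrite divr_gt0.
have e0 k : 0 < e k by rewrite mulr_gt0 ?invr_gt0.
have ec k : e k <= c by rewrite ler_piMr ?(ltW c0)// invf_le1// ler1n.
have q1 k : 1 < q k by rewrite ltrDl.
have qz k : defect z / 2 <= defect ((q k)%:C *: z).
  rewrite /defect sqnormZ /q; have := e0 k; have := ec k; rewrite /c.
  move: (e k) => x xc x0; have S0 := sqnorm_ge0 z; move: dz dz1 xc; rewrite /defect.
  move: (sqnorm z) S0 => S S0 dz dz1 xc.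
  have h1 : (1 + x) ^+ 2 <= 1 + 3 * x by rewrite expr2; nra.
  have h2 : (1 + x) ^+ 2 * S <= (1 + 3 * x) * S by rewrite ler_wpM2r.
  nra.
have qzB k : cball ((q k)%:C *: z).
  have := qz k; rewrite /cball /= => h.
  have : 0 < defect ((q k)%:C *: z) by apply: lt_le_trans h; rewrite divr_gt0.
  by rewrite /defect subr_gt0.
have ee : e k @[k --> \oo] --> (0 : R).
  by rewrite -(mulr0 c); apply: cvgM; [exact: cvg_cst|exact: cvg_harmonic0].
pose B := 2 `^ s * (defect z / 2) `^ (- s).
have B0 : 0 <= B by rewrite mulr_ge0 ?powR_ge0.
have kB k w : cball w -> normc (kern s w ((q k)%:C *: z)) <= B.
  move=> wB; apply: le_trans (kern_le s0 wB (qzB k)) _; rewrite ler_wpM2l ?powR_ge0//.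
  by apply: le_powRN; rewrite ?divr_gt0.
have cvk w : cball w -> ccvg (fun k => kern s w ((q k)%:C *: z) * (trunc (q k) p w)%:C)
    (kern s w z * (defect w `^ p)%:C).
  move=> wB; apply: ccvgM.
    have ck := contB_at (@contB_kernr R n s w wB) zB.
    refine (@ccvg_continuous _ _ (fun x => kern s w x) (fun k => (q k)%:C *: z) z e ck ee _) => k j.
    rewrite normc_scale_sub /q addrC addKr gtr0_norm// ler_piMr ?ltW// normc_coord_lt1//.
  apply: ccvg_real; have dw := defect_gt0 wB.
  pose T := fun x : R => Num.max (1 - sqnorm w * x) 0 `^ p.
  have -> : defect w `^ p = T 1 by rewrite /T mulr1 max_l// ltW.
  have -> : (fun k => trunc (q k) p w) = T \o q.
    by apply/funext => k; rewrite /trunc /T /= mulrC.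
  have qc : q k @[k --> \oo] --> (1 : R).
    by rewrite -[X in _ --> X]addr0; apply: cvgD => //; exact: cvg_cst.
  apply: (cvg_comp q T qc).
  apply: differentiable_continuous; apply/derivable1_diffP.
  by have h := is_derive_truncsq (sqnorm w) 1 p2; exact: ex_derive.
have T1 k w : cball w -> trunc (q k) p w <= defect w `^ p.
  by move=> wB; exact: trunc_le_defect (ltW (q1 k)) p0 wB.
have cont k : contB (fun w => kern s w ((q k)%:C *: z) * (trunc (q k) p w)%:C).
  have cT := @contBr_trunc R n (q k) p p2; have h := qzB k; contB_tac; exact: h.
have l1 : ccvg (fun k => cintegral (fun w => u w * (kern s w ((q k)%:C *: z) * (trunc (q k) p w)%:C)))
    (cintegral (fun w => u w * (kern s w z * (defect w `^ p)%:C))).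
  apply: (@cint_dominated _ _ (fun k w => u w * (kern s w ((q k)%:C *: z) * (trunc (q k) p w)%:C))
     (fun w => u w * (kern s w z * (defect w `^ p)%:C)) (fun w => B * (normc (u w) * defect w `^ p))).
  - by move=> k; apply: measC_cont; have h := cont k; apply contBM.
  - by move=> w wB; apply: ccvgM; [exact: ccvg_cst|exact: cvk].
  - exact: intBZ.
  - move=> k w wB; rewrite normcM mulrCA; apply: ler_wpM2l; first exact: normc_ge0.
    rewrite normcM normc_real (ger0_norm (trunc_ge0 _ _ _)).
    by apply: ler_pM; [exact: normc_ge0|exact: trunc_ge0|exact: kB|exact: T1].
have l2 : ccvg (fun k => cintegral (fun w => kern s w ((q k)%:C *: z) * (trunc (q k) p w)%:C))
    (cintegral (fun w => kern s w z * (defect w `^ p)%:C)).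
  apply: (@cint_dominated _ _ (fun k w => kern s w ((q k)%:C *: z) * (trunc (q k) p w)%:C)
     (fun w => kern s w z * (defect w `^ p)%:C) (fun w => B)).
  - by move=> k; apply: measC_cont; exact: cont.
  - exact: cvk.
  - exact: (@intB_bounded _ _ _ `|B| (measB_cst _)).
  - move=> k w wB; rewrite normcM normc_real (ger0_norm (trunc_ge0 _ _ _)) -[leRHS]mulr1.
    apply: ler_pM; [exact: normc_ge0|exact: trunc_ge0|exact: kB|].
    exact: le_trans (T1 k w wB) (defectp_le1 p0 wB).
have l3 := ccvgM (ccvg_cst (u z)) l2.
apply: ccvg_unique l1 _.
rewrite (_ : (fun k => _) = (fun k => u z * cintegral (fun w => kern s w ((q k)%:C *: z) * (trunc (q k) p w)%:C))).
  exact: l3.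
by apply/funext => k; exact: (homotopy hu zB (q1 k) (qzB k) p3).
Qed.

Lemma cintble_defectp (f : V -> C) (B p : R) : 0 < p -> contB f -> (forall w, cball w -> normc (f w) <= B) ->
  cintble (fun w => f w * (defect w `^ (p - 1))%:C).
Proof.
move=> p0 cf fB; apply: (@cintble_le _ _ _ (fun w => B * defect w `^ (p - 1))).
- by apply: measC_cont; contB_tac.
- move=> w wB; rewrite normcM normc_real (ger0_norm (powR_ge0 _ _)).
  by apply: ler_wpM2r; [exact: powR_ge0|exact: fB].
- by apply: intBZ; exact: intB_defectp.
Qed.

(** Up to the factor -p the integrand is the j-th holomorphic derivative of D^p K_s, the kernel
    being antiholomorphic in [w]. *)
Lemma cint_conj_kern j (s p : R) z : 0 <= s -> 0 < p -> cball z ->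
  cintegral (fun w => conjc (w 0 j) * kern s w z * (defect w `^ (p - 1))%:C) = 0.
Proof.
move=> s0 p0 zB.
have cK : contB (fun w => kern s w z) by contB_tac.
have cj w : cball w -> normc (conjc (w 0 j)) <= 1 by move=> wB; rewrite normc_conj ltW// normc_coord_lt1.
pose M := 2 `^ s * defect z `^ (- s).
have KM w : cball w -> normc (kern s w z) <= M by move=> wB; exact: kern_le.
have i1 : cintble (fun w => conjc (w 0 j) * kern s w z * (defect w `^ (p - 1))%:C).
  apply: (@cintble_defectp _ M _ p0); first by contB_tac.
  by move=> w wB; rewrite normcM -[leRHS]mul1r; apply: ler_pM; rewrite ?normc_ge0 ?cj ?KM.
pose A (w : V) : C := (defect w `^ p)%:C * 0 + - ((p * defect w `^ (p - 1))%:C * conjc (w 0 j)) * kern s w z.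
pose B (w : V) : C := (defect w `^ p)%:C * (s%:C * z 0 j * kern (s + 1) w z) +
   - ((p * defect w `^ (p - 1))%:C * w 0 j) * kern s w z.
have EA w : A w = - p%:C * (conjc (w 0 j) * kern s w z * (defect w `^ (p - 1))%:C).
  by rewrite /A rmorphM /=; ring.
have A0 : cintegral A = 0.
  apply: (@ibp_pd _ _ j (fun w => (defect w `^ p)%:C * kern s w z) A B).
  - by move=> w wB; exact: wdM (wd_defectp j p wB) (wd_kern j s wB zB).
  - by contB_tac.
  - by rewrite /A; contB_tac.
  - by rewrite /B; contB_tac.
  - apply: cintble_normc; apply: eq_cintble (cintbleZ (- p%:C) i1) => w wB; by rewrite EA.
  - apply: (@intB_le _ _ _ (fun w => M * defect w `^ (p - 1))).
    + by apply: measB_cont; contB_tac; move=> w wB; rewrite gt_eqF// defect_gt0.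
    + move=> w wB; have dw := defect_gt0 wB.
      rewrite ger0_norm; last by rewrite divr_ge0 ?normc_ge0// ltW.
      rewrite ler_pdivrMr// normcM normc_real (ger0_norm (powR_ge0 _ _)) powR_pred// mulrC -mulrA.
      apply: ler_pM; [exact: normc_ge0|by rewrite mulr_ge0 ?powR_ge0// ltW|exact: KM|].
      by rewrite mulrC.
    + by apply: intBZ; exact: intB_defectp.
move: A0; rewrite (eq_cintegral (g := fun w => - p%:C * (conjc (w 0 j) * kern s w z * (defect w `^ (p - 1))%:C))); last first.
  by move=> w _; exact: EA.
rewrite cintegralZ// => /eqP; rewrite mulf_eq0 oppr_eq0 => /orP[|/eqP//].
by rewrite -normc_eq0 normc_real normr_eq0 gt_eqF.
Qed.

Lemma kern0 (s : R) w : kern s w 0 = 1.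
Proof.
rewrite /kern (_ : hdot w 0 = 0); last by apply: big1 => j _; rewrite mxE mulr0.
by rewrite subr0 (cpow_real _ ltr01) powR1.
Qed.

Lemma rder_kern_integral (u : V -> C) (W : V -> R) (s : R) v z : 0 <= s -> cball z ->
  contB u -> contBr W -> (forall w, cball w -> 0 <= W w) -> intB (fun w => normc (u w) * W w) ->
  rder (fun x => cintegral (fun w => kern s w x * (u w * (W w)%:C))) v z
   (cintegral (fun w => s%:C * hdot w v * kern (s + 1) w z * (u w * (W w)%:C))).
Proof.
move=> s0 zB cu cW W0 iu; have [e e0 he] := cball_line v zB.
have dz := defect_gt0 zB.
pose S := \sum_j normc (v 0 j).
have S0 : 0 <= S by apply: sumr_ge0 => j _; exact: normc_ge0.
have s10 : 0 <= s + 1 by rewrite addr_ge0.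
pose M := 2 `^ (s + 1) * (defect z / 2) `^ (- (s + 1)).
have M0 : 0 <= M by rewrite mulr_ge0 ?powR_ge0.
apply: (@rder_cintegral _ _ (fun w x => kern s w x * (u w * (W w)%:C))
  (fun w x => s%:C * hdot w v * kern (s + 1) w x * (u w * (W w)%:C)) z v e
  (fun w => s * S * M * (normc (u w) * W w))) => //.
- exact: intBZ.
- move=> t te w wB; have [tB td] := he t te; split.
    have := rderM (rder_kern s v wB tB) (rder_cst (u w * (W w)%:C) v (z + t%:C *: v)).
    by move=> h; apply: rder_eq h _; rewrite mulr0 add0r.
  have hS : normc (hdot w v) <= S.
    apply: le_trans (normc_sum _ _ _) _; apply: ler_sum => j _.
    by rewrite normcM normc_conj ler_piMl ?normc_ge0// ltW// normc_coord_lt1.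
  have hK : normc (kern (s + 1) w (z + t%:C *: v)) <= M.
    apply: le_trans (kern_le s10 wB tB) _; rewrite ler_wpM2l ?powR_ge0//.
    by apply: le_powRN; rewrite ?divr_gt0.
  move: (kern _ _ _) hK => x hK.
  rewrite !normcM !normc_real (ger0_norm s0) (ger0_norm (W0 w wB)).
  apply: ler_wpM2r; first by rewrite mulr_ge0 ?normc_ge0 ?W0.
  apply: ler_pM; rewrite ?mulr_ge0 ?normc_ge0//.
  by rewrite ler_wpM2l.
- move=> t te; have [tB td] := he t te.
  have cK : contB (fun w => kern s w (z + t%:C *: v)) by contB_tac.
  exact: (cintbleM_le cK cu cW W0 (fun w wB => kern_le s0 wB tB)).
Qed.

(** The derivative along the ray is a combination of the integrals in [cint_conj_kern], hence 0, and
    the kernel is 1 at z = 0. *)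
Lemma kern_integral_const (s p : R) z : 0 <= s -> 0 < p -> cball z ->
  cintegral (fun w => kern s w z * (defect w `^ (p - 1))%:C) = cintegral (fun w : V => (defect w `^ (p - 1))%:C).
Proof.
move=> s0 p0 zB; have s10 : 0 <= s + 1 by rewrite addr_ge0.
pose W (w : V) := defect w `^ (p - 1).
pose g (x : V) := cintegral (fun w => kern s w x * (1 * (W w)%:C)).
have cW : contBr W by exact: contBr_defectp.
have c1 : contB (fun _ : V => 1 : C) by apply contB_cst.
have i1 : intB (fun w : V => normc (1 : C) * W w).
  by apply: eq_intB (intB_defectp p0) => w wB; rewrite normc1 mul1r.
have dg x : cball x -> rder g z x 0.
  move=> xB; apply: rder_eq (rder_kern_integral z s0 xB c1 cW (fun w _ => powR_ge0 _ _) i1) _.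
  have cj w j : cball w -> normc (conjc (w 0 j)) <= 1 by move=> wB; rewrite normc_conj ltW// normc_coord_lt1.
  have cK : contB (fun w => kern (s + 1) w x) by contB_tac.
  have i2 j : cintble (fun w => conjc (w 0 j) * kern (s + 1) w x * (defect w `^ (p - 1))%:C).
    apply: (@cintble_defectp _ (2 `^ (s + 1) * defect x `^ (- (s + 1))) _ p0); first by contB_tac.
    by move=> w wB; rewrite normcM -[leRHS]mul1r; apply: ler_pM; rewrite ?normc_ge0 ?cj ?kern_le.
  rewrite (eq_cintegral (g := fun w => \sum_j (s%:C * z 0 j) * (conjc (w 0 j) * kern (s + 1) w x * (defect w `^ (p - 1))%:C))).
    rewrite cintegral_sum => [|j _]; last exact: cintbleZ.
    by rewrite big1// => j _; rewrite cintegralZ// cint_conj_kern// mulr0.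
  move=> w wB; rewrite /hdot mulr_sumr !mulr_suml; apply: eq_bigr => j _; rewrite /W; ring.
have E (x : V) : cintegral (fun w => kern s w x * (defect w `^ (p - 1))%:C) = g x.
  by rewrite /g /W; apply: eq_cintegral => w wB; rewrite mul1r.
rewrite E.
have -> : cintegral (fun w : V => (defect w `^ (p - 1))%:C) = g 0.
  by rewrite -E; apply: eq_cintegral => w wB; rewrite kern0 mul1r.
have h : forall t : R, t \in `[0, 1] -> rdc (fun t => g (0 + t%:C *: z)) t 0.
  by move=> t; rewrite in_itv /= => t01; apply: rder_line; apply: dg; rewrite add0r; exact: cball_ray.
have := rdc0_eq ler01 h (fun t _ => erefl).
by rewrite !add0r scale0r scale1r.
Qed.

Lemma Rint_gt0 (F : V -> R) : intB F -> (forall w, cball w -> 0 < F w) -> 0 < Rint F.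
Proof.
move=> iF F0; rewrite lt_neqAle Rint_ge0 ?andbT; last by move=> w wB; exact: ltW (F0 w wB).
apply/eqP => h.
have mB := @measurable_rball R n.
have := RintE iF; rewrite -h => /esym I0.
have mF : measurable_fun (@rball R n) (fun v => (F (Cn_of_R2n v))%:E) by apply/measurable_EFinP; exact: intB_meas.
have I1 : (\int[@nu R n]_(v in @rball R n) `|(F (Cn_of_R2n v))%:E| = 0)%E.
  transitivity (\int[@nu R n]_(v in @rball R n) (F (Cn_of_R2n v))%:E)%E; last exact: I0.
  apply: eq_integral => v; rewrite inE => vB; rewrite gee0_abs// lee_fin ltW//.
  exact: F0.
have /(ae_eq_integral_abs _ mB mF) h0 := I1.
have [A [mA A0 sA]] := h0.
have sub : @rball R n `<=` A.
  move=> v vB; apply: sA => /= k; have := k vB => -[e].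
  by have := F0 _ vB; rewrite e ltxx.
have k : (@nu R n (@rball R n) <= 0)%E.
  apply: le_trans (le_measure (@nu R n) (mem_set mB) (mem_set mA) sub) _.
  by rewrite le_eqVlt; apply/orP; left; apply/eqP; exact: A0.
have : (0 < @nu R n (@rball R n))%E.
  rewrite /nu /mscale /= mule_gt0 ?lte_fin ?invr_gt0 ?ball_volume_gt0//.
  exact: lebesgue_rball_gt0.
by rewrite ltNge k.
Qed.

Lemma cintegral_real (F : V -> R) : cintegral (fun w => (F w)%:C) = (Rint F)%:C.
Proof.
apply: complex_eqP; rewrite ?Re_cintegral ?Im_cintegral //=.
by have := congr1 (@complex.Im R) (@cintegral0 R n); rewrite Im_cintegral.
Qed.

(** The weight D^{N+3} has an exponent large enough for [reproduce_big], and [kern_integral_const]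
    evaluates the remaining integral. Four descents then lead to D^{N-1} for every N > 0. *)
Lemma reproducing (N : R) : 0 < N -> exists2 lam : R, 0 < lam &
  forall u a z, hol u a -> cball z -> intB (fun w => normc (u w) * defect w `^ (N - 1)) ->
  cintegral (fun w => kern (n%:R + N) w z * (u w * (defect w `^ (N - 1))%:C)) = lam%:C * u z.
Proof.
move=> N0.
(* At s = n + p the first coefficient in [weight_raise] vanishes, leaving a relation between the
   weights D^p and D^{p-1}; the constant is multiplied by (n + p)/p. *)
have step (p lam : R) : 0 < p -> 0 < lam ->
   (forall u a z, hol u a -> cball z -> intB (fun w => normc (u w) * defect w `^ p) ->
     cintegral (fun w => kern (n%:R + p + 1) w z * (u w * (defect w `^ p)%:C)) = lam%:C * u z) ->
   exists2 lam : R, 0 < lam & forall u a z, hol u a -> cball z ->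
     intB (fun w => normc (u w) * defect w `^ (p - 1)) ->
     cintegral (fun w => kern (n%:R + p) w z * (u w * (defect w `^ (p - 1))%:C)) = lam%:C * u z.
  move=> p0 l0 H; have np0 : 0 < n%:R + p by rewrite ltr_wpDl.
  exists ((n%:R + p) / p * lam); first by rewrite mulr_gt0 ?divr_gt0.
  move=> u a z hu zB iu; have [cu ca _] := hu.
  have iu' : intB (fun w => normc (u w) * defect w `^ p).
    apply: (intB_le _ _ iu); first by apply: measB_cont; contB_tac.
    move=> w wB; rewrite ger0_norm ?mulr_ge0 ?normc_ge0 ?powR_ge0//.
    apply: ler_wpM2l; first exact: normc_ge0.
    by apply: le_powR_exp; [exact: defect_gt0|exact: defect_le1|rewrite gerBl].
  have ck t : contB (fun w => kern t w z) by contB_tac.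
  have i1 := cintbleM_le (ck (n%:R + p)) cu (@contBr_defectp R n (p - 1)) (fun w _ => powR_ge0 _ _)
    (fun w wB => kern_le (ltW np0) wB zB) iu.
  have np1 : 0 <= n%:R + p + 1 by rewrite addr_ge0// ltW.
  have i2 := cintbleM_le (ck (n%:R + p + 1)) cu (@contBr_defectp R n p) (fun w _ => powR_ge0 _ _)
    (fun w wB => kern_le np1 wB zB) iu'.
  have := @weight_raise _ _ 1 p (n%:R + p) _ _ z u a (weight_defect p) zB hu iu (ltW np0).
  rewrite (eq_cintegral (g := fun w => - p%:C * (kern (n%:R + p) w z * (u w * (defect w `^ (p - 1))%:C)) +
    (n%:R + p)%:C * (kern (n%:R + p + 1) w z * (u w * (defect w `^ p)%:C)))); last first.
    by move=> w _; rewrite subrr; ring.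
  rewrite cintegralD ?cintegralZ//; [|exact: cintbleZ|exact: cintbleZ].
  rewrite (H _ _ _ hu zB iu') => /eqP; rewrite mulNr addrC subr_eq0 => /eqP h.
  have pn0 : p%:C != 0 by rewrite -normc_eq0 normc_real normr_eq0 gt_eqF.
  apply: (mulfI pn0); rewrite -h !mulrA -!rmorphM /=; congr (_%:C * _).
  by field; rewrite gt_eqF.
have N30 : 0 < N + 3 by rewrite ltr_wpDr.
have base : exists2 lam : R, 0 < lam & forall u a z, hol u a -> cball z ->
     intB (fun w => normc (u w) * defect w `^ (N + 3)) ->
     cintegral (fun w => kern (n%:R + (N + 3) + 1) w z * (u w * (defect w `^ (N + 3))%:C)) = lam%:C * u z.
  have N40 : 0 < N + 3 + 1 by rewrite ltr_wpDr// ltW.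
  have iD : intB (fun w : V => defect w `^ (N + 3)) by have := intB_defectp N40; rewrite addrK.
  exists (Rint (fun w : V => defect w `^ (N + 3))).
    by apply: Rint_gt0 => // w wB; rewrite powR_gt0// defect_gt0.
  move=> u a z hu zB iu.
  have N33 : 3 <= N + 3 by rewrite lerDr ltW.
  rewrite (eq_cintegral (g := fun w => u w * (kern (n%:R + (N + 3) + 1) w z * (defect w `^ (N + 3))%:C))); last first.
    by move=> w _; rewrite mulrCA.
  rewrite (reproduce_big hu zB N33 iu) mulrC; congr (_ * _).
  have s0 : 0 <= n%:R + (N + 3) + 1 by rewrite !addr_ge0// ltW.
  have := kern_integral_const s0 N40 zB; rewrite addrK => ->.
  exact: cintegral_real.
have [l0 l00 H0] := base.
have [l1 l10 H1] := step _ _ N30 l00 H0.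
have N20 : 0 < N + 2 by rewrite ltr_wpDr.
have N10 : 0 < N + 1 by rewrite ltr_wpDr.
have E3 : N + 3 - 1 = N + 2 by ring.
have E3' : n%:R + (N + 3) = n%:R + (N + 2) + 1 by ring.
rewrite E3 E3' in H1.
have [l2 l20 H2] := step _ _ N20 l10 H1.
have E2 : N + 2 - 1 = N + 1 by ring.
have E2' : n%:R + (N + 2) = n%:R + (N + 1) + 1 by ring.
rewrite E2 E2' in H2.
have [l3 l30 H3] := step _ _ N10 l20 H2.
rewrite addrK addrA in H3.
exact: step N0 l30 H3.
Qed.

End Reproducing.

(** * Forelli-Rudin estimates *)

Section ForelliRudin.
Context {R : realType} {n : nat}.
Local Notation C := R[i].
Local Notation V := 'rV[C]_n.
Local Notation Re := (@complex.Re R).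
Implicit Types (z w : V).

Definition fr (M s : R) z w : R := rho w z `^ (- s) * defect w `^ (M - 1).

Lemma contBr_rho z : cball z -> contBr (fun w => rho w z).
Proof.
move=> zB; rewrite /rho; apply contBr_normc; apply contBD; first by apply contB_cst.
apply contBN; exact: contB_sum (fun j _ => contBM (@contB_cbar R n j) (@contB_cst R n (z 0 j))).
Qed.

Lemma contBr_fr M s z : cball z -> contBr (fr M s z).
Proof.
move=> zB; rewrite /fr; apply contBrM; last by apply contBr_defectp.
by apply contBr_powR; [exact: contBr_rho|move=> w wB; exact: rho_gt0].
Qed.

Lemma fr_ge0 M s z w : 0 <= fr M s z w. Proof. by rewrite mulr_ge0 ?powR_ge0. Qed.

Lemma fr_le_defect M s z w : 0 <= s -> cball z -> cball w ->
  fr M s z w <= 2 `^ s * defect z `^ (- s) * defect w `^ (M - 1).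
Proof. by move=> s0 zB wB; rewrite /fr -normc_kern ler_wpM2r ?powR_ge0 ?kern_le. Qed.

Lemma intB_fr M s z : 0 < M -> 0 <= s -> cball z -> intB (fr M s z).
Proof.
move=> M0 s0 zB.
apply: (@intB_le _ _ _ (fun w => 2 `^ s * defect z `^ (- s) * defect w `^ (M - 1))).
- by apply: measB_cont; exact: contBr_fr.
- by move=> w wB; rewrite ger0_norm ?fr_ge0 ?fr_le_defect.
- by apply: intBZ; exact: intB_defectp.
Qed.

Definition fr_bound (M b : R) : Prop := exists2 c : R, 0 <= c &
  forall z, cball z -> Rint (fr M (n%:R + M + b) z) <= c * defect z `^ (- b).

(* Reproducing the kernel itself gives the integral of [|K|^2] exactly. *)
Lemma fr_square (M : R) : 0 < M -> exists2 lam : R, 0 <= lam &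
  forall z, cball z -> Rint (fr M ((n%:R + M) + (n%:R + M)) z) = lam * defect z `^ (- (n%:R + M)).
Proof.
move=> M0; have [lam l0 H] := @reproducing R n M M0; exists lam; first exact: ltW.
move=> z zB; set b := n%:R + M; have b0 : 0 <= b by rewrite addr_ge0// ltW.
have hu := hol_kern b zB; have [cu _ _] := hu.
have iu : intB (fun w => normc (kern b z w) * defect w `^ (M - 1)).
  have := intB_fr M0 b0 zB; apply: eq_intB => w wB.
  by rewrite normc_kern rho_sym.
have := H _ _ _ hu zB iu.
rewrite (eq_cintegral (g := fun w => (fr M (b + b) z w)%:C)); last first.
  move=> w wB; rewrite -(kern_conj b w z) mulrA mulc_conj -rmorphM /fr normc_kern; congr ((_ * _)%:C).
  by rewrite expr2 -powRDp ?rho_gt0// -opprD.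
rewrite cintegral_real.
have -> : kern b z z = (defect z `^ (- b))%:C.
  by rewrite /kern hdot_self -rmorphB cpow_real// defect_gt0.
by rewrite -rmorphM => /complexI.
Qed.

(** Reduction to the exact value in [fr_square] for a smaller weight exponent M'. The surplus powers
    are removed with D(w) <= 2 rho and D(z) <= 2 rho; b > n leaves room for M' > 0 with n + M' <=
    b. *)
Lemma fr_large (M b : R) : 0 < M -> n%:R < b -> fr_bound M b.
Proof.
move=> M0 bn; pose M' := Num.min M (b - n%:R).
have M'0 : 0 < M' by rewrite lt_min M0 subr_gt0.
have M'M : M' <= M by rewrite ge_min lexx.
have M'b : n%:R + M' <= b by rewrite -lerBrDl ge_min lexx orbT.
have [lam l0 H] := fr_square M'0; set be := n%:R + M' in H M'b.
have be0 : 0 <= be by rewrite addr_ge0// ltW.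
have b0 : 0 <= b by apply: le_trans M'b.
have nMb : 0 <= n%:R + M + b by rewrite !addr_ge0// ltW.
exists (2 `^ (M - M') * 2 `^ (b - be) * lam); first by rewrite !mulr_ge0 ?powR_ge0.
move=> z zB; have dz := defect_gt0 zB.
have -> : 2 `^ (M - M') * 2 `^ (b - be) * lam * defect z `^ (- b) =
   (2 `^ (M - M') * (2 `^ (b - be) * defect z `^ (- (b - be)))) * (lam * defect z `^ (- be)).
  rewrite (_ : - b = - (b - be) + - be) ?powRDp//; first by ring.
  by ring.
rewrite -H// -RintZ; last by apply: intB_fr => //; rewrite addr_ge0.
apply: le_Rint; first exact: intB_fr.
  by apply: intBZ; apply: intB_fr => //; rewrite addr_ge0.
move=> w wB; have dw := defect_gt0 wB; have r0 := rho_gt0 wB zB.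
rewrite -powR_half// /fr.
have E1 : defect w `^ (M - 1) = defect w `^ (M - M') * defect w `^ (M' - 1).
  by rewrite -powRDp//; congr (_ `^ _); ring.
have E2 : rho w z `^ (- (n%:R + M + b)) = rho w z `^ (- (M - M')) * (rho w z `^ (- (b - be)) * rho w z `^ (- (be + be))).
  by rewrite -!powRDp//; congr (_ `^ _); rewrite /be; ring.
have h1 : rho w z `^ (- (M - M')) * defect w `^ (M - M') <= 2 `^ (M - M').
  rewrite powRN -ler_pdivlMl ?invr_gt0 ?powR_gt0// invrK -powRM ?(ltW r0)//.
  apply: ge0_ler_powR; [by rewrite subr_ge0|by rewrite nnegrE ltW|by rewrite nnegrE mulr_ge0// ltW|].
  by rewrite mulrC rho_sym; exact: defect_le_2rho.
have h2 : rho w z `^ (- (b - be)) <= (defect z / 2) `^ (- (b - be)).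
  apply: le_powRN; rewrite ?divr_gt0 ?subr_ge0//.
  by rewrite ler_pdivrMr// mulrC; exact: defect_le_2rho.
rewrite E1 E2.
have -> : rho w z `^ (- (M - M')) * (rho w z `^ (- (b - be)) * rho w z `^ (- (be + be))) *
   (defect w `^ (M - M') * defect w `^ (M' - 1)) =
   (rho w z `^ (- (M - M')) * defect w `^ (M - M')) * rho w z `^ (- (b - be)) *
   (rho w z `^ (- (be + be)) * defect w `^ (M' - 1)) by ring.
apply: ler_wpM2r; first by rewrite mulr_ge0 ?powR_ge0.
by apply: ler_pM; rewrite ?mulr_ge0 ?powR_ge0.
Qed.

Lemma normc_hdot_le w v : cball w -> normc (hdot w v) <= n%:R * cnorm v.
Proof.
move=> wB; apply: le_trans (normc_sum _ _ _) _.
rewrite -[X in X%:R * _](card_ord n) mulr_natl -sumr_const; apply: ler_sum => j _.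
rewrite normcM normc_conj; apply: le_trans (normc_le_cnorm v j).
by rewrite ler_piMl ?normc_ge0// ltW// normc_coord_lt1.
Qed.

Section Descend.
Variables (M b c : R).
Hypotheses (M0 : 0 < M) (b1 : -1 < b) (c0 : 0 <= c).
Hypothesis hc : forall z, cball z -> Rint (fr M (n%:R + M + (b + 1)) z) <= c * defect z `^ (- (b + 1)).

Let s := n%:R + M + b.
Hypothesis s0 : 0 <= s.
(** The integral of rho^{-s} D^{M-1}, written with K_{s/2} times its conjugate so that it can be
    differentiated in [z]. *)
Let g z : C := cintegral (fun w => kern (s / 2) w z * conjc (kern (s / 2) w z) * (defect w `^ (M - 1))%:C).
Let dF v w z : C := (kern (s / 2) w z * conjc ((s / 2)%:C * hdot w v * kern (s / 2 + 1) w z) +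
    (s / 2)%:C * hdot w v * kern (s / 2 + 1) w z * conjc (kern (s / 2) w z)) * (defect w `^ (M - 1))%:C.

Let kk w z : cball w -> cball z ->
  kern (s / 2) w z * conjc (kern (s / 2) w z) * (defect w `^ (M - 1))%:C = (fr M s z w)%:C.
Proof.
move=> wB zB; rewrite mulc_conj -rmorphM normc_kern /fr; congr ((_ * _)%:C).
by rewrite expr2 -powRDp ?rho_gt0//; congr (_ `^ _); field.
Qed.

Let gE z : cball z -> g z = (Rint (fr M s z))%:C.
Proof.
move=> zB; rewrite -cintegral_real; apply: eq_cintegral => w wB; exact: kk.
Qed.

Let dF_le v w z : cball w -> cball z -> normc (dF v w z) <= s * (n%:R * cnorm v) * fr M (s + 1) z w.
Proof.
move=> wB zB; rewrite /dF normcM normc_real (ger0_norm (powR_ge0 _ _)) /fr mulrA.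
apply: ler_wpM2r; first exact: powR_ge0.
have s20 : 0 <= s / 2 by rewrite divr_ge0.
have E : rho w z `^ (- (s + 1)) = normc (kern (s / 2) w z) * normc (kern (s / 2 + 1) w z).
  by rewrite !normc_kern -powRDp ?rho_gt0//; congr (_ `^ _); field.
apply: le_trans (le_normcD _ _) _.
rewrite E; move: (kern (s / 2) w z) => x; move: (kern (s / 2 + 1) w z) => y.
rewrite !(normcM, normc_conj) normc_real (ger0_norm s20).
have h := normc_hdot_le v wB; have x0 := normc_ge0 x; have y0 := normc_ge0 y.
have -> : normc x * (s / 2 * normc (hdot w v) * normc y) + s / 2 * normc (hdot w v) * normc y * normc x =
  normc (hdot w v) * (s * (normc x * normc y)) by field.
have -> : s * (n%:R * cnorm v) * (normc x * normc y) = (n%:R * cnorm v) * (s * (normc x * normc y)) by ring.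
by rewrite ler_wpM2r// !mulr_ge0.
Qed.

Let contdF v z : cball z -> contB (dF v^~ z).
Proof.
move=> zB.
have ck t : contB (fun w => kern t w z) by contB_tac.
have ch : contB (fun w => hdot w v) by exact: contB_sum (fun j _ => contBM (@contB_cbar R n j) (@contB_cst R n (v 0 j))).
by rewrite /dF; contB_tac.
Qed.

Let dg v z : cball z -> rder g v z (cintegral (fun w => dF v w z)).
Proof.
move=> zB; have [e e0 he] := cball_line v zB; have dz := defect_gt0 zB.
have s10 : 0 <= s + 1 by rewrite addr_ge0.
pose B := s * (n%:R * cnorm v) * (2 `^ (s + 1) * (defect z / 2) `^ (- (s + 1))).
apply: (@rder_cintegral _ _ _ (dF v) z v e (fun w => B * defect w `^ (M - 1)) e0).
- by apply: intBZ; exact: intB_defectp.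
- move=> t te w wB; have [tB td] := he t te; split.
    have := rderM (rderM (rder_kern (s / 2) v wB tB) (rder_conj (rder_kern (s / 2) v wB tB)))
      (rder_cst (defect w `^ (M - 1))%:C v (z + t%:C *: v)).
    by move=> h; apply: rder_eq h _; rewrite mulr0 add0r.
  apply: le_trans (dF_le v wB tB) _; rewrite /B -!mulrA.
  do 3! (apply: ler_wpM2l; rewrite ?cnorm_ge0 ?ler0n//).
  rewrite mulrA; apply: le_trans (fr_le_defect _ s10 tB wB) _.
  apply: ler_wpM2r; first exact: powR_ge0.
  by rewrite ler_wpM2l ?powR_ge0//; apply: le_powRN; rewrite ?divr_gt0.
- move=> t te; have [tB td] := he t te.
  have i := intB_fr M0 s0 tB.
  apply: (@cintble_le _ _ _ (fr M s (z + t%:C *: v))) => //.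
    have ck : contB (fun w => kern (s / 2) w (z + t%:C *: v)) by contB_tac.
    by apply: measC_cont; contB_tac.
  by move=> w wB; rewrite kk// normc_real ger0_norm// fr_ge0.
Qed.

Let A := 2 * (s * n%:R * c).
Let A0 : 0 <= A. Proof. by rewrite !mulr_ge0. Qed.

Let dg_le z (t : R) : cball z -> 0 <= t <= 1 ->
  normc (cintegral (fun w => dF z w (t%:C *: z))) <= A * cnorm z * defect (t%:C *: z) `^ (- (b + 1)).
Proof.
move=> zB t01; have tB := cball_ray zB t01.
have s10 : 0 <= s + 1 by rewrite addr_ge0.
have i := intB_fr M0 s10 tB.
apply: le_trans (normc_cintegral_le _ (fun w wB => dF_le z wB tB) (intBZ _ i)) _.
  by apply: measC_cont; exact: contdF.
rewrite RintZ// /A -!mulrA ler_wpM2l//.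
have -> : s * (n%:R * (cnorm z * Rint (fr M (s + 1) (t%:C *: z)))) =
  s * (n%:R * cnorm z) * Rint (fr M (s + 1) (t%:C *: z)) by ring.
have -> : s * (n%:R * (c * (cnorm z * defect (t%:C *: z) `^ (- (b + 1))))) =
  s * (n%:R * cnorm z) * (c * defect (t%:C *: z) `^ (- (b + 1))) by ring.
apply: ler_wpM2l; first by rewrite !mulr_ge0 ?cnorm_ge0.
by have := hc tB; rewrite addrA.
Qed.

(** A derivative in [z] raises s by one, so the estimate for b + 1 bounds it; integrating back along
    the ray gives D^{-b} when b > 0 and boundedness when -1 < b < 0. *)
Lemma fr_descend : (0 < b -> fr_bound M b) /\
  (b < 0 -> exists2 c : R, 0 <= c & forall z, cball z -> Rint (fr M s z) <= c).
Proof.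
have I0 : 0 <= Rint (fr M s 0) by apply: Rint_ge0 => w _; exact: fr_ge0.
have B0 : cball (0 : V) by rewrite /cball /= sqnorm0.
have gn z : cball z -> normc (g z) = Rint (fr M s z).
  move=> zB; have I : 0 <= Rint (fr M s z) by apply: Rint_ge0 => w _; exact: fr_ge0.
  by rewrite (gE zB) normc_real (ger0_norm I).
split => bb.
  have e1 : 1 < b + 1 by rewrite ltrDr.
  have k0 : 0 <= 2 `^ (b + 1) / (b + 1 - 1) * A by rewrite mulr_ge0// divr_ge0 ?powR_ge0// addrK ltW.
  exists (Rint (fr M s 0) + 2 `^ (b + 1) / (b + 1 - 1) * A); first by rewrite addr_ge0.
  move=> z zB; have := radial_bound_neg zB A0 e1 (fun t t01 => dg z (cball_ray zB t01)) (fun t t01 => dg_le zB t01).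
  rewrite !gn// => h; apply: le_trans h _; rewrite mulrDl (_ : 1 - (b + 1) = - b); last by ring.
  rewrite lerD2r ler_peMr// -[X in X <= _](powRr0 (defect z)); apply: le_powR_exp.
  - exact: defect_gt0.
  - exact: defect_le1.
  - by rewrite oppr_le0 ltW.
have e0 : 0 <= b + 1 by rewrite -lerBlDr sub0r ltW.
have e1 : b + 1 < 1 by rewrite gtrDr.
exists (Rint (fr M s 0) + 2 / (1 - (b + 1)) * A).
  by rewrite addr_ge0// mulr_ge0// divr_ge0// subr_ge0 ltW.
move=> z zB; have := radial_bound_pos zB A0 e0 e1 (fun t t01 => dg z (cball_ray zB t01)) (fun t t01 => dg_le zB t01).
by rewrite !gn.
Qed.

End Descend.

(** Descent by unit steps from an exponent b + k above n, where [fr_large] applies. *)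
Lemma forelli_rudin (M b : R) : 0 < M -> 0 < b -> fr_bound M b.
Proof.
move=> M0 b0; have [k] : exists k : nat, n%:R < b + k%:R.
  by exists n.+1; rewrite -natr1; lra.
elim: k b b0 => [|k IH] b b0 hb; first by apply: fr_large => //; rewrite addr0 in hb.
have b10 : 0 < b + 1 by lra.
have [|c c0 hc] := IH (b + 1) b10; first by move: hb; rewrite -natr1; lra.
have s0 : 0 <= n%:R + M + b by rewrite !addr_ge0// ltW.
have b1 : -1 < b by lra.
exact: (fr_descend M0 b1 c0 hc s0).1.
Qed.

(** A single descent from the positive exponent 1 - b. *)
Lemma forelli_rudin_neg (M b : R) : 0 < M -> 0 < b -> b < 1 -> 0 <= n%:R + M - b ->
  exists2 c : R, 0 <= c & forall z, cball z -> Rint (fr M (n%:R + M - b) z) <= c.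
Proof.
move=> M0 b0 b1 s0; have b10 : 0 < - b + 1 by lra.
have [c c0 hc] := forelli_rudin M0 b10.
have b1' : -1 < - b by lra.
have bn : - b < 0 by lra.
exact: (fr_descend M0 b1' c0 hc s0).2 bn.
Qed.

End ForelliRudin.

(** * Finiteness and positivity of the Gamma integral *)

Section GammaPositive.
Context {R : realType}.
Local Notation leb := (@lebesgue_measure R).

Lemma pow_expRN_bound (s : R) : 0 < s -> exists2 c : R, 0 < c &
  forall t, 0 < t -> (1 + t `^ s) ^+ 2 * expR (- t) <= c.
Proof.
(* An integer above s: for t >= 1, (1 + t^s)^2 <= 4 t^{2m} <= 4 (2m)! e^t. *)
move=> s0; pose m := (Num.trunc s).+1.
have sm : s <= m%:R by rewrite ltW// truncnS_gt.
pose k := (m * 2)%N.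
have k1 : (1 <= k`!)%N by rewrite fact_gt0.
exists (4 * k`!%:R); first by rewrite mulr_gt0// ltr0n.
move=> t t0.
have et : 0 < expR (- t) by exact: expR_gt0.
have [t1|t1] := lerP t 1.
  have h : t `^ s <= 1 by rewrite -(powRr0 t); apply: le_powR_exp => //; exact: ltW.
  have h0 := powR_ge0 t s.
  apply: (@le_trans _ _ (4 * 1)); last by rewrite ler_wpM2l// ler1n.
  apply: ler_pM; rewrite ?sqr_ge0 ?(ltW et)//; last by rewrite -expR0 ler_expR oppr_le0 ltW.
  rewrite expr2; nra.
have h : t `^ s <= t ^+ m.
  by rewrite -powR_mulrn ?(ltW t0)//; apply: ler_powR => //; exact: ltW.
have h1 : 1 <= t ^+ m by rewrite expr_ge1 ?ltW.
have h0 := powR_ge0 t s.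
apply: (@le_trans _ _ (4 * t ^+ k * expR (- t))).
  rewrite ler_wpM2r ?(ltW et)// /k exprM.
  by move: (t ^+ m) h h1 => y h h1; rewrite !expr2; nra.
rewrite -mulrA ler_wpM2l// expRN ler_pdivrMr ?expR_gt0//.
have := expR_ge1Dxn k.-1 (ltW t0); rewrite prednK; last by rewrite /k.
rewrite -ler_pdivrMl ?ltr0n ?fact_gt0// mulrC => h2.
by apply: le_trans h2; rewrite lerDr.
Qed.

Let f (s t : R) := t `^ (s - 1) * expR (- t).
Let f_ge0 s t : 0 <= f s t. Proof. by rewrite mulr_ge0 ?powR_ge0 ?expR_ge0. Qed.

Let mf s : measurable_fun [set: R] (f s).
Proof.
apply: measurable_funM; first exact: measurable_powR.
by apply: measurableT_comp => //; exact: measurable_expR.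
Qed.

Let contf s (t : R) : 0 < t -> {for t, continuous (f s)}.
Proof.
move=> t0; apply: (@continuousM R R (fun t => t `^ (s - 1)) (fun t => expR (- t))).
  by apply: differentiable_continuous; apply/derivable1_diffP; apply: derivable_powR; rewrite in_itv/= t0.
apply: (@continuous_comp _ _ _ (fun t : R => - t) (@expR R)); last exact: continuous_expR.
exact: continuousN.
Qed.

(** The integrand is at most c t^{s-1}/(1 + t^s)^2, the derivative of -(c/s)/(1 + t^s). This
    primitive is bounded on the whole half-line, so one comparison controls both ends. *)
Lemma Gamma_itv_le (s c a b : R) : 0 < s -> 0 < a -> a < b ->
  (forall t, 0 < t -> (1 + t `^ s) ^+ 2 * expR (- t) <= c) ->
  (\int[leb]_(t in `[a, b]) (f s t)%:E <= (c / s)%:E)%E.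
Proof.
move=> s0 a0 ab hc.
pose G (t : R) := - (c / s) / (1 + t `^ s).
pose dG (t : R) := c * t `^ (s - 1) / (1 + t `^ s) ^+ 2.
have p1 (t : R) : 0 < 1 + t `^ s by rewrite ltr_wpDr ?powR_ge0.
have c0 : 0 <= c.
  by apply: le_trans (hc 1 ltr01); rewrite mulr_ge0 ?sqr_ge0 ?expR_ge0.
have GD (t : R) : 0 < t -> is_derive t 1 G (dG t).
  move=> t0.
  pose g (t : R) := 1 + t `^ s.
  have h1 : is_derive t 1 g (0 + s * t `^ (s - 1)) := is_deriveD (is_derive_cst (1 : R) t 1) (is_derive1_powR s t0).
  have g0 : g t != 0 := lt0r_neq0 (p1 t).
  have h2 := is_deriveV g0 h1.
  have h3 := is_deriveZ (- (c / s)) h2.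
  apply: is_derive_eq h3 _; rewrite /dG /g /GRing.scale /= add0r; field.
  by rewrite gt_eqF//= gt_eqF.
have tab (t : R) : t \in `[a, b] -> 0 < t by rewrite in_itv /= => /andP[at_ _]; exact: lt_le_trans at_.
have dGc (t : R) : 0 < t -> {for t, continuous dG}.
  move=> t0; have cp p : {for t, continuous (fun t : R => t `^ p)}.
    by apply: differentiable_continuous; apply/derivable1_diffP; apply: derivable_powR; rewrite in_itv/= t0.
  have c1 : {for t, continuous (fun t : R => 1 + t `^ s)}.
    by apply: (@continuousD R R R (fun=> 1) (fun t => t `^ s)); [exact: cvg_cst|exact: cp].
  apply: (@continuousM R R (fun t => c * t `^ (s - 1)) (fun t => ((1 + t `^ s) ^+ 2)^-1)).
    by apply: (@continuousM R R (fun=> c) (fun t => t `^ (s - 1))); [exact: cvg_cst|exact: cp].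
  apply: (@continuousV R R (fun t => (1 + t `^ s) ^+ 2)); first by rewrite expf_neq0// gt_eqF.
  apply: (@continuous_comp _ _ _ (fun t : R => 1 + t `^ s) (fun x : R => x ^+ 2)) => //.
  exact: exprn_continuous.
have wc (h : R -> R) : (forall t : R, 0 < t -> {for t, continuous h}) -> {within `[a, b], continuous h}.
  move=> hh; apply: continuous_in_subspaceT => t; rewrite inE /= => /tab; exact: hh.
have GC (t : R) : 0 < t -> {for t, continuous G}.
  move=> t0; apply: differentiable_continuous; apply/derivable1_diffP.
  by have h := GD t t0; exact: ex_derive.
have mi : measurable (`[a, b]%classic : set R) by exact: measurable_itv.
apply: (@le_trans _ _ (\int[leb]_(t in `[a, b]) (dG t)%:E)%E).
  apply: ge0_le_integral => //.
  - by move=> t _; rewrite lee_fin.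
  - by apply/measurable_EFinP; apply: measurable_funTS; exact: mf.
  - apply/measurable_EFinP; apply: subspace_continuous_measurable_fun => //; exact: wc.
  - move=> t /= /tab t0; rewrite lee_fin /f /dG.
    rewrite mulrAC [leRHS]mulrC ler_wpM2l ?powR_ge0//.
    by rewrite ler_pdivlMr ?exprn_gt0// mulrC hc.
rewrite (@continuous_FTC2 _ dG G a b ab).
- rewrite -EFinD lee_fin /G !mulNr opprK addrC.
  have h : 0 <= c / s by rewrite divr_ge0// ltW.
  apply: (@le_trans _ _ (c / s / (1 + a `^ s))).
    by rewrite gerDl oppr_le0 divr_ge0// ltW.
  by rewrite ler_pdivrMr// ler_peMr// lerDl powR_ge0.
- exact: wc.
- split.
  + by move=> t tab'; have h := GD t (tab t (subset_itv_oo_cc tab')); exact: ex_derive.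
  + by apply: cvg_at_right_filter; exact: GC.
  + by apply: cvg_at_left_filter; apply: GC; exact: lt_trans ab.
- by move=> t tab'; have h := GD t (tab t (subset_itv_oo_cc tab')); rewrite derive1E; exact: derive_val.
Qed.

(** [Rintegral] sends an infinite integral to 0, so positivity requires finiteness first; it follows
    by exhausting the half-line and Fatou's lemma. *)
Lemma Gamma_gt0 (s : R) : 0 < s -> 0 < Gamma s.
Proof.
move=> s0; have [c c0 hc] := pow_expRN_bound s0.
have mD : measurable (`]0, +oo[%classic : set R) by exact: measurable_itv.
pose E (k : nat) : set R := `[k.+2%:R^-1, k.+2%:R]%classic.
have mE k : measurable (E k) by exact: measurable_itv.
have ED k : E k `<=` `]0, +oo[%classic.
  rewrite /E => t /=; rewrite !in_itv /= andbT => /andP[h _]; apply: lt_le_trans h; by rewrite invr_gt0.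
pose F (k : nat) : R -> \bar R := (EFin \o f s) \_ (E k).
have mF (k : nat) : measurable_fun (`]0, +oo[%classic : set R) (F k).
  apply/measurable_restrict => //; apply: measurable_funS measurableT _ _ => //.
  by apply/measurable_EFinP; exact: mf.
have F0 (k : nat) (t : R) : (`]0, +oo[%classic : set R) t -> (0 <= F k t)%E.
  by move=> _; rewrite /F patchE; case: ifP => // _; rewrite lee_fin.
have IF (k : nat) : (\int[leb]_(t in `]0%R, +oo[) F k t <= (c / s)%:E)%E.
  have DE : (`]0, +oo[%classic : set R) `&` E k = E k.
    by apply/seteqP; split => [t []//|t Et]; split => //; exact: (ED k t Et).
  rewrite /F -integral_mkcondr DE.
  have k0 : (0 : R) < k.+2%:R^-1 by rewrite invr_gt0.
  have k1 : (k.+2%:R^-1 : R) < k.+2%:R.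
    by apply: (@lt_le_trans _ _ 1); rewrite ?invf_lt1 ?ltr1n ?ler1n.
  exact: (Gamma_itv_le s0 k0 k1 hc).
have Ifin : (\int[leb]_(t in `]0%R, +oo[) (f s t)%:E <= (c / s)%:E)%E.
  have -> : (\int[leb]_(t in `]0%R, +oo[) (f s t)%:E = \int[leb]_(t in `]0%R, +oo[) limn_einf (F^~ t))%E.
    apply: eq_integral => t; rewrite inE /= in_itv /= andbT => t0.
    have lim : F k t @[k --> \oo] --> (f s t)%:E.
      apply: cvg_near_cst.
      apply: (@filterS _ (nbhs \oo) _ _ _ _ (filterI (nbhs_infty_ger t^-1) (nbhs_infty_ger t))) => k [h1 h2].
      have hk : (k%:R : R) <= k.+2%:R by rewrite ler_nat -addn2 leq_addr.
      rewrite /F patchE mem_set// /E /= in_itv /= (le_trans h2 hk) andbT.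
      by rewrite -[leRHS]invrK lef_pV2 ?posrE ?invr_gt0 ?ltr0n//; exact: le_trans h1 hk.
    by rewrite is_cvg_limn_einfE; [apply/esym/cvg_lim|apply/cvg_ex; exists (f s t)%:E].
  apply: le_trans (fatou leb mD mF F0) _; rewrite limn_einf_lim.
  apply: lime_le; first exact: is_cvg_einfs.
  apply: nearW => k; apply: le_trans (IF k).
  by apply: ereal_inf_lbound; exists k => /=.
rewrite /Gamma /Rintegral fine_gt0//; apply/andP; split; last exact: le_lt_trans Ifin (ltry _).
have m12 : measurable (`[1, 2]%classic : set R) by exact: measurable_itv.
(* A lower bound for the integrand on [1, 2] that covers both signs of s - 1. *)
pose d := Num.min 1 (2 `^ (s - 1)) * expR (- 2).
have d0 : 0 < d by rewrite mulr_gt0 ?expR_gt0// lt_min ltr01 powR_gt0.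
apply: (@lt_le_trans _ _ (\int[leb]_(t in `[1%R, 2%R]) d%:E)%E).
  have m1 : leb `[1%R, 2%R]%classic = 1%:E.
    have := @lebesgue_measure_itv R `[1, 2]; rewrite /= lte_fin ltr1n => h; apply: etrans h _.
    by rewrite -EFinB; congr EFin; ring.
  rewrite integral_cst//; have := m1; set x := (X in X = _ -> _); move=> xE.
  by rewrite [X in (_ * X)%E](_ : _ = 1%:E) -?EFinM ?mulr1 ?lte_fin.
apply: (@le_trans _ _ (\int[leb]_(t in `[1%R, 2%R]) (f s t)%:E)%E).
  apply: ge0_le_integral => //.
  - by move=> t _; rewrite lee_fin ltW.
  - by apply/measurable_EFinP; apply: measurable_funTS; exact: mf.
  - move=> t /=; rewrite in_itv /= lee_fin => /andP[t1 t2].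
    have t0 : 0 < t by apply: lt_le_trans t1.
    have P2 : 0 < (2 : R) `^ (s - 1) by rewrite powR_gt0.
    apply: ler_pM; rewrite ?expR_ge0 ?ler_expR ?lerN2// ?le_min ?ler01 ?(ltW P2)//.
    have [s1|s1] := lerP 1 s.
      apply: le_trans (_ : 1 <= _); first by rewrite ge_min lexx.
      have p1 := congr1 (fun g : R -> R => g (s - 1)) (@powR1 R); rewrite -[leLHS]p1; apply: ge0_ler_powR; rewrite ?nnegrE ?subr_ge0 ?(ltW t0)//.
    apply: le_trans (_ : 2 `^ (s - 1) <= _); first by rewrite ge_min lexx orbT.
    by rewrite -opprB; apply: le_powRN => //; rewrite subr_ge0 ltW.
apply: ge0_subset_integral => //.
- by apply/measurable_EFinP; apply: measurable_funTS; exact: mf.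
- by move=> t _; rewrite lee_fin.
- by move=> t /=; rewrite !in_itv /= andbT => /andP[t1 _]; apply: lt_le_trans t1.
Qed.

Lemma c_gt0 (n : nat) (N : R) : 0 < N -> 0 < @c_ R n N.
Proof.
move=> N0; rewrite /c_ divr_gt0 ?mulr_gt0 ?Gamma_gt0 ?ltr0n ?fact_gt0//.
by rewrite ltr_wpDl.
Qed.

End GammaPositive.

(** * Goursat's theorem on rectangles *)

Section RealGoursat.
Context {R : realType}.
Implicit Types (f g u : R -> R) (x y d e : R).

Lemma is_derive_epsP f x d : is_derive x 1 f d <->
  forall e, 0 < e -> exists2 r : R, 0 < r & forall h, `|h| <= r -> `|f (x + h) - f x - d * h| <= e * `|h|.
Proof.
have key : (forall e, 0 < e -> exists2 r : R, 0 < r & forall h, `|h| <= r -> `|f (x + h) - f x - d * h| <= e * `|h|) <->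
    (fun h : R => h^-1 *: ((f \o shift x) (h *: (1 : R)) - f x)) @ 0^' --> d.
  split=> [H|/cvgrPdist_le H e e0].
    apply/cvgrPdist_le => e e0; have [r r0 hr] := H e e0.
    apply/nbhs_ballP; exists r => //= h hh h0.
    have hr' : `|h| <= r by move: hh; rewrite -ball_normE /ball_/= sub0r normrN => /ltW.
    have -> : d - h^-1 *: ((f \o shift x) (h *: 1) - f x) = - ((f (x + h) - f x - d * h) / h).
      by rewrite /GRing.scale /= mulr1 [h + x]addrC; field.
    by rewrite normrN normrM normfV ler_pdivrMr ?normr_gt0//; exact: hr.
  have /nbhs_ballP[r /= r0 hr] := H e e0; exists (r / 2); first by rewrite divr_gt0.
  move=> h hh; have [->|h0] := eqVneq h 0; first by rewrite addr0 subrr mulr0 subr0 normr0 mulr0.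
  have hb : ball 0 r h.
    rewrite -ball_normE /ball_/= sub0r normrN; apply: le_lt_trans hh _.
    by rewrite ltr_pdivrMr// ltr_pMr// ltr1n.
  have := hr h hb h0; rewrite /GRing.scale /= mulr1 [h + x]addrC => le.
  rewrite (_ : _ - d * h = - ((d - h^-1 * (f (x + h) - f x)) * h)); last first.
    by rewrite mulrBl mulrAC mulVf// mul1r; ring.
  by rewrite normrN normrM ler_wpM2r.
have [k1 k2] := key; split=> [dv|/k1 h].
  by apply: k2; have [dv' dE] := dv; rewrite -dE; exact: dv'.
by apply: DeriveDef; [apply/cvg_ex; exists d|exact: cvg_lim].
Qed.

Lemma primitive_exists g (a b : R) : a < b ->
  (forall y, a <= y -> y <= b -> {for y, continuous g}) ->
  exists G : R -> R, forall y, a < y -> y < b -> is_derive y 1 G (g y).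
Proof.
move=> ab cg; exists (fun y => \int[@lebesgue_measure R]_(t in `[a, y]) g t)%R => y ay yb.
have ig : (@lebesgue_measure R).-integrable `[a, b]%classic (EFin \o g).
  apply: continuous_compact_integrable; first exact: segment_compact.
  apply: continuous_in_subspaceT => t; rewrite inE /= in_itv /= => /andP[at_ tb]; exact: cg.
have [d1 d2] := continuous_FTC1_closed yb ig ay (cg y (ltW ay) (ltW yb)).
by apply: (DeriveDef d1); rewrite -derive1E; exact: d2.
Qed.

Section Rectangle.
Variables A B P Q : R -> R -> R.
(* [A y] is a primitive in x of [P y], and [B x] a primitive in y of [Q x]. *)
Definition bdry x y s t : R :=
  (A y (x + s) - A y x) - (A (y + t) (x + s) - A (y + t) x)
  + (B (x + s) (y + t) - B (x + s) y) - (B x (y + t) - B x y).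

Variables x0 y0 s0 t0 : R.
Hypothesis s0_gt0 : 0 < s0.
Hypothesis t0_gt0 : 0 < t0.
Let inr x y := x0 <= x /\ x <= x0 + s0 /\ y0 <= y /\ y <= y0 + t0.
Hypothesis dA : forall x y, inr x y -> is_derive x 1 (A y) (P y x).
Hypothesis dB : forall x y, inr x y -> is_derive y 1 (B x) (Q x y).

(** An affine form with the same cross coefficient [p2] in both components is exact, so its boundary
    integral vanishes. Subtracting its primitives leaves a remainder of size [eta] on sides of total
    length 2 (s + t). *)
Lemma bdry_affine x y s t xs ys p q p1 p2 q2 eta : 0 <= s -> 0 <= t ->
  inr x y -> inr (x + s) (y + t) ->
  (forall X Y, x <= X -> X <= x + s -> y <= Y -> Y <= y + t ->
     `|P Y X - p - p1 * (X - xs) - p2 * (Y - ys)| <= eta /\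
     `|Q X Y - q - p2 * (X - xs) - q2 * (Y - ys)| <= eta) ->
  `|bdry x y s t| <= 2 * eta * (s + t).
Proof.
move=> s_0 t_0 [i1 [i2 [i3 i4]]] [i5 [i6 [i7 i8]]] H.
have yt : y <= y + t by rewrite lerDl.
have xs' : x <= x + s by rewrite lerDl.
have inr' X Y : x <= X -> X <= x + s -> y <= Y -> Y <= y + t -> inr X Y.
  by move=> h1 h2 h3 h4; rewrite /inr; repeat split; lra.
have hA Y : y <= Y -> Y <= y + t ->
  `|(A Y (x + s) - (p * (x + s) + p1 * ((x + s - xs) ^+ 2 / 2) + p2 * (Y - ys) * (x + s)))
   - (A Y x - (p * x + p1 * ((x - xs) ^+ 2 / 2) + p2 * (Y - ys) * x))| <= eta * (x + s) - eta * x.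
  move=> h1 h2.
  apply: (@MVT_bound R (fun X => A Y X - (p * X + p1 * ((X - xs) ^+ 2 / 2) + p2 * (Y - ys) * X))
     (fun X => P Y X - (p + p1 * (X - xs) + p2 * (Y - ys))) (fun X => eta * X) (fun=> eta)) => //.
  - move=> X; rewrite in_itv /= => /andP[X1 X2]; have h := dA (inr' X Y X1 X2 h1 h2).
    by apply: is_derive_eq; rewrite /GRing.scale /=; field.
  - by move=> X _; apply: is_derive_eq; rewrite /GRing.scale /= mulr1.
  - move=> X; rewrite in_itv /= => /andP[X1 X2]; have [h _] := H X Y X1 X2 h1 h2.
    by rewrite !opprD !addrA.
have hB X : x <= X -> X <= x + s ->
  `|(B X (y + t) - (q * (y + t) + q2 * ((y + t - ys) ^+ 2 / 2) + p2 * (X - xs) * (y + t)))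
   - (B X y - (q * y + q2 * ((y - ys) ^+ 2 / 2) + p2 * (X - xs) * y))| <= eta * (y + t) - eta * y.
  move=> h1 h2.
  apply: (@MVT_bound R (fun Y => B X Y - (q * Y + q2 * ((Y - ys) ^+ 2 / 2) + p2 * (X - xs) * Y))
     (fun Y => Q X Y - (q + q2 * (Y - ys) + p2 * (X - xs))) (fun Y => eta * Y) (fun=> eta)) => //.
  - move=> Y; rewrite in_itv /= => /andP[Y1 Y2]; have h := dB (inr' X Y h1 h2 Y1 Y2).
    by apply: is_derive_eq; rewrite /GRing.scale /=; field.
  - by move=> Y _; apply: is_derive_eq; rewrite /GRing.scale /= mulr1.
  - move=> Y; rewrite in_itv /= => /andP[Y1 Y2]; have [_ h] := H X Y h1 h2 Y1 Y2.
    by rewrite (_ : _ - _ = Q X Y - q - p2 * (X - xs) - q2 * (Y - ys))//; ring.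
have := hA y (lexx _) yt; have := hA (y + t) yt (lexx _).
have := hB x (lexx _) xs'; have := hB (x + s) xs' (lexx _).
rewrite /bdry !ler_norml => /andP[a1 a2] /andP[a3 a4] /andP[a5 a6] /andP[a7 a8].
apply/andP; split; nra.
Qed.

Lemma bdry_quarter x y s t : exists x' y',
  [/\ x' = x \/ x' = x + s / 2, y' = y \/ y' = y + t / 2 &
   `|bdry x y s t| <= 4 * `|bdry x' y' (s / 2) (t / 2)|].
Proof.
apply: contrapT => H.
have K x' y' : (x' = x \/ x' = x + s / 2) -> (y' = y \/ y' = y + t / 2) ->
    4 * `|bdry x' y' (s / 2) (t / 2)| < `|bdry x y s t|.
  by move=> h1 h2; rewrite ltNge; apply/negP => h3; apply: H; exists x', y'.
have := K _ _ (or_introl erefl) (or_introl erefl); have := K _ _ (or_introl erefl) (or_intror erefl).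
have := K _ _ (or_intror erefl) (or_introl erefl); have := K _ _ (or_intror erefl) (or_intror erefl).
have E : bdry x y s t = bdry x y (s / 2) (t / 2) + bdry x (y + t / 2) (s / 2) (t / 2)
    + bdry (x + s / 2) y (s / 2) (t / 2) + bdry (x + s / 2) (y + t / 2) (s / 2) (t / 2).
  rewrite /bdry; have -> : x + s / 2 + s / 2 = x + s by field.
  by have -> : y + t / 2 + t / 2 = y + t; [field|ring].
have := ler_normD (bdry x y (s / 2) (t / 2) + bdry x (y + t / 2) (s / 2) (t / 2)
    + bdry (x + s / 2) y (s / 2) (t / 2)) (bdry (x + s / 2) (y + t / 2) (s / 2) (t / 2)).
have := ler_normD (bdry x y (s / 2) (t / 2) + bdry x (y + t / 2) (s / 2) (t / 2)) (bdry (x + s / 2) y (s / 2) (t / 2)).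
have := ler_normD (bdry x y (s / 2) (t / 2)) (bdry x (y + t / 2) (s / 2) (t / 2)).
rewrite -E; lra.
Qed.

Hypothesis D : forall xs ys, inr xs ys -> exists p1 p2 q2 : R, forall e, 0 < e ->
  exists2 r : R, 0 < r & forall X Y, `|X - xs| <= r -> `|Y - ys| <= r ->
    `|P Y X - P ys xs - p1 * (X - xs) - p2 * (Y - ys)| <= e * (`|X - xs| + `|Y - ys|) /\
    `|Q X Y - Q xs ys - p2 * (X - xs) - q2 * (Y - ys)| <= e * (`|X - xs| + `|Y - ys|).

(** Repeated quartering keeps at least the fraction 4^{-k} of the boundary integral on nested
    rectangles. At their common point the form is closed to first order, and [bdry_affine] makes
    that boundary integral o(4^{-k}). *)
Lemma goursat : bdry x0 y0 s0 t0 = 0.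
Proof.
pose h k : R := (2 ^+ k)^-1.
have hS k : h k.+1 = h k / 2 by rewrite /h exprS invfM mulrC.
have h_gt0 k : 0 < h k by rewrite invr_gt0 exprn_gt0.
have /choice[nx Hnx] : forall v : R * R * nat, exists v' : R * R,
   [/\ v'.1 = v.1.1 \/ v'.1 = v.1.1 + s0 * h v.2.+1, v'.2 = v.1.2 \/ v'.2 = v.1.2 + t0 * h v.2.+1 &
   `|bdry v.1.1 v.1.2 (s0 * h v.2) (t0 * h v.2)| <= 4 * `|bdry v'.1 v'.2 (s0 * h v.2.+1) (t0 * h v.2.+1)|].
  move=> [[x y] k] /=; have [x' [y' H]] := bdry_quarter x y (s0 * h k) (t0 * h k).
  by exists (x', y') => /=; move: H; rewrite !hS !mulrA.
pose v := fix v k := if k is k'.+1 then nx (v k', k') else (x0, y0).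
have vx k : (v k).1 <= (v k.+1).1 /\ (v k.+1).1 + s0 * h k.+1 <= (v k).1 + s0 * h k.
  have [/= H _ _] := Hnx (v k, k); have := mulr_gt0 s0_gt0 (h_gt0 k).
  by move: H; rewrite -[nx _]/(v k.+1) hS => -[|] -> hh; split; lra.
have vy k : (v k).2 <= (v k.+1).2 /\ (v k.+1).2 + t0 * h k.+1 <= (v k).2 + t0 * h k.
  have [/= _ H _] := Hnx (v k, k); have := mulr_gt0 t0_gt0 (h_gt0 k).
  by move: H; rewrite -[nx _]/(v k.+1) hS => -[|] -> hh; split; lra.
have vb k : `|bdry x0 y0 s0 t0| <= 4 ^+ k * `|bdry (v k).1 (v k).2 (s0 * h k) (t0 * h k)|.
  elim: k => [|k IH]; first by rewrite expr0 mul1r /h expr0 invr1 !mulr1.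
  have [/= _ _ H] := Hnx (v k, k); apply: le_trans IH _.
  by rewrite exprSr -mulrA ler_pM2l ?exprn_gt0.
have nest (w : nat -> R) c : 0 < c -> (forall k, w k <= w k.+1 /\ w k.+1 + c * h k.+1 <= w k + c * h k) ->
    exists ws : R, forall k, w k <= ws /\ ws <= w k + c * h k.
  move=> c0 W.
  have mono i j : w i <= w (i + j)%N.
    by elim: j => [|j IH]; rewrite ?addn0// addnS (le_trans IH)//; have [] := W (i + j)%N.
  have mono' i j : w (i + j)%N + c * h (i + j)%N <= w i + c * h i.
    by elim: j => [|j IH]; rewrite ?addn0// addnS; apply: le_trans IH; have [] := W (i + j)%N.
  have ub i j : w i <= w j + c * h j.
    apply: le_trans (mono i j) _; apply: le_trans (_ : w (i + j)%N + c * h (i + j)%N <= _).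
      by rewrite lerDl ltW// mulr_gt0.
    by rewrite addnC mono'.
  exists (sup (range w)) => k; split.
    apply: ub_le_sup; last by exists k.
    by exists (w 0%N + c * h 0%N) => _ [i _ <-]; exact: ub.
  by apply: ge_sup; [exists (w 0%N), 0%N|move=> _ [i _ <-]; exact: ub].
have [xs Hx] := nest _ _ s0_gt0 vx; have [ys Hy] := nest _ _ t0_gt0 vy.
have h0 : h 0%N = 1 by rewrite /h expr0 invr1.
have hd k : h k <= 1 by rewrite /h invf_le1 ?exprn_gt0// exprn_ege1// ler1n.
have vin k : inr (v k).1 (v k).2 /\ inr ((v k).1 + s0 * h k) ((v k).2 + t0 * h k).
  have L : x0 <= (v k).1 /\ (v k).1 + s0 * h k <= x0 + s0 /\ y0 <= (v k).2 /\ (v k).2 + t0 * h k <= y0 + t0.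
    elim: k => [|k [l1 [l2 [l3 l4]]]] /=; first by rewrite h0 !mulr1; repeat split.
    have [a1 a2] := vx k; have [a3 a4] := vy k; rewrite -[nx _]/(v k.+1); repeat split; lra.
  have := mulr_gt0 s0_gt0 (h_gt0 k); have := mulr_gt0 t0_gt0 (h_gt0 k).
  by move: L => [l1 [l2 [l3 l4]]] g1 g2; rewrite /inr; split; repeat split; lra.
have sin : inr xs ys.
  have [/= a1 a2] := Hx 0%N; have [/= a3 a4] := Hy 0%N; rewrite h0 !mulr1 in a2 a4.
  by rewrite /inr.
have [p1 [p2 [q2 Dq]]] := D sin.
have st0 : 0 < s0 + t0 by rewrite addr_gt0.
apply/eqP; rewrite -normr_le0; apply/ler_addgt0Pr => e e0; rewrite add0r.
(* Chosen so that the factor 4^k times the estimate 2 e' (s0 + t0)^2 4^{-k} equals e. *)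
pose e' := e / (2 * (s0 + t0) ^+ 2).
have e'0 : 0 < e' by rewrite divr_gt0// mulr_gt0// exprn_gt0.
have [r r0 Hr] := Dq e' e'0.
have [k hk] : exists k, (s0 + t0) * h k <= r.
  exists (Num.bound ((s0 + t0) / r)); rewrite ler_pdivrMr ?exprn_gt0// mulrC -ler_pdivrMr//.
  apply: le_trans (ltW (archi_boundP (ltW (divr_gt0 st0 r0)))) _.
  by rewrite -natrX ler_nat ltnW// ltn_expl.
have [v1 v2] := vin k; have [x1 x2] := Hx k; have [y1 y2] := Hy k.
have hs := mulr_gt0 s0_gt0 (h_gt0 k); have ht := mulr_gt0 t0_gt0 (h_gt0 k).
rewrite mulrDl in hk.
apply: le_trans (vb k) _.
apply: le_trans (_ : 4 ^+ k * (2 * (e' * (s0 * h k + t0 * h k)) * (s0 * h k + t0 * h k)) <= _).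
  rewrite ler_pM2l ?exprn_gt0//.
  apply: (@bdry_affine _ _ _ _ xs ys (P ys xs) (Q xs ys) p1 p2 q2); rewrite ?(ltW hs) ?(ltW ht)//.
  move=> X Y X1 X2 Y1 Y2.
  have eX : `|X - xs| <= s0 * h k by rewrite ler_norml; apply/andP; clear -X1 X2 x1 x2; split; lra.
  have eY : `|Y - ys| <= t0 * h k by rewrite ler_norml; apply/andP; clear -Y1 Y2 y1 y2; split; lra.
  have [b1 b2] : `|P Y X - P ys xs - p1 * (X - xs) - p2 * (Y - ys)| <= e' * (`|X - xs| + `|Y - ys|) /\
    `|Q X Y - Q xs ys - p2 * (X - xs) - q2 * (Y - ys)| <= e' * (`|X - xs| + `|Y - ys|) by apply: Hr; lra.
  have le : e' * (`|X - xs| + `|Y - ys|) <= e' * (s0 * h k + t0 * h k) by rewrite ler_pM2l// lerD.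
  by split; exact: le_trans le.
have E4 : 4 ^+ k * (h k * h k) = 1.
  by rewrite /h -invfM -exprMn (_ : 2 * 2 = 4 :> R) ?mulfV ?expf_neq0//; rewrite -natrM.
rewrite (_ : 4 ^+ k * _ = (4 ^+ k * (h k * h k)) * (2 * (s0 + t0) ^+ 2 * e')); last by ring.
by rewrite E4 mul1r /e' mulrC divfK// gt_eqF// mulr_gt0// exprn_gt0.
Qed.

End Rectangle.
End RealGoursat.

(** * Complex derivatives and means over circles *)

Section ComplexDerivative.
Context {R : realType}.
Local Notation C := R[i].
Local Notation Re := (@complex.Re R).
Local Notation Im := (@complex.Im R).
Implicit Types (F G : C -> C) (x y d h : C).

(** Tolerances and radii are real, in contrast with the derivative of the normed module [R[i]],
    whose norm is [R[i]]-valued. *)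
Definition cder F x d := forall e : R, 0 < e ->
  exists2 r : R, 0 < r & forall h, normc h <= r -> normc (F (x + h) - F x - d * h) <= e * normc h.

Lemma cder_lip F x d : cder F x d -> exists2 r : R, 0 < r &
  forall h, normc h <= r -> normc (F (x + h) - F x) <= (normc d + 1) * normc h.
Proof.
move=> /(_ 1 ltr01)[r r0 hr]; exists r => // h /hr.
rewrite mul1r => H; rewrite -[F (x + h) - F x](subrK (d * h)); apply: le_trans (le_normcD _ _) _.
rewrite normcM mulrDl mul1r; lra.
Qed.

Lemma cder_cont F x d : cder F x d -> forall e : R, 0 < e -> exists2 r : R, 0 < r &
  forall h, normc h <= r -> normc (F (x + h) - F x) <= e.
Proof.
move=> /cder_lip[r r0 hr] e e0; have c0 : 0 < normc d + 1 by rewrite ltr_wpDl ?normc_ge0.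
exists (Num.min r (e / (normc d + 1))); first by rewrite lt_min r0 divr_gt0.
move=> h; rewrite le_min => /andP[h1 h2]; apply: le_trans (hr h h1) _.
by rewrite mulrC -ler_pdivlMr.
Qed.

Lemma cderB F x d c : cder F x d -> cder (fun y => F y - c) x d.
Proof.
move=> H e e0; have [r r0 hr] := H e e0; exists r => // h /hr.
by rewrite (_ : F (x + h) - c - (F x - c) = F (x + h) - F x)//; ring.
Qed.

Lemma cderZ F x d c : cder F x d -> cder (fun y => c * F y) x (c * d).
Proof.
move=> H e e0; have c0 : 0 < normc c + 1 by rewrite ltr_wpDl ?normc_ge0.
have [r r0 hr] := H (e / (normc c + 1)) (divr_gt0 e0 c0); exists r => // h /hr hh.
rewrite (_ : _ - _ = c * (F (x + h) - F x - d * h)); last by ring.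
rewrite normcM; apply: le_trans (_ : (normc c + 1) * (e / (normc c + 1) * normc h) <= _).
  by apply: ler_pM; rewrite ?normc_ge0 ?lerDl.
by rewrite mulrA [_ * (e / _)]mulrC divfK// gt_eqF.
Qed.

Lemma cderM F G x d d' : cder F x d -> cder G x d' -> cder (fun y => F y * G y) x (d * G x + F x * d').
Proof.
move=> hF hG e e0.
pose M := normc (G x) + 1 + normc d + normc (F x) + 1.
have M0 : 0 < M by have := normc_ge0 (G x); have := normc_ge0 d; have := normc_ge0 (F x); rewrite /M; lra.
have eM : 0 < e / M by rewrite divr_gt0.
have [r1 r10 h1] := hF _ eM; have [r2 r20 h2] := hG _ eM.
have [r3 r30 h3] := cder_cont hG eM; have [r4 r40 h4] := cder_cont hG ltr01.
exists (Num.min (Num.min r1 r2) (Num.min r3 r4)); first by rewrite !lt_min r10 r20 r30.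
move=> h; rewrite !le_min => /andP[/andP[/h1 a1 /h2 a2] /andP[/h3 a3 /h4 a4]].
set f1 := F (x + h) in a1 *; set g1 := G (x + h) in a2 a3 a4 *.
move: (F x) (G x) @M M0 eM f1 g1 a1 a2 a3 a4 {h1 h2 h3 h4} => f g M M0 eM f1 g1 a1 a2 a3 a4.
rewrite (_ : _ - _ = (f1 - f - d * h) * g1 + (d * h * (g1 - g) + f * (g1 - g - d' * h))); last by ring.
have b1 : normc g1 <= normc g + 1.
  by rewrite -[g1](subrK g); apply: le_trans (le_normcD _ _) _; rewrite addrC lerD2l.
have nh := normc_ge0 h.
apply: le_trans (_ : e / M * normc h * (normc g + 1) + (normc d * normc h * (e / M) + normc f * (e / M * normc h)) <= _).
  apply: le_trans (le_normcD _ _) _; apply: lerD.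
    by rewrite normcM; apply: ler_pM; rewrite ?normc_ge0.
  apply: le_trans (le_normcD _ _) _; apply: lerD; rewrite normcM.
    by rewrite normcM; apply: ler_pM; rewrite ?mulr_ge0 ?normc_ge0.
  by rewrite ler_wpM2l ?normc_ge0.
rewrite (_ : _ + _ = (e / M * normc h) * (M - 1)); last by rewrite /M; ring.
rewrite [leRHS](_ : _ = (e / M * normc h) * M); last by rewrite mulrAC divfK// gt_eqF.
by rewrite (ler_wpM2l (mulr_ge0 (ltW eM) nh))// gerBl.
Qed.

Lemma cder_comp F G x d d' : cder F (G x) d -> cder G x d' -> cder (fun y => F (G y)) x (d * d').
Proof.
move=> hF hG e e0.
have nd := normc_ge0 d; have nd' := normc_ge0 d'.
pose M := normc d' + 1 + normc d + 1.
have M0 : 0 < M by rewrite /M; lra.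
have eM : 0 < e / M by rewrite divr_gt0.
have [r1 r10 h1] := hF _ eM; have [r2 r20 h2] := hG _ eM.
have [r3 r30 h3] := cder_cont hG r10; have [r4 r40 h4] := cder_lip hG.
exists (Num.min r2 (Num.min r3 r4)); first by rewrite !lt_min r20 r30.
move=> h; rewrite !le_min => /andP[/h2 a2 /andP[/h3 /h1 a3 /h4 a4]].
move: a3; rewrite [G x + _]addrC subrK => a3.
set f1 := F (G (x + h)) in a3 *; set g1 := G (x + h) in a2 a3 a4 *.
set f := F (G x) in a3 *; set g := G x in a2 a3 a4 *.
rewrite (_ : _ - _ = (f1 - f - d * (g1 - g)) + d * (g1 - g - d' * h)); last by ring.
apply: le_trans (le_normcD _ _) _; rewrite normcM.
have nh := normc_ge0 h.
apply: le_trans (_ : e / M * ((normc d' + 1) * normc h) + normc d * (e / M * normc h) <= _).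
  apply: lerD; last by rewrite ler_wpM2l.
  by apply: le_trans a3 _; rewrite ler_wpM2l// ltW.
rewrite (_ : _ + _ = (e / M * normc h) * (M - 1)); last by rewrite /M; ring.
rewrite [leRHS](_ : _ = (e / M * normc h) * M); last by rewrite mulrAC divfK// gt_eqF.
by rewrite (ler_wpM2l (mulr_ge0 (ltW eM) nh))// gerBl.
Qed.

Definition cexp x : C := (expR (Re x))%:C * (cos (Im x) +i* sin (Im x)).

Lemma cexpD x y : cexp (x + y) = cexp x * cexp y.
Proof. by rewrite /cexp cReD cImD expRD -cisD rmorphM /=; ring. Qed.

Lemma cexp0 : cexp 0 = 1.
Proof. by rewrite /cexp /= expR0 cos0 sin0; apply: complex_eqP => /=; ring. Qed.

Lemma cexpN x : cexp x * cexp (- x) = 1.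
Proof. by rewrite -cexpD subrr cexp0. Qed.

Lemma normc_cexp x : normc (cexp x) = expR (Re x).
Proof. by rewrite normcM normc_cis normc_real mulr1 ger0_norm ?expR_ge0. Qed.

Lemma cder_cexp0 : cder cexp 0 1.
Proof.
move=> e e0; have e5 : 0 < Num.min 1 (e / 8) by rewrite lt_min ltr01 divr_gt0.
have [r1 r10 h1] := (is_derive_epsP _ _ _).1 (is_derive_expR (0 : R)) _ e5.
have [r2 r20 h2] := (is_derive_epsP _ _ _).1 (is_derive_cos (0 : R)) _ e5.
have [r3 r30 h3] := (is_derive_epsP _ _ _).1 (is_derive_sin (0 : R)) _ e5.
exists (Num.min (Num.min r1 r2) (Num.min r3 (Num.min 1 (e / 8)))); first by rewrite !lt_min r10 r20 r30 ltr01 divr_gt0.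
move=> h; have nRe := abs_Re_le h; have nIm := abs_Im_le h.
rewrite !le_min => /andP[/andP[a1 a2] /andP[a3 /andP[a4 a5]]].
have := h1 _ (le_trans nRe a1); have := h2 _ (le_trans nIm a2); have := h3 _ (le_trans nIm a3).
rewrite !add0r expR0 cos0 sin0 oppr0 mul0r !subr0 !addr0 !mul1r.
set X := Re h in nRe *; set Y := Im h in nIm *; set m := Num.min 1 (e / 8) => b3 b2 b1.
have m1 : m <= 1 by rewrite ge_min lexx.
have m8 : m <= e / 8 by rewrite ge_min lexx orbT.
have nh := normc_ge0 h.
have mh (k : R) : `|k| <= normc h -> m * `|k| <= e / 8 * normc h by move=> kh; apply: ler_pM; rewrite ?(ltW e5).
have E : cexp h - cexp 0 - h = ((expR X - 1 - X) * cos Y + (1 + X) * (cos Y - 1)) +i*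
    ((expR X - 1 - X) * sin Y + X * sin Y + (sin Y - Y)).
  by rewrite /X /Y; case: (h) => a b; rewrite cexp0 /cexp; apply: complex_eqP => /=; ring.
rewrite E; apply: le_trans (normc_le_ReIm _) _ => /=.
have cY : `|cos Y| <= 1 by rewrite ler_norml cos_geN1 cos_le1.
have sY : `|sin Y| <= 1 by rewrite ler_norml sin_geN1 sin_le1.
have q1 : `|expR X - 1 - X| <= e / 8 * normc h by apply: le_trans b1 (mh _ nRe).
have q2 : `|cos Y - 1| <= e / 8 * normc h by apply: le_trans b2 (mh _ nIm).
have q3 : `|sin Y - Y| <= e / 8 * normc h by apply: le_trans b3 (mh _ nIm).
have q4 : `|sin Y| <= 2 * normc h.
  rewrite -[sin Y](subrK Y); apply: le_trans (ler_normD _ _) _.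
  have : m * `|Y| <= 1 * normc h by apply: ler_pM; rewrite ?(ltW e5).
  by move: b3 nIm; lra.
have X1 : `|1 + X| <= 2 by apply: le_trans (ler_normD _ _) _; rewrite normr1; move: nRe a4; lra.
have q5 : `|X * sin Y| <= e / 8 * (2 * normc h).
  by rewrite normrM; apply: ler_pM => //; apply: le_trans a5.
have q6 : `|(expR X - 1 - X) * cos Y| <= e / 8 * normc h * 1 by rewrite normrM; apply: ler_pM.
have q7 : `|(expR X - 1 - X) * sin Y| <= e / 8 * normc h * 1 by rewrite normrM; apply: ler_pM.
have q8 : `|(1 + X) * (cos Y - 1)| <= 2 * (e / 8 * normc h) by rewrite normrM; apply: ler_pM.
have := ler_normD ((expR X - 1 - X) * cos Y) ((1 + X) * (cos Y - 1)).
have := ler_normD ((expR X - 1 - X) * sin Y + X * sin Y) (sin Y - Y).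
have := ler_normD ((expR X - 1 - X) * sin Y) (X * sin Y).
have k0 : 0 <= e / 8 * normc h by rewrite mulr_ge0// ltW// divr_gt0.
have -> : e * normc h = 8 * (e / 8 * normc h) by field.
move: k0 q3 q5 q6 q7 q8; rewrite !mulr1 [e / 8 * (2 * _)]mulrCA; move: (e / 8 * normc h) => k; lra.
Qed.

Lemma cder_cexp x : cder cexp x (cexp x).
Proof.
have H := cderZ (cexp x) cder_cexp0.
move=> e e0; have [r r0 hr] := H e e0; exists r => // h /hr.
by rewrite add0r cexp0 cexpD !mulr1.
Qed.

Lemma cder_cexpN x : cder (fun y => cexp (- y)) x (- cexp (- x)).
Proof.
rewrite -mulrN1; apply: (@cder_comp cexp -%R); first exact: cder_cexp.
by move=> e e0; exists 1 => // h _; rewrite (_ : _ - _ = 0) ?normc0 ?mulr_ge0 ?normc_ge0 ?ltW//; ring.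
Qed.

Section CircleMean.
Variables (F : C -> C) (d0 : C) (X : R).
Hypothesis F0 : cder F 0 d0.
Hypothesis F1 : forall x, normc x < expR X -> exists d, cder F x d.

(** The difference quotient (F(zeta) - F(0))/zeta in the logarithmic coordinate zeta = cexp x:
    circles about 0 become vertical segments of length 2 pi, and annuli become rectangles. *)
Definition logq (x : C) : C := (F (cexp x) - F 0) * cexp (- x).

Lemma cder_logq (x : C) : Re x < X -> exists d, cder logq x d.
Proof.
move=> xX; have hx : normc (cexp x) < expR X by rewrite normc_cexp ltr_expR.
have [d hd] := F1 hx; by eexists; apply: cderM (cder_cexpN x); apply: cderB; apply: cder_comp (cder_cexp x); exact: hd.
Qed.

Lemma logq_near0 (e : R) : 0 < e -> exists r : R, forall x, Re x <= r -> normc (logq x - d0) <= e.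
Proof.
move=> e0; have [r r0 hr] := F0 e0; exists (ln r) => x xr.
have n0 : 0 < normc (cexp x) by rewrite normc_cexp expR_gt0.
have hx : normc (cexp x) <= r by rewrite normc_cexp -(lnK r0) ler_expR.
have := hr _ hx; rewrite add0r => H.
rewrite -(ler_pM2r n0) -normcM /logq mulrBl -mulrA [cexp (- x) * _]mulrC cexpN mulr1.
exact: H.
Qed.

Lemma logq_cont_y (s y : R) : s < X -> {for y, continuous (fun y : R => Re (logq (s +i* y)))}.
Proof.
move=> sX; have [d hd] := @cder_logq (s +i* y) sX.
apply/cvgrPdist_le => e e0; have [r r0 hr] := cder_cont hd e0.
apply/nbhs_ballP; exists r; first exact: r0.
move=> t /=; rewrite distrC => /ltW ht.
rewrite distrC -cReN -cReD; apply: le_trans (abs_Re_le _) _.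
have E : s +i* t = (s +i* y) + (0 +i* (t - y)) by apply: complex_eqP => /=; ring.
rewrite E; apply: hr; apply: le_trans (normc_le_ReIm _) _.
by rewrite /= normr0 add0r.
Qed.

Lemma logq_cont_x (y s : R) : s < X -> {for s, continuous (fun s : R => Im (logq (s +i* y)))}.
Proof.
move=> sX; have [d hd] := @cder_logq (s +i* y) sX.
apply/cvgrPdist_le => e e0; have [r r0 hr] := cder_cont hd e0.
apply/nbhs_ballP; exists r; first exact: r0.
move=> t /=; rewrite distrC => /ltW ht.
rewrite distrC -cImN -cImD; apply: le_trans (abs_Im_le _) _.
have E : t +i* y = (s +i* y) + (t - s)%:C by apply: complex_eqP => /=; ring.
by rewrite E; apply: hr; rewrite normc_real.
Qed.

Lemma logq_periodic (s : R) : logq (s +i* (pi *+ 2)) = logq (s +i* 0).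
Proof.
have E a : cexp (a +i* (pi *+ 2)) = cexp (a +i* 0) by rewrite /cexp /= cos2pi sin2pi cos0 sin0.
have E' a : cexp (- (a +i* (pi *+ 2))) = cexp (- (a +i* 0)).
  by rewrite /cexp /= cosN sinN cos2pi sin2pi oppr0 cos0 sin0.
by rewrite /logq E E'.
Qed.

(** Cauchy's formula for the derivative at the centre. By [goursat] and periodicity the integral
    over a vertical side does not depend on its abscissa, and far to the left the quotient is close
    to [d0]. Any primitive [U] along the side expresses the integral. *)
Lemma circle_mean_Re (s1 : R) (U : R -> R) : s1 < X ->
  (forall y : R, 0 <= y -> y <= pi *+ 2 -> is_derive y 1 U (Re (logq (s1 +i* y)))) ->
  U (pi *+ 2) - U 0 = Re d0 * (pi *+ 2).
Proof.
move=> s1X dU.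
have [u [pi2 per uE]] : exists u : R, [/\ 0 < u, forall s : R, logq (s +i* u) = logq (s +i* 0) & pi *+ 2 = u].
  by exists (pi *+ 2); split => //; [rewrite mulrn_wgt0// pi_gt0|exact: logq_periodic].
rewrite uE; rewrite uE in dU.
have /choice[B HB] : forall s : R, exists B : R -> R, s < X -> forall y : R, -1 < y -> y < u + 1 ->
    is_derive y 1 B (Re (logq (s +i* y))).
  move=> s.
  have [sX|sX] := ltrP s X; last by exists (fun=> 0).
  have lt : -1 < u + 1 by lra.
  have [B HB] := primitive_exists lt (fun (y : R) _ _ => @logq_cont_y s y sX).
  by exists B.
apply/eqP; rewrite -subr_eq0 -normr_le0; apply/ler_addgt0Pr => e e0; rewrite add0r.
have e1 : 0 < e / u by rewrite divr_gt0.
have [r hr] := logq_near0 e1.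
(* An abscissa so far to the left that the quotient is within e/u, that is e/(2 pi), of [d0]. *)
pose s0 := Num.min r (s1 - 1).
have s01 : s0 < s1 by rewrite gt_min; apply/orP; right; lra.
have E1 : `|(U u - B s1 u) - (U 0 - B s1 0)| <= 0 - 0.
  apply: (@MVT_bound R (fun y : R => U y - B s1 y) (fun=> 0) (fun=> 0) (fun=> 0) 0 u); first exact: ltW.
  - move=> y; rewrite in_itv /= => /andP[y1 y2]; have h1 := dU y y1 y2.
    have h2 : is_derive y 1 (B s1) (Re (logq (s1 +i* y))) by apply: HB => //; lra.
    by apply: is_derive_eq; rewrite subrr.
  - by move=> y _; rewrite normr0.
have E2 : `|(B s0 u - Re d0 * u) - (B s0 0 - Re d0 * 0)| <= e / u * u - e / u * 0.
  apply: (@MVT_bound R (fun y : R => B s0 y - Re d0 * y) (fun y : R => Re (logq (s0 +i* y)) - Re d0)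
     (fun y : R => e / u * y) (fun=> e / u) 0 u); first exact: ltW.
  - move=> y; rewrite in_itv /= => /andP[y1 y2].
    have h2 : is_derive y 1 (B s0) (Re (logq (s0 +i* y))) by apply: HB => //; lra.
    by apply: is_derive_eq; rewrite /GRing.scale /=; ring.
  - by move=> y _; apply: is_derive_eq; rewrite /GRing.scale /= mulr1.
  - move=> y _; rewrite -cReN -cReD; apply: le_trans (abs_Re_le _) _; apply: hr.
    by rewrite /= ge_min lexx.
pose X' := (s1 + X) / 2.
have /choice[A HA] : forall y : R, exists A : R -> R, forall s : R, s0 - 1 < s -> s < X' ->
    is_derive s 1 A (Im (logq (s +i* y))).
  move=> y.
  have lt : s0 - 1 < X' by rewrite /X'; lra.
  have cc s : s0 - 1 <= s -> s <= X' -> {for s, continuous (fun s : R => Im (logq (s +i* y)))}.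
    by move=> _ sX; apply: logq_cont_x; rewrite /X' in sX; lra.
  have [A HA] := primitive_exists lt cc.
  by exists A.
have sX s : s <= s1 -> s < X' by rewrite /X'; lra.
have E3 : `|(A 0 s1 - A u s1) - (A 0 s0 - A u s0)| <= 0 - 0.
  apply: (@MVT_bound R (fun s => A 0 s - A u s) (fun=> 0) (fun=> 0) (fun=> 0) s0 s1); first exact: ltW.
  - move=> s; rewrite in_itv /= => /andP[y1 y2].
    have h1 : is_derive s 1 (A 0) (Im (logq (s +i* 0))) by apply: HA; [lra|exact: sX].
    have h2 : is_derive s 1 (A u) (Im (logq (s +i* u))) by apply: HA; [lra|exact: sX].
    by apply: is_derive_eq; rewrite per subrr.
  - by move=> y _; rewrite normr0.
(* The form is the imaginary part of logq dx, namely Im(logq) ds + Re(logq) dy; the Cauchy-Riemann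
   equations give its linearization a common cross coefficient. *)
have G : bdry A B s0 0 (s1 - s0) u = 0.
  apply: (@goursat R A B (fun y s : R => Im (logq (s +i* y))) (fun s y : R => Re (logq (s +i* y)))) => //.
  - by rewrite subr_gt0.
  - by move=> s y [i1 [i2 _]]; apply: HA; [lra|apply: sX; lra].
  - by move=> s y [i1 [i2 [i3 i4]]]; apply: HB; rewrite ?add0r in i4 *; lra.
  - move=> s y [i1 [i2 _]]; have sX' : s < X by move: s1X i2; lra.
    have [d hd] := @cder_logq (s +i* y) sX'.
    exists (Im d), (Re d), (- Im d) => e' e'0; have [q q0 hq] := hd _ e'0.
    exists (q / 2); first by rewrite divr_gt0.
    move=> S Y hS hY; pose h := (S - s) +i* (Y - y).
    have nh : normc h <= `|S - s| + `|Y - y| by exact: normc_le_ReIm.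
    have hh : normc h <= q by apply: le_trans nh _; move: hS hY; lra.
    have := hq _ hh; rewrite (_ : (s +i* y) + h = S +i* Y); last first.
      by apply: complex_eqP => /=; ring.
    move: (logq _) (logq _) => L1 L2 H.
    have le : e' * normc h <= e' * (`|S - s| + `|Y - y|) by rewrite ler_pM2l.
    split; apply: le_trans le; apply: le_trans H.
      apply: le_trans (abs_Im_le _); rewrite !cImD !cImN cImM /= le_eqVlt; apply/orP; left.
      by apply/eqP; congr `|_|; ring.
    apply: le_trans (abs_Re_le _); rewrite !cReD !cReN cReM /= le_eqVlt; apply/orP; left.
    by apply/eqP; congr `|_|; ring.
move: G; rewrite /bdry add0r (_ : s0 + (s1 - s0) = s1); last by ring.
move: E2; rewrite divfK ?gt_eqF// !mulr0 !subr0.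
move: E1 E3; rewrite subr0 !normr_le0 => /eqP E1 /eqP E3 E2 G.
rewrite (_ : _ - _ = (B s0 u - Re d0 * u) - B s0 0)//.
move: E1 E3 G;  lra.
Qed.

End CircleMean.
End ComplexDerivative.

(** * Differentiable functions have continuous derivatives *)

Section Holo.
Context {R : realType} {n : nat}.
Local Notation C := R[i].
Local Notation V := 'rV[C]_n.
Local Notation Re := (@complex.Re R).
Local Notation Im := (@complex.Im R).
Implicit Types (f : V -> C) (z w v : V).

Lemma cder_diff f z v : differentiable (f : V -> C^o) z ->
  cder (fun x => f (z + x *: v)) 0 ('d (f : V -> C^o) z v).
Proof.
move=> df; have dv := diff_derivable (v := v) df; rewrite -(deriveE v df).
move: (dv : _ --> 'D_v (f : V -> C^o) z); set d := 'D_v _ _ => /cvgrPdist_le H e e0.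
have eC : 0 < e%:C by rewrite ltcE /= eqxx.
have /nbhs_ballP[r /= r0 hr] := H _ eC.
have rR : 0 < Re r by move: r0; rewrite ltcE/= => /andP[_].
exists (Re r / 2); first by rewrite divr_gt0.
move=> h hh; have [->|h0] := eqVneq h 0.
  by rewrite addr0 subrr mulr0 subr0 normc0 mulr0.
have hb : ball (0 : C^o) r h.
  rewrite -ball_normE /ball_/= sub0r normrN normc_normE ltcE /=.
  move: r0; rewrite ltcE /= => /andP[/eqP-> _]; rewrite eqxx /=.
  by apply: le_lt_trans hh _; rewrite ltr_pdivrMr// ltr_pMr// ltr1n.
have := hr h hb h0; rewrite normc_normE lecE /= => /andP[_].
rewrite scale0r addr0 add0r [h *: v + z]addrC => le.
rewrite (_ : _ - d * h = - ((d - h^-1 * (f (z + h *: v) - f z)) * h)).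
  by rewrite normc_opp normcM ler_wpM2r// normc_ge0.
by rewrite mulrBl mulrAC mulVf// mul1r; ring.
Qed.

Lemma cder_rder f z v d : cder (fun x => f (z + x *: v)) 0 d -> rder f v z d.
Proof.
move=> H; split; apply/is_derive_epsP => e e0; have [r r0 hr] := H e e0; exists r => // h hh;
  have := hr h%:C; rewrite !add0r normc_real => /(_ hh) le; apply: le_trans le.
  apply: le_trans (abs_Re_le _); rewrite !cReD !cReN cReM /= mulr0 subr0 scale0r.
  exact: lexx.
apply: le_trans (abs_Im_le _); rewrite !cImD !cImN cImM /= mulr0 add0r scale0r.
exact: lexx.
Qed.

Lemma differentiable_continuous_normc f z : differentiable (f : V -> C^o) z -> {for z, continuous f}.
Proof. by move=> df; exact: (differentiable_continuous df). Qed.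

Lemma contB_uniform f (r e : R) : contB f -> r < 1 -> 0 < e -> exists2 d : R, 0 < d &
  forall z w, sqnorm z <= r -> (forall j, normc (w 0 j - z 0 j) < d) -> normc (f w - f z) <= e.
Proof.
move=> cf r1 e0.
pose P (d : R) z := forall w, (forall j, normc (w 0 j - z 0 j) < d) -> normc (f w - f z) <= e.
have [|d d0 hd] := @closed_ball_uniform R n r P; last by exists d => // z w zr; exact: hd.
move=> z zr; have zB : cball z by apply: le_lt_trans r1.
have e2 : 0 < e / 2 by rewrite divr_gt0.
have [d d0 hd] := (continuousCP _ _).1 (cf z zB) _ e2.
exists (d / 2); first by rewrite divr_gt0.
move=> w e' wz _ e'0 e'd w' ww'.
have h1 : normc (f w - f z) < e / 2 by apply: hd => j; move: (wz j); lra.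
have h2 : normc (f w' - f z) < e / 2.
  apply: hd => j; rewrite -[w' 0 j](subrK (w 0 j)) -addrA; apply: le_lt_trans (le_normcD _ _) _.
  by move: (wz j) (ww' j); lra.
rewrite (_ : f w' - f w = (f w' - f z) + (f z - f w)); last by ring.
by apply: le_trans (le_normcD _ _) _; rewrite [normc (f z - _)]normc_sub; lra.
Qed.

(** Both derivatives are circle means, so their real parts differ by at most the difference of the
    quotients on a single circle. *)
Lemma circle_mean_bound (F G : C -> C) (d0 d1 : C) (X s1 e : R) : cder F 0 d0 -> cder G 0 d1 ->
  (forall x, normc x < expR X -> exists d, cder F x d) ->
  (forall x, normc x < expR X -> exists d, cder G x d) -> s1 < X ->
  (forall y : R, normc (logq F (s1 +i* y) - logq G (s1 +i* y)) <= e) ->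
  `|Re d0 - Re d1| <= e.
Proof.
move=> F0 G0 F1 G1 s1X H.
have u0 : 0 < (pi : R) *+ 2 by rewrite mulrn_wgt0// pi_gt0.
have lt : -1 < (pi : R) *+ 2 + 1 by lra.
have [U dU] := primitive_exists lt (fun (y : R) _ _ => @logq_cont_y R F X F1 s1 y s1X).
have [W dW] := primitive_exists lt (fun (y : R) _ _ => @logq_cont_y R G X G1 s1 y s1X).
have dU' (y : R) : 0 <= y -> y <= pi *+ 2 -> is_derive y 1 U (Re (logq F (s1 +i* y))) by move=> ? ?; apply: dU; lra.
have dW' (y : R) : 0 <= y -> y <= pi *+ 2 -> is_derive y 1 W (Re (logq G (s1 +i* y))) by move=> ? ?; apply: dW; lra.
have E1 := circle_mean_Re F0 F1 s1X dU'; have E2 := circle_mean_Re G0 G1 s1X dW'.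
have := @MVT_bound R (fun y : R => U y - W y) (fun y : R => Re (logq F (s1 +i* y)) - Re (logq G (s1 +i* y)))
   (fun y : R => e * y) (fun=> e) 0 (pi *+ 2) (ltW u0).
have -> : U (pi *+ 2) - W (pi *+ 2) - (U 0 - W 0) = (Re d0 - Re d1) * (pi *+ 2).
  by rewrite mulrBl -E1 -E2; ring.
rewrite normrM (gtr0_norm u0) mulr0 subr0 (ler_pM2r u0); apply.
- move=> y; rewrite in_itv /= => /andP[y1 y2]; have h1 := dU' y y1 y2; have h2 := dW' y y1 y2.
  exact: is_deriveB.
- by move=> y _; apply: is_derive_eq; rewrite /GRing.scale /= mulr1.
- by move=> y _; rewrite -cReN -cReD; apply: le_trans (abs_Re_le _) _.
Qed.

Lemma normc_sub_lt (p q : C) (e : R) : `|Re (1 * p) - Re (1 * q)| <= e / 4 ->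
  `|Re (- (0 +i* 1) * p) - Re (- (0 +i* 1) * q)| <= e / 4 -> 0 < e -> normc (p - q) < e.
Proof.
move=> h1 h2 e0; apply: le_lt_trans (normc_le_ReIm _) _; move: h1 h2.
case: p q => [a b] [c d] /=; rewrite !mul1r !mul0r !subr0 !oppr0 !mul0r !sub0r !mulN1r !opprK; lra.
Qed.

(** [holo] asks for pointwise differentiability. Each partial derivative is a mean of difference
    quotients of [f] over a circle of fixed radius, and uniform continuity of [f] makes this mean
    continuous in the centre. *)
Lemma hol_of_holo f : holo f -> hol f (fun j z => 'd (f : V -> C^o) z (delta_mx 0 j)).
Proof.
move=> hf; have cf : contB f by move=> z zB; apply: differentiable_continuous_normc; exact: hf.
have dline z v x : cball (z + x *: v) -> cder (fun x => f (z + x *: v)) x ('d (f : V -> C^o) (z + x *: v) v).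
  move=> B; have H := cder_diff v (hf _ B); move=> e e0; have [r r0 hr] := H e e0; exists r => // h /hr.
  by rewrite add0r scale0r addr0 scalerDl addrA.
split; [exact: cf| |]; last first.
  move=> z zB v; apply: cder_rder; have H := cder_diff v (hf z zB).
  rewrite (_ : \sum_j _ = 'd (f : V -> C^o) z v)//.
  rewrite [v in RHS](row_sum_delta v) raddf_sum; apply: eq_bigr => j _.
  exact: esym (linearZ_LR ('d (f : V -> C^o) z) (v 0 j) (delta_mx 0 j)).
move=> j z0 z0B; set a := fun z => _.
pose r := (1 + sqnorm z0) / 2.
have r01 : sqnorm z0 < r /\ r < 1 by move: z0B; rewrite /cball /= /r; lra.
have r0 : 0 < r - sqnorm z0 by rewrite subr_gt0; exact: r01.1.
have [d d0 hd] := (continuousRP _ _).1 (@continuous_sqnorm R n z0) _ r0.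
have d4 : 0 < d / 2 by rewrite divr_gt0.
pose X := ln (d / 2); have eX : expR X = d / 2 by rewrite lnK.
have inr w x : (forall i, normc (w 0 i - z0 0 i) < d / 2) -> normc x < d / 2 -> sqnorm (w + x *: delta_mx 0 j) <= r.
  move=> wz xd; have hw' : `|sqnorm (w + x *: delta_mx 0 j) - sqnorm z0| < r - sqnorm z0.
    apply: hd => i; rewrite !mxE eqxx /=.
    rewrite (_ : _ - _ = (w 0 i - z0 0 i) + x * (i == j)%:R); last by ring.
    apply: le_lt_trans (le_normcD _ _) _.
    have : normc (x * (i == j)%:R) <= normc x.
      by case: (i == j); rewrite ?mulr1// mulr0 normc0 normc_ge0.
    by move: (wz i); lra.
  by move: hw'; rewrite ltr_norml => /andP[_]; lra.
have F1 w : (forall i, normc (w 0 i - z0 0 i) < d / 2) -> forall x, normc x < expR X ->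
    exists d', cder (fun x => f (w + x *: delta_mx 0 j)) x d'.
  move=> wz x; rewrite eX => xd; eexists; apply: dline; rewrite /cball /=.
  by apply: le_lt_trans (inr w x wz xd) r01.2.
have F0 w : (forall i, normc (w 0 i - z0 0 i) < d / 2) -> cder (fun x => f (w + x *: delta_mx 0 j)) 0 (a w).
  move=> wz; apply: cder_diff; apply: hf; rewrite /cball /=; apply: le_lt_trans r01.2.
  by have := inr w 0 wz; rewrite normc0 scale0r addr0; exact.
have z0z i : normc (z0 0 i - z0 0 i) < d / 2 by rewrite subrr normc0.
apply/continuousCP => e e0.
(* The circle has radius exp(X - 1), strictly inside the disc of radius exp(X) = d/2 on which the
   complex lines stay in the ball. *)
pose s1 := X - 1.
have s1X : s1 < X by rewrite /s1 ltrBlDr ltrDl.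
have p0 : 0 < expR s1 by rewrite expR_gt0.
have e4 : 0 < e / 8 * expR s1 by rewrite mulr_gt0// divr_gt0.
have [d' d'0 hd'] := contB_uniform cf r01.2 e4.
exists (Num.min d' (d / 2)); first by rewrite lt_min d'0.
move=> w hw; have wd' i : normc (w 0 i - z0 0 i) < d' by have := hw i; rewrite lt_min => /andP[].
have wz i : normc (w 0 i - z0 0 i) < d / 2 by have := hw i; rewrite lt_min => /andP[].
pose F w x := f (w + x *: delta_mx 0 j).
have B (c : C) (y : R) : normc c = 1 ->
    normc (logq (fun x => c * F w x) (s1 +i* y) - logq (fun x => c * F z0 x) (s1 +i* y)) <= e / 4.
  move=> c1; rewrite /logq -mulrBl normcM normc_cexp /= expRN ler_pdivrMr//.
  have rg (b1 b2 b3 b4 : C) : c * b1 - c * b2 - (c * b3 - c * b4) = c * ((b1 - b3) - (b2 - b4)) by ring.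
  rewrite rg.
  rewrite normcM c1 mul1r; apply: le_trans (le_normcD _ _) _; rewrite normc_opp.
  have b1 x : normc x < d / 2 -> normc (F w x - F z0 x) <= e / 8 * expR s1.
    move=> xd; apply: hd'; first exact: inr.
    by move=> i; rewrite !mxE (_ : _ - _ = w 0 i - z0 0 i)//; ring.
  have x1 : normc (cexp (s1 +i* y)) < d / 2 by rewrite normc_cexp -eX ltr_expR.
  have x0 : normc (0 : C) < d / 2 by rewrite normc0.
  apply: le_trans (lerD (b1 _ x1) (b1 _ x0)) _.
  by rewrite -mulrDl (_ : e / 8 + e / 8 = e / 4)//; field.
have N1 : normc (1 : C) = 1 by rewrite normc1.
have Ni : normc (- (0 +i* 1) : C) = 1 by rewrite normc_opp normc_i.
have Z (c : C) w' : (forall i, normc (w' 0 i - z0 0 i) < d / 2) ->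
   cder (fun x => c * F w' x) 0 (c * a w') /\ forall x, normc x < expR X -> exists d', cder (fun x => c * F w' x) x d'.
  move=> wz'; split; first exact: cderZ (F0 w' wz').
  by move=> x xX; have [d1 hd1] := F1 w' wz' x xX; exists (c * d1); exact: cderZ.
have K c : normc c = 1 -> `|Re (c * a w) - Re (c * a z0)| <= e / 4.
  move=> c1; have [a1 a2] := Z c w wz; have [a3 a4] := Z c z0 z0z.
  by apply: (circle_mean_bound a1 a3 a2 a4 s1X) => y; exact: B.
(* The multipliers 1 and -i turn bounds on real parts into a bound on the modulus. *)
have k1 := K _ N1; have k2 := K _ Ni.
exact: normc_sub_lt k1 k2 e0.
Qed.

End Holo.

(** * Hoelder continuity from gradient growth *)

Section Holder.
Context {R : realType} {n : nat}.
Local Notation C := R[i].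
Local Notation V := 'rV[C]_n.
Local Notation Re := (@complex.Re R).
Local Notation Im := (@complex.Im R).
Implicit Types (g : V -> C) (z w v u : V).

Lemma rder_eps g v z d : (forall e : R, 0 < e -> exists2 r : R, 0 < r &
   forall t : R, `|t| <= r -> normc (g (z + t%:C *: v) - g z - t%:C * d) <= e * `|t|) -> rder g v z d.
Proof.
move=> H; split; apply/is_derive_epsP => e e0; have [r r0 hr] := H e e0; exists r => // t /hr le;
  rewrite add0r line0; apply: le_trans le.
  by apply: le_trans (abs_Re_le _); rewrite !cReD !cReN cReM /= mul0r subr0 mulrC.
by apply: le_trans (abs_Im_le _); rewrite !cImD !cImN cImM /= mul0r addr0 mulrC.
Qed.

Lemma epsP_rder g v z d : rder g v z d -> forall e : R, 0 < e -> exists2 r : R, 0 < r &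
   forall t : R, `|t| <= r -> normc (g (z + t%:C *: v) - g z - t%:C * d) <= e * `|t|.
Proof.
move=> [/is_derive_epsP h1 /is_derive_epsP h2] e e0.
have e2 : 0 < e / 2 by rewrite divr_gt0.
have [r1 r10 H1] := h1 _ e2; have [r2 r20 H2] := h2 _ e2.
exists (Num.min r1 r2); first by rewrite lt_min r10.
move=> t; rewrite le_min => /andP[/H1 a1 /H2 a2]; apply: le_trans (normc_le_ReIm _) _.
move: a1 a2; rewrite !add0r !line0 !cReD !cReN !cImD !cImN cReM cImM /= !mul0r subr0 addr0.
rewrite [Re d * t]mulrC [Im d * t]mulrC; lra.
Qed.

Lemma sub_affine_bound g (dg : V -> C) u x (c : C) (e t : R) :
  (forall s : R, `|s| <= `|t| -> rder g u (x + s%:C *: u) (dg (x + s%:C *: u))) ->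
  (forall s : R, `|s| <= `|t| -> normc (dg (x + s%:C *: u) - c) <= e) ->
  normc (g (x + t%:C *: u) - g x - t%:C * c) <= 2 * (e * `|t|).
Proof.
move=> hg hc.
pose F (s : R) := g (x + s%:C *: u) + - (s%:C * c).
have dF (s : R) : `|s| <= `|t| -> rdc F s (dg (x + s%:C *: u) - c).
  move=> st; have [h1 h2] := rder_line (hg s st).
  have E1 : (fun s => Re (F s)) = (fun s : R => Re (g (x + s%:C *: u))) - Re c *: id.
    by apply/funext => y; rewrite [RHS]/(Re _ - Re c * y) /F cReD cReN cReM /= mul0r subr0 mulrC.
  have E2 : (fun s => Im (F s)) = (fun s : R => Im (g (x + s%:C *: u))) - Im c *: id.
    by apply/funext => y; rewrite [RHS]/(Im _ - Im c * y) /F cImD cImN cImM /= mul0r addr0 mulrC.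
  split; rewrite ?E1 ?E2.
    by apply: is_derive_eq (is_deriveB h1 (is_deriveZ _ (is_derive_id s 1))) _; rewrite /GRing.scale /= mulr1 cReD cReN.
  by apply: is_derive_eq (is_deriveB h2 (is_deriveZ _ (is_derive_id s 1))) _; rewrite /GRing.scale /= mulr1 cImD cImN.
have F0 : F 0 = g x by rewrite /F line0 mul0r oppr0 addr0.
have -> : g (x + t%:C *: u) - g x - t%:C * c = F t - F 0 by rewrite F0 /F; ring.
have bnd (a b : R) : a <= b -> `|a| <= `|t| -> `|b| <= `|t| -> normc (F b - F a) <= 2 * (e * b - e * a).
  move=> ab ha hb.
  have st (s : R) : s \in `[a, b] -> `|s| <= `|t|.
    rewrite in_itv /= => /andP[s1 s2]; move: ha hb; rewrite !ler_norml => /andP[a1 a2] /andP[b1 b2].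
    by apply/andP; split; lra.
  apply: (@curve_bound R F (fun s => dg (x + s%:C *: u) - c) (fun s => e * s) (fun=> e)) => // s /st sst.
  - exact: dF.
  - by apply: is_derive_eq; rewrite /GRing.scale /= mulr1.
  - exact: hc.
have [t0|t0] := lerP 0 t.
  have := bnd 0 t t0; rewrite normr0 normr_ge0 lexx mulr0 subr0 => H.
  by rewrite [X in e * X]ger0_norm//; exact: H.
rewrite normc_sub; have := bnd t 0 (ltW t0); rewrite normr0 normr_ge0 lexx mulr0 sub0r -mulrN => H.
by rewrite [X in e * X]ltr0_norm//; exact: H.
Qed.

Lemma rderZ g u z (r : R) (d : C) : rder g u z d -> rder g (r%:C *: u) z (r%:C * d).
Proof.
move=> /epsP_rder H; apply: rder_eps => e e0.
have c0 : 0 < `|r| + 1 by rewrite ltr_wpDl.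
have [q q0 hq] := H _ (divr_gt0 e0 c0); exists (q / (`|r| + 1)); first by rewrite divr_gt0.
move=> t ht; have := hq (t * r).
rewrite normrM rmorphM /= scalerA mulrA => /(_ _) le; apply: le_trans (le _) _.
  by move: ht; rewrite ler_pdivlMr//; apply: le_trans; rewrite ler_wpM2l// lerDl.
rewrite mulrAC ler_pdivrMr// -mulrA ler_pM2l// ler_wpM2l// lerDl//.
Qed.

(** The increment splits into a step along [v] from [z] and a step along [u] from the displaced
    point; continuity of [dg] at [z] handles the second. *)
Lemma rder_step g (dg : V -> C) u v z d : cball z -> (forall w, cball w -> rder g u w (dg w)) ->
  {for z, continuous dg} -> rder g v z d -> rder g (u + v) z (dg z + d).
Proof.
move=> zB hg cdg /epsP_rder H; apply: rder_eps => e e0.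
have e4 : 0 < e / 4 by rewrite divr_gt0.
have [r r0 hr] := H _ e4; have [q q0 hq] := (continuousCP _ _).1 cdg _ e4.
have [p p0 hp] := cball_near zB.
pose S := \sum_j (normc (u 0 j) + normc (v 0 j)) + 1.
have S1 : 0 < S by rewrite ltr_wpDl// sumr_ge0// => j _; rewrite addr_ge0 ?normc_ge0.
have uvS j : normc (u 0 j) + normc (v 0 j) < S.
  rewrite /S (bigD1 j)//= -addrA ltrDl ltr_wpDl// sumr_ge0// => i _; rewrite addr_ge0 ?normc_ge0//.
pose m := Num.min p q.
have m0 : 0 < m by rewrite lt_min p0.
exists (Num.min r (m / S)); first by rewrite lt_min r0 divr_gt0.
move=> t; rewrite le_min => /andP[tr tm].
have near (s : R) j : `|s| <= `|t| -> normc ((z + t%:C *: v + s%:C *: u) 0 j - z 0 j) < m.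
  move=> st; rewrite !mxE (_ : _ - _ = t%:C * v 0 j + s%:C * u 0 j); last by ring.
  apply: le_lt_trans (le_normcD _ _) _; rewrite !normcM !normc_real.
  apply: le_lt_trans (_ : `|t| * (normc (u 0 j) + normc (v 0 j)) < _).
    by rewrite mulrDr addrC lerD2r ler_wpM2r ?normc_ge0.
  have [->|t0] := eqVneq t 0; first by rewrite normr0 mul0r.
  apply: lt_le_trans (_ : `|t| * S <= _); first by rewrite ltr_pM2l ?normr_gt0.
  by rewrite -ler_pdivlMr.
have nB (s : R) : `|s| <= `|t| -> cball (z + t%:C *: v + s%:C *: u).
  by move=> st; apply: hp => j; apply: lt_le_trans (near s j st) _; rewrite ge_min lexx.
have := @sub_affine_bound g dg u (z + t%:C *: v) (dg z) (e / 4) t.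
move=> /(_ (fun s st => hg _ (nB s st))) h1.
have mq : m <= q by rewrite ge_min lexx orbT.
have {h1}h1 := h1 (fun s st => ltW (hq _ (fun j => lt_le_trans (near s j st) mq))).
have h2 := hr t tr.
rewrite [u + v]addrC scalerDr addrA.
rewrite (_ : _ - _ = (g (z + t%:C *: v + t%:C *: u) - g (z + t%:C *: v) - t%:C * dg z)
   + (g (z + t%:C *: v) - g z - t%:C * d)); last by ring.
by apply: le_trans (le_normcD _ _) _; move: h1 h2 (mulr_ge0 (ltW e0) (normr_ge0 t)); lra.
Qed.

Lemma rder0 g z : rder g 0 z 0.
Proof.
apply: rder_eps => e e0; exists 1 => // t _.
by rewrite scaler0 addr0 mulr0 !subrr normc0 mulr_ge0// ltW.
Qed.

(** Continuous partial derivatives give every directional derivative: [v] is assembled from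
    coordinate directions one at a time. *)
Lemma rder_wd g (P Q : 'I_n -> V -> C) v z : cball z ->
  (forall j w, cball w -> wd j g w (P j w) (Q j w)) -> (forall j, contB (P j)) -> (forall j, contB (Q j)) ->
  rder g v z (\sum_j (v 0 j * P j z + conjc (v 0 j) * Q j z)).
Proof.
move=> zB hw cP cQ.
have E : v = \sum_j ((Re (v 0 j))%:C *: dirx j + ((Im (v 0 j))%:C *: diry j)).
  rewrite [LHS]row_sum_delta; apply: eq_bigr => j _; rewrite /diry /dirx scalerA -scalerDl; congr (_ *: _).
  by case: (v 0 j) => a b; apply: complex_eqP => /=; ring.
rewrite [v in rder _ v]E; elim: (index_enum _) => [|j s IH]; first by rewrite !big_nil; exact: rder0.
rewrite !big_cons.
have -> : v 0 j * P j z + conjc (v 0 j) * Q j z =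
    (Re (v 0 j))%:C * (P j z + Q j z) + (Im (v 0 j))%:C * ((0 +i* 1) * (P j z - Q j z)).
  by case: (v 0 j) => a b; case: (P j z) => c d; case: (Q j z) => c' d'; apply: complex_eqP => /=; ring.
rewrite -!addrA.
have h1 w : cball w -> rder g ((Re (v 0 j))%:C *: dirx j) w ((Re (v 0 j))%:C * (P j w + Q j w)).
  by move=> wB; apply: rderZ; have [] := hw j w wB.
have h2 w : cball w -> rder g ((Im (v 0 j))%:C *: diry j) w ((Im (v 0 j))%:C * ((0 +i* 1) * (P j w - Q j w))).
  by move=> wB; apply: rderZ; have [] := hw j w wB.
have cPj := cP j; have cQj := cQ j.
have c1 : contB (fun w => (Re (v 0 j))%:C * (P j w + Q j w)) by clear -cPj cQj; contB_tac.
have c2 : contB (fun w => (Im (v 0 j))%:C * ((0 +i* 1) * (P j w - Q j w))) by clear -cPj cQj; contB_tac.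
apply: (rder_step zB h1 (c1 z zB)).
exact: (rder_step zB h2 (c2 z zB)).
Qed.

Lemma powR_subadd (a b s : R) : 0 <= a -> 0 <= b -> 0 <= s -> s <= 1 -> (a + b) `^ s <= a `^ s + b `^ s.
Proof.
move=> a0 b0 s0 s1.
have [->|ab] := eqVneq (a + b) 0.
  have [->|sn0] := eqVneq s 0; first by rewrite !powRr0 lerDl.
  by rewrite powR0// addr_ge0 ?powR_ge0.
have p : 0 < a + b by rewrite lt_neqAle eq_sym ab addr_ge0.
have H x : 0 <= x -> x <= a + b -> x / (a + b) * (a + b) `^ s <= x `^ s.
  move=> x0 xl; have [->|xn0] := eqVneq x 0; first by rewrite mul0r mul0r powR_ge0.
  have xp : 0 < x by rewrite lt_neqAle eq_sym xn0.
  have E : x `^ s = (x / (a + b)) `^ s * (a + b) `^ s by rewrite -powRM ?divr_ge0 ?ltW// divfK.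
  rewrite E ler_wpM2r ?powR_ge0//.
  have q0 : 0 < x / (a + b) by rewrite divr_gt0.
  rewrite -[leLHS](powRr1 (ltW q0)); apply: le_powR_exp => //.
  by rewrite ler_pdivrMr// mul1r.
have := H a a0; have := H b b0; rewrite lerDl lerDr => /(_ a0) h1 /(_ b0) h2.
by apply: le_trans (lerD h2 h1); rewrite -mulrDl -mulrDl divff// mul1r.
Qed.

Lemma sum_coord_le v : \sum_j normc (v 0 j) <= n%:R * cnorm v.
Proof.
apply: le_trans (_ : \sum_(j < n) cnorm v <= _); first by apply: ler_sum => j _; exact: normc_le_cnorm.
by rewrite sumr_const card_ord mulr_natl.
Qed.

Lemma sqnorm_le2rho z w : cball z -> cball w -> sqnorm (z - w) <= 2 * rho w z.
Proof.
move=> zB wB; have := Re_1hdot w z; have := Re_le_rho w z.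
by have := defect_gt0 zB; have := defect_gt0 wB; lra.
Qed.

Section Gradient.
Variables (g : V -> C) (dg : V -> V -> C) (A B s : R).
Hypothesis A0 : 0 <= A.
Hypothesis B0 : 0 <= B.
Hypothesis s01 : 0 < s /\ s < 1.
Hypothesis g_rder : forall v z, cball z -> rder g v z (dg v z).
Hypothesis dg_le : forall v z, cball z -> normc (dg v z) <= B * cnorm v * defect z `^ (s - 1).
Hypothesis gA : forall z, cball z -> normc (g z) <= A.

Lemma radial_holder z (p : R) : cball z -> 0 <= p -> p <= 1 ->
  normc (g z - g (p%:C *: z)) <= 2 * (B / s) * (1 - p) `^ s.
Proof.
move: s01 => [s0 s1] zB p0 p1.
have E (t : R) : (0 : V) + t%:C *: z = t%:C *: z by rewrite add0r.
have it (t : R) : t \in `[p, 1] -> 0 <= t <= 1.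
  by rewrite in_itv /= => /andP[t1 t2]; rewrite t2 (le_trans p0).
have := @line_bound R n g z 0 (fun t => dg z (t%:C *: z)) (fun t => - (B / s) * (1 - t * cnorm z) `^ s)
  (fun t => - (- (B / s) * cnorm z * s * (1 - t * cnorm z) `^ (s - 1))) p 1 p1.
rewrite !E scale1r mul1r => /(_ _ _ _) h; apply: le_trans (h _ _ _) _ => {h} [t /it t01|t /it t01|t /it t01|].
- by rewrite E; apply: g_rder; exact: cball_ray.
- exact: is_derive_pow1B (ray_gt0 zB t01).
- apply: le_trans (dg_le _ (cball_ray zB t01)) _.
  rewrite [leRHS](_ : _ = B * cnorm z * (1 - t * cnorm z) `^ (s - 1)); last first.
    by field; rewrite gt_eqF.
  rewrite ler_wpM2l ?mulr_ge0 ?cnorm_ge0//.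
  have -> : s - 1 = - (1 - s) by ring.
  by rewrite le_powRN ?ray_gt0 ?defect_ray// subr_ge0 ltW.
have c0 := cnorm_ge0 z; have c1 := cnorm_lt1 zB.
(* 1 - p |z| <= (1 - |z|) + (1 - p), and x^s is subadditive. *)
have h1 : (1 - p * cnorm z) `^ s <= (1 - cnorm z) `^ s + (1 - p) `^ s.
  apply: le_trans (_ : ((1 - cnorm z) + (1 - p)) `^ s <= _).
    by apply: ge0_ler_powR; rewrite ?nnegrE ?(ltW s0)//; nra.
  by apply: powR_subadd; rewrite ?(ltW s0) ?(ltW s1)//; lra.
have q0 : 0 <= B / s by rewrite divr_ge0// ltW.
by rewrite -mulrA ler_pM2l//; nra.
Qed.

(** The Hardy-Littlewood argument. Points at distance e < 1 are both scaled by 1 - e, where the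
    defect is at least e, and joined there, which gives a bound by |z - w|^s. Then |z - w|^2 <= 2
    rho turns the exponent s into s/2. *)
Lemma gradient_holder : exists2 c : R, 0 <= c &
  forall z w, cball z -> cball w -> normc (g z - g w) <= c * rho w z `^ (s / 2).
Proof.
move: s01 => [s0 s1].
have q0 : 0 <= B / s by rewrite divr_ge0// ltW.
(* Two radial moves at 2 B/s each, one crossing at 2 B, and 2 A for points at distance at least
   1. *)
pose K := 4 * (B / s) + 2 * B + 2 * A.
have K0 : 0 <= K by rewrite !addr_ge0// mulr_ge0.
exists (K * 2 `^ (s / 2)); first by rewrite mulr_ge0 ?powR_ge0.
move=> z w zB wB.
suff H : normc (g z - g w) <= K * cnorm (z - w) `^ s.
  apply: le_trans H _; rewrite -mulrA ler_wpM2l// -powRM ?normc_ge0//.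
  have -> : cnorm (z - w) `^ s = sqnorm (z - w) `^ (s / 2).
    rewrite -sqr_cnorm -powR_mulrn ?cnorm_ge0// -powRrM mulrC divfK//.
  apply: ge0_ler_powR; rewrite ?nnegrE ?sqnorm_ge0 ?mulr_ge0 ?normc_ge0 ?divr_ge0 ?(ltW s0)//.
  exact: sqnorm_le2rho.
have e_ge0 := cnorm_ge0 (z - w); set e := cnorm (z - w) in e_ge0 *.
have [e0|e_neq0] := eqVneq e 0.
  have : sqnorm (z - w) = 0 by rewrite -sqr_cnorm -/e e0 expr0n.
  move=> h0; have -> : z = w.
    apply/rowP => j; apply/eqP; rewrite -subr_eq0 -normc_eq0 -sqrf_eq0.
    by have := normc_coord_le (z - w) j; rewrite h0 !mxE => h; rewrite eq_le h sqr_ge0.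
  by rewrite subrr normc0 mulr_ge0 ?powR_ge0.
have e0 : 0 < e by rewrite lt_neqAle eq_sym e_neq0.
have [e1|e1] := lerP 1 e.
  apply: le_trans (le_normcD _ _) _; rewrite normc_opp.
  have h1 : 1 <= e `^ s by rewrite -(@powRr0 _ e) ler_powR// ltW.
  apply: le_trans (_ : K * 1 <= _); last by rewrite ler_wpM2l.
  by move: (gA zB) (gA wB); rewrite /K mulr1; move: B0 q0; lra.
pose p := 1 - e.
have p0 : 0 <= p by rewrite /p subr_ge0 ltW.
have p1 : p <= 1 by rewrite /p gerBl.
have pe : 1 - p = e by rewrite /p; ring.
have h1 := radial_holder zB p0 p1; have h2 := radial_holder wB p0 p1.
rewrite pe in h1 h2.
have h3 : normc (g (p%:C *: z) - g (p%:C *: w)) <= 2 * (B * e `^ s).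
  have ZE : p%:C *: w + (1 : R)%:C *: (p%:C *: (z - w)) = p%:C *: z by rewrite scale1r scalerBr addrC subrK.
  have SE (t : R) : p%:C *: w + t%:C *: (p%:C *: (z - w)) = p%:C *: (w + t%:C *: (z - w)).
    by rewrite [RHS]scalerDr !scalerA [t%:C * _]mulrC.
  have hB (t : R) : 0 <= t <= 1 -> cball (w + t%:C *: (z - w)).
    by move=> t01; exact: (cball_seg wB zB t01).
  have hD (t : R) : 0 <= t <= 1 -> e <= defect (p%:C *: (w + t%:C *: (z - w))).
    move=> t01; have := hB t t01; rewrite /cball /defect sqnormZ /= => q1.
    have : p ^+ 2 * sqnorm (w + t%:C *: (z - w)) <= p * 1.
      by rewrite expr2 -mulrA ler_wpM2l// mulr_ile1 ?sqnorm_ge0// ltW.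
    by rewrite /p; lra.
  have cp : cnorm (p%:C *: (z - w)) <= e.
    rewrite /cnorm sqnormZ sqrtrM ?sqr_ge0// sqrtr_sqr ger0_norm// -/(cnorm _) -/e.
    by rewrite ler_piMl.
  have := @line_bound R n g (p%:C *: (z - w)) (p%:C *: w)
    (fun t => dg (p%:C *: (z - w)) (p%:C *: w + t%:C *: (p%:C *: (z - w))))
    (fun t => B * e `^ s * t) (fun=> B * e `^ s) 0 1 ler01.
  rewrite ZE scale0r addr0 mulr1 mulr0 subr0; apply => t; rewrite in_itv /= => t01.
  - apply: g_rder; rewrite SE; apply: cball_ray; first exact: hB.
    by rewrite p0.
  - by apply: is_derive_eq; rewrite /GRing.scale /= mulr1.
  - have tB : cball (p%:C *: w + t%:C *: (p%:C *: (z - w))).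
      by rewrite SE; apply: cball_ray; [exact: hB|rewrite p0].
    apply: le_trans (dg_le _ tB) _.
    rewrite (powR_pred s e0) -!mulrA ler_wpM2l//.
    apply: ler_pM; rewrite ?cnorm_ge0 ?powR_ge0//.
    have -> : s - 1 = - (1 - s) by ring.
    by rewrite le_powRN// ?SE ?hD// subr_ge0 ltW.
rewrite (_ : g z - g w = (g z - g (p%:C *: z)) + (g (p%:C *: z) - g (p%:C *: w)) - (g w - g (p%:C *: w))); last by ring.
apply: le_trans (le_normcD _ _) _; rewrite normc_opp.
have := le_normcD (g z - g (p%:C *: z)) (g (p%:C *: z) - g (p%:C *: w)).
have := mulr_ge0 A0 (powR_ge0 e s).
by move: h1 h2 h3; rewrite /K; move: (e `^ s) => E; nra.
Qed.

End Gradient.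

Lemma gradient_holder_wd g (P Q : 'I_n -> V -> C) (A s : R) : 0 <= A -> 0 < s /\ s < 1 ->
  (forall j w, cball w -> wd j g w (P j w) (Q j w)) -> (forall j, contB (P j)) -> (forall j, contB (Q j)) ->
  (forall j z, cball z -> normc (P j z) <= A * defect z `^ (s - 1)) ->
  (forall j z, cball z -> normc (Q j z) <= A * defect z `^ (s - 1)) ->
  (forall z, cball z -> normc (g z) <= A) ->
  exists2 c : R, 0 <= c & forall z w, cball z -> cball w -> normc (g z - g w) <= c * rho w z `^ (s / 2).
Proof.
move=> A0 s01 gw cP cQ PA QA gA.
have B0 : 0 <= 2 * n%:R * A by rewrite !mulr_ge0.
apply: (gradient_holder A0 B0 s01 (dg := fun v z => \sum_j (v 0 j * P j z + conjc (v 0 j) * Q j z))) => //.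
  by move=> v z zB; exact: rder_wd.
move=> v z zB; apply: le_trans (normc_sum _ _ _) _.
apply: le_trans (_ : \sum_j (normc (v 0 j) * (2 * (A * defect z `^ (s - 1)))) <= _).
  apply: ler_sum => j _; apply: le_trans (le_normcD _ _) _; rewrite !normcM normc_conj -mulrDr.
  by rewrite ler_wpM2l ?normc_ge0//; move: (PA j z zB) (QA j z zB); lra.
rewrite -mulr_suml; apply: le_trans (ler_wpM2r _ (sum_coord_le v)) _.
  by rewrite !mulr_ge0 ?powR_ge0.
by rewrite le_eqVlt; apply/orP; left; apply/eqP; ring.
Qed.

End Holder.

(** * Symmetric kernels and Tonelli's theorem *)

Section Tonelli.
Context {R : realType} {n : nat}.
Local Notation C := R[i].
Local Notation V := 'rV[C]_n.
Local Notation RT := (measurableTypeR R).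
Local Notation tup m := (m.-tuple RT).
Local Notation T := ((n + n).-tuple RT).
Local Notation Cn := (@Cn_of_R2n R n).
Local Notation rB := (@rball R n).
Local Notation Re := (@complex.Re R).
Local Notation Im := (@complex.Im R).

Let mB := @measurable_rball R n.

Lemma nu_sigma_finite : sigma_finite setT (@nu R n).
Proof.
have [F FT HF] := @lebesgue_tuple_sigma_finite R (n + n); exists F => // i.
have [mF Fi] := HF i; split => //.
by rewrite /nu /= /mscale /= lte_mul_pinfty// lee_fin ball_volume_inv_ge0.
Qed.

(* An alias of [nu] carrying the sigma-finite structure that Fubini-Tonelli requires. *)
Definition nuS : set T -> \bar R := @nu R n.
HB.instance Definition _ := Measure.copy nuS (@nu R n).
HB.instance Definition _ := @Measure_isSigmaFinite.Build _ _ _ nuS nu_sigma_finite.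

Lemma measurable_rho_powR (p : R) :
  measurable_fun [set: T * T] (fun v : T * T => rho (Cn v.2) (Cn v.1) `^ p).
Proof.
apply: (@measurableT_comp _ _ _ _ _ _ (fun x : R => x `^ p)); first exact: measurable_powR.
have c1 i : measurable_fun [set: T * T] (fun v : T * T => tnth v.1 i : R).
  apply: (@measurableT_comp _ _ _ _ _ _ (fun t : T => tnth t i : RT)); first exact: measurable_tnth.
  exact: measurable_fst.
have c2 i : measurable_fun [set: T * T] (fun v : T * T => tnth v.2 i : R).
  apply: (@measurableT_comp _ _ _ _ _ _ (fun t : T => tnth t i : RT)); first exact: measurable_tnth.
  exact: measurable_snd.
pose X (v : T * T) := 1 - \sum_(j < n) (tnth v.2 (lshift n j) * tnth v.1 (lshift n j) + tnth v.2 (rshift n j) * tnth v.1 (rshift n j)).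
pose Y (v : T * T) := - \sum_(j < n) (tnth v.2 (lshift n j) * tnth v.1 (rshift n j) - tnth v.2 (rshift n j) * tnth v.1 (lshift n j)).
have E : (fun v : T * T => rho (Cn v.2) (Cn v.1)) = (fun v => (X v * X v + Y v * Y v) `^ 2^-1).
  apply/funext => v; rewrite powR12_sqrt; last by rewrite addr_ge0 // -expr2 sqr_ge0.
  have -> : X v = Re (1 - hdot (Cn v.2) (Cn v.1)).
    rewrite cReD cReN /hdot cRe_sum /X; congr (_ - _); apply: eq_bigr => j _.
    by rewrite cReM Re_conjc Im_conjc !CnE /=; ring.
  have -> : Y v = Im (1 - hdot (Cn v.2) (Cn v.1)).
    rewrite cImD cImN /hdot cIm_sum /Y add0r; congr (- _); apply: eq_bigr => j _.
    by rewrite cImM Re_conjc Im_conjc !CnE /=; ring.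
  by rewrite /rho; case: (1 - _) => a b.
rewrite E; apply: (@measurableT_comp _ _ _ _ _ _ (fun x : R => x `^ 2^-1)); first exact: measurable_powR.
have mX : measurable_fun [set: T * T] X.
  apply: measurable_funB; first exact: measurable_cst.
  by apply: measurable_sum => j; apply: measurable_funD; apply: measurable_funM.
have mY : measurable_fun [set: T * T] Y.
  apply: measurableT_comp => //.
  by apply: measurable_sum => j; apply: measurable_funB; apply: measurable_funM.
by apply: measurable_funD; apply: measurable_funM.
Qed.

(** Integrate u <= th K u against D and exchange the integrals. By symmetry the kernel is then
    integrated in its other variable, where its integral is at most [c]; the finite integral of u D
    is at most half of itself. *)
Lemma tonelli_contraction (K : V -> V -> R) (u D : V -> R) (th c : R) :
  measurable_fun [set: T * T] (fun v : T * T => K (Cn v.1) (Cn v.2)) ->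
  (forall z w, cball z -> cball w -> 0 <= K z w) -> (forall z w, K z w = K w z) ->
  measB u -> (forall z, cball z -> 0 <= u z) -> measB D -> (forall z, cball z -> 0 <= D z) ->
  intB (fun z => u z * D z) ->
  (forall z, cball z -> intB (fun w => K z w * D w)) ->
  (forall z, cball z -> Rint (fun w => K z w * D w) <= c) ->
  (forall z, cball z -> intB (fun w => K z w * (u w * D w))) ->
  (forall z, cball z -> u z <= th * Rint (fun w => K z w * (u w * D w))) ->
  0 <= th -> th * c <= 2^-1 -> Rint (fun z => u z * D z) = 0.
Proof.
move=> mK K0 Ks mu u0 mD D0 iu iK hc iKu hu th0 thc.
(* Extension by 0 outside the ball, so that the exchange takes place on the whole product space. *)
pose d' := (fun v : T => D (Cn v)) \_ rB.
pose u' := (fun v : T => u (Cn v) * D (Cn v)) \_ rB.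
have md' : measurable_fun [set: T] d' by apply: (measurable_restrictT _ mB).1.
have mu' : measurable_fun [set: T] u' by apply: (measurable_restrictT _ mB).1; exact: measurable_funM.
pose F (v : T * T) : \bar R := (K (Cn v.1) (Cn v.2) * (d' v.1 * u' v.2))%:E.
have mF : measurable_fun [set: T * T] F.
  apply/measurable_EFinP; apply: measurable_funM => //; apply: measurable_funM.
    exact: (measurableT_comp md' measurable_fst).
  exact: (measurableT_comp mu' measurable_snd).
have F0 v : (0 <= F v)%E.
  rewrite lee_fin /d' /u' !patchE; case: ifP; case: ifP => //; rewrite ?mul0r ?mulr0 ?mul0r ?mulr0//.
  rewrite !inE => h1 h2.
  by apply: mulr_ge0; [exact: K0|apply: mulr_ge0; [exact: D0|apply: mulr_ge0; [exact: u0|exact: D0]]].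
have in1 v : rB v -> (\int[nuS]_w F (v, w) = (D (Cn v) * Rint (fun w => K (Cn v) w * (u w * D w)))%:E)%E.
  move=> vB; rewrite -RintZ; last exact: iKu.
  rewrite RintE; last by apply: intBZ; exact: iKu.
  rewrite [RHS]integral_mkcond; apply: eq_integral => w _.
  rewrite /F /d' /u' /= !patchE (mem_set vB); case: ifP => _; last by rewrite !mulr0.
  by congr EFin; ring.
have in2 w : (\int[nuS]_v F (v, w) <= (c * u' w)%:E)%E.
  rewrite /u' patchE; case: ifP => [|wB]; last first.
    rewrite (eq_integral (fun=> 0%E)); first by rewrite integral0 mulr0.
    by move=> v _; rewrite /F /u' /= [X in _ * (_ * X)]patchE wB !mulr0.
  rewrite inE => wB.
  apply: (@le_trans _ _ (u (Cn w) * D (Cn w) * Rint (fun v => K (Cn w) v * D v))%:E); last first.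
    by rewrite lee_fin mulrC ler_wpM2r ?hc// mulr_ge0 ?u0 ?D0.
  rewrite -RintZ; last exact: iK.
  rewrite RintE; last by apply: intBZ; exact: iK.
  rewrite le_eqVlt; apply/orP; left; apply/eqP.
  rewrite [RHS]integral_mkcond; apply: eq_integral => v _.
  rewrite /F /d' /u' /= !patchE (mem_set wB); case: ifP => _; last by rewrite mul0r mulr0.
  by rewrite Ks; congr EFin; ring.
have mJ : measurable_fun [set: T] (fun v => \int[nuS]_w F (v, w))%E.
  by apply: (@measurable_fun_fubini_tonelli_F _ _ _ _ _ nuS F).
have mJ2 : measurable_fun [set: T] (fun w => \int[nuS]_v F (v, w))%E.
  by apply: (@measurable_fun_fubini_tonelli_G _ _ _ _ _ nuS F).
have J0 v : (0 <= \int[nuS]_w F (v, w))%E by apply: integral_ge0.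
have I0 : 0 <= Rint (fun z => u z * D z) by apply: Rint_ge0 => z zB; rewrite mulr_ge0 ?u0 ?D0.
have u'0 w : 0 <= u' w by rewrite /u' patchE; case: ifP => //; rewrite inE => wB; rewrite mulr_ge0 ?u0 ?D0.
have main : ((Rint (fun z => u z * D z))%:E <= (th * (c * Rint (fun z => u z * D z)))%:E)%E.
  rewrite {1}RintE//.
  apply: (@le_trans _ _ (\int[nuS]_(v in rB) (th%:E * \int[nuS]_w F (v, w)))%E).
    apply: ge0_le_integral => //.
    - by move=> v vB; rewrite lee_fin mulr_ge0 ?u0 ?D0.
    - by apply/measurable_EFinP; exact: measurable_funM.
    - by apply: measurable_funeM; exact: measurable_funTS.
    - move=> v vB; rewrite in1// -EFinM lee_fin mulrC mulrCA ler_wpM2l ?D0//; exact: hu.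
  rewrite ge0_integralZl//; last exact: measurable_funTS.
  rewrite EFinM; apply: lee_wpmul2l; first by rewrite lee_fin.
  apply: (@le_trans _ _ (\int[nuS]_v \int[nuS]_w F (v, w))%E).
    by apply: ge0_subset_integral.
  rewrite (@fubini_tonelli _ _ _ _ _ nuS nuS F mF F0).
  apply: (@le_trans _ _ (\int[nuS]_w (c * u' w)%:E)%E).
    apply: ge0_le_integral => //.
    - by move=> w _; apply: integral_ge0.
    - by apply/measurable_EFinP; apply: measurable_funM => //; exact: measurable_cst.
  have -> : (\int[nuS]_w (c * u' w)%:E = \int[@nu R n]_(w in rB) (c * (u (Cn w) * D (Cn w)))%:E)%E.
    rewrite [RHS]integral_mkcond; apply: eq_integral => w _.
    by rewrite /u' !patchE; case: ifP; rewrite ?mulr0.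
  by rewrite -RintZ// RintE//; exact: intBZ.
move: main I0; rewrite lee_fin mulrA; set x := Rint _ => h1 h2; nra.
Qed.

End Tonelli.

(** * Boundedness of f *)

Section Boundedness.
Context {R : realType} {n : nat}.
Local Notation C := R[i].
Local Notation V := 'rV[C]_n.
Local Notation T := ((n + n).-tuple (measurableTypeR R)).
Local Notation Cn := (@Cn_of_R2n R n).
Implicit Types (phi f h : V -> C) (z w : V).

Lemma nonvanishing_near_sphere phi : {within @cclosed_ball R n, continuous phi} ->
  (forall z, csphere z -> phi z <> 0) ->
  exists2 e : R, 0 < e & forall z, cball z -> defect z <= e -> e <= normc (phi z).
Proof.
move=> cphi phiS.
pose P (e : R) z := defect z <= e -> e <= normc (phi z).
have [|e e0 he] := @closed_ball_uniform R n 1 P.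
  (* At a point of the sphere continuity keeps |phi| above half its value; at an interior point the
     condition D <= e fails nearby once e is small. *)
  move=> z z1; have [zS|zS] := eqVneq (sqnorm z) 1.
    have m0 : 0 < normc (phi z) by rewrite normc_gt0; apply/eqP; exact: phiS.
    have m2 : 0 < normc (phi z) / 2 by rewrite divr_gt0.
    have zc : cclosed_ball z by rewrite /cclosed_ball /= zS.
    have /subspace_continuousP/(_ z zc) H := cphi.
    have : \forall y \near phi z, normc (y - phi z) < normc (phi z) / 2 by apply/near_CP; exists (normc (phi z) / 2).
    move=> /H /near_rVP[d d0 hd].
    exists (Num.min d (normc (phi z) / 2)); first by rewrite lt_min d0.
    move=> w e wz w1 e0; rewrite le_min => /andP[ed em] _.
    have md : Num.min d (normc (phi z) / 2) <= d by rewrite ge_min lexx.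
    have := hd w (fun j => lt_le_trans (wz j) md) w1.
    have := le_normcD (phi w) (phi z - phi w); rewrite addrC subrK [normc (phi z - _)]normc_sub.
    move=> h1 h2; have h3 : normc (phi w - phi z) < normc (phi z) / 2 := h2.
    by move: em h1 h3; lra.
  have dz : 0 < defect z / 2 by rewrite divr_gt0// /defect subr_gt0 lt_neqAle zS.
  have [d d0 hd] := (continuousRP _ _).1 (@continuous_defect R n z) _ dz.
  exists (Num.min d (defect z / 4)); first by rewrite lt_min d0 divr_gt0//; move: dz; lra.
  move=> w e wz w1 e0; rewrite le_min => /andP[ed em] we.
  have md : Num.min d (defect z / 4) <= d by rewrite ge_min lexx.
  have := hd w (fun j => lt_le_trans (wz j) md).
  by rewrite ltr_norml => /andP[]; move: dz em we; lra.
by exists e => // z zB; apply: he; exact: ltW.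
Qed.

Lemma toeplitz_defect (N : R) (lam A : R) phi f (a : 'I_n -> V -> C) h z : 0 < N ->
  contB phi -> (forall w, cball w -> normc (phi w) <= A) -> hol f a ->
  intB (fun w => normc (f w) * defect w `^ (N - 1)) -> cball z ->
  cintegral (fun w => kern (n%:R + N) w z * (f w * (defect w `^ (N - 1))%:C)) = lam%:C * f z ->
  cintegral (fun w => kern (n%:R + N) w z * (phi w * f w * (defect w `^ (N - 1))%:C)) = h z ->
  lam%:C * (phi z * f z) - h z =
   cintegral (fun w => (phi z - phi w) * (kern (n%:R + N) w z * (f w * (defect w `^ (N - 1))%:C))).
Proof.
move=> N0 cphi phiA [cf _ _] iF zB rep top.
have d0 : 0 <= n%:R + N by rewrite addr_ge0// ltW.
have cK : contB (fun w => kern (n%:R + N) w z) by contB_tac.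
have cD : contBr (fun w : V => defect w `^ (N - 1)) by exact: contBr_defectp.
have D0 w : cball w -> 0 <= defect (w : V) `^ (N - 1) by move=> _; exact: powR_ge0.
have kM w : cball w -> normc (kern (n%:R + N) w z) <= 2 `^ (n%:R + N) * defect z `^ (- (n%:R + N)).
  by move=> wB; exact: kern_le.
have i1 := cintbleM_le cK cf cD D0 kM iF.
have i2 : cintble (fun w => (phi w * kern (n%:R + N) w z) * (f w * (defect w `^ (N - 1))%:C)).
  have cpk : contB (fun w => phi w * kern (n%:R + N) w z) by contB_tac.
  refine (@cintbleM_le R n _ f _ (A * (2 `^ (n%:R + N) * defect z `^ (- (n%:R + N)))) cpk cf cD D0 _ iF).
  move=> w wB; have k1 := kM w wB; move: (kern _ w z) k1 => k k1.
  by rewrite normcM; apply: ler_pM; rewrite ?normc_ge0 ?phiA.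
have E : h z = cintegral (fun w => (phi w * kern (n%:R + N) w z) * (f w * (defect w `^ (N - 1))%:C)).
  by rewrite -top; apply: eq_cintegral => w _; ring.
rewrite E mulrCA -rep -cintegralZ// -cintegralN// -cintegralD; first last.
- exact: cintbleN.
- exact: cintbleZ.
by apply: eq_cintegral => w _; ring.
Qed.

(** The positive part g of u - 2 G satisfies g <= th K g, since th times the integral of the kernel
    is at most 1/2 and G absorbs the contribution of the constant 2 G. So g has integral 0 by
    [tonelli_contraction], and then g <= th K g = 0 at every point. *)
Lemma absorb (u : V -> R) (N s G th c : R) : 0 < N -> 0 <= s -> 0 <= G -> 0 <= th ->
  contBr u -> (forall z, cball z -> 0 <= u z) -> intB (fun z => u z * defect z `^ (N - 1)) ->
  (forall z, cball z -> Rint (fr N s z) <= c) -> th * c <= 2^-1 ->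
  (forall z, cball z -> u z <= G + th * Rint (fun w => rho w z `^ (- s) * (u w * defect w `^ (N - 1)))) ->
  forall z, cball z -> u z <= 2 * G.
Proof.
move=> N0 s0 G0 th0 cu u0 iu hc thc hu.
pose g z := Num.max (u z - 2 * G) 0.
have g0 z : 0 <= g z by rewrite le_max lexx orbT.
have gu z : cball z -> g z <= u z by move=> zB; rewrite ge_max u0// andbT gerBl mulr_ge0.
have ug z : u z <= 2 * G + g z by rewrite -lerBlDl le_max lexx.
have mu : measB u := measB_cont cu.
have mD : measB (fun z : V => defect z `^ (N - 1)) by apply: measB_powR; exact: measB_defect.
have mg : measB g.
  apply: measurable_maxr; last exact: measB_cst.
  by apply: (@measBD _ _ u (fun=> - (2 * G))) => //; exact: measB_cst.
have ig : intB (fun z => g z * defect z `^ (N - 1)).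
  apply: intB_le iu; first exact: measBM.
  move=> z zB; rewrite ger0_norm ?mulr_ge0 ?g0 ?powR_ge0//.
  by rewrite ler_wpM2r ?powR_ge0 ?gu.
have mk z : cball z -> measB (fun w => rho w z `^ (- s)).
  by move=> zB; apply: measB_powR; apply: measB_cont; exact: contBr_rho.
have kM z w : cball z -> cball w -> rho w z `^ (- s) <= 2 `^ s * defect z `^ (- s).
  by move=> zB wB; rewrite -normc_kern; exact: kern_le.
have ik (v : V -> R) z : cball z -> measB v -> (forall w, cball w -> 0 <= v w) ->
    intB (fun w => v w * defect w `^ (N - 1)) ->
    intB (fun w => rho w z `^ (- s) * (v w * defect w `^ (N - 1))).
  move=> zB mv v0 iv; apply: intB_le (intBZ (2 `^ s * defect z `^ (- s)) iv).
    by apply: measBM; [exact: mk|exact: measBM].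
  move=> w wB; rewrite ger0_norm ?mulr_ge0 ?powR_ge0 ?v0//.
  by rewrite ler_wpM2r ?kM// mulr_ge0 ?v0 ?powR_ge0.
have iF z : cball z -> intB (fun w => rho w z `^ (- s) * defect w `^ (N - 1)).
  by move=> zB; exact: intB_fr.
have gle z : cball z -> g z <= th * Rint (fun w => rho w z `^ (- s) * (g w * defect w `^ (N - 1))).
  move=> zB.
  have I0 : 0 <= Rint (fun w => rho w z `^ (- s) * (g w * defect w `^ (N - 1))).
    by apply: Rint_ge0 => w _; rewrite !mulr_ge0 ?powR_ge0.
  rewrite ge_max mulr_ge0// andbT.
  have le1 : Rint (fun w => rho w z `^ (- s) * (u w * defect w `^ (N - 1))) <=
     2 * G * Rint (fr N s z) + Rint (fun w => rho w z `^ (- s) * (g w * defect w `^ (N - 1))).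
    rewrite -RintZ; last exact: iF.
    rewrite -RintD; [|by apply: intBZ; exact: iF|exact: ik].
    apply: le_Rint; [exact: ik|apply: intBD; [by apply: intBZ; exact: iF|exact: ik]|].
    move=> w wB; rewrite /fr (_ : 2 * G * _ + _ = rho w z `^ (- s) * ((2 * G + g w) * defect w `^ (N - 1))); last by ring.
    by rewrite ler_wpM2l ?powR_ge0// ler_wpM2r ?powR_ge0.
  have := hu z zB; have := ler_wpM2l th0 le1; rewrite mulrDr.
  have : th * (2 * G * Rint (fr N s z)) <= G.
    rewrite (_ : _ * _ = 2 * G * (th * Rint (fr N s z))); last by ring.
    apply: le_trans (_ : 2 * G * 2^-1 <= _); last by rewrite mulrAC mulfV// mul1r.
    rewrite ler_wpM2l ?mulr_ge0//; apply: le_trans thc; rewrite ler_wpM2l//; exact: hc.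
  lra.
have Z : Rint (fun z => g z * defect z `^ (N - 1)) = 0.
  apply: (@tonelli_contraction _ _ (fun z w => rho w z `^ (- s)) g (fun z => defect z `^ (N - 1)) th c) => //.
  - exact: measurable_rho_powR.
  - by move=> z w _ _; exact: powR_ge0.
  - by move=> z w; rewrite rho_sym.
  - by move=> z _; exact: powR_ge0.
  - by move=> z zB; exact: ik.
move=> z zB; suff : g z <= 0 by rewrite ge_max lexx andbT subr_le0.
apply: le_trans (gle z zB) _.
have : Rint (fun w => rho w z `^ (- s) * (g w * defect w `^ (N - 1))) <= 2 `^ s * defect z `^ (- s) * Rint (fun z => g z * defect z `^ (N - 1)).
  rewrite -RintZ//; apply: le_Rint; [exact: ik|exact: intBZ|].
  by move=> w wB; rewrite ler_wpM2r ?kM// mulr_ge0 ?powR_ge0.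
by rewrite Z mulr0 => h; rewrite mulr_ge0_le0.
Qed.

(** Where rho <= r, half of the Hoelder gain rho^s gives the small factor r^{s/2}, and the other
    half leaves the kernel rho^{-(n+N-s/2)}, whose integrals are uniformly bounded by
    [forelli_rudin_neg]. Where rho > r the kernel is bounded and costs the L^1 norm of [f]. *)
Lemma bounded_of_toeplitz (N s c A : R) phi : 0 < N -> 0 < s -> s < 1 -> (1 <= n)%N -> 0 <= c -> contB phi ->
  {within @cclosed_ball R n, continuous phi} -> (forall z, csphere z -> phi z <> 0) ->
  (forall w, cball w -> normc (phi w) <= A) ->
  (forall z w, cball z -> cball w -> normc (phi z - phi w) <= c * rho w z `^ s) ->
  exists2 K : R, 0 <= K & forall f a h H, hol f a ->
    intB (fun w => normc (f w) * defect w `^ (N - 1)) ->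
    (forall z, cball z ->
      cintegral (fun w => kern (n%:R + N) w z * (phi w * f w * (defect w `^ (N - 1))%:C)) = h z) ->
    (forall z, cball z -> normc (h z) <= H) ->
    forall z, cball z -> normc (f z) <= K * (Rint (fun w => normc (f w) * defect w `^ (N - 1)) + H).
Proof.
move=> N0 s0 s1 n1 c0 cphi cphi' phiS phiA hold.
have n1R : 1 <= n%:R :> R by rewrite ler1n.
have [e e0 he] := nonvanishing_near_sphere cphi' phiS.
have [lam lam0 hlam] := @reproducing R n N N0.
have s20 : 0 < s / 2 by rewrite divr_gt0.
have s21 : s / 2 < 1 by lra.
have ns : 0 <= n%:R + N - s / 2 by lra.
have [cF cF0 hcF] := forelli_rudin_neg N0 s20 s21 ns.
pose d := n%:R + N.
have d0 : 0 <= d by rewrite /d; lra.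
(* The small factor x = r^{s/2} is fixed first: with this value th cF = c cF / (2 (c cF + 1)) <=
   1/2. *)
have [x x0 xE] : exists2 x : R, 0 < x & x = e * lam / (4 * (c * cF + 1)).
  exists (e * lam / (4 * (c * cF + 1))) => //.
  by rewrite divr_gt0 ?mulr_gt0//; have := mulr_ge0 c0 cF0; lra.
pose r := x `^ (2 / s).
have r0 : 0 < r by rewrite powR_gt0.
have rx : r `^ (s / 2) = x by rewrite -powRrM mulrA divfK ?gt_eqF// divff// powRr1// ltW.
pose th := 2 * c * x / (e * lam).
have el0 : 0 < e * lam by rewrite mulr_gt0.
have th0 : 0 <= th by apply: divr_ge0; [rewrite !mulr_ge0// ltW|exact: ltW].
have thc : th * cF <= 2^-1.
  have -> : th * cF = 2^-1 * ((c * cF) / (c * cF + 1)).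
    rewrite /th xE; field; rewrite !gt_eqF//; have := mulr_ge0 c0 cF0; lra.
  rewrite ler_piMr// ler_pdivrMr; have := mulr_ge0 c0 cF0; lra.
pose K1 := 2 * c * r `^ (- (d - s)) / (e * lam) + 2 * 2 `^ d * e `^ (- d) / lam.
pose K := 2 * (K1 + (e * lam)^-1).
have K10 : 0 <= K1 by rewrite addr_ge0// divr_ge0 ?mulr_ge0 ?powR_ge0// ltW.
have K0 : 0 <= K by rewrite mulr_ge0// addr_ge0// invr_ge0 ltW.
exists K => // f a h H hf iF top hH.
have [cf _ _] := hf.
set I := Rint _.
have I0 : 0 <= I by apply: Rint_ge0 => w _; rewrite mulr_ge0 ?normc_ge0 ?powR_ge0.
have H0 : 0 <= H.
  have z0 : cball (0 : V) by rewrite /cball /= sqnorm0.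
  exact: le_trans (normc_ge0 _) (hH 0 z0).
pose G := K1 * I + (e * lam)^-1 * H.
have G0 : 0 <= G by rewrite addr_ge0// mulr_ge0// invr_ge0 ltW.
suff X z : cball z -> normc (f z) <= G + th * Rint (fun w => rho w z `^ (- (n%:R + N - s / 2)) * (normc (f w) * defect w `^ (N - 1))).
  have ce : 0 <= n%:R + N - s / 2 by lra.
  have cn : contBr (fun z => normc (f z)) by exact: contBr_normc.
  move=> z zB; apply: le_trans (absorb N0 ce G0 th0 cn (fun z _ => normc_ge0 _) iF hcF thc X zB) _.
  have -> : K * (I + H) = 2 * (G + (K1 * H + (e * lam)^-1 * I)) by rewrite /K /G; ring.
  by rewrite ler_pM2l// lerDl addr_ge0// mulr_ge0// invr_ge0 ltW.
move=> zB; set J := Rint _.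
have mF : measB (fun w => normc (f w) * defect w `^ (N - 1)) by exact: intB_meas.
have J0 : 0 <= J by apply: Rint_ge0 => w _; rewrite !mulr_ge0 ?normc_ge0 ?powR_ge0.
have ik p : 0 <= p -> intB (fun w => rho w z `^ (- p) * (normc (f w) * defect w `^ (N - 1))).
  move=> p0; apply: intB_le (intBZ (2 `^ p * defect z `^ (- p)) iF).
    by apply: measBM => //; apply: measB_powR; apply: measB_cont; exact: contBr_rho.
  move=> w wB; rewrite ger0_norm ?mulr_ge0 ?powR_ge0 ?normc_ge0//.
  by rewrite -normc_kern ler_wpM2r ?mulr_ge0 ?powR_ge0 ?normc_ge0 ?kern_le.
have cK : contB (fun w => kern d w z) by contB_tac.
have cD : contBr (fun w : V => defect w `^ (N - 1)) by exact: contBr_defectp.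
have rep := hlam f a z hf zB iF.
(* Away from the sphere, where phi may vanish, the reproducing formula itself bounds [f] by its L^1
   norm. *)
have [zd|zd] := lerP (defect z) e; last first.
  have b1 : normc (lam%:C * f z) <= 2 * Rint (fun w => 2 `^ d * e `^ (- d) * (normc (f w) * defect w `^ (N - 1))).
    rewrite -rep; apply: normc_cintegral_le; last exact: intBZ.
      by apply: measC_cont; contB_tac.
    move=> w wB; have k1 := kern_le d0 wB zB; move: (kern _ w z) k1 => k k1.
    rewrite !normcM normc_real (ger0_norm (powR_ge0 _ _)) ler_wpM2r ?mulr_ge0 ?normc_ge0 ?powR_ge0//.
    apply: le_trans k1 _; rewrite ler_wpM2l ?powR_ge0// le_powRN// ltW//.
  move: b1; rewrite RintZ// -/I normcM normc_real gtr0_norm// => b1.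
  apply: le_trans (_ : K1 * I <= _); last first.
    by rewrite /G -addrA lerDl addr_ge0// mulr_ge0// invr_ge0 ltW.
  have k2 : 2 * 2 `^ d * e `^ (- d) / lam * I <= K1 * I.
    by rewrite ler_wpM2r// lerDr divr_ge0 ?mulr_ge0 ?powR_ge0// ltW.
  apply: le_trans k2; rewrite mulrAC ler_pdivlMr// mulrC; apply: le_trans b1 _.
  by rewrite !mulrA.
have b2 := toeplitz_defect N0 cphi phiA hf iF zB rep (top z zB).
have b3 : normc (lam%:C * (phi z * f z) - h z) <=
   2 * Rint (fun w => c * x * (rho w z `^ (- (n%:R + N - s / 2)) * (normc (f w) * defect w `^ (N - 1)))
     + c * r `^ (- (d - s)) * (normc (f w) * defect w `^ (N - 1))).
  rewrite b2; apply: normc_cintegral_le.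
  - by apply: measC_cont; contB_tac.
  - move=> w wB; have rw := rho_gt0 wB zB; have hp := hold z w zB wB.
    have k1 := normc_kern d w z; rewrite -/d; move: (kern d w z) k1 => k k1.
    rewrite !normcM k1 normc_real (ger0_norm (powR_ge0 _ _)) !mulrA -mulrDl -mulrDl.
    rewrite ler_wpM2r ?powR_ge0// ler_wpM2r ?normc_ge0//.
    apply: le_trans (_ : c * rho w z `^ s * rho w z `^ (- d) <= _).
      by rewrite ler_wpM2r ?powR_ge0.
    rewrite -!mulrA -mulrDr ler_wpM2l//.
    have E : rho w z `^ s * rho w z `^ (- d) = rho w z `^ (s / 2) * rho w z `^ (- (d - s / 2)).
      by rewrite -!powRDp//; congr (_ `^ _); field.
    have [rr|rr] := lerP (rho w z) r.
      rewrite E -rx; apply: le_trans (_ : r `^ (s / 2) * rho w z `^ (- (d - s / 2)) <= _).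
        by rewrite ler_wpM2r ?powR_ge0// ge0_ler_powR ?nnegrE ?divr_ge0 ?(ltW s0) ?(ltW r0) ?(ltW rw).
      by rewrite lerDl powR_ge0.
    rewrite -powRDp// (_ : s + - d = - (d - s)); last by ring.
    apply: le_trans (_ : r `^ (- (d - s)) <= _).
      by rewrite le_powRN ?(ltW rr)//; rewrite /d; lra.
    by rewrite lerDr mulr_ge0 ?powR_ge0// ltW.
  - by apply: intBD; apply: intBZ => //; apply: ik; lra.
move: b3; rewrite RintD; [|by apply: intBZ; apply: ik; lra|exact: intBZ].
rewrite RintZ; last by apply: ik; lra.
rewrite RintZ// -/I -/J => b3.
have b4 : normc (lam%:C * (phi z * f z)) <= H + 2 * (c * x * J + c * r `^ (- (d - s)) * I).
  rewrite -[lam%:C * _](subrK (h z)); apply: le_trans (le_normcD _ _) _.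
  by rewrite addrC; apply: lerD => //; exact: hH.
rewrite !normcM normc_real gtr0_norm// in b4.
have b5 : e * lam * normc (f z) <= H + 2 * (c * x * J + c * r `^ (- (d - s)) * I).
  apply: le_trans b4; rewrite [e * lam]mulrC -mulrA ler_pM2l// ler_wpM2r ?normc_ge0//; exact: he.
rewrite mulrC -ler_pdivlMr// in b5; apply: le_trans b5 _.
have -> : (H + 2 * (c * x * J + c * r `^ (- (d - s)) * I)) / (e * lam) =
   (2 * c * r `^ (- (d - s)) / (e * lam)) * I + (e * lam)^-1 * H + th * J.
  by rewrite /th; field; rewrite !gt_eqF.
rewrite lerD2r /G lerD2r ler_wpM2r// /K1 lerDl divr_ge0 ?mulr_ge0 ?powR_ge0// ltW//.
Qed.

End Boundedness.

(** * Derivatives of kernel integrals *)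

Section KernelDerivatives.
Context {R : realType} {n : nat}.
Local Notation C := R[i].
Local Notation V := 'rV[C]_n.
Local Notation Re := (@complex.Re R).
Local Notation Im := (@complex.Im R).
Implicit Types (f g u : V -> C) (z w v : V) (l : seq 'I_n) (W : V -> R).

(** Derivatives are indexed by sequences rather than multi-indices, so that induction and the
    Leibniz rule are structural; the head of the sequence acts last. *)
Definition dl l f : V -> C := foldr pd f l.
Definition mono l w : C := \prod_(j <- l) conjc (w 0 j).
Definition poch (s : R) (k : nat) : R := \prod_(i < k) (s + i%:R).
Definition Hk (s : R) u W z : C := cintegral (fun w => kern s w z * (u w * (W w)%:C)).

Lemma poch_gt0 (s : R) k : 0 < s -> 0 < poch s k.
Proof. by move=> s0; apply: prodr_gt0 => i _; rewrite ltr_wpDr. Qed.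

Lemma contB_mono l : contB (mono l).
Proof.
elim: l => [|j l IH]; first by rewrite /mono (_ : (fun w => _) = fun=> 1); [contB_tac|apply/funext => w; rewrite big_nil].
rewrite (_ : mono (j :: l) = fun w => conjc (w 0 j) * mono l w); first by contB_tac.
by apply/funext => w; rewrite /mono big_cons.
Qed.

Lemma mono_le1 l w : cball w -> normc (mono l w) <= 1.
Proof.
move=> wB; rewrite /mono normc_prod; elim: l => [|j l IH]; first by rewrite big_nil.
by rewrite big_cons mulr_ile1 ?normc_ge0 ?prodr_ge0// ?normc_conj ?(ltW (normc_coord_lt1 _ wB))// => i _; rewrite normc_ge0.
Qed.

Lemma mono_perm l l' w : perm_eq l l' -> mono l w = mono l' w.
Proof. exact: perm_big. Qed.

Transparent contB.
(** Directional derivatives bounded on smaller balls make [g] locally Lipschitz. *)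
Lemma contB_of_rder g (dg : V -> V -> C) :
  (forall v z, cball z -> rder g v z (dg v z)) ->
  (forall r : R, r < 1 -> exists2 M : R, 0 <= M & forall z v, sqnorm z <= r -> normc (dg v z) <= M * \sum_j normc (v 0 j)) ->
  contB g.
Proof.
move=> hg hM.
move=> z zB; apply/continuousCP => e e0.
pose r := (1 + sqnorm z) / 2.
have [zr r1] : sqnorm z < r /\ r < 1 by move: zB; rewrite /cball /= /r; lra.
have r0 : 0 < r - sqnorm z by rewrite subr_gt0.
have [M M0 hM'] := hM r r1.
have [d d0 hd] := (continuousRP _ _).1 (@continuous_sqnorm R n z) _ r0.
pose c := 2 * (M * n%:R) + 1.
have c0 : 0 < c by rewrite ltr_wpDl// mulr_ge0// mulr_ge0.
exists (Num.min d (e / c)); first by rewrite lt_min d0 divr_gt0.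
move=> w hw; pose v := w - z.
have hj j : normc (v 0 j) < d /\ normc (v 0 j) < e / c by have := hw j; rewrite lt_min !mxE => /andP[].
have Sv : \sum_j normc (v 0 j) <= n%:R * (e / c).
  apply: le_trans (_ : \sum_(j < n) e / c <= _); first by apply: ler_sum => j _; exact: ltW (hj j).2.
  by rewrite sumr_const card_ord mulr_natl.
have inr (t : R) : 0 <= t <= 1 -> sqnorm (z + t%:C *: v) <= r.
  move=> /andP[t0 t1]; have := hd (z + t%:C *: v); rewrite ltr_norml => H.
  have /andP[_ H2] : - (r - sqnorm z) < sqnorm (z + t%:C *: v) - sqnorm z < r - sqnorm z.
    apply: H => j; rewrite (_ : _ - _ = t%:C * v 0 j); last by rewrite !mxE; ring.
    rewrite normcM normc_real ger0_norm//.
    by apply: le_lt_trans (hj j).1; rewrite ler_piMl ?normc_ge0.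
  by move: H2; lra.
have := @line_bound R n g v z (fun t => dg v (z + t%:C *: v)) (fun t => M * (n%:R * (e / c)) * t)
  (fun=> M * (n%:R * (e / c))) 0 1 ler01.
have E1 : z + (1 : R)%:C *: v = w by rewrite scale1r /v addrC subrK.
have E0 : z + (0 : R)%:C *: v = z by rewrite scale0r addr0.
rewrite E1 E0 mulr1 mulr0 subr0 => H.
apply: le_lt_trans (H _ _ _) _ => [t|t|t|].
- by rewrite in_itv /= => /inr tr; apply: hg; exact: le_lt_trans r1.
- by move=> _; apply: is_derive_eq; rewrite /GRing.scale /= mulr1.
- rewrite in_itv /= => /inr tr; apply: le_trans (hM' _ _ tr) _.
  by rewrite ler_wpM2l.
rewrite (_ : 2 * _ = (2 * (M * n%:R)) / c * e); last by ring.
rewrite -[ltRHS]mul1r ltr_pM2r// ltr_pdivrMr// mul1r /c ltrDl//.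
Qed.
Opaque contB.

Lemma hol_eq_ball f g (a b : 'I_n -> V -> C) : (forall z, cball z -> f z = g z) ->
  (forall j z, cball z -> a j z = b j z) -> hol g b -> hol f a.
Proof.
move=> fg ab [cg cb rg]; split.
- by apply: eq_contB cg => z zB; rewrite fg.
- by move=> j; apply: eq_contB (cb j) => z zB; rewrite ab.
- move=> z zB v; apply: (rder_ball zB (f := g)); first by move=> w wB; rewrite fg.
  by apply: rder_eq (rg z zB v) _; apply: eq_bigr => j _; rewrite ab.
Qed.

Lemma hol_pdE f (a : 'I_n -> V -> C) j z : hol f a -> cball z -> pd j f z = a j z.
Proof. by move=> hf zB; exact: wd_pd (hol_wd j hf zB). Qed.

Lemma hol_pdbar0 f (a : 'I_n -> V -> C) j z : hol f a -> cball z -> pdbar j f z = 0.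
Proof. by move=> hf zB; exact: wd_pdbar (hol_wd j hf zB). Qed.

Lemma hol_pd f (a : 'I_n -> V -> C) : hol f a -> hol f (fun j => pd j f).
Proof. move=> hf; apply: (hol_eq_ball _ _ hf) => [//|j z zB]; exact: hol_pdE hf zB. Qed.

Lemma holZ (c : C) f (a : 'I_n -> V -> C) : hol f a -> hol (fun z => c * f z) (fun j z => c * a j z).
Proof.
move=> [cf ca rf]; split; first by contB_tac.
  by move=> j; have caj := ca j; contB_tac.
move=> z zB v; apply: rder_eq (rderM (rder_cst c v z) (rf z zB v)) _.
by rewrite mul0r addr0 mulr_sumr; apply: eq_bigr => j _; ring.
Qed.

Section Kernel.
Variables (u : V -> C) (W : V -> R).
Hypotheses (cu : contB u) (cW : contBr W) (W0 : forall w, cball w -> 0 <= W w).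
Hypothesis iu : intB (fun w => normc (u w) * W w).

Let intu l : intB (fun w => normc (mono l w * u w) * W w).
Proof.
have cm := @contB_mono l.
apply: intB_le iu; first by apply: measB_cont; contB_tac.
move=> w wB; rewrite normcM ger0_norm ?mulr_ge0 ?normc_ge0 ?W0//.
by rewrite ler_wpM2r ?W0// ler_piMl ?normc_ge0 ?mono_le1.
Qed.

Let cml l : contB (fun w => mono l w * u w).
Proof. by have cm := @contB_mono l; contB_tac. Qed.

Lemma normc_Hk_le l (s : R) z : 0 <= s -> cball z ->
  normc (Hk s (fun w => mono l w * u w) W z) <= 2 * Rint (fun w => rho w z `^ (- s) * (normc (u w) * W w)).
Proof.
move=> s0 zB; have cm := @contB_mono l.
have i1 : intB (fun w => rho w z `^ (- s) * (normc (u w) * W w)).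
  apply: intB_le (intBZ (2 `^ s * defect z `^ (- s)) iu).
    apply: measBM; first by apply: measB_powR; apply: measB_cont; exact: contBr_rho.
    exact: intB_meas.
  move=> w wB; have h := kern_le s0 wB zB; rewrite normc_kern in h.
  by rewrite ger0_norm ?mulr_ge0 ?powR_ge0 ?normc_ge0 ?W0// ler_wpM2r// mulr_ge0 ?normc_ge0 ?W0.
apply: normc_cintegral_le => //; first by apply: measC_cont; contB_tac.
move=> w wB; have k1 := normc_kern s w z; move: (kern s w z) k1 => k k1.
rewrite !normcM k1 normc_real ger0_norm ?W0// ler_wpM2l ?powR_ge0// ler_wpM2r ?W0//.
by rewrite ler_piMl ?normc_ge0 ?mono_le1.
Qed.

(** A derivative in [z] raises the kernel exponent by one and multiplies the density by conj(w_j).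
    Allowing a monomial in the density makes the family closed under differentiation. *)
Lemma hol_Hk l (s : R) : 0 <= s -> hol (Hk s (fun w => mono l w * u w) W)
  (fun j z => s%:C * Hk (s + 1) (fun w => mono (j :: l) w * u w) W z).
Proof.
move=> s0; have s1 : 0 <= s + 1 by rewrite addr_ge0.
pose a (s : R) l j z := s%:C * Hk (s + 1) (fun w => mono (j :: l) w * u w) W z.
have rd (t : R) k v z : 0 <= t -> cball z -> rder (Hk t (fun w => mono k w * u w) W) v z (\sum_j v 0 j * a t k j z).
  move=> t0 zB; have t1 : 0 <= t + 1 by rewrite addr_ge0.
  have H := rder_kern_integral v t0 zB (@cml k) cW W0 (@intu k).
  rewrite /Hk; apply: (rder_eq H).
  have ci j : cintble (fun w => kern (t + 1) w z * (mono (j :: k) w * u w * (W w)%:C)).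
    have cK : contB (fun w => kern (t + 1) w z) by contB_tac.
    refine (@cintbleM_le R n _ (fun w => mono (j :: k) w * u w) W (2 `^ (t + 1) * defect z `^ (- (t + 1)))
      cK (@cml (j :: k)) cW W0 _ (@intu (j :: k))).
    by move=> w wB; exact: kern_le.
  rewrite [RHS](_ : _ = \sum_j cintegral (fun w => (v 0 j * t%:C) * (kern (t + 1) w z * (mono (j :: k) w * u w * (W w)%:C)))).
    rewrite -cintegral_sum; last by move=> j _; exact: cintbleZ.
    apply: eq_cintegral => w wB; rewrite /hdot mulr_sumr !mulr_suml; apply: eq_bigr => j _.
    by rewrite /mono big_cons; ring.
  by apply: eq_bigr => j _; rewrite cintegralZ// /a mulrA.
have bd (t : R) k : 0 <= t -> contB (Hk t (fun w => mono k w * u w) W).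
  move=> t0; have t1 : 0 <= t + 1 by rewrite addr_ge0.
  apply: (contB_of_rder (dg := fun v z => \sum_j v 0 j * a t k j z)); first by move=> v z; exact: rd.
  move=> r r1; have q0 : 0 < 1 - r by rewrite subr_gt0.
  pose I := Rint (fun w => normc (u w) * W w).
  have I0 : 0 <= I by apply: Rint_ge0 => w wB; rewrite mulr_ge0 ?normc_ge0 ?W0.
  pose M := t * (2 * (2 `^ (t + 1) * (1 - r) `^ (- (t + 1)) * I)).
  have M0 : 0 <= M by rewrite mulr_ge0// mulr_ge0// mulr_ge0// mulr_ge0 ?powR_ge0.
  exists M => // z v zr; have zB : cball z by exact: le_lt_trans r1.
  apply: le_trans (normc_sum _ _ _) _; rewrite mulr_sumr; apply: ler_sum => j _.
  rewrite normcM mulrC ler_wpM2r ?normc_ge0// /a normcM normc_real ger0_norm// /M ler_wpM2l//.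
  apply: le_trans (normc_Hk_le _ t1 zB) _; rewrite ler_pM2l// -RintZ//.
  have le w : cball w -> rho w z `^ (- (t + 1)) * (normc (u w) * W w) <=
      2 `^ (t + 1) * (1 - r) `^ (- (t + 1)) * (normc (u w) * W w).
    move=> wB; rewrite ler_wpM2r ?mulr_ge0 ?normc_ge0 ?W0//.
    have h := kern_le t1 wB zB; rewrite normc_kern in h; apply: le_trans h _.
    by rewrite ler_wpM2l ?powR_ge0// le_powRN// /defect lerD2l lerN2.
  apply: le_Rint => //; last exact: intBZ.
  apply: intB_le (intBZ (2 `^ (t + 1) * (1 - r) `^ (- (t + 1))) iu).
    apply: measBM; first by apply: measB_powR; apply: measB_cont; exact: contBr_rho.
    exact: intB_meas.
  by move=> w wB; rewrite ger0_norm ?mulr_ge0 ?powR_ge0 ?normc_ge0 ?W0//; exact: le.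
split; [exact: bd| |by move=> z zB v; exact: rd].
by move=> j; have cj := bd (s + 1) (j :: l) s1; contB_tac.
Qed.

Lemma dl_Hk l (s : R) : 0 <= s -> forall z, cball z ->
  dl l (Hk s u W) z = (poch s (size l))%:C * Hk (s + (size l)%:R) (fun w => mono l w * u w) W z.
Proof.
move=> s0; elim: l => [|j l IH] z zB /=.
  rewrite /poch big_ord0 mul1r addr0; apply: eq_cintegral => w _.
  by rewrite /mono big_nil mul1r.
have sl : 0 <= s + (size l)%:R by rewrite addr_ge0.
have H := holZ (poch s (size l))%:C (hol_Hk l sl).
have H' : hol (dl l (Hk s u W)) _ := hol_eq_ball IH (fun _ _ _ => erefl) H.
rewrite (hol_pdE _ H' zB) mulrA -rmorphM /=; congr (_ * _); last by rewrite -natr1 addrA.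
by rewrite /poch big_ord_recr.
Qed.

Lemma hol_dl_Hk l (s : R) : 0 <= s -> hol (dl l (Hk s u W)) (fun j => dl (j :: l) (Hk s u W)).
Proof.
move=> s0; have sl : 0 <= s + (size l)%:R by rewrite addr_ge0.
have H := holZ (poch s (size l))%:C (hol_Hk l sl).
exact: hol_pd (hol_eq_ball (dl_Hk l s0) (fun _ _ _ => erefl) H).
Qed.

Lemma dl_Hk_perm l l' (s : R) z : 0 <= s -> cball z -> perm_eq l l' -> dl l (Hk s u W) z = dl l' (Hk s u W) z.
Proof.
move=> s0 zB ll'; rewrite !dl_Hk// (perm_size ll'); congr (_ * _).
by apply: eq_cintegral => w _; rewrite (mono_perm _ ll').
Qed.

End Kernel.

(** Holomorphic derivatives of all orders on the ball, together with their commutation; for an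
    arbitrary function [dl] depends on the order of [l]. *)
Definition smooth f := (forall l, hol (dl l f) (fun j => dl (j :: l) f)) /\
  (forall l l' z, cball z -> perm_eq l l' -> dl l f z = dl l' f z).

Lemma dl_eq_ball l f g z : smooth g -> (forall z, cball z -> f z = g z) -> cball z -> dl l f z = dl l g z.
Proof.
move=> [hg _] fg; elim: l z => [|j l IH] z zB /=; first exact: fg.
have H : hol (dl l f) _ := hol_eq_ball IH (fun _ _ _ => erefl) (hg l).
by rewrite (hol_pdE _ H zB).
Qed.

Lemma smooth_eq_ball f g : smooth g -> (forall z, cball z -> f z = g z) -> smooth f.
Proof.
move=> sg fg; have [hg pg] := sg; split=> [l|l l' z zB ll'].
  by apply: (hol_eq_ball _ _ (hg l)) => *; exact: dl_eq_ball.
by rewrite !(dl_eq_ball _ sg fg)//; exact: pg.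
Qed.

Lemma smoothZ (c : C) f : smooth f -> smooth (fun z => c * f z) /\
  forall l z, cball z -> dl l (fun z => c * f z) z = c * dl l f z.
Proof.
move=> [hf pf].
have E l z : cball z -> dl l (fun z => c * f z) z = c * dl l f z.
  elim: l z => [//|j l IH] z zB /=.
  have H : hol (dl l (fun z => c * f z)) _ := hol_eq_ball IH (fun _ _ _ => erefl) (holZ c (hf l)).
  by rewrite (hol_pdE _ H zB).
split=> //; split=> [l|l l' z zB ll']; last first.
  by rewrite (E l z zB) (E l' z zB) (pf _ _ _ zB ll').
exact: (hol_eq_ball (fun z => @E l z) (fun j z => @E (j :: l) z) (holZ c (hf l))).
Qed.

Lemma smooth_Hk u W (s : R) : contB u -> contBr W -> (forall w, cball w -> 0 <= W w) ->
  intB (fun w => normc (u w) * W w) -> 0 <= s -> smooth (Hk s u W).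
Proof.
move=> cu cW W0 iu s0; split=> [l|l l' z zB ll']; first exact: hol_dl_Hk.
exact: dl_Hk_perm.
Qed.

(** By the reproducing formula [f] is a multiple of a kernel integral, whose derivatives of all
    orders exist and commute. *)
Lemma smooth_hol f (a : 'I_n -> V -> C) (N : R) : 0 < N -> hol f a ->
  intB (fun w => normc (f w) * defect w `^ (N - 1)) -> smooth f.
Proof.
move=> N0 hf iF; have [lam lam0 hlam] := @reproducing R n N N0.
have [cf _ _] := hf; have d0 : 0 <= n%:R + N by rewrite addr_ge0// ltW.
have S := smooth_Hk cf (@contBr_defectp R n (N - 1)) (fun w _ => powR_ge0 _ _) iF d0.
have [S' _] := smoothZ (lam%:C)^-1 S; apply: smooth_eq_ball S' _ => z zB.
by rewrite /Hk (hlam f a z hf zB iF) mulKf// eq_complex /= negb_and gt_eqF.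
Qed.

End KernelDerivatives.

(** * Moving derivatives from the kernel to the density *)

Section Conversion.
Context {R : realType} {n : nat}.
Local Notation C := R[i].
Local Notation V := 'rV[C]_n.
Implicit Types (f g u phi G : V -> C) (z w v : V) (l a b : seq 'I_n).

(** The j-th holomorphic derivative of D^M is -M conj(w_j) D^{M-1}, and [G] is antiholomorphic.
    Integration by parts trades the factor conj(w_j) for a derivative of [u] and one more power of
    D. *)
Lemma conv_step j (M B : R) u P Q G Gb : 0 < M ->
  contB u -> contB P -> contB Q -> contB G -> contB Gb ->
  (forall w, cball w -> wd j u w (P w) (Q w)) -> (forall w, cball w -> wd j G w 0 (Gb w)) ->
  (forall w, cball w -> normc (G w) <= B) ->
  intB (fun w => normc (u w) * defect w `^ (M - 1)) -> intB (fun w => normc (P w) * defect w `^ M) ->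
  cintegral (fun w => conjc (w 0 j) * G w * (u w * (defect w `^ (M - 1))%:C)) =
  (M^-1)%:C * cintegral (fun w => G w * (P w * (defect w `^ M)%:C)).
Proof.
move=> M0 cu cP cQ cG cGb hu hG GB iu iP.
have D0 (p : R) w : cball w -> 0 <= defect (w : V) `^ p by move=> _; exact: powR_ge0.
have cD (p : R) : contBr (fun w : V => defect w `^ p) by exact: contBr_defectp.
have cDM := cD M; have cDM1 := cD (M - 1).
pose a1 w := conjc (w 0 j) * G w * (u w * (defect w `^ (M - 1))%:C).
pose a2 w := G w * (P w * (defect w `^ M)%:C).
have cjG : contB (fun w => conjc (w 0 j) * G w) by contB_tac.
have i1 : cintble a1.
  refine (@cintbleM_le R n _ u _ B cjG cu cDM1 (D0 _) _ iu) => w wB.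
  rewrite normcM normc_conj; apply: le_trans (GB w wB).
  by rewrite ler_piMl ?normc_ge0// ltW// normc_coord_lt1.
have i2 : cintble a2 by exact: (@cintbleM_le R n _ P _ B cG cP cDM (D0 _) GB iP).
pose a w := G w * (u w * - ((M * defect w `^ (M - 1))%:C * conjc (w 0 j)) + P w * (defect w `^ M)%:C) + 0 * (u w * (defect w `^ M)%:C).
pose b w := G w * (u w * - ((M * defect w `^ (M - 1))%:C * w 0 j) + Q w * (defect w `^ M)%:C) + Gb w * (u w * (defect w `^ M)%:C).
have aE w : a w = a2 w + (- M)%:C * a1 w.
  by rewrite /a /a1 /a2 rmorphN rmorphM /=; ring.
have ia : cintble a by apply: (@eq_cintble _ _ (fun w => a2 w + (- M)%:C * a1 w)) => //; apply: cintbleD => //; exact: cintbleZ.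
have key : cintegral a = 0.
  apply: (@ibp_pd R n j (fun w => G w * (u w * (defect w `^ M)%:C)) a b).
  - by move=> w wB; exact: wdM (hG w wB) (wdM (hu w wB) (wd_defectp j M wB)).
  - by contB_tac.
  - by rewrite /a; contB_tac.
  - by rewrite /b; contB_tac.
  - exact: cintble_normc.
  - apply: intB_le (intBZ B iu).
      apply: measB_cont; rewrite -/(contBr _); apply contBrM; first by contB_tac.
      by apply contBrV; [contB_tac|move=> w wB; rewrite gt_eqF ?defect_gt0].
    move=> w wB; have dw := defect_gt0 wB; rewrite ger0_norm ?divr_ge0 ?normc_ge0 ?(ltW dw)//.
    have GBw := GB w wB; move: (G w) (u w) GBw => p q pB.
    rewrite !normcM normc_real (ger0_norm (powR_ge0 _ _)) ler_pdivrMr// (powR_pred M dw).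
    rewrite (_ : B * (normc q * defect w `^ (M - 1)) * defect w = B * (normc q * (defect w * defect w `^ (M - 1)))); last by ring.
    by rewrite ler_wpM2r// !mulr_ge0 ?normc_ge0 ?powR_ge0 ?(ltW dw).
have : cintegral a2 = M%:C * cintegral a1.
  have := key; rewrite (eq_cintegral (g := fun w => a2 w + (- M)%:C * a1 w)); last by move=> w _; exact: aE.
  rewrite cintegralD//; last exact: cintbleZ.
  by rewrite cintegralZ// rmorphN /= mulNr => /eqP; rewrite subr_eq0 => /eqP.
move=> E; rewrite -/a1 -/a2 E mulrA -rmorphM /= mulVf ?gt_eqF// mul1r//.
Qed.

(** What [conv_step] asks for at each stage, collected along the suffixes of [l]. *)
Fixpoint ibpable (M : R) u l : Prop :=
  if l is j :: l' then
    [/\ ibpable M u l', contB (dl l u), intB (fun w => normc (dl l u w) * defect w `^ (M + (size l)%:R - 1)) &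
      exists2 Q, contB Q & forall w, cball w -> wd j (dl l' u) w (dl l u w) (Q w)]
  else contB u /\ intB (fun w => normc (u w) * defect w `^ (M - 1)).

Lemma ibpable_hd (M : R) u l : ibpable M u l -> contB (dl l u) /\
  intB (fun w => normc (dl l u w) * defect w `^ (M + (size l)%:R - 1)).
Proof. by case: l => [|j l] /= []; rewrite ?addr0. Qed.

(** Iterated, [conv_step] turns the monomial that [dl_Hk] produces into derivatives of the density;
    the exponents M, M + 1, ... accumulate into [poch]. *)
Lemma conv l (M B : R) u G : 0 < M -> ibpable M u l -> contB G ->
  (forall j, exists2 Gb, contB Gb & forall w, cball w -> wd j G w 0 (Gb w)) ->
  (forall w, cball w -> normc (G w) <= B) ->
  cintegral (fun w => mono l w * G w * (u w * (defect w `^ (M - 1))%:C)) =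
  ((poch M (size l))^-1)%:C * cintegral (fun w => G w * (dl l u w * (defect w `^ (M + (size l)%:R - 1))%:C)).
Proof.
move=> M0; elim: l G => [|j l IH] G H cG hG GB.
  rewrite /poch big_ord0 invr1 mul1r addr0; apply: eq_cintegral => w _.
  by rewrite /mono big_nil mul1r.
have [H1 cdl idl [Q cQ hQ]] := H.
have cbj : forall i, contB (fun w : V => (i == j)%:R * G w) by move=> i; contB_tac.
pose G' w := conjc (w 0 j) * G w.
have cG' : contB G' by rewrite /G'; contB_tac.
have hG' i : exists2 Gb, contB Gb & forall w, cball w -> wd i G' w 0 (Gb w).
  have [Gb cGb hGb] := hG i.
  exists (fun w => conjc (w 0 j) * Gb w + (j == i)%:R * G w); first by contB_tac.
  by move=> w wB; apply: wd_eq (wdM (wd_coordbar j i w) (hGb w wB)) _ _; rewrite ?mulr0 ?mul0r ?addr0.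
have GB' w : cball w -> normc (G' w) <= B.
  move=> wB; rewrite normcM normc_conj; apply: le_trans (GB w wB).
  by rewrite ler_piMl ?normc_ge0// ltW// normc_coord_lt1.
have E : cintegral (fun w => mono (j :: l) w * G w * (u w * (defect w `^ (M - 1))%:C)) =
   cintegral (fun w => mono l w * G' w * (u w * (defect w `^ (M - 1))%:C)).
  by apply: eq_cintegral => w _; rewrite /G' /mono big_cons; ring.
rewrite E (IH G' H1 cG' hG' GB').
have Ml : 0 < M + (size l)%:R by rewrite ltr_wpDr.
have [Gb cGb hGb] := hG j.
have [cl il] := ibpable_hd H1.
have sE : M + (size (j :: l))%:R - 1 = M + (size l)%:R by rewrite /= -natr1; ring.
rewrite sE in idl *.
rewrite (@conv_step j (M + (size l)%:R) B (dl l u) (dl (j :: l) u) Q G Gb)//.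
rewrite mulrA -rmorphM /=; congr (_%:C * _).
by rewrite /poch big_ord_recr /= invfM.
Qed.

(** The terms of the Leibniz rule: every distribution of the derivatives in [l] over two factors,
    each part keeping the order of [l]. *)
Fixpoint splits l : seq (seq 'I_n * seq 'I_n) :=
  if l is j :: l' then [seq (j :: p.1, p.2) | p <- splits l'] ++ [seq (p.1, j :: p.2) | p <- splits l']
  else [:: ([::], [::])].

Lemma splits_size l p : p \in splits l -> (size p.1 + size p.2 = size l)%N.
Proof.
elim: l p => [|j l IH] p /=; first by rewrite inE => /eqP ->.
by rewrite mem_cat => /orP[] /mapP[q /IH <- ->] /=; rewrite ?addnS.
Qed.

Lemma splits_subseq l p : p \in splits l -> subseq p.1 l.
Proof.
elim: l p => [|j l IH] p /=; first by rewrite inE => /eqP ->.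
rewrite mem_cat => /orP[] /mapP[q /IH h ->] /=; first by rewrite eqxx.
exact: subseq_trans h (subseq_cons _ _).
Qed.

(** Singles out the Leibniz term with the top-order derivative of f, which the bootstrap pairs with
    phi(z); in the others phi is differentiated. *)
Lemma splits_rcons l : exists s, splits l = rcons s ([::], l) /\ forall p, p \in s -> (0 < size p.1)%N.
Proof.
elim: l => [|j l [s [E hs]]] /=; first by exists [::].
exists ([seq (j :: p.1, p.2) | p <- splits l] ++ [seq (p.1, j :: p.2) | p <- s]); split.
  by rewrite [X in _ ++ map _ X = _]E map_rcons -rcons_cat.
by move=> p; rewrite mem_cat => /orP[] /mapP[q hq ->] //=; exact: hs.
Qed.

(** The C^k regularity of the symbol in the form that integration by parts consumes: one
    antiholomorphic derivative of each holomorphic derivative of order below k must be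
    continuous. *)
Definition diffk k phi := [/\ forall a, (size a <= k)%N -> contB (dl a phi),
  forall a j, (size a < k)%N -> contB (pdbar j (dl a phi)) &
  forall a j w, (size a < k)%N -> cball w -> wd j (dl a phi) w (dl (j :: a) phi w) (pdbar j (dl a phi) w)].

Lemma leibniz k phi f l : diffk k phi -> smooth f -> (size l <= k)%N ->
  forall w, cball w -> dl l (fun w => phi w * f w) w = \sum_(p <- splits l) dl p.1 phi w * dl p.2 f w.
Proof.
move=> [c1 c2 hw] [hf _]; elim: l => [|j l IH] lk w wB; first by rewrite /= big_seq1.
have W : wd j (fun w => \sum_(p <- splits l) dl p.1 phi w * dl p.2 f w) w
   (\sum_(p <- splits l) (dl p.1 phi w * dl (j :: p.2) f w + dl (j :: p.1) phi w * dl p.2 f w))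
   (\sum_(p <- splits l) (dl p.1 phi w * 0 + pdbar j (dl p.1 phi) w * dl p.2 f w)).
  rewrite (eq_fun (fun w => big_seq _ _ _ _)) big_seq [X in wd _ _ _ _ X]big_seq.
  apply: wd_sum => p /splits_size ps; apply: wdM (hol_wd j (hf p.2) wB); apply: hw => //.
  by apply: leq_trans lk; rewrite /= ltnS -ps leq_addr.
rewrite [dl _ _]/= (wd_pd (wd_ball wB _ W)); last by move=> w' wB'; rewrite IH// ltnW.
by rewrite /= big_cat !big_map /= big_split /= addrC.
Qed.

Lemma leibniz_wd k phi f l j w : diffk k phi -> smooth f -> (size l < k)%N -> cball w ->
  wd j (dl l (fun w => phi w * f w)) w (dl (j :: l) (fun w => phi w * f w) w)
    (\sum_(p <- splits l | p \in splits l) (dl p.1 phi w * 0 + pdbar j (dl p.1 phi) w * dl p.2 f w)).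
Proof.
move=> hphi hf lk wB; have [c1 c2 hw] := hphi; have [hf' _] := hf.
have W : wd j (fun w => \sum_(p <- splits l | p \in splits l) dl p.1 phi w * dl p.2 f w) w
   (\sum_(p <- splits l | p \in splits l) (dl p.1 phi w * dl (j :: p.2) f w + dl (j :: p.1) phi w * dl p.2 f w))
   (\sum_(p <- splits l | p \in splits l) (dl p.1 phi w * 0 + pdbar j (dl p.1 phi) w * dl p.2 f w)).
  apply: wd_sum => p /splits_size ps; apply: wdM (hol_wd j (hf' p.2) wB); apply: hw => //.
  by apply: leq_ltn_trans lk; rewrite -ps leq_addr.
have W' := wd_ball (g := dl l (fun w => phi w * f w)) wB _ W.
have {}W' := W' (fun w' wB' => esym (etrans (leibniz hphi hf (ltnW lk) wB') (big_seq _ _ _ _))).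
have E := wd_pd W'; apply: (wd_eq W' _ erefl).
by rewrite /= E.
Qed.

Lemma contB_dl_prod k phi f l : diffk k phi -> smooth f -> (size l <= k)%N ->
  contB (dl l (fun w => phi w * f w)).
Proof.
move=> hphi hf lk; have [c1 _ _] := hphi; have [hf' _] := hf.
apply: (@eq_contB _ _ (fun w => \sum_(p <- splits l | p \in splits l) dl p.1 phi w * dl p.2 f w)).
  by move=> w wB; rewrite (leibniz hphi hf lk wB) [RHS]big_seq.
apply contB_sum => p /splits_size ps; apply contBM; last by have [] := hf' p.2.
by apply: c1; apply: leq_trans lk; rewrite -ps leq_addr.
Qed.

(** Every Leibniz term of a derivative along l' is O(D^{-|l'|}), which brings the weight
    D^{N+|l'|-1} down to the integrable D^{N-1}. *)
Lemma ibpable_prod k (N c A : R) phi f l : 0 < N -> diffk k phi -> smooth f -> (size l <= k)%N ->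
  0 <= c -> 0 <= A ->
  (forall a w, subseq a l -> cball w -> normc (dl a phi w) <= c * defect w `^ (- (size a)%:R)) ->
  (forall b w, (size b <= size l)%N -> cball w -> normc (dl b f w) <= A * defect w `^ (- (size b)%:R)) ->
  ibpable N (fun w => phi w * f w) l.
Proof.
move=> N0 hphi hf lk c0 A0 hc hA; have [c1 c2 _] := hphi; have [hf' _] := hf.
have ib l' : subseq l' l -> intB (fun w => normc (dl l' (fun w => phi w * f w) w) * defect w `^ (N + (size l')%:R - 1)).
  move=> sl; have lk' : (size l' <= k)%N by apply: leq_trans lk; exact: size_subseq.
  have i0 : intB (fun w : V => (\sum_(p <- splits l') c * A) * defect w `^ (N - 1)).
    by apply: intBZ; exact: intB_defectp.
  have m0 : measB (fun w => normc (dl l' (fun w => phi w * f w) w) * defect w `^ (N + (size l')%:R - 1)).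
    have cd := contB_dl_prod hphi hf lk'.
    by apply: measB_cont; contB_tac.
  refine (intB_le m0 _ i0).
  move=> w wB; have dw := defect_gt0 wB; rewrite ger0_norm ?mulr_ge0 ?normc_ge0 ?powR_ge0//.
  rewrite (_ : N + (size l')%:R - 1 = (N - 1) + (size l')%:R); last by ring.
  rewrite powRDp// mulrCA mulrC ler_wpM2r ?powR_ge0//.
  rewrite (leibniz hphi hf lk' wB); apply: le_trans (ler_wpM2r (powR_ge0 _ _) (normc_sum _ _ _)) _.
  rewrite mulr_suml big_seq [leRHS]big_seq; apply: ler_sum => p hp.
  have ps := splits_size hp; have h1 := hc p.1 w (subseq_trans (splits_subseq hp) sl) wB.
  have pl : (size p.2 <= size l)%N.
    by apply: (leq_trans (leq_addl (size p.1) _)); rewrite ps; exact: size_subseq.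
  have h2 := hA p.2 w pl wB; move: (dl p.1 phi w) (dl p.2 f w) h1 h2 => x y h1 h2; rewrite normcM.
  apply: le_trans (_ : c * defect w `^ (- (size p.1)%:R) * (A * defect w `^ (- (size p.2)%:R)) * defect w `^ (size l')%:R <= _).
    by rewrite ler_wpM2r ?powR_ge0//; apply: ler_pM; rewrite ?normc_ge0.
  rewrite (_ : _ * _ = c * A * (defect w `^ (- (size p.1)%:R) * defect w `^ (- (size p.2)%:R) * defect w `^ (size l')%:R)); last by ring.
  rewrite (_ : defect w `^ _ * _ * _ = 1) ?mulr1//.
  by rewrite -!powRDp// -ps natrD -[RHS](powRr0 (defect w)); congr (_ `^ _); ring.
suff H l' : subseq l' l -> ibpable N (fun w => phi w * f w) l' by exact: H (subseq_refl l).
elim: l' => [|j l' IH] sl.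
  have := ib [::] sl; rewrite /= addr0 => i0; split=> //.
  exact: (@contB_dl_prod k phi f [::]).
have sl' : subseq l' l by apply: subseq_trans sl; exact: subseq_cons.
have lk' : (size (j :: l') <= k)%N by apply: leq_trans lk; exact: size_subseq.
split; [exact: IH|exact: contB_dl_prod hphi hf lk'|exact: ib|].
exists (fun w => \sum_(p <- splits l' | p \in splits l') (dl p.1 phi w * 0 + pdbar j (dl p.1 phi) w * dl p.2 f w)).
  apply contB_sum => p /splits_size ps.
  have lp : (size p.1 < k)%N by apply: (leq_ltn_trans (leq_addr (size p.2) _)); rewrite ps; exact: lk'.
  have cp1 := c1 p.1 (ltnW lp); have cp2 := c2 p.1 j lp; have [cp3 _ _] := hf' p.2.
  by contB_tac.
move=> w wB; exact: (leibniz_wd j hphi hf lk' wB).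
Qed.

End Conversion.

(** * Growth of derivatives of holomorphic functions *)

Section Bootstrap.
Context {R : realType} {n : nat}.
Local Notation C := R[i].
Local Notation V := 'rV[C]_n.
Implicit Types (f g u phi : V -> C) (z w v : V) (l a b : seq 'I_n).

Lemma defect_powN_ge1 z (e : R) : cball z -> 0 <= e -> 1 <= defect z `^ (- e).
Proof.
by move=> zB e0; rewrite -[leLHS](powRr0 (defect z)) le_powR_exp ?defect_gt0 ?defect_le1// oppr_le0.
Qed.

Lemma le_defect_powN z (e e' : R) : cball z -> e <= e' -> defect z `^ (- e) <= defect z `^ (- e').
Proof. by move=> zB ee; rewrite le_powR_exp ?defect_gt0 ?defect_le1// lerN2. Qed.

Lemma cball0 : cball (0 : V). Proof. by rewrite /cball /= sqnorm0. Qed.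

Lemma defect0 : defect (0 : V) = 1. Proof. by rewrite /defect sqnorm0 subr0. Qed.

Lemma dl_radial u l z (A e : R) : smooth u -> cball z -> 0 <= A ->
  (forall i w, cball w -> normc (dl (i :: l) u w) <= A * defect w `^ (- e)) ->
  (forall t : R, 0 <= t <= 1 -> rder (dl l u) z (t%:C *: z) (\sum_i z 0 i * dl (i :: l) u (t%:C *: z))) /\
  (forall t : R, 0 <= t <= 1 -> normc (\sum_i z 0 i * dl (i :: l) u (t%:C *: z)) <=
     n%:R * A * cnorm z * defect (t%:C *: z) `^ (- e)).
Proof.
move=> [hu _] zB A0 H; have [_ _ rd] := hu l; split=> t t01; have tB := cball_ray zB t01; first exact: rd.
apply: le_trans (normc_sum _ _ _) _.
apply: le_trans (_ : \sum_i (normc (z 0 i) * (A * defect (t%:C *: z) `^ (- e))) <= _).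
  by apply: ler_sum => i _; have h := H i _ tB; move: (dl _ _ _) h => x h; rewrite normcM ler_wpM2l ?normc_ge0.
rewrite -mulr_suml; apply: le_trans (ler_wpM2r _ (sum_coord_le z)) _; first by rewrite mulr_ge0 ?powR_ge0.
by rewrite le_eqVlt; apply/orP; left; apply/eqP; ring.
Qed.

(** Integration along rays, one order at a time. The floor [eta] stands in for the logarithm that an
    exponent 1 would produce and for exponents that would become negative. *)
Lemma integrate_down (t eta : R) (J : nat) : 0 < eta -> exists2 K : R, 0 <= K & forall u (A : R), smooth u -> 0 <= A ->
  (forall l z, size l = J -> cball z -> normc (dl l u z) <= A * defect z `^ (- Num.max (J%:R - t) eta)) ->
  (forall l, (size l < J)%N -> normc (dl l u 0) <= A) ->
  forall l z, (size l <= J)%N -> cball z ->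
    normc (dl l u z) <= K * A * defect z `^ (- Num.max ((size l)%:R - t) eta).
Proof.
move=> eta0.
suff H i : exists2 K : R, 0 <= K & forall u (A : R), smooth u -> 0 <= A ->
  (forall l z, size l = J -> cball z -> normc (dl l u z) <= A * defect z `^ (- Num.max (J%:R - t) eta)) ->
  (forall l, (size l < J)%N -> normc (dl l u 0) <= A) ->
  forall l z, (size l <= J)%N -> (J <= size l + i)%N -> cball z ->
    normc (dl l u z) <= K * A * defect z `^ (- Num.max ((size l)%:R - t) eta).
  have [K K0 HK] := H J; exists K => // u A su A0 h1 h2 l z lJ zB.
  by apply: (HK u A su A0 h1 h2) => //; rewrite leq_addl.
elim: i => [|i [K K0 IH]].
  exists 1 => // u A su A0 h1 h2 l z lJ Jl zB; rewrite addn0 in Jl.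
  by have E : size l = J by [apply/eqP; rewrite eqn_leq lJ]; rewrite mul1r E; exact: h1.
(* The exponent at order j + 1, raised above 1 so that [radial_bound_neg] applies; e j - 1 is
   exactly max(j - t, eta). *)
pose e j := Num.max (Num.max (j.+1%:R - t) eta) (1 + eta).
pose K' := 1 + \sum_(j < J) 2 `^ e j / (e j - 1) * (n%:R * K).
have e1 j : 1 < e j by rewrite lt_max ltrDl eta0 orbT.
have T0 j : 0 <= 2 `^ e j / (e j - 1) * (n%:R * K).
  by apply: mulr_ge0; [rewrite divr_ge0 ?powR_ge0// subr_ge0 ltW|exact: mulr_ge0].
have K'0 : 0 <= K' by rewrite addr_ge0// sumr_ge0.
exists (K + K'); first by rewrite addr_ge0.
move=> u A su A0 h1 h2 l z lJ Jl zB.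
have D0 p : 0 <= defect z `^ p by exact: powR_ge0.
have [Jl'|Jl'] := leqP J (size l + i).
  apply: le_trans (IH u A su A0 h1 h2 l z lJ Jl' zB) _.
  by rewrite ler_wpM2r// ler_wpM2r// lerDl.
have lJ' : (size l < J)%N by apply: leq_ltn_trans Jl'; rewrite leq_addr.
set m := Num.max ((size l)%:R - t) eta.
have E : 1 - e (size l) = - m.
  rewrite /e /m -natr1; set x := (size l)%:R.
  have -> : Num.max (Num.max (x + 1 - t) eta) (1 + eta) = 1 + Num.max (x - t) eta.
    have [h|h] := leP (x - t) eta.
      by have [h'|h'] := leP (x + 1 - t) eta; have [h''|h''] := leP _ (1 + eta) => //; lra.
    by have [h'|h'] := leP (x + 1 - t) eta; have [h''|h''] := leP _ (1 + eta) => //; lra.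
  by ring.
have B i' w : cball w -> normc (dl (i' :: l) u w) <= K * A * defect w `^ (- e (size l)).
  move=> wB; apply: le_trans (IH u A su A0 h1 h2 (i' :: l) w lJ' _ wB) _.
    by rewrite /= addSn -addnS.
  by rewrite ler_wpM2l ?mulr_ge0// le_defect_powN// le_max lexx.
have KA0 : 0 <= K * A by rewrite mulr_ge0.
have [r1 r2] := dl_radial su zB KA0 B.
have nKA : 0 <= n%:R * (K * A) by rewrite mulr_ge0.
apply: le_trans (radial_bound_neg zB nKA (e1 (size l)) r1 r2) _; rewrite E.
have m0 : 0 <= m by rewrite le_max (ltW eta0) orbT.
have p1 := defect_powN_ge1 zB m0.
have h3 : normc (dl l u 0) <= A * defect z `^ (- m) by apply: le_trans (h2 l lJ') _; rewrite ler_peMr.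
have h4 : 2 `^ e (size l) / (e (size l) - 1) * (n%:R * K) <= \sum_(j < J) 2 `^ e j / (e j - 1) * (n%:R * K).
  rewrite (bigD1 (Ordinal lJ'))//= lerDl sumr_ge0//.
have h5 : 2 `^ e (size l) / (e (size l) - 1) * (n%:R * (K * A)) * defect z `^ (- m) <=
    (K' - 1) * (A * defect z `^ (- m)).
  rewrite [K' - 1](_ : _ = \sum_(j < J) 2 `^ e j / (e j - 1) * (n%:R * K)); last by rewrite /K'; ring.
  rewrite (_ : _ * defect z `^ _ = 2 `^ e (size l) / (e (size l) - 1) * (n%:R * K) * (A * defect z `^ (- m))); last by ring.
  by rewrite ler_wpM2r// mulr_ge0.
have h6 : 0 <= K * (A * defect z `^ (- m)) by rewrite !mulr_ge0.
move: h3 h5 h6; rewrite mulrBl mul1r !mulrDl -!mulrA; lra.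
Qed.

(** The last integration starts from an exponent below 1, because t > 0 and eta < 1, and therefore
    loses nothing. *)
Lemma bounded_down (t eta : R) : 0 < t -> 0 < eta -> eta < 1 -> exists2 K : R, 0 <= K & forall u (A : R), smooth u -> 0 <= A ->
  (forall i z, cball z -> normc (dl [:: i] u z) <= A * defect z `^ (- Num.max (1 - t) eta)) ->
  normc (u 0) <= A -> forall z, cball z -> normc (u z) <= K * A.
Proof.
move=> t0 eta0 eta1; pose e := Num.max (1 - t) eta.
have e0 : 0 <= e by rewrite le_max (ltW eta0) orbT.
have e1 : e < 1 by rewrite gt_max eta1 andbT; lra.
have q0 : 0 <= 2 / (1 - e) * n%:R by rewrite mulr_ge0// divr_ge0// subr_ge0 ltW.
exists (1 + 2 / (1 - e) * n%:R); first by rewrite addr_ge0.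
move=> u A su A0 H h0 z zB.
have [r1 r2] := @dl_radial u [::] z A e su zB A0 (fun i w wB => H i w wB).
have nA : 0 <= n%:R * A by rewrite mulr_ge0.
apply: le_trans (radial_bound_pos zB nA e0 e1 r1 r2) _.
by rewrite [leRHS]mulrDl mul1r -[X in _ <= _ + X]mulrA lerD2r.
Qed.

(** Reproduce [u] with the weight D^g, which makes the product |u| D^g bounded. Then j derivatives
    raise the kernel exponent by j, and [forelli_rudin] with M = 1 and b = g + j gives the
    growth. *)
Lemma derivative_growth (g : R) (j : nat) : 0 <= g -> 0 < g + j%:R -> exists2 K : R, 0 <= K &
  forall u (c : 'I_n -> V -> C) (A : R), hol u c -> 0 <= A -> (forall z, cball z -> normc (u z) <= A * defect z `^ (- g)) ->
  forall l z, size l = j -> cball z -> normc (dl l u z) <= K * A * defect z `^ (- (g + j%:R)).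
Proof.
move=> g0 gj; have [lam lam0 hlam] := @reproducing R n (g + 1) (ltr_wpDl g0 ltr01).
have [cF cF0 hF] := @forelli_rudin R n 1 (g + j%:R) ltr01 gj.
have d0 : 0 <= n%:R + (g + 1) by rewrite !addr_ge0.
have p0 : 0 <= poch (n%:R + (g + 1)) j by apply: ltW; apply: poch_gt0; rewrite ltr_wpDl// ltr_wpDl.
pose K := lam^-1 * poch (n%:R + (g + 1)) j * (2 * cF).
have K0 : 0 <= K by rewrite !mulr_ge0// invr_ge0 ltW.
exists K => // u c A hu A0 H l z lj zB; have [cu _ _] := hu.
have cD : contBr (fun w : V => defect w `^ (g + 1 - 1)) by exact: contBr_defectp.
have W0 w : cball w -> 0 <= defect (w : V) `^ (g + 1 - 1) by move=> _; exact: powR_ge0.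
have le w : cball w -> normc (u w) * defect w `^ (g + 1 - 1) <= A.
  move=> wB; have dw := defect_gt0 wB; apply: le_trans (ler_wpM2r (W0 w wB) (H w wB)) _.
  by rewrite -mulrA -powRDp// (_ : _ + _ = 0) ?powRr0 ?mulr1//; ring.
have iu : intB (fun w => normc (u w) * defect w `^ (g + 1 - 1)).
  apply: (@intB_bounded _ _ _ A); first by apply: measB_cont; contB_tac.
  by move=> w wB; rewrite ger0_norm ?le// mulr_ge0 ?normc_ge0 ?W0.
have S := smooth_Hk cu cD W0 iu d0.
have [S' E] := smoothZ (lam%:C)^-1 S.
have uE w : cball w -> u w = (lam%:C)^-1 * Hk (n%:R + (g + 1)) u (fun w => defect w `^ (g + 1 - 1)) w.
  by move=> wB; rewrite /Hk (hlam u c w hu wB iu) mulKf// eq_complex /= negb_and gt_eqF.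
rewrite (dl_eq_ball l S' uE zB) E// (dl_Hk cu cD W0 iu l d0 zB) lj.
have dj : 0 <= n%:R + (g + 1) + j%:R by rewrite addr_ge0.
have := normc_Hk_le cu cD W0 iu l dj zB; move: (Hk _ _ _ _) => X hX.
rewrite !normcM normcV !normc_real (gtr0_norm lam0) (ger0_norm p0) /K -!mulrA.
rewrite ler_wpM2l ?invr_ge0 ?(ltW lam0)// ler_wpM2l//; apply: le_trans hX _.
rewrite ler_pM2l//.
have sE : n%:R + (g + 1) + j%:R = n%:R + 1 + (g + j%:R) by ring.
apply: le_trans (_ : Rint (fun w => A * fr 1 (n%:R + 1 + (g + j%:R)) z w) <= _).
  have s0 : 0 <= n%:R + 1 + (g + j%:R) by rewrite -sE.
  apply: le_Rint.
  - apply: intB_le (intBZ (2 `^ (n%:R + 1 + (g + j%:R)) * defect z `^ (- (n%:R + 1 + (g + j%:R)))) iu).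
      apply: measBM; last exact: intB_meas.
      by apply: measB_powR; apply: measB_cont; exact: contBr_rho.
    move=> w wB; rewrite ger0_norm ?mulr_ge0 ?powR_ge0 ?normc_ge0//.
    by rewrite sE -normc_kern ler_wpM2r ?mulr_ge0 ?powR_ge0 ?normc_ge0 ?kern_le.
  - by apply: intBZ; exact: intB_fr.
  - move=> w wB; rewrite sE /fr subrr powRr0 mulr1 mulrC ler_wpM2r ?powR_ge0//; exact: le.
rewrite RintZ; last by apply: intB_fr => //; rewrite -sE.
by rewrite mulrCA ler_wpM2l//; exact: hF.
Qed.

Lemma cauchy_estimates (J : nat) : exists2 K : R, 0 <= K &
  forall u (c : 'I_n -> V -> C) (A : R), hol u c -> 0 <= A -> (forall z, cball z -> normc (u z) <= A) ->
  forall l z, (size l <= J)%N -> cball z -> normc (dl l u z) <= K * A * defect z `^ (- (size l)%:R).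
Proof.
elim: J => [|J [K K0 IH]].
  exists 1 => // u c A hu A0 H l z; rewrite leqn0 size_eq0 => /eqP -> zB.
  by rewrite mul1r oppr0 powRr0 mulr1; exact: H.
have [K' K'0 H'] := @derivative_growth 0 J.+1 (lexx 0) (ltr_wpDl (lexx 0) (ltr0Sn _ J)).
exists (K + K'); first by rewrite addr_ge0.
move=> u c A hu A0 H l z lJ zB.
have [lJ'|lJ'] := leqP (size l) J.
  apply: le_trans (IH u c A hu A0 H l z lJ' zB) _.
  by rewrite ler_wpM2r ?powR_ge0// ler_wpM2r// lerDl.
have lE : size l = J.+1 by apply/eqP; rewrite eqn_leq lJ.
have H0 w : cball w -> normc (u w) <= A * defect w `^ (- 0) by move=> wB; rewrite oppr0 powRr0 mulr1; exact: H.
apply: le_trans (H' u c A hu A0 H0 l z lE zB) _.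
by rewrite add0r lE ler_wpM2r ?powR_ge0// ler_wpM2r// lerDr.
Qed.

Lemma size_splits l : size (splits l) = (2 ^ size l)%N.
Proof. by elim: l => [//|j l IH] /=; rewrite size_cat !size_map IH expnS mul2n addnn. Qed.

End Bootstrap.

(** * The bootstrap on the order of growth *)

Section BootstrapStep.
Context {R : realType} {n : nat}.
Local Notation C := R[i].
Local Notation V := 'rV[C]_n.
Implicit Types (f g u phi : V -> C) (z w v : V) (l a b : seq 'I_n).

(** The norm of G bounds the derivatives of the symbol in the order of [iterpd], that is along
    sorted sequences. Subsequences of sorted sequences are sorted, so Leibniz terms remain
    controlled. *)
Definition osorted l := sorted (fun i j : 'I_n => (i <= j)%N) l.

Lemma osorted_subseq a l : subseq a l -> osorted l -> osorted a.
Proof. by apply: subseq_sorted => i j k; exact: leq_trans. Qed.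

Lemma exists_osorted l : exists2 l', perm_eq l l' & osorted l'.
Proof.
exists (sort (fun i j : 'I_n => (i <= j)%N) l); first by rewrite perm_sym perm_sort.
by apply: sort_sorted => i j; exact: leq_total.
Qed.

Variables (N tau sg eta c e0 : R) (K : nat) (phi : V -> C).
Hypothesis N0 : 0 < N.
Hypothesis tau0 : 0 < tau.
Hypothesis tauK : tau < K%:R.
Hypothesis sg0 : 0 < sg.
Hypothesis eta0 : 0 < eta.
Hypothesis eta_le : [/\ eta <= 1, 2 * eta <= K%:R - tau & sg + eta <= 1].
Hypothesis c0 : 0 <= c.
Hypothesis e0_gt0 : 0 < e0.
Hypothesis phid : diffk K phi.
Hypothesis phic : forall w, cball w -> normc (phi w) <= c.
Hypothesis phia : forall a w, osorted a -> (0 < size a <= K)%N -> cball w ->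
  normc (dl a phi w) <= c * defect w `^ (- Num.max ((size a)%:R - tau) eta).
Hypothesis phih : forall z w, cball z -> cball w -> normc (phi z - phi w) <= c * rho w z `^ sg.
Hypothesis phis : forall z, cball z -> defect z <= e0 -> e0 <= normc (phi z).

Let W (w : V) := defect w `^ (N - 1).

(* The symbol equation enters only through the growth of the derivatives of [T_phi f] of order [K]. *)
Definition datum f (A : R) := [/\ exists h : 'I_n -> V -> C, hol f h, 0 <= A, forall z, cball z -> normc (f z) <= A &
  forall l z, osorted l -> size l = K -> cball z ->
    normc (dl l (Hk (n%:R + N) (fun w => phi w * f w) W) z) <= A * defect z `^ (- (K%:R - tau))].

(** The constant [B] is uniform over all data, which is what makes the final constant independent of
    f and h. *)
Definition growth (s : R) := exists2 B : R, 0 <= B & forall f A, datum f A ->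
  forall l z, size l = K -> cball z -> normc (dl l f z) <= B * A * defect z `^ (- (K%:R - s)).

Lemma datum_smooth f A : datum f A -> smooth f.
Proof.
move=> [[a hf] A0 fA _]; apply: (smooth_hol ltr01 hf); have [cf _ _] := hf.
apply: (@intB_bounded _ _ _ A); first by apply: measB_cont; contB_tac.
by move=> w wB; rewrite subrr powRr0 mulr1 ger0_norm ?normc_ge0 ?fA.
Qed.

Lemma growth0 : growth 0.
Proof.
have [B B0 H] := @cauchy_estimates R n K; exists B => // f A [[a hf] A0 fA _] l z lK zB.
by rewrite subr0 -lK; apply: (H f a A hf A0 fA) => //; rewrite lK.
Qed.

Lemma lower_growth (s : R) : 0 <= s -> s <= tau -> growth s -> exists2 B : R, 0 <= B & forall f A, datum f A ->
  forall l z, (size l <= K)%N -> cball z ->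
    normc (dl l f z) <= B * A * defect z `^ (- Num.max ((size l)%:R - s) eta).
Proof.
move=> s0 st [B B0 HB]; have [B1 B10 H1] := @integrate_down R n s eta K eta0.
have [B2 B20 H2] := @cauchy_estimates R n K.
exists (B1 * (B + B2)); first by rewrite mulr_ge0// addr_ge0.
move=> f A fA l z lK zB; have [[a hf] A0 fbd _] := fA.
have BA0 : 0 <= (B + B2) * A by rewrite mulr_ge0// addr_ge0.
rewrite -[B1 * (B + B2) * A]mulrA.
apply: (H1 f _ (datum_smooth fA) BA0) => // [l' z' lE z'B|l' lK'].
  apply: le_trans (HB f A fA l' z' lE z'B) _.
  apply: ler_pM; rewrite ?mulr_ge0 ?powR_ge0//; first by rewrite ler_wpM2r// lerDl.
  by apply: le_defect_powN => //; rewrite le_max lexx.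
apply: le_trans (H2 f a A hf A0 fbd l' 0 (ltnW lK') cball0) _.
by rewrite defect0 powR1 mulr1 ler_wpM2r// lerDr.
Qed.

(** With a >= 1 derivatives on phi and b on f, the two growth exponents add up to at most K - s'. A
    maximum equal to [eta] is absorbed by one of s' - s + eta <= 1 <= a, eta <= 1 <= b and 2 eta <=
    K - tau. For b = 0 the boundedness of f enters directly. *)
Lemma split_growth (s s' B A : R) f p l w : 0 <= s -> s' <= tau -> s' - s <= sg ->
  0 <= A -> 0 <= B -> osorted l -> size l = K -> cball w -> p \in splits l -> (0 < size p.1)%N ->
  (forall z, cball z -> normc (f z) <= A) ->
  (forall l z, (size l <= K)%N -> cball z -> normc (dl l f z) <= B * A * defect z `^ (- Num.max ((size l)%:R - s) eta)) ->
  normc (dl p.1 phi w * dl p.2 f w) <= c * (1 + B) * A * defect w `^ (- (K%:R - s')).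
Proof.
move=> s0 s't s's A0 B0 sl lK wB pl p1 fA H; have [et1 et2 et3] := eta_le.
have ps := splits_size pl; rewrite lK in ps.
have h1 : normc (dl p.1 phi w) <= c * defect w `^ (- Num.max ((size p.1)%:R - tau) eta).
  apply: phia => //; first exact: osorted_subseq (splits_subseq pl) sl.
  by rewrite p1 -ps leq_addr.
have dw := defect_gt0 wB.
have KE : K%:R = (size p.1)%:R + (size p.2)%:R :> R by rewrite -natrD ps.
have a1 : 1 <= (size p.1)%:R :> R by rewrite ler1n.
have B1A : 0 <= (1 + B) * A by rewrite mulr_ge0// addr_ge0.
have fin (e : R) : normc (dl p.2 f w) <= (1 + B) * A * defect w `^ (- e) ->
    Num.max ((size p.1)%:R - tau) eta + e <= K%:R - s' ->
    normc (dl p.1 phi w * dl p.2 f w) <= c * (1 + B) * A * defect w `^ (- (K%:R - s')).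
  move: (dl _ _ _) h1 (dl _ _ _) => x h1 y h2 ee; rewrite normcM.
  apply: le_trans (ler_pM (normc_ge0 _) (normc_ge0 _) h1 h2) _.
  rewrite [leLHS](_ : _ = c * (1 + B) * A * (defect w `^ (- Num.max ((size p.1)%:R - tau) eta) * defect w `^ (- e))); last by ring.
  have q0 : 0 <= c * (1 + B) * A by rewrite -mulrA mulr_ge0.
  by rewrite -powRDp// -opprD ler_wpM2l// le_defect_powN.
have [b0|b0] := posnP (size p.2).
  apply: (fin 0).
    rewrite oppr0 powRr0 mulr1 (size0nil b0) /=; apply: le_trans (fA w wB) _.
    by rewrite ler_peMl// lerDl.
  rewrite b0 addr0 in KE; rewrite addr0 -KE ge_max; apply/andP; move: eta0 => et0; split; lra.
apply: (fin (Num.max ((size p.2)%:R - s) eta)).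
  apply: le_trans (H p.2 w _ wB) _; first by rewrite -ps leq_addl.
  by rewrite ler_wpM2r ?powR_ge0// ler_wpM2r// lerDr.
have b1 : 1 <= (size p.2)%:R :> R by rewrite ler1n.
have [h|h] := leP ((size p.1)%:R - tau) eta; have [h'|h'] := leP ((size p.2)%:R - s) eta; rewrite KE in et2 *; lra.
Qed.

(** The reproducing formula for the derivative of f and the by-parts form of the derivative of T_phi
    f are given the same kernel, of exponent n + N + K. Their difference consists of (phi(z) -
    phi(w)) times the top derivative of f and of the other Leibniz terms, each matched with
    [forelli_rudin] at b = K - s'. *)
Lemma growth_step (s : R) : 0 <= s -> s <= tau -> growth s -> growth (Num.min (s + sg) tau).
Proof.
move=> s0 st gs; set s' := Num.min (s + sg) tau.
have [et1 et2 et3] := eta_le.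
have s't : s' <= tau by rewrite ge_min lexx orbT.
have s's : s' - s <= sg by rewrite lerBlDl ge_min lexx.
have ss' : s <= s' by rewrite le_min st andbT lerDl ltW.
have s'0 : 0 <= s' by exact: le_trans ss'.
have Ks' : 0 < K%:R - s' by move: tauK; lra.
have [B B0 HB] := gs; have [B1 B10 HB1] := lower_growth s0 st gs.
have [B2 B20 HB2] := growth0.
pose M := N + K%:R.
have M0 : 0 < M by rewrite ltr_wpDr.
have [lam lam0 hlam] := @reproducing R n M M0.
(* The first instance serves the top-order term, where rho^{s'-s} is taken from the kernel; the
   second serves the Leibniz terms, which already grow like D^{-(K-s')}. *)
have [F1 F10 hF1] := @forelli_rudin R n (N + s) (K%:R - s') (ltr_wpDr s0 N0) Ks'.
have [F2 F20 hF2] := @forelli_rudin R n (N + s') (K%:R - s') (ltr_wpDr s'0 N0) Ks'.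
pose d := n%:R + N.
have d0 : 0 < d by rewrite ltr_wpDl.
have pd0 := poch_gt0 K d0; have pN0 := poch_gt0 K N0.
pose c1 := poch N K / poch d K.
have c10 : 0 <= c1 by rewrite divr_ge0 ?ltW.
(* Since rho <= 2 and s' - s <= sg, the Hoelder power rho^sg is weakened to rho^(s' - s) at the cost
   of this power of 2. *)
pose cs := c * 2 `^ (sg - (s' - s)) * B.
pose cr := (2 ^ K)%:R * (c * (1 + B1)).
have cs0 : 0 <= cs by rewrite !mulr_ge0 ?powR_ge0.
have cr0 : 0 <= cr by rewrite !mulr_ge0// addr_ge0.
pose T := c1 + 2 * (cs * F1 + cr * F2).
have T0 : 0 <= T by rewrite addr_ge0// mulr_ge0// addr_ge0// mulr_ge0.
exists (T / (e0 * lam) + B2 * e0 `^ (- K%:R)).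
  by rewrite addr_ge0// ?mulr_ge0 ?powR_ge0// invr_ge0 mulr_ge0// ltW.
move=> f A fA l0 z l0K zB.
have [[a hf] A0 fbd hX] := fA; have [cf _ _] := hf.
have sf := datum_smooth fA; have [hf' pf] := sf.
(* Derivatives of [f] commute, so the sequence may be sorted, as the bounds on the derivatives of
   phi require. *)
have [l l0l sl] := exists_osorted l0; rewrite (pf l0 l z zB l0l).
have lK : size l = K by rewrite -(perm_size l0l).
have dz := defect_gt0 zB.
set E := defect z `^ (- (K%:R - s')).
have E0 : 0 <= E by exact: powR_ge0.
have E1 : 1 <= E by apply: defect_powN_ge1 => //; exact: ltW.
have AE : 0 <= A * E by rewrite mulr_ge0.
(* Away from the sphere D is bounded below and the Cauchy estimates suffice. *)
have [zd|zd] := lerP (defect z) e0; last first.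
  apply: le_trans (HB2 f A fA l z lK zB) _; rewrite subr0.
  have h : defect z `^ (- K%:R) <= e0 `^ (- K%:R) by rewrite le_powRN// ltW.
  apply: le_trans (_ : B2 * e0 `^ (- K%:R) * (A * E) <= _); last first.
    by rewrite mulrDl mulrDl -!mulrA lerDr mulr_ge0// mulr_ge0// invr_ge0 mulr_ge0// ltW.
  rewrite (_ : _ * (A * E) = B2 * A * (e0 `^ (- K%:R) * E)); last by ring.
  rewrite ler_wpM2l ?mulr_ge0//; apply: le_trans h _; rewrite ler_peMr ?powR_ge0//.
have c1' := phid; have [cdl _ _] := c1'.
have cphi : contB phi by exact: (cdl [::]).
pose u w := phi w * f w.
have cu : contB u by rewrite /u; contB_tac.
have cW : contBr W by exact: contBr_defectp.
have W0 w : cball w -> 0 <= W w by move=> _; exact: powR_ge0.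
have hc b w : subseq b l -> cball w -> normc (dl b phi w) <= c * defect w `^ (- (size b)%:R).
  move=> sb wB; have [bn|bn] := posnP (size b).
    by rewrite bn (size0nil bn) oppr0 powRr0 mulr1; exact: phic.
  apply: le_trans (phia _ _ wB) _.
  - exact: osorted_subseq sb sl.
  - by rewrite bn -lK size_subseq.
  rewrite ler_wpM2l// le_defect_powN// ge_max; have : 1 <= (size b)%:R :> R by rewrite ler1n.
  by move=> h1; apply/andP; split; lra.
have [Bc Bc0 HBc] := @cauchy_estimates R n K.
have hA b w : (size b <= size l)%N -> cball w -> normc (dl b f w) <= Bc * A * defect w `^ (- (size b)%:R).
  by rewrite lK => bK wB; exact: (HBc f a A hf A0 fbd).
have lK' : (size l <= K)%N by rewrite lK.
have BA0 : 0 <= Bc * A by rewrite mulr_ge0.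
have ib : ibpable N u l := ibpable_prod N0 phid sf lK' c0 BA0 hc hA.
have dK0 : 0 <= d + K%:R by rewrite addr_ge0// ltW.
have cG : contB (fun w => kern (d + K%:R) w z) by contB_tac.
have hG j : exists2 Gb, contB Gb & forall w, cball w -> wd j (fun w => kern (d + K%:R) w z) w 0 (Gb w).
  exists (fun w => (d + K%:R)%:C * z 0 j * kern (d + K%:R + 1) w z); first by contB_tac.
  by move=> w wB; exact: wd_kern.
have GB w : cball w -> normc (kern (d + K%:R) w z) <= 2 `^ (d + K%:R) * defect z `^ (- (d + K%:R)).
  by move=> wB; exact: kern_le.
have cv := conv N0 ib cG hG GB.
have [cdu idu] := ibpable_hd ib.
have cDM : contBr (fun w : V => defect w `^ (M - 1)) by exact: contBr_defectp.
have DM0 w : cball w -> 0 <= defect (w : V) `^ (M - 1) by move=> _; exact: powR_ge0.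
have iW : intB (fun w => normc (u w) * W w).
  apply: (@intB_le _ _ _ (fun w => c * A * defect w `^ (N - 1))).
  - by apply: measB_cont; contB_tac.
  - move=> w wB; rewrite ger0_norm ?mulr_ge0 ?normc_ge0 ?W0// /W ler_wpM2r ?powR_ge0// /u normcM.
    by apply: ler_pM; rewrite ?normc_ge0 ?phic ?fbd.
  - by apply: intBZ; exact: intB_defectp.
rewrite lK -/M in cv idu.
(* Up to Pochhammer constants and the normalization c_N this is the derivative of T_phi f along [l],
   which [datum] bounds. *)
pose X := cintegral (fun w => kern (d + K%:R) w z * (dl l u w * (defect w `^ (M - 1))%:C)).
have XE : dl l (Hk d u W) z = (poch d K)%:C * (((poch N K)^-1)%:C * X).
  rewrite (dl_Hk cu cW W0 iW l (ltW d0) zB) lK -cv; congr (_ * _).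
  by apply: eq_cintegral => w _; ring.
have X1 : normc X <= c1 * (A * E).
  have := hX l z sl lK zB; rewrite -/d -/u XE.
  move: (X) => x; rewrite !normcM !normc_real (gtr0_norm pd0) gtr0_norm ?invr_gt0// => h.
  have : poch d K / poch N K * normc x <= A * E.
    rewrite -mulrA; apply: le_trans h _; rewrite ler_wpM2l//; apply: le_defect_powN => //; lra.
  move=> h2; rewrite (_ : normc x = c1 * (poch d K / poch N K * normc x)).
    by rewrite ler_wpM2l.
  by rewrite /c1; field; rewrite !gt_eqF.
have nM : n%:R + M = d + K%:R by rewrite /M /d; ring.
have cdf : contB (dl l f) by have [] := hf' l.
have idf : intB (fun w => normc (dl l f w) * defect w `^ (M - 1)).
  apply: (@intB_le _ _ _ (fun w => B2 * A * defect w `^ (N - 1))).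
  - by apply: measB_cont; contB_tac.
  - move=> w wB; have dw := defect_gt0 wB; rewrite ger0_norm ?mulr_ge0 ?normc_ge0 ?powR_ge0//.
    apply: le_trans (ler_wpM2r (powR_ge0 _ _) (HB2 f A fA l w lK wB)) _.
    rewrite -[leLHS]mulrA -powRDp// subr0 (_ : _ + _ = N - 1)//; rewrite /M; ring.
  - by apply: intBZ; exact: intB_defectp.
have rep := hlam (dl l f) _ z (hf' l) zB idf; rewrite nM in rep.
have key : phi z * (lam%:C * dl l f z) - X = cintegral (fun w => kern (d + K%:R) w z *
    ((phi z * dl l f w - dl l u w) * (defect w `^ (M - 1))%:C)).
  have i1 := cintbleM_le cG cdf cDM DM0 GB idf; have i2 := cintbleM_le cG cdu cDM DM0 GB idu.
  rewrite -rep /X -cintegralZ// -cintegralN// -cintegralD; first last.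
  - exact: cintbleN.
  - exact: cintbleZ.
  by apply: eq_cintegral => w _; ring.
have [sp [spE sp1]] := splits_rcons l.
have sz : (size sp <= 2 ^ K)%N by rewrite -lK -size_splits spE size_rcons leqnSn.
have leib w : cball w -> phi z * dl l f w - dl l u w =
    (phi z - phi w) * dl l f w - \sum_(p <- sp) dl p.1 phi w * dl p.2 f w.
  by move=> wB; rewrite (leibniz phid sf lK' wB) spE -cats1 big_cat big_seq1 /=; ring.
have fr10 : 0 <= n%:R + (N + s) + (K%:R - s').
  exact: addr_ge0 (addr_ge0 (ler0n _ _) (addr_ge0 (ltW N0) s0)) (ltW Ks').
have fr20 : 0 <= n%:R + (N + s') + (K%:R - s').
  exact: addr_ge0 (addr_ge0 (ler0n _ _) (addr_ge0 (ltW N0) s'0)) (ltW Ks').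
have if1 := intB_fr (ltr_wpDr s0 N0) fr10 zB.
have if2 := intB_fr (ltr_wpDr s'0 N0) fr20 zB.
have bnd : normc (phi z * (lam%:C * dl l f z) - X) <= 2 * Rint (fun w =>
    cs * A * fr (N + s) (n%:R + (N + s) + (K%:R - s')) z w
    + cr * A * fr (N + s') (n%:R + (N + s') + (K%:R - s')) z w).
  rewrite key; apply: normc_cintegral_le; last by apply: intBD; exact: intBZ.
    by apply: measC_cont; contB_tac.
  move=> w wB; have dw := defect_gt0 wB; have rw := rho_gt0 wB zB.
  have k1 := normc_kern (d + K%:R) w z; move: (kern _ w z) k1 => k k1.
  have P1 : normc ((phi z - phi w) * dl l f w) <= cs * A * (rho w z `^ (s' - s) * defect w `^ (- (K%:R - s))).
    have h1 := phih zB wB; have h2 := HB f A fA l w lK wB.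
    move: (phi z - phi w) (dl l f w) h1 h2 => x y h1 h2; rewrite normcM.
    apply: le_trans (ler_pM (normc_ge0 _) (normc_ge0 _) h1 h2) _.
    have h3 : rho w z `^ sg <= rho w z `^ (s' - s) * 2 `^ (sg - (s' - s)).
      have -> : rho w z `^ sg = rho w z `^ (s' - s) * rho w z `^ (sg - (s' - s)).
        by rewrite -powRDp//; congr (_ `^ _); ring.
      rewrite ler_wpM2l ?powR_ge0// ge0_ler_powR ?nnegrE ?subr_ge0 ?(ltW rw)//.
      by apply: rho_le2; apply: ltW.
    rewrite /cs (_ : _ * (_ * _ * _) = (c * B * A * defect w `^ (- (K%:R - s))) * rho w z `^ sg); last by ring.
    rewrite [leRHS](_ : _ = (c * B * A * defect w `^ (- (K%:R - s))) * (rho w z `^ (s' - s) * 2 `^ (sg - (s' - s)))); last by ring.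
    by rewrite ler_wpM2l// !mulr_ge0 ?powR_ge0.
  have P2 : normc (\sum_(p <- sp) dl p.1 phi w * dl p.2 f w) <= cr * A * defect w `^ (- (K%:R - s')).
    apply: le_trans (normc_sum _ _ _) _.
    apply: le_trans (_ : \sum_(p <- sp) (c * (1 + B1) * A * defect w `^ (- (K%:R - s'))) <= _).
      rewrite big_seq [leRHS]big_seq; apply: ler_sum => p psp.
      apply: (@split_growth s s' B1 A f p l w) => //; last 2 first.
      - exact: sp1.
      - exact: HB1 fA.
      by rewrite spE mem_rcons inE psp orbT.
    rewrite big_const_seq count_predT iter_addr addr0 -[leLHS]mulr_natl /cr.
    rewrite [leRHS](_ : _ = (2 ^ K)%:R * (c * (1 + B1) * A * defect w `^ (- (K%:R - s')))); last by ring.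
    by rewrite ler_wpM2r ?ler_nat// !mulr_ge0 ?powR_ge0// addr_ge0.
  rewrite leib//; move: (phi z - phi w) (dl l f w) (\sum_(p <- sp) _) P1 P2 => x y S P1 P2.
  rewrite normcM k1 normcM normc_real (ger0_norm (powR_ge0 _ _)).
  have P3 : normc (x * y - S) <= cs * A * (rho w z `^ (s' - s) * defect w `^ (- (K%:R - s))) + cr * A * defect w `^ (- (K%:R - s')).
    by apply: le_trans (le_normcD _ _) _; rewrite normc_opp lerD.
  apply: le_trans (ler_wpM2l (powR_ge0 _ _) (ler_wpM2r (powR_ge0 _ _) P3)) _.
  rewrite le_eqVlt; apply/orP; left; apply/eqP; rewrite /fr.
  have Q1 : rho w z `^ (- (n%:R + (N + s) + (K%:R - s'))) = rho w z `^ (- (d + K%:R)) * rho w z `^ (s' - s).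
    by rewrite -powRDp//; congr (_ `^ _); rewrite /d; ring.
  have Q2 : defect w `^ (N + s - 1) = defect w `^ (- (K%:R - s)) * defect w `^ (M - 1).
    by rewrite -powRDp//; congr (_ `^ _); rewrite /M; ring.
  have Q3 : - (n%:R + (N + s') + (K%:R - s')) = - (d + K%:R) by rewrite /d; ring.
  have Q4 : defect w `^ (N + s' - 1) = defect w `^ (- (K%:R - s')) * defect w `^ (M - 1).
    by rewrite -powRDp//; congr (_ `^ _); rewrite /M; ring.
  by rewrite Q1 Q2 Q3 Q4; ring.
move: bnd; rewrite RintD; [|exact: intBZ|exact: intBZ].
rewrite !RintZ// => bnd.
have bnd2 : normc (phi z * (lam%:C * dl l f z)) <= T * (A * E).
  rewrite -[phi z * _](subrK X); apply: le_trans (le_normcD _ _) _.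
  have b1 : cs * A * Rint (fr (N + s) (n%:R + (N + s) + (K%:R - s')) z) <= cs * A * (F1 * E).
    by rewrite ler_wpM2l ?mulr_ge0//; exact: hF1.
  have b2 : cr * A * Rint (fr (N + s') (n%:R + (N + s') + (K%:R - s')) z) <= cr * A * (F2 * E).
    by apply: (ler_wpM2l (mulr_ge0 cr0 A0)); exact: hF2.
  rewrite [leRHS](_ : _ = 2 * (cs * A * (F1 * E) + cr * A * (F2 * E)) + c1 * (A * E)); last by rewrite /T; ring.
  by apply: lerD => //; apply: le_trans bnd _; rewrite ler_pM2l// lerD.
have bnd3 : e0 * lam * normc (dl l f z) <= T * (A * E).
  have h1 := phis zB zd; move: (phi z) (dl l f z) h1 bnd2 => x y h1; rewrite !normcM normc_real gtr0_norm// => h2.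
  by apply: le_trans h2; rewrite -mulrA ler_wpM2r// mulr_ge0 ?normc_ge0// ltW.
have el : 0 < e0 * lam by rewrite mulr_gt0.
rewrite mulrC -ler_pdivlMr// in bnd3; apply: le_trans bnd3 _.
rewrite -[_ * A * E]mulrA [leRHS]mulrDl (_ : T * (A * E) / _ = T / (e0 * lam) * (A * E)); last by ring.
by rewrite lerDl !mulr_ge0 ?powR_ge0.
Qed.

Lemma growth_tau : growth tau.
Proof.
have H (i : nat) : exists2 s : R, [/\ 0 <= s, s <= tau & Num.min (i%:R * sg) tau <= s] & growth s.
  elim: i => [|i [s [s0 st si] gs]].
    by exists 0; [split; rewrite ?(ltW tau0)// mul0r ge_min lexx|exact: growth0].
  exists (Num.min (s + sg) tau); last exact: growth_step.
  split; first by rewrite le_min (ltW tau0) andbT addr_ge0// ltW.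
    by rewrite ge_min lexx orbT.
  have h0 : Num.min (i.+1%:R * sg) tau <= tau by rewrite ge_min lexx orbT.
  rewrite le_min h0 andbT -natr1 mulrDl mul1r.
  move: si; rewrite ge_min => /orP[h|h]; rewrite ge_min; apply/orP; [left; rewrite lerD2r//|right].
  by apply: le_trans h _; rewrite lerDl ltW.
have [s [s0 st si] gs] := H (Num.bound (tau / sg)).
suff -> : tau = s by [].
apply/eqP; rewrite eq_le st andbT; move: si; rewrite ge_min => /orP[h|//].
apply: le_trans h; rewrite -ler_pdivrMr//; apply: ltW; apply: archi_boundP.
by rewrite divr_ge0// ltW.
Qed.

End BootstrapStep.

(** * From multi-indices to index sequences *)

Section MultiIndices.
Context {R : realType} {n : nat}.
Local Notation C := R[i].
Local Notation V := 'rV[C]_n.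
Implicit Types (f g u phi : V -> C) (z w v : V) (l a b : seq 'I_n).

Definition expand (al : 'I_n -> nat) : seq 'I_n := flatten [seq nseq (al i) i | i <- enum 'I_n].

Lemma iterpd_dl al u : iterpd pd al u = dl (expand al) u.
Proof.
rewrite /iterpd /expand /dl; elim: (enum 'I_n) => [//|i e IH] /=.
by rewrite foldr_cat -IH; elim: (al i) => [//|m IHm] /=; rewrite IHm.
Qed.

Lemma size_expand al : size (expand al) = (\sum_i al i)%N.
Proof.
rewrite /expand size_flatten /shape -map_comp sumnE big_map big_enum /=.
by apply: eq_bigr => i _; rewrite size_nseq.
Qed.

Lemma count_expand al i : count_mem i (expand al) = al i.
Proof.
rewrite /expand count_flatten -map_comp sumnE big_map big_enum /= (bigD1 i)//=.
rewrite count_nseq /= eqxx mul1n big1 ?addn0// => j ji.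
by rewrite count_nseq /= (negbTE ji) mul0n.
Qed.

Lemma osorted_expand al : osorted (expand al).
Proof.
have tr : transitive (fun i j : 'I_n => (i <= j)%N) by move=> i j k; exact: leq_trans.
have sE : pairwise (fun i j : 'I_n => (i <= j)%N) (enum 'I_n).
  rewrite -sorted_pairwise//; have := iota_sorted 0 n; rewrite -val_enum_ord sorted_map.
  exact.
rewrite /osorted sorted_pairwise// /expand; elim: (enum 'I_n) sE => [//|i e IH] /= /andP[ie pe].
rewrite pairwise_cat IH// andbT; apply/andP; split.
  apply/allrelP => x y /nseqP[-> _] /flattenP[s /mapP[j je ->] /nseqP[-> _]].
  by move/allP: ie => /(_ j je).
by elim: (al i) => [//|m IHm] /=; rewrite IHm andbT; apply/allP => x /nseqP[-> _].
Qed.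

Lemma expand_count l : osorted l -> expand (fun i => count_mem i l) = l.
Proof.
move=> sl; apply: (@sorted_eq _ (fun i j : 'I_n => (i <= j)%N)) => //.
- by move=> i j k; exact: leq_trans.
- by move=> i j ij; apply/val_inj/anti_leq.
- exact: osorted_expand.
- by apply/allP => i _ /=; rewrite count_expand.
Qed.

Definition mindex l : {ffun 'I_n -> 'I_(size l).+1} := [ffun i => inord (count_mem i l)].

Lemma mindexE l i : mindex l i = count_mem i l :> nat.
Proof. by rewrite ffunE inordK// ltnS count_size. Qed.

Lemma sum_count l : (\sum_i count_mem i l)%N = size l.
Proof.
by elim: l => [|j l IH] /=; [rewrite big1|rewrite big_split /= IH (bigD1 j)//= eqxx big1 ?addn0// => i; rewrite eq_sym => /negbTE ->].
Qed.

Lemma dl_le_norm_pd l u z : osorted l -> normc (dl l u z) <= norm_pd (size l) u z.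
Proof.
move=> sl; rewrite /norm_pd (bigD1 (mindex l))/=; last first.
  by apply/eqP; rewrite -[RHS]sum_count; apply: eq_bigr => i _; rewrite mindexE.
rewrite (_ : iterpd pd (fun i => mindex l i) u = dl l u).
  by rewrite lerDl; apply: sumr_ge0 => b _; rewrite normc_ge0.
rewrite iterpd_dl -[in RHS](expand_count sl); congr (dl (flatten _) u).
by apply: eq_map => i; rewrite mindexE.
Qed.

Lemma iterpd0 (D : 'I_n -> (V -> C) -> V -> C) u : iterpd D (fun=> 0%N) u = u.
Proof. by rewrite /iterpd; elim: (enum 'I_n) => [//|i e IH] /=. Qed.

Lemma dl_le_norm_d l u z : osorted l -> normc (dl l u z) <= norm_d (size l) u z.
Proof.
move=> sl; pose z0 : {ffun 'I_n -> 'I_(size l).+1} := [ffun=> ord0].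
have z0E : (fun i => z0 i : nat) = (fun=> 0%N) by apply/funext => i; rewrite ffunE.
have z0s : (\sum_i z0 i)%N = 0%N by apply: big1 => i _; rewrite ffunE.
rewrite /norm_d (bigD1 (mindex l, z0))/=; last first.
  by apply/eqP; rewrite z0s addn0 -[RHS]sum_count; apply: eq_bigr => i _; rewrite mindexE.
rewrite z0E iterpd0 (_ : iterpd pd (fun i => mindex l i) u = dl l u).
  by rewrite lerDl; apply: sumr_ge0 => b _; rewrite normc_ge0.
rewrite iterpd_dl -[in RHS](expand_count sl); congr (dl (flatten _) u).
by apply: eq_map => i; rewrite mindexE.
Qed.

(** The ball is open, so derivatives at its points ignore the values outside; this matters because
    functions are known on the ball only. *)
Lemma zero_ball_pd (D : 'I_n -> (V -> C) -> V -> C) (j : 'I_n) u : D = pd \/ D = pdbar -> (forall z, cball z -> u z = 0) ->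
  forall z, cball z -> D j u z = 0.
Proof.
move=> HD u0 z zB; have W : wd j u z 0 0.
  by apply: (wd_ball zB (f := fun=> 0)) => [w wB|]; [rewrite u0|exact: wd_cst].
by case: HD => ->; [exact: wd_pd W|exact: wd_pdbar W].
Qed.

Lemma zero_ball_iterpd (D : 'I_n -> (V -> C) -> V -> C) al u : D = pd \/ D = pdbar -> (forall z, cball z -> u z = 0) ->
  forall z, cball z -> iterpd D al u z = 0.
Proof.
move=> HD u0; rewrite /iterpd; elim: (enum 'I_n) => [//|i e IH] /=.
by elim: (al i) => [//|m IHm] /=; exact: zero_ball_pd.
Qed.

(** The innermost antiholomorphic derivative is already 0 on the ball, and further derivatives
    preserve this. *)
Lemma iterpd_pdbar_hol al u (h : 'I_n -> V -> C) : hol u h -> (exists i, al i != 0%N) ->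
  forall z, cball z -> iterpd pdbar al u z = 0.
Proof.
move=> hu [i ai]; rewrite /iterpd; have : i \in enum 'I_n by rewrite mem_enum.
have U0 w j : cball w -> pdbar j u w = 0 by exact: hol_pdbar0 hu.
suff H e : (forall z, cball z -> foldr (fun i g => iter (al i) (pdbar i) g) u e z = 0) \/
   (foldr (fun i g => iter (al i) (pdbar i) g) u e = u /\ forall j, j \in e -> al j = 0%N).
  by case: (H (enum 'I_n)) => [//|[_ h2]] /h2 a0; rewrite a0 in ai.
elim: e => [|j e [IH|[IH1 IH2]]] /=; first by right.
  by left; elim: (al j) => [//|m IHm] /=; apply: zero_ball_pd => //; right.
rewrite IH1; case E : (al j) => [|m] /=.
  by right; split=> // k; rewrite inE => /orP[/eqP ->//|]; exact: IH2.
left; elim: m {E} => [|m IHm] /=; first by move=> z zB; exact: U0.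
by apply: zero_ball_pd => //; right.
Qed.

(** The terms without antiholomorphic derivatives alone survive; the cardinal is a crude count of
    all pairs of indices. *)
Lemma norm_d_le j u (h : 'I_n -> V -> C) z (X : R) : hol u h -> cball z -> 0 <= X ->
  (forall l, size l = j -> normc (dl l u z) <= X) ->
  norm_d j u z <= #|{: {ffun 'I_n -> 'I_j.+1} * {ffun 'I_n -> 'I_j.+1}}|%:R * X.
Proof.
move=> hu zB X0 H; rewrite /norm_d.
apply: le_trans (_ : \sum_(ab : {ffun 'I_n -> 'I_j.+1} * {ffun 'I_n -> 'I_j.+1}) X <= _); last first.
  by rewrite sumr_const mulr_natl.
rewrite big_mkcond; apply: ler_sum => -[al be] _ /=; case: eqP => // s.
have [/existsP[i bi]|] := boolP [exists i, (be i : nat) != 0%N].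
  rewrite (zero_ball_iterpd _ _ _ zB) ?normc0//; first by left.
  by apply: (iterpd_pdbar_hol hu); exists i.
rewrite negb_exists => /forallP b0.
have bE : (fun i => be i : nat) = (fun=> 0%N) by apply/funext => i; apply/eqP; have := b0 i; rewrite negbK.
rewrite bE iterpd0 iterpd_dl; apply: H; rewrite size_expand; apply: etrans s.
by rewrite [X in _ = (_ + X)%N]big1 ?addn0// => i _; apply/eqP; have := b0 i; rewrite negbK.
Qed.

Lemma norm_d0 j z : cball z -> norm_d j (fun _ : V => 0 : C) z = 0.
Proof.
move=> zB; rewrite /norm_d big1// => ab _.
rewrite (zero_ball_iterpd _ _ _ zB) ?normc0//; first by left.
by apply: zero_ball_iterpd => //; right.
Qed.

Lemma rderive_ball f g v z : cball z -> (forall w, cball w -> f w = g w) -> rderivable f v z ->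
  rderivable g v z /\ rderive v g z = rderive v f z.
Proof.
move=> zB fg /rderivable_rder h; have h' := rder_ball zB fg h.
by split; [exact: rder_rderivable h'|exact: rder_rderive].
Qed.

Lemma Ck_ball_eq k f g : (forall z, cball z -> f z = g z) -> Ck_ball k f -> Ck_ball k g.
Proof.
elim: k f g => [|k IH] f g fg [cf hf]; split.
- by move=> z zB; exact: near_eq_continuous zB fg (cf z zB).
- by [].
- by move=> z zB; exact: near_eq_continuous zB fg (cf z zB).
move=> j v jv; have [d1 d2] := hf j v jv; split.
  by move=> z zB; have [] := rderive_ball zB fg (d1 z zB).
by apply: IH d2 => z zB; have [_ ->] := rderive_ball zB fg (d1 z zB).
Qed.

Lemma Ck_ballD k f g : Ck_ball k f -> Ck_ball k g -> Ck_ball k (fun z => f z + g z).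
Proof.
elim: k f g => [|k IH] f g [cf hf] [cg hg].
  by split; [move=> z zB; exact: continuousDc (cf z zB) (cg z zB)|].
split; first by move=> z zB; exact: continuousDc (cf z zB) (cg z zB).
move=> j v jv; have [d1 d2] := hf j v jv; have [d3 d4] := hg j v jv.
have rd z : cball z -> rder (fun z => f z + g z) v z (rderive v f z + rderive v g z).
  by move=> zB; apply: rderD; apply: rderivable_rder; [exact: d1|exact: d3].
split; first by move=> z /rd; exact: rder_rderivable.
by apply: Ck_ball_eq (IH _ _ d2 d4) => z /rd /rder_rderive ->.
Qed.

Lemma Ck_ballZ k (c : C) f : Ck_ball k f -> Ck_ball k (fun z => c * f z).
Proof.
elim: k f => [|k IH] f [cf hf].
  by split; [move=> z zB; exact: continuousMc (@continuous_cstc _ _ c z) (cf z zB)|].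
split; first by move=> z zB; exact: continuousMc (@continuous_cstc _ _ c z) (cf z zB).
move=> j v jv; have [d1 d2] := hf j v jv.
have rd z : cball z -> rder (fun z => c * f z) v z (c * rderive v f z).
  move=> zB; apply: rder_eq (rderM (rder_cst c v z) (rderivable_rder (d1 z zB))) _.
  by rewrite mul0r addr0.
split; first by move=> z /rd; exact: rder_rderivable.
by apply: Ck_ball_eq (IH _ d2) => z /rd /rder_rderive ->.
Qed.

Lemma Ck_ball_pd k f j : Ck_ball k.+1 f -> Ck_ball k (pd j f) /\ Ck_ball k (pdbar j f).
Proof.
move=> [_ hf]; have [_ dx] := hf j (dirx j) (or_introl erefl); have [_ dy] := hf j (diry j) (or_intror erefl).
split; apply: Ck_ballZ.
  apply: Ck_ball_eq (Ck_ballD dx (Ck_ballZ (- (0 +i* 1)) dy)) => z _; by rewrite mulNr.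
exact: Ck_ballD dx (Ck_ballZ _ dy).
Qed.

Lemma Ck_ball_dl k f l : (size l <= k)%N -> Ck_ball k f -> Ck_ball (k - size l) (dl l f).
Proof.
move=> lk hf; elim: l lk => [|j l IH] lk; first by rewrite subn0.
have := IH (ltnW lk); rewrite (_ : (k - size l = (k - size (j :: l)).+1)%N).
  by move=> /(Ck_ball_pd j) [].
by rewrite /= subnSK.
Qed.

Transparent contB.
Lemma Ck_ball_contB k f : Ck_ball k f -> contB f.
Proof. by case: k => [|k] []. Qed.
Opaque contB.

Lemma diffk_Ck k f : Ck_ball k f -> diffk k f.
Proof.
move=> hf; split.
- by move=> l lk; exact: Ck_ball_contB (Ck_ball_dl lk hf).
- move=> l j lk; have := Ck_ball_dl (ltnW lk) hf.
  by rewrite -(subnSK lk) => /(Ck_ball_pd j)[_ h]; exact: Ck_ball_contB h.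
- move=> l j w lk wB; have := Ck_ball_dl (ltnW lk) hf; rewrite -(subnSK lk) => -[_ hg].
  apply: wdP.
    by have [h _] := hg j (dirx j) (or_introl erefl); exact: h.
  by have [h _] := hg j (diry j) (or_intror erefl); exact: h.
Qed.

Lemma diffk_le k k' f : (k' <= k)%N -> diffk k f -> diffk k' f.
Proof.
move=> kk [h1 h2 h3]; split=> [l lk|l j lk|l j w lk wB].
- by apply: h1; exact: leq_trans kk.
- by apply: h2; exact: leq_trans kk.
- by apply: h3 => //; exact: leq_trans kk.
Qed.

End MultiIndices.

(** * Norms of the function spaces *)

Section Norms.
Context {R : realType} {n : nat}.
Local Notation C := R[i].
Local Notation V := 'rV[C]_n.
Implicit Types (f g u h phi : V -> C) (z w v : V) (l a b : seq 'I_n) (F : V -> R).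

Lemma le_sup_ball F z : cball z -> ((F z)%:E <= sup_ball F)%E.
Proof. by move=> zB; apply: ereal_sup_ubound; exists z. Qed.

Lemma sup_ball_le F (x : R) : (forall z, cball z -> F z <= x) -> (sup_ball F <= x%:E)%E.
Proof. by move=> H; apply: ge_ereal_sup => _ [z zB <-]; rewrite lee_fin; exact: H. Qed.

Lemma sup_ball_ge0 F : (forall z, cball z -> 0 <= F z) -> (0 <= sup_ball F)%E.
Proof.
by move=> H; apply: le_trans (le_sup_ball F (cball0 (n := n))); rewrite lee_fin; apply: H; exact: cball0.
Qed.

Lemma norm_d_ge0 j u z : 0 <= norm_d j u z.
Proof. by apply: sumr_ge0 => ab _; exact: normc_ge0. Qed.

Lemma norm_pd_ge0 j u z : 0 <= norm_pd j u z.
Proof. by apply: sumr_ge0 => ab _; exact: normc_ge0. Qed.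

Lemma normBinf_ge0 m (tau : R) u : (0 <= normBinf m tau u)%E.
Proof.
by apply: sume_ge0 => j _; apply: sup_ball_ge0 => z _; rewrite mulr_ge0 ?norm_d_ge0 ?powR_ge0.
Qed.

Lemma normBinf_dl m (tau : R) u l z : (normBinf m tau u < +oo)%E -> osorted l -> (size l <= m)%N -> cball z ->
  normc (dl l u z) * defect z `^ (m%:R - tau) <= fine (normBinf m tau u).
Proof.
move=> fi sl lm zB; rewrite -lee_fin fineK; last by rewrite ge0_fin_numE// normBinf_ge0.
have lm' : (size l < m.+1)%N by [].
rewrite /normBinf (bigD1 (Ordinal lm'))//=.
apply: le_trans (leeDl _ _); last first.
  by apply: sume_ge0 => j _; apply: sup_ball_ge0 => w _; rewrite mulr_ge0 ?norm_d_ge0 ?powR_ge0.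
apply: le_trans (le_sup_ball (fun z => norm_d (size l) u z * defect z `^ (m%:R - tau)) zB).
by rewrite lee_fin ler_wpM2r ?powR_ge0// dl_le_norm_d.
Qed.

Lemma normBinf_le m (tau : R) u (X : nat -> R) :
  (forall j z, (j <= m)%N -> cball z -> norm_d j u z * defect z `^ (m%:R - tau) <= X j) ->
  (normBinf m tau u <= (\sum_(j < m.+1) X j)%:E)%E.
Proof.
move=> H; rewrite /normBinf -sumEFin; apply: lee_sum => j _; apply: sup_ball_le => z zB.
by apply: H => //; rewrite -ltnS.
Qed.

Lemma omega_gt0 (t : R) z : cball z -> 0 < omega t z.
Proof.
move=> zB; have dz := defect_gt0 zB; rewrite /omega; case: eqP => _; last exact: powR_gt0.
rewrite ln_gt0// ltr_pdivlMr// mul1r; apply: le_lt_trans (defect_le1 z) _.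
by rewrite expR_gt1.
Qed.

(** The logarithm in omega_0 is traded for a small power: 1 + x <= exp x at x = -eta ln D bounds -ln
    D by (D^{-eta} - 1)/eta. *)
Lemma omega_le (t eta : R) z : 0 < eta -> cball z ->
  omega t z <= (1 + eta^-1) * defect z `^ (- Num.max (- t) eta).
Proof.
move=> eta0 zB; have dz := defect_gt0 zB; have d1 := defect_le1 z.
have ei0 : 0 < eta^-1 by rewrite invr_gt0.
rewrite /omega; case: eqP => [->|_]; last first.
  apply: le_trans (_ : defect z `^ (- Num.max (- t) eta) <= _).
    by rewrite le_powR_exp// le_min lerNl le_max lexx oppr_le0 le_max (ltW eta0) orbT.
  by rewrite ler_peMl ?powR_ge0// lerDl ltW.
rewrite oppr0 (max_idPr (ltW eta0)) ln_div ?posrE ?expR_gt0// expRK.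
have h : 1 + - eta * ln (defect z) <= defect z `^ (- eta) by rewrite /powR gt_eqF// expR_ge1Dx.
have p1 : 1 <= defect z `^ (- eta) by apply: defect_powN_ge1 => //; exact: ltW.
have h2 : - ln (defect z) <= eta^-1 * (defect z `^ (- eta) - 1).
  by rewrite mulrC ler_pdivlMr//; move: h; lra.
have : 0 <= eta^-1 * 1 by rewrite mulr1 ltW.
move: h2; rewrite mulrDl mul1r mulrBr; lra.
Qed.

Lemma tilde_ge0 u z : cball z -> 0 <= tilde u z.
Proof.
move=> zB; rewrite /tilde addr_ge0// mulr_ge0 ?sqrtr_ge0 ?(ltW (defect_gt0 zB))//.
  by apply: sumr_ge0 => j _; exact: normc_ge0.
by apply: sumr_ge0 => i _; apply: sumr_ge0 => j _; exact: normc_ge0.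
Qed.

Lemma normG_bound (tau0 tau : R) k phi : (normG tau0 tau k phi < +oo)%E -> exists2 A : R, 0 <= A &
  (forall l z, osorted l -> (size l <= k)%N -> cball z -> normc (dl l phi z) <= A * omega (tau - (size l)%:R) z) /\
  (forall z, cball z -> tilde phi z <= A * defect z `^ tau0).
Proof.
move=> fi.
have s0 (j : 'I_k.+1) : (0 <= sup_ball (fun z => norm_pd j phi z / omega (tau - j%:R) z)%R)%E.
  by apply: sup_ball_ge0 => z zB; rewrite divr_ge0 ?norm_pd_ge0// ltW// omega_gt0.
have t0 : (0 <= sup_ball (fun z => tilde phi z / defect z `^ tau0)%R)%E.
  by apply: sup_ball_ge0 => z zB; rewrite divr_ge0 ?tilde_ge0// powR_ge0.
have S0 : (0 <= \sum_(j < k.+1) sup_ball (fun z => norm_pd j phi z / omega (tau - j%:R) z)%R)%E by exact: sume_ge0.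
have G0 : (0 <= normG tau0 tau k phi)%E by exact: adde_ge0.
have GE : (fine (normG tau0 tau k phi))%:E = normG tau0 tau k phi by rewrite fineK// ge0_fin_numE.
exists (fine (normG tau0 tau k phi)); first exact: fine_ge0.
split=> [l z sl lk zB|z zB].
  have om := omega_gt0 (tau - (size l)%:R) zB; rewrite -ler_pdivrMr// -lee_fin GE.
  have lk' : (size l < k.+1)%N by [].
  apply: le_trans (leeDl _ t0); rewrite (bigD1 (Ordinal lk'))//=.
  apply: le_trans (leeDl _ _); last by apply: sume_ge0.
  apply: le_trans (le_sup_ball (fun z => norm_pd (size l) phi z / omega (tau - (size l)%:R) z) zB).
  by rewrite lee_fin ler_pM2r ?invr_gt0// dl_le_norm_pd.
rewrite -ler_pdivrMr ?powR_gt0 ?defect_gt0// -lee_fin GE.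
apply: le_trans (leeDr _ S0).
exact: (le_sup_ball (fun z => tilde phi z / defect z `^ tau0) zB).
Qed.

Lemma normB1_int (N : R) f (a : 'I_n -> V -> C) : hol f a -> (normB1 N f < +oo)%E ->
  intB (fun w => normc (f w) * defect w `^ (N - 1)) /\
  Rint (fun w => normc (f w) * defect w `^ (N - 1)) = fine (normB1 N f).
Proof.
move=> [cf _ _] fi.
have mF : measB (fun w => normc (f w) * defect w `^ (N - 1)).
  have cD := @contBr_defectp R n (N - 1).
  by apply: measB_cont; contB_tac.
have iF : (@nu R n).-integrable (@rball R n) (fun t : (n + n).-tuple (measurableTypeR R) => (normc (f (Cn_of_R2n t)) * defect (Cn_of_R2n t) `^ (N - 1))%:E).
  apply/integrableP; split; first exact/measurable_EFinP.
  apply: le_lt_trans fi; rewrite le_eqVlt; apply/orP; left; apply/eqP.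
  by apply: eq_integral => t _; rewrite gee0_abs// lee_fin mulr_ge0 ?normc_ge0 ?powR_ge0.
split; first exact: iF.
by apply: EFin_inj; rewrite RintE// fineK// ge0_fin_numE// integral_ge0// => t _; rewrite lee_fin mulr_ge0 ?normc_ge0 ?powR_ge0.
Qed.

Lemma toeplitz_Hk (N : R) phi f z (B : R) : 0 < N -> contB phi -> contB f ->
  (forall w, cball w -> normc (phi w) <= B) ->
  intB (fun w => normc (f w) * defect w `^ (N - 1)) -> cball z ->
  toeplitz N phi f z = (@c_ R n N)%:C * Hk (n%:R + N) (fun w => phi w * f w) (fun w => defect w `^ (N - 1)) z /\
  intB (fun w => normc (phi w * f w) * defect w `^ (N - 1)).
Proof.
move=> N0 cphi cf phiB iF zB; have d0 : 0 <= n%:R + N by rewrite addr_ge0// ltW.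
have cu : contB (fun w => phi w * f w) by contB_tac.
have cD := @contBr_defectp R n (N - 1).
have iu : intB (fun w => normc (phi w * f w) * defect w `^ (N - 1)).
  apply: intB_le (intBZ B iF); first by apply: measB_cont; contB_tac.
  move=> w wB; rewrite ger0_norm ?mulr_ge0 ?normc_ge0 ?powR_ge0// normcM.
  by rewrite [leRHS]mulrA ler_wpM2r ?powR_ge0// ler_wpM2r ?normc_ge0// phiB.
split=> //; rewrite /toeplitz /bergman /Hk -cintegralZ; last first.
  have cK : contB (fun w => kern (n%:R + N) w z) by contB_tac.
  refine (cintbleM_le cK cu cD (fun w _ => powR_ge0 _ _) _ iu).
  by move=> w wB; exact: kern_le.
apply: eq_cintegral => w wB; rewrite /dens /kern cpowN ?Re_1hdot_gt0//.
by move: (cpow _ _) => K; rewrite rmorphM /=; ring.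
Qed.

End Norms.

(** * Assembly of the regularity theorem *)

Section Regularity.
Context {R : realType} {n : nat}.
Local Notation C := R[i].
Local Notation V := 'rV[C]_n.
Implicit Types (f g u h phi : V -> C) (z w v : V) (l a b : seq 'I_n).

(** Holomorphic derivatives of order one are bounded through [omega_le] with 1 - tau0 in place of
    [eta], and as tau0 <= tau the result is D^{tau0-1}. Antiholomorphic ones come from the summand D
    |dbar phi| of [tilde]. Both feed [gradient_holder_wd]. *)
Lemma symbol_bounds (tau0 tau eta : R) k phi : 0 < tau0 -> tau0 <= tau -> tau < k%:R -> tau0 < 2^-1 -> 0 < eta ->
  inG tau0 tau k phi -> exists2 c : R, 0 <= c &
  [/\ forall w, cball w -> normc (phi w) <= c,
    forall a w, osorted a -> (0 < size a <= k)%N -> cball w ->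
      normc (dl a phi w) <= c * defect w `^ (- Num.max ((size a)%:R - tau) eta) &
    forall z w, cball z -> cball w -> normc (phi z - phi w) <= c * rho w z `^ (tau0 / 2)].
Proof.
move=> t0 t0t tk th eta0 [/diffk_Ck phid _ /normG_bound[A A0 [HA HT]]].
have k0 : (0 < k)%N by rewrite -(ltr_nat R); lra.
have [phi1 phi2 phi3] := phid.
have phiA w : cball w -> normc (phi w) <= A.
  move=> wB; have := HA [::] w isT isT wB; rewrite /omega /= subr0 gt_eqF; last by lra.
  by rewrite (min_idPr _); [rewrite powRr0 mulr1|lra].
have e0 : 0 < 1 - tau0 by lra.
have [B B0 BE] : exists2 B : R, 0 <= B & B = A * (1 + (1 - tau0)^-1).
  by exists (A * (1 + (1 - tau0)^-1)) => //; rewrite mulr_ge0// addr_ge0// invr_ge0 ltW.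
have AB : A <= B by rewrite BE ler_peMr// lerDl invr_ge0 ltW.
have s01 : 0 < tau0 /\ tau0 < 1 by split; lra.
have [ch ch0 Hh] : exists2 c : R, 0 <= c & forall z w, cball z -> cball w -> normc (phi z - phi w) <= c * rho w z `^ (tau0 / 2).
  apply: (@gradient_holder_wd R n phi (fun j => pd j phi) (fun j => pdbar j phi) B tau0 B0 s01).
  - by move=> j w wB; exact: (phi3 [::] j w k0 wB).
  - by move=> j; exact: (phi1 [:: j] k0).
  - by move=> j; exact: (phi2 [::] j k0).
  - move=> j w wB; apply: le_trans (HA [:: j] w isT k0 wB) _.
    apply: le_trans (ler_wpM2l A0 (omega_le _ e0 wB)) _.
    rewrite mulrA -BE (max_idPr _); last by rewrite /=; lra.
    by rewrite opprB.
  - move=> j w wB; have dw := defect_gt0 wB; apply: le_trans (_ : A * defect w `^ (tau0 - 1) <= _); last first.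
      by rewrite ler_wpM2r ?powR_ge0.
    have E : defect w `^ tau0 = defect w `^ (tau0 - 1) * defect w.
      by rewrite -[X in _ * X]powRr1 ?ltW// -powRDp// subrK.
    rewrite -(ler_pM2l dw) [leRHS]mulrC -mulrA -E.
    apply: le_trans (HT w wB); rewrite /tilde; apply: le_trans (_ : defect w * norm_pdbar phi w <= _).
      by rewrite ler_pM2l// /norm_pdbar (bigD1 j)// lerDl; apply: sumr_ge0 => i _; rewrite normc_ge0.
    rewrite lerDl mulr_ge0 ?sqrtr_ge0//.
    by apply: sumr_ge0 => i _; apply: sumr_ge0 => i' _; exact: normc_ge0.
  - by move=> z zB; apply: le_trans (phiA z zB) AB.
have ei : 0 <= 1 + eta^-1 by rewrite addr_ge0// invr_ge0 ltW.
have p2 : 0 <= A * (1 + eta^-1) by exact: mulr_ge0.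
exists (A + A * (1 + eta^-1) + ch); first by rewrite !addr_ge0.
split=> [w wB|a w sa /andP[_ ak] wB|z w zB wB].
- by apply: le_trans (phiA w wB) _; lra.
- apply: le_trans (HA a w sa ak wB) _; apply: le_trans (ler_wpM2l A0 (omega_le _ eta0 wB)) _.
  rewrite mulrA opprB ler_wpM2r ?powR_ge0//; lra.
- by apply: le_trans (Hh z w zB wB) _; rewrite ler_wpM2r ?powR_ge0//; lra.
Qed.

(** The norm weights every order by the same D^{m-tau}; taking eta = m - tau in [integrate_down]
    makes this the exponent at all orders. *)
Lemma normBinf_le_top (tau : R) m : 0 < tau -> tau < m%:R -> exists2 K : R, 0 <= K &
  forall f (a : 'I_n -> V -> C) (A : R), hol f a -> smooth f -> 0 <= A -> (forall z, cball z -> normc (f z) <= A) ->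
  (forall l z, size l = m -> cball z -> normc (dl l f z) <= A * defect z `^ (- (m%:R - tau))) ->
  (normBinf m tau f <= (K * A)%:E)%E.
Proof.
move=> t0 tm; have [K1 K10 H1] := @cauchy_estimates R n m.
have eta0 : 0 < m%:R - tau by lra.
have [K2 K20 H2] := @integrate_down R n tau (m%:R - tau) m eta0.
pose cd j : R := #|{: {ffun 'I_n -> 'I_j.+1} * {ffun 'I_n -> 'I_j.+1}}|%:R.
have q0 : 0 <= K2 * (1 + K1) by rewrite mulr_ge0// addr_ge0.
exists (\sum_(j < m.+1) cd j * (K2 * (1 + K1))).
  by apply: sumr_ge0 => j _; rewrite mulr_ge0// ler0n.
move=> f a A hf sf A0 fA ftop.
have A1 : 0 <= (1 + K1) * A by rewrite mulr_ge0// addr_ge0.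
have AA : A <= (1 + K1) * A by rewrite ler_peMl// lerDl.
have KA : K1 * A <= (1 + K1) * A by rewrite ler_wpM2r// lerDr.
have H l z : (size l <= m)%N -> cball z -> normc (dl l f z) <= K2 * ((1 + K1) * A) * defect z `^ (- (m%:R - tau)).
  move=> lm zB; have mE : Num.max ((size l)%:R - tau) (m%:R - tau) = m%:R - tau by rewrite (max_idPr _)// lerD2r ler_nat.
  rewrite -[X in _ `^ (- X)]mE; apply: H2 => //.
  - move=> l' z' l'm z'B; rewrite maxxx; apply: le_trans (ftop _ _ l'm z'B) _.
    by rewrite ler_wpM2r ?powR_ge0.
  - move=> l' l'm; apply: le_trans (H1 f a A hf A0 fA l' 0 (ltnW l'm) (cball0 (n := n))) _.
    by rewrite defect0 powR1 mulr1.
rewrite mulr_suml; apply: (normBinf_le (X := fun j => cd j * (K2 * (1 + K1)) * A)) => j z jm zB.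
have dz := defect_gt0 zB.
have X0 : 0 <= K2 * ((1 + K1) * A) * defect z `^ (- (m%:R - tau)) by rewrite mulr_ge0 ?powR_ge0// mulr_ge0.
have HX l : size l = j -> normc (dl l f z) <= K2 * ((1 + K1) * A) * defect z `^ (- (m%:R - tau)).
  by move=> lj; apply: H => //; rewrite lj.
apply: le_trans (ler_wpM2r (powR_ge0 _ _) (norm_d_le hf zB X0 HX)) _.
rewrite -/(cd j) -!mulrA -powRDp// addNr powRr0 mulr1.
by rewrite !mulrA.
Qed.

(** The missing m - K derivatives are applied to the derivatives of order K through
    [derivative_growth]. *)
Lemma raise_order (tau : R) K m : tau < K%:R -> (K <= m)%N -> exists2 B : R, 0 <= B &
  forall f (A : R), smooth f -> 0 <= A ->
  (forall l z, size l = K -> cball z -> normc (dl l f z) <= A * defect z `^ (- (K%:R - tau))) ->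
  forall l z, size l = m -> cball z -> normc (dl l f z) <= B * A * defect z `^ (- (m%:R - tau)).
Proof.
move=> tK Km; have g0 : 0 <= K%:R - tau by lra.
have E : K%:R - tau + (m - K)%:R = m%:R - tau by rewrite natrB//; ring.
have Km' : K%:R <= m%:R :> R by rewrite ler_nat.
have gj : 0 < K%:R - tau + (m - K)%:R by rewrite E; lra.
have [B B0 HB] := @derivative_growth R n (K%:R - tau) (m - K) g0 gj.
exists B => // f A [hf pf] A0 fK l z lm zB.
have -> : dl l f = dl (take (m - K) l) (dl (drop (m - K) l) f) by rewrite /dl -foldr_cat cat_take_drop.
rewrite -E; apply: (HB _ _ A (hf (drop (m - K) l)) A0) => //.
  by move=> z' z'B; apply: fK => //; rewrite size_drop lm subKn.
by rewrite size_take lm; case: ltnP => // h; apply/eqP; rewrite eqn_leq h leq_subr.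
Qed.

(** The norm of h controls order m; integration along rays brings this down to order K and to a
    bound on the function. *)
Lemma image_bounds (tau eta : R) K m : 0 < tau -> 0 < eta -> eta < 1 -> eta <= K%:R - tau -> (0 < K <= m)%N ->
  exists2 B : R, 0 <= B & forall u (A : R), smooth u -> 0 <= A ->
  (forall l z, osorted l -> (size l <= m)%N -> cball z -> normc (dl l u z) * defect z `^ (m%:R - tau) <= A) ->
  (forall z, cball z -> normc (u z) <= B * A) /\
  (forall l z, size l = K -> cball z -> normc (dl l u z) <= B * A * defect z `^ (- (K%:R - tau))).
Proof.
move=> t0 eta0 eta1 etaK /andP[K0 Km].
have [K1 K10 H1] := @integrate_down R n tau eta m eta0.
have [K2 K20 H2] := @bounded_down R n tau eta t0 eta0 eta1.
have Km' : K%:R <= m%:R :> R by rewrite ler_nat.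
have p0 : 0 <= K2 * (1 + K1) by rewrite mulr_ge0// addr_ge0.
exists (K2 * (1 + K1) + K1); first by rewrite addr_ge0.
move=> u A su A0 uA; have [_ pu] := su.
have uA' l z : (size l <= m)%N -> cball z -> normc (dl l u z) * defect z `^ (m%:R - tau) <= A.
  move=> lm zB; have [l' ll' sl'] := exists_osorted l.
  by rewrite (pu l l' z zB ll'); apply: uA => //; rewrite -(perm_size ll').
have u0 l : (size l <= m)%N -> normc (dl l u 0) <= A.
  by move=> lm; have := uA' l 0 lm (cball0 (n := n)); rewrite defect0 powR1 mulr1.
have D l z : (size l <= m)%N -> cball z -> normc (dl l u z) <= K1 * A * defect z `^ (- Num.max ((size l)%:R - tau) eta).
  apply: H1 => // [l' z' lm zB|l' lm]; last by apply: u0; exact: ltnW.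
  have dz := defect_gt0 zB; have lm' : (size l' <= m)%N by rewrite lm.
  rewrite (max_idPl _); last by lra.
  by rewrite powRN ler_pdivlMr ?powR_gt0// uA'.
have KA : 0 <= (1 + K1) * A by rewrite mulr_ge0// addr_ge0.
split=> [z zB|l z lK zB].
  apply: le_trans (_ : K2 * ((1 + K1) * A) <= _); last by rewrite mulrA ler_wpM2r// lerDl.
  apply: H2 => // [i w wB|].
    apply: le_trans (D [:: i] w (leq_trans K0 Km) wB) _.
    by rewrite ler_wpM2r ?powR_ge0// ler_wpM2r// lerDr.
  apply: le_trans (u0 [::] _) _ => //.
  by rewrite ler_peMl// lerDl.
have lm : (size l <= m)%N by rewrite lK.
apply: le_trans (D l z lm zB) _; rewrite lK (max_idPl _); last by [].
by rewrite ler_wpM2r ?powR_ge0// ler_wpM2r// lerDr.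
Qed.

Lemma normBinf0 m (tau : R) : normBinf m tau (fun _ : V => 0 : C) = 0%E.
Proof.
rewrite /normBinf big1// => j _; apply/eqP; rewrite eq_le sup_ball_ge0 ?andbT; last first.
  by move=> z zB; rewrite mulr_ge0 ?norm_d_ge0 ?powR_ge0.
by apply: sup_ball_le => z zB; rewrite norm_d0// mul0r.
Qed.

Lemma holo0 : holo (fun _ : V => 0 : C).
Proof. move=> z zB; exact: differentiable_cst. Qed.

Lemma toeplitz_regularity (N tau0 tau : R) (k m : nat) phi : (1 <= n)%N ->
  0 < N -> 0 < tau0 -> tau0 <= tau -> tau < k%:R -> tau0 < 2^-1 -> tau < m%:R ->
  inG tau0 tau k phi -> (forall z, csphere z -> phi z <> 0) ->
  exists2 B : R, 0 <= B & forall f h, inB1 N f -> inBinf m tau h ->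
    (forall z, cball z -> toeplitz N phi f z = h z) ->
    (normBinf m tau f <= (B * (fine (normB1 N f) + fine (normBinf m tau h)))%:E)%E.
Proof.
move=> n1 N0 t00 t0t tk th tm phiG phiS.
(* At most k, so that the symbol has K derivatives, and at most m, so that the norm of h reaches
   order K; it still exceeds tau. *)
pose K := minn k m; pose W := fun w : V => defect w `^ (N - 1).
have t0 : 0 < tau by lra.
have tK : tau < K%:R by rewrite /K /minn; case: ifP.
have Kk : (K <= k)%N by exact: geq_minl.
have Km : (K <= m)%N by exact: geq_minr.
have K0 : (0 < K)%N by rewrite -(ltr_nat R); lra.
(* These bounds imply the conditions of the bootstrap; tau0/2 + eta <= 1 holds because tau0 <
   1/2. *)
have [eta eta0 [etah etaK]] : exists2 eta : R, 0 < eta & eta <= 2^-1 /\ eta <= (K%:R - tau) / 2.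
  exists (Num.min 2^-1 ((K%:R - tau) / 2)); first by rewrite lt_min; apply/andP; split; lra.
  by rewrite !ge_min !lexx orbT.
have s0 : 0 < tau0 / 2 by lra.
have s1 : tau0 / 2 < 1 by lra.
have eta_le : [/\ eta <= 1, 2 * eta <= K%:R - tau & tau0 / 2 + eta <= 1] by split; lra.
have [c c0 [phic phia phih]] := symbol_bounds t00 t0t tk th eta0 phiG.
have [phiC phiW _] := phiG.
have phid : diffk K phi := diffk_le Kk (diffk_Ck phiC).
have cphi : contB phi by have [cp _ _] := phid; exact: (cp [::] isT).
have phia' l w : osorted l -> (0 < size l <= K)%N -> cball w ->
    normc (dl l phi w) <= c * defect w `^ (- Num.max ((size l)%:R - tau) eta).
  by move=> sl /andP[l0 lK] wB; apply: phia => //; rewrite l0 (leq_trans lK).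
have [e0 e00 he0] := nonvanishing_near_sphere phiW phiS.
have [Kb Kb0 Hb] := bounded_of_toeplitz N0 s0 s1 n1 c0 cphi phiW phiS phic phih.
have [G G0 HG] := growth_tau N0 t0 tK s0 eta0 eta_le c0 e00 phid phic phia' phih he0.
have etaK' : eta <= K%:R - tau by lra.
have eta1 : eta < 1 by lra.
have Kmb : (0 < K <= m)%N by rewrite K0.
have [Ki Ki0 Hi] := @image_bounds tau eta K m t0 eta0 eta1 etaK' Kmb.
have [Kr Kr0 Hr] := @raise_order tau K m tK Km.
have [Kn Kn0 Hn] := @normBinf_le_top tau m t0 tm.
have cN0 : 0 < @c_ R n N by exact: c_gt0.
have d0 : 0 <= n%:R + N by rewrite addr_ge0// ltW.
(* On the ball h is c_N times the kernel integral [g], so bounds on h pass to [g] after division by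
   c_N, which is positive. *)
have [q q0 qE] : exists2 q : R, 0 <= q & q = Ki / @c_ R n N.
  by exists (Ki / @c_ R n N) => //; rewrite divr_ge0// ltW.
have q10 : 0 <= 1 + q by rewrite addr_ge0.
have [Ka Ka0 KaE] : exists2 x : R, 0 <= x & x = (1 + Kb) * (1 + q).
  by exists ((1 + Kb) * (1 + q)) => //; rewrite mulr_ge0// addr_ge0.
have GK0 : 0 <= 1 + Kr * G by rewrite addr_ge0// mulr_ge0.
exists (Kn * ((1 + Kr * G) * Ka)); first by rewrite mulr_ge0// mulr_ge0.
move=> f h [/hol_of_holo hf f1] [_ hm] Tfh.
have [iF IE] := normB1_int hf f1.
have [cf _ _] := hf.
have T z (zB : cball z) := toeplitz_Hk N0 cphi cf phic iF zB.
pose g := Hk (n%:R + N) (fun w => phi w * f w) W.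
have [_ iu] := T 0 (cball0 (n := n)).
have sg : smooth g.
  have cu : contB (fun w => phi w * f w) by contB_tac.
  exact: (smooth_Hk cu (@contBr_defectp R n (N - 1)) (fun w _ => powR_ge0 _ _) iu d0).
have hg z : cball z -> h z = (@c_ R n N)%:C * g z by move=> zB; rewrite -Tfh//; have [] := T z zB.
have [sZ dZ] := smoothZ (@c_ R n N)%:C sg.
have H0 : 0 <= fine (normBinf m tau h) by rewrite fine_ge0// normBinf_ge0.
have I0 : 0 <= fine (normB1 N f).
  by rewrite fine_ge0// integral_ge0// => t _; rewrite lee_fin mulr_ge0 ?normc_ge0 ?powR_ge0.
have gB l z : osorted l -> (size l <= m)%N -> cball z ->
    normc (dl l g z) * defect z `^ (m%:R - tau) <= fine (normBinf m tau h) / @c_ R n N.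
  move=> sl lm zB; rewrite ler_pdivlMr// mulrC mulrA.
  have := normBinf_dl hm sl lm zB.
  by rewrite (dl_eq_ball _ sZ hg zB) dZ// normcM normc_real gtr0_norm.
have [g1 g2] := Hi g _ sg (divr_ge0 H0 (ltW cN0)) gB.
have qH : Ki * (fine (normBinf m tau h) / @c_ R n N) = q * fine (normBinf m tau h).
  by rewrite qE; ring.
rewrite qH in g1 g2.
pose A := fine (normB1 N f) + fine (normBinf m tau h).
have A0 : 0 <= A by exact: addr_ge0.
have HA : fine (normBinf m tau h) <= A by rewrite lerDr.
have qA : q * fine (normBinf m tau h) <= q * A by exact: ler_wpM2l.
have fA z : cball z -> normc (f z) <= Ka * A.
  move=> zB; have := Hb f _ g _ hf iF (fun z _ => erefl) g1 z zB.
  rewrite IE => b1; apply: le_trans b1 _; rewrite KaE.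
  have qA' : fine (normB1 N f) + q * fine (normBinf m tau h) <= (1 + q) * A.
    rewrite mulrDl mul1r lerD// /A lerDl//.
  rewrite -mulrA; apply: ler_pM => //; last by rewrite lerDr.
  by rewrite addr_ge0// mulr_ge0.
have KA0 : 0 <= Ka * A by exact: mulr_ge0.
have fD : datum N tau K phi f (Ka * A).
  split=> //; first by exists (fun j z => 'd (f : V -> C^o) z (delta_mx 0 j)).
  move=> l z _ lK zB; apply: le_trans (g2 l z lK zB) _.
  rewrite ler_wpM2r ?powR_ge0//; apply: le_trans qA _; rewrite ler_wpM2r// KaE.
  by rewrite mulrDl mul1r ler_wpDr ?lerDr//; exact: mulr_ge0.
have sf : smooth f := smooth_hol N0 hf iF.
have fK := HG f _ fD.
have GA0 : 0 <= G * (Ka * A) by exact: mulr_ge0.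
have fm := Hr f _ sf GA0 fK.
have M0 : 0 <= (1 + Kr * G) * (Ka * A) by exact: mulr_ge0.
rewrite -mulrA -[_ * Ka * A]mulrA; apply: (Hn f _ _ hf sf M0) => [z zB|l z lm zB].
  by apply: le_trans (fA z zB) _; rewrite ler_peMl// lerDl mulr_ge0.
apply: le_trans (fm l z lm zB) _; rewrite ler_wpM2r ?powR_ge0//.
by rewrite mulrA ler_wpM2r// lerDr.
Qed.

End Regularity.

Local Close Scope complex_scope.

Theorem theorem1p4 (R : realType) (n : nat) (hn : (1 <= n)%N)
    (N tau0 tau : R) (k m : nat)
    (hN : 0 < N) (htau0 : 0 < tau0) (htau0tau : tau0 <= tau)
    (htauk : tau < k%:R) (htau0half : tau0 < 2^-1) (hm : tau < m%:R)
    (phi : 'rV[R[i]]_n -> R[i]) (hphi : inG tau0 tau k phi)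
    (hphiS : forall z, csphere z -> phi z <> 0) :
  exists C : R,
    [/\ 0 < C,
        forall f h : 'rV[R[i]]_n -> R[i],
          inB1 N f -> inBinf m tau h ->
          (forall z, cball z -> toeplitz N phi f z = h z) ->
          inBinf m tau f /\
          (normBinf m tau f <= C%:E * (normB1 N f + normBinf m tau h))%E
      & forall f : 'rV[R[i]]_n -> R[i],
          inB1 N f ->
          (forall z, cball z -> toeplitz N phi f z = 0) ->
          (normBinf m tau f <= C%:E * normB1 N f)%E].
Proof.
have [B B0 HB] := toeplitz_regularity hn hN htau0 htau0tau htauk htau0half hm hphi hphiS.
have H (f h : 'rV[R[i]]_n -> R[i]) : inB1 N f -> inBinf m tau h ->
    (forall z, cball z -> toeplitz N phi f z = h z) ->
    inBinf m tau f /\ (normBinf m tau f <= (B + 1)%:E * (normB1 N f + normBinf m tau h))%E.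
  move=> f1 hm' Tfh; have [hf fi] := f1; have [_ hi] := hm'.
  have n0 : (0 <= normB1 N f)%E.
    by apply: integral_ge0 => t _; rewrite lee_fin mulr_ge0 ?normc_ge0 ?powR_ge0.
  have h0 : (0 <= normBinf m tau h)%E by exact: normBinf_ge0.
  have b := HB f h f1 hm' Tfh.
  split; first by split=> //; apply: le_lt_trans b (ltry _).
  rewrite -[normB1 N f]fineK ?ge0_fin_numE// -[normBinf m tau h]fineK ?ge0_fin_numE// -EFinD -EFinM.
  apply: le_trans b _; rewrite lee_fin ler_wpM2r//; last by lra.
  by rewrite addr_ge0// fine_ge0.
(* The increment makes the constant positive even if B = 0. The kernel of the operator is the case h
   = 0, whose norm is 0. *)
exists (B + 1); split; [by lra|exact: H|move=> f f1 Tf].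
have h0 : inBinf m tau (fun _ : 'rV[R[i]]_n => 0 : R[i]) by split; [exact: holo0|rewrite normBinf0 ltry].
by have [_] := H f (fun=> 0) f1 h0 Tf; rewrite normBinf0 adde0.
Qed.
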